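(* Let $f(x)=|\log x|$ and $g(x)=\log^2 x$. There are constants $c,C\in(0,\infty)$ such that for every closed subset $A$ of the disk $\{x\in\mathbb{R}^2:|x|\le 1/3\}$, $$c\,\operatorname{Cap}_{f\to g}(A)\ \le\ \mathbf{P}(\mathcal{D}\cap A\ne\varnothing)\ \le\ C\,\operatorname{Cap}_{f\to g}(A).$$ Moreover, the constants $c,C$ may be taken to be the same as constants for which $c\,\operatorname{Cap}_\varepsilon(A)\le\mathbf{P}(\mathcal{D}_\varepsilon\cap A\ne\varnothing)\le C\,\operatorname{Cap}_\varepsilon(A)$ holds for every $\varepsilon\in(0,1/3)$ and every such $A$.
   Context: $(B_t)_{t\ge0}$ is a standard planar Brownian motion started at the point $(1,0)$ under $\mathbf{P}$, and $\tau_*=\inf\{t:|B_t|=3\}$. The set of double points is $$\mathcal{D}=\{x:B_r=B_s=x\text{ for some }0<r<s<\tau_*\},$$ and the set of $\varepsilon$-separated double points is $\mathcal{D}_\varepsilon=\{x: B_r=B_s=x\text{ for some }0<r<r+\varepsilon^2\le s<\tau_*\}$. For a function $h:(0,\infty)\to[0,\infty)$ (with $h(0)=+\infty$ for the functions used here) and a probability measure $\mu$ on the plane, the $h$-energy is $\mathcal{E}_h(\mu)=\iint h(|x-y|)\,d\mu(x)\,d\mu(y)$, and $\operatorname{Cap}_h(A)=[\inf_\mu \mathcal{E}_h(\mu)]^{-1}$, the infimum being over probability measures $\mu$ supported on $A$ (with $1/\infty=0$, and capacity $0$ for the empty set). With $f(x)=|\log x|$ and $g(x)=\log^2 x$, let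 $h_\varepsilon(x)=f(x)$ for $x\ge\varepsilon$ and $h_\varepsilon(x)=g(x)f(\varepsilon)/g(\varepsilon)$ for $x<\varepsilon$; put $\operatorname{Cap}_\varepsilon=\operatorname{Cap}_{h_\varepsilon}$. The two-gauge (hybrid) capacity is $\operatorname{Cap}_{f\to g}(A)=\lim_{\varepsilon\to0}\operatorname{Cap}_\varepsilon(A)$ (this limit exists). *)

(* Defs.v *)
From HB Require Import structures.
From mathcomp Require Import all_boot all_order all_algebra.
From mathcomp Require Export all_classical all_reals all_analysis.

Set Implicit Arguments.
Unset Strict Implicit.
Unset Printing Implicit Defensive.

Import Order.TTheory GRing.Theory Num.Theory.
Import numFieldNormedType.Exports.

Local Open Scope classical_set_scope.
Local Open Scope ring_scope.

(* The plane is R * R, with the product topology and the product of the Borel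
   sigma-algebras.  The norm the library puts on R * R is the max norm, hence
   the separate Euclidean norm. *)
Definition enorm (R : realType) (x : R * R) : R :=
  Num.sqrt (x.1 ^+ 2 + x.2 ^+ 2).

(* Centred Gaussian law on the plane with covariance matrix v * I_2, for v > 0
   (the second parameter of normal_prob is the standard deviation). *)
Definition gauss2 (R : realType) (v : R) : set (R * R) -> \bar R :=
  (normal_prob 0 (Num.sqrt v) \x normal_prob 0 (Num.sqrt v))%E.

(* The time parameter ranges over R, but only times t >= 0 are constrained. *)
Record planar_brownian_motion (R : realType) (d : measure_display)
    (Omega : measurableType d) (P : probability Omega R) (x0 : R * R)
    (B : R -> Omega -> R * R) : Prop := PlanarBrownianMotion {
  bm_measurable : forall t : R, 0 <= t -> measurable_fun [set: Omega] (B t) ;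
  bm_start : forall w, B 0 w = x0 ;
  bm_continuous : forall w, {within `[0, +oo[, continuous (B ^~ w)} ;
  bm_gaussian : forall s t : R, 0 <= s -> s < t ->
    forall E : set (R * R), measurable E ->
    P [set w | E (B t w - B s w)] = gauss2 (t - s) E ;
  bm_independent : forall (n : nat) (t : nat -> R),
    0 <= t 0 -> (forall i, t i <= t i.+1) ->
    forall E : nat -> set (R * R), (forall i, measurable (E i)) ->
    P (\bigcap_(i < n) [set w | E i (B (t i.+1) w - B (t i) w)]) =
    (\prod_(i < n) P [set w | E i (B (t i.+1) w - B (t i) w)%R])%E }.

Section DoublePoints.
Context {R : realType} {Omega : Type} (B : R -> Omega -> R * R).

(* tau_* = inf {t : |B_t| = 3}, equal to +oo if the circle is never reached *)
Definition exit_time (w : Omega) : \bar R :=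
  ereal_inf [set t%:E | t in [set t : R | 0 <= t /\ enorm (B t w) = 3]].

Definition double_points (w : Omega) : set (R * R) :=
  [set x | exists r s : R, [/\ 0 < r, r < s, (s%:E < exit_time w)%E,
                           B r w = x & B s w = x]].

Definition separated_double_points (eps : R) (w : Omega) : set (R * R) :=
  [set x | exists r s : R, [/\ 0 < r, r < r + eps ^+ 2 /\ r + eps ^+ 2 <= s,
                           (s%:E < exit_time w)%E, B r w = x & B s w = x]].

End DoublePoints.

(* P(D meets A), for a random set D *)
Definition hitting_prob (R : realType) (d : measure_display)
    (Omega : measurableType d) (P : probability Omega R)
    (D : Omega -> set (R * R)) (A : set (R * R)) : \bar R :=
  P [set w | D w `&` A !=set0].

Section Capacity.
Context {R : realType}.
Local Open Scope ereal_scope.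

Definition energy (h : R -> \bar R) (mu : probability (R * R)%type R) : \bar R :=
  \int[mu]_x \int[mu]_y h (enorm (x - y)%R).

(* With no admissible measure the infimum is +oo and the capacity is 0. *)
Definition capacity (h : R -> \bar R) (A : set (R * R)) : \bar R :=
  (ereal_inf [set energy h mu | mu in
    [set mu : probability (R * R)%type R | mu A = 1]])^-1.

(* lne 0 = -oo, so that both gauges are +oo at 0. *)
Definition gauge_f (x : R) : \bar R := `|lne x%:E|.
Definition gauge_g (x : R) : \bar R := lne x%:E ^+ 2.

Definition gauge_eps (eps x : R) : \bar R :=
  if (eps <= x)%R then gauge_f x
  else gauge_g x * (gauge_f eps / gauge_g eps).

Definition cap_eps (eps : R) : set (R * R) -> \bar R :=
  capacity (gauge_eps eps).

Definition cap_two_gauge (A : set (R * R)) : \bar R :=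
  lim (cap_eps eps A @[eps --> (0%R : R)^'+]).

(* cap estimates p, up to the factors c and C, on closed subsets of the disk *)
Definition capacity_estimate (c C : R) (cap p : set (R * R) -> \bar R) : Prop :=
  forall A : set (R * R), closed A -> A `<=` [set x | (enorm x <= 1 / 3)%R] ->
    c%:E * cap A <= p A <= C%:E * cap A.

End Capacity.

(* Main.v *)
From HB Require Import structures.
Require Import Defs.
From mathcomp Require Import all_boot all_order all_algebra.
From mathcomp Require Import all_classical all_reals all_analysis.
From mathcomp Require Import measurable_realfun.
From mathcomp Require Import ring lra zify.
Set Implicit Arguments.
Unset Strict Implicit.
Unset Printing Implicit Defensive.
Import Order.TTheory GRing.Theory Num.Theory.
Import numFieldNormedType.Exports.
Local Open Scope classical_set_scope.
Local Open Scope ring_scope.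

(* Both bounds compare the path with the walk obtained by sampling it on a fine
   grid, for which hitting probabilities of small squares are explicit.

   Lower bound (second moment).  A measure mu on A of energy M is discretised
   into weights m on small cells, and Z counts, with these weights, the pairs of
   times at distance at least eps^2 at which the walk, killed outside a ball of
   radius 2, visits the same cell.  The two pairs of times occurring in E Z^2
   interleave in four ways, which bounds E Z^2 by the energy, while E Z is
   bounded below.  By Paley-Zygmund P(Z > 0) >= c / M; letting the mesh tend to
   0, compactness turns near double points into double points in A.

   Upper bound.  On the event that there is a double point in A, let X be a
   measurable choice of one, with (sub-probability) law m.  The potential V of m
   at X is at most its maximum along the path.  By Doob's inequality the mean
   square of this maximum is controlled by the m-weighted occupation times, whose
   second moment is the energy of m again.  Hence E V(X)^2 <= K E V(X), and
   Cauchy-Schwarz bounds the energy E V(X) by K P(event).  For pairs of points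
   within eps the kernel is a squared logarithm and the two passages through X
   are used: they lie in two time intervals of length of order eps^2, to which
   Doob's inequality is applied one after the other.  The gap between the
   intervals is removed by dominating the density of the increment of the path
   over it; summing over the possible pairs of intervals gives the factor
   |log eps|.  The normalised law of X restricted to a quarter of the eps-cells,
   chosen so that two different cells are at distance at least eps, then has
   energy at most C / P(event).

   The hybrid capacity follows by monotonicity in eps. *)

(** All constants have to be uniform in the probability space, [eps], the mesh and the time horizon.
    Uniformity in the horizon comes from windows of 72 time units: a path confined to the disk of
    radius 3 moves little over each of them, which has probability at most 1/2, so sums over all
    windows converge geometrically.

    Conditioning is expressed by independence of disjoint blocks of steps and by testing against
    every bounded nonnegative function of the past; this form also enters Doob's inequality.

    In the upper bound the kernels are truncated at a radius [r > 0], so every energy is a finite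
    real number and a bound of E V^2 by E V can be exploited. Monotone convergence removes the
    truncation at the end.

    Hitting probabilities are computed for max-norm squares, on which Gaussian laws factorise, while
    gauges and the exit time use the Euclidean norm. Distances are comparable, and the summand 1 in
    [Lam] absorbs the resulting additive error in the logarithm. *)

(** * Independence of disjoint blocks of increments *)

(** The law of [(U, V)] is the product of its marginals, so Tonelli lets [U] be frozen while [V] is
    integrated along an independent copy. All later conditioning goes through this identity. *)
Lemma independent_integral (R : realType) d d1 d2 (T : measurableType d)
    (T1 : measurableType d1) (T2 : measurableType d2) (P : probability T R)
    (U : T -> T1) (V : T -> T2) (Phi : T1 * T2 -> \bar R) :
  measurable_fun setT U -> measurable_fun setT V ->
  (forall A B, measurable A -> measurable B ->
     P (U @^-1` A `&` V @^-1` B) = (P (U @^-1` A) * P (V @^-1` B))%E) ->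
  measurable_fun [set: T1 * T2] Phi -> (forall z, (0 <= Phi z)%E) ->
  (\int[P]_w Phi (U w, V w) = \int[P]_u \int[P]_v Phi (U u, V v))%E.
Proof.
move=> mU mV ind mPhi Phi0.
pose U' : {mfun T >-> T1} := HB.pack U (isMeasurableFun.Build _ _ _ _ U mU).
pose V' : {mfun T >-> T2} := HB.pack V (isMeasurableFun.Build _ _ _ _ V mV).
have mUV : measurable_fun setT (fun w => (U w, V w)).
  exact/measurable_fun_pair.
pose W' : {mfun T >-> (T1 * T2)%type} :=
  HB.pack (fun w => (U w, V w)) (isMeasurableFun.Build _ _ _ _ _ mUV).
have -> : (\int[P]_w Phi (U w, V w) = \int[distribution P W']_z Phi z)%E.
  by rewrite ge0_integral_distribution.
have E X : measurable X ->
    (distribution P U' \x distribution P V')%E X = distribution P W' X.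
  move=> mX; exact: product_measure_unique.
have -> : (\int[distribution P W']_z Phi z =
   \int[(distribution P U' \x distribution P V')%E]_z Phi z)%E.
  by apply: eq_measure_integral => A mA _; exact/esym/E.
rewrite fubini_tonelli1//= ge0_integral_distribution//; last 2 first.
- exact: measurable_fun_fubini_tonelli_F.
- by move=> y; apply: integral_ge0.
apply: eq_integral => u _ /=; rewrite /fubini_F ge0_integral_distribution//.
exact: measurableT_comp.
Qed.

Section sigma_walk.
Context (R : realType) d (T : measurableType d) d' (E : measurableType d').
Variables (P : probability T R) (xi : nat -> T -> E).

Definition indep_seq := forall n (A : nat -> set E), (forall i, measurable (A i)) ->
  P (\bigcap_(i < n) (xi i @^-1` A i)) = (\prod_(i < n) P (xi i @^-1` A i))%E.

(** Cylinders that constrain only increments with index in [I]; they form a pi-system. Demanding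
    [A i = setT] from [n] on allows two cylinders to be written over a common range. *)
Definition incr_rect (I : pred nat) : set (set T) :=
  [set X | exists n, exists A : nat -> set E,
     [/\ forall i, measurable (A i), forall i, ~~ I i -> A i = setT,
         forall i, (n <= i)%N -> A i = setT &
         X = \bigcap_(i < n) (xi i @^-1` A i)]].

Hypothesis mxi : forall i, measurable_fun setT (xi i).
Hypothesis ind : indep_seq.

Lemma bigcap_widen n m (A : nat -> set E) : (n <= m)%N ->
  (forall i, (n <= i)%N -> A i = setT) ->
  \bigcap_(i < n) (xi i @^-1` A i) = \bigcap_(i < m) (xi i @^-1` A i).
Proof.
move=> nm AT; apply/seteqP; split => w H i /= im.
  have [/H//|ni] := ltnP i n; by rewrite /= AT.
by apply: H => /=; apply: leq_trans nm.
Qed.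

Lemma incr_rect_measurable I : incr_rect I `<=` measurable.
Proof.
move=> _ [n [A [mA _ _ ->]]].
rewrite bigcap_mkord; apply: bigsetI_measurable.
by move=> i _; rewrite -[X in measurable X]setTI; exact: mxi.
Qed.

Lemma incr_rect_setI I : setI_closed (incr_rect I).
Proof.
move=> _ _ [n [A [mA AI An ->]]] [m [B [mB BI Bm ->]]].
exists (maxn n m), (fun i => A i `&` B i); split.
- by move=> i; exact: measurableI.
- by move=> i iI; rewrite AI// BI// setIT.
- by move=> i; rewrite geq_max => /andP[ni mi]; rewrite An// Bm// setIT.
rewrite (@bigcap_widen n (maxn n m)) ?leq_maxl//.
by rewrite (@bigcap_widen m (maxn n m)) ?leq_maxr// -bigcapI.
Qed.

Lemma incr_rectT I : incr_rect I setT.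
Proof.
exists 0%N, (fun=> setT); split => //.
by rewrite bigcap_mkord big_ord0.
Qed.

Lemma incr_rect_indep I J A B : (forall i, ~~ (I i && J i)) ->
  incr_rect I A -> incr_rect J B -> P (A `&` B) = (P A * P B)%E.
Proof.
move=> IJ [n [F [mF FI Fn ->]]] [m [G [mG GI Gm ->]]].
rewrite (@bigcap_widen n (maxn n m)) ?leq_maxl//.
rewrite (@bigcap_widen m (maxn n m)) ?leq_maxr// -bigcapI.
have mFG i : measurable (F i `&` G i) by exact: measurableI.
rewrite (ind _ mFG) (ind _ mF) (ind _ mG).
rewrite -big_split/=; apply: eq_bigr => i _.
have := IJ i; rewrite negb_and => /orP[/FI ->|/GI ->].
- by rewrite setTI preimage_setT probability_setT mul1e.
- by rewrite setIT preimage_setT probability_setT mule1.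
Qed.

End sigma_walk.

Section sigma_indep.
Context (R : realType) d (T : measurableType d).
Variables (P : probability T R).

(* pi-lambda, applied to one sigma-algebra after the other *)
Lemma sigma_indep (G H : set (set T)) :
  G `<=` measurable -> H `<=` measurable ->
  setI_closed G -> setI_closed H -> G setT -> H setT ->
  (forall A B, G A -> H B -> P (A `&` B) = (P A * P B)%E) ->
  forall A B, <<s G >> A -> <<s H >> B -> P (A `&` B) = (P A * P B)%E.
Proof.
move=> Gm Hm GI HI GT HT GH.
have sub (K : set (set T)) : K `<=` measurable -> <<s K >> `<=` measurable.
  by move=> Km; apply: smallest_sub => //; exact: sigma_algebra_measurable.
have step (K : set (set T)) (B : set T) : K `<=` measurable -> setI_closed K ->
    K setT -> measurable B -> (forall A, K A -> P (A `&` B) = (P A * P B)%E) ->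
    forall A, <<s K >> A -> P (A `&` B) = (P A * P B)%E.
  move=> Km KI KT mB KB A sA.
  have PB0 : 0 <= fine (P B) by rewrite fine_ge0.
  (* For fixed [B], both sides are finite measures in [A] that agree on the pi-system [K]. *)
  pose m1 : {measure set T -> \bar R} := mrestr P mB.
  pose m2 : {measure set T -> \bar R} := mscale (NngNum PB0) P.
  have : m1 A = m2 A.
    apply: (@g_sigma_algebra_measure_unique _ _ _ K Km (fun=> setT)) => //.
    - by rewrite bigcup_const//; exists 0%N.
    - move=> X KX; change (P (X `&` B) = (fine (P B))%:E * P X)%E.
      by rewrite KB// fineK ?fin_num_measure// muleC.
    - move=> k; change (P (setT `&` B) < +oo)%E.
      by rewrite setTI -ge0_fin_numE// fin_num_measure.
  change (P (A `&` B) = (fine (P B))%:E * P A -> P (A `&` B) = P A * P B)%E.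
  by rewrite fineK ?fin_num_measure// muleC.
move=> A B sA sB.
apply: (step G) => //; first exact: (sub H).
move=> A' GA'; rewrite setIC muleC; apply: (step H) => //; first exact: Gm.
by move=> B' HB'; rewrite setIC muleC GH.
Qed.
End sigma_indep.

(** * Expectations and Gaussian walks *)

Definition ind (R : realType) (b : bool) : R := b%:R.

Section bounded_measurable.
Context (R : realType) d (T : measurableType d).
Implicit Types X Y : T -> R.

(* Nonnegative bounded measurable functions: their integrals are real numbers. *)
Definition bmf X := measurable_fun setT X /\ exists M, forall w, 0 <= X w <= M.

Lemma bmf_ge0 X w : bmf X -> 0 <= X w.
Proof. by case=> _ [M /(_ w)/andP[]]. Qed.

Lemma bmf_meas X : bmf X -> measurable_fun setT X.
Proof. by case. Qed.

Lemma bmf_cst r : 0 <= r -> bmf (fun=> r).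
Proof. by move=> r0; split=> //; exists r => _; rewrite r0 lexx. Qed.

Lemma bmfD X Y : bmf X -> bmf Y -> bmf (fun w => X w + Y w).
Proof.
move=> [mX [M XM]] [mY [N YN]]; split; first exact: measurable_funD.
exists (M + N) => w; move: (XM w) (YN w) => /andP[? ?] /andP[? ?].
by rewrite addr_ge0//= lerD.
Qed.

Lemma bmfM X Y : bmf X -> bmf Y -> bmf (fun w => X w * Y w).
Proof.
move=> [mX [M XM]] [mY [N YN]]; split; first exact: measurable_funM.
exists (M * N) => w; move: (XM w) (YN w) => /andP[? ?] /andP[? ?].
by rewrite mulr_ge0//= ler_pM.
Qed.

Lemma bmfX X n : bmf X -> bmf (fun w => X w ^+ n).
Proof.
move=> bX; elim: n => [|n ih]; first by under eq_fun do rewrite expr0; exact: bmf_cst.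
by under eq_fun do rewrite exprS; exact: bmfM.
Qed.

Lemma bmf_max X Y : bmf X -> bmf Y -> bmf (fun w => Num.max (X w) (Y w)).
Proof.
move=> [mX [M XM]] [mY [N YN]]; split; first exact: measurable_maxr.
exists (Num.max M N) => w; move: (XM w) (YN w) => /andP[? ?] /andP[? ?].
by rewrite le_max ge_max !le_max; apply/and3P; split; apply/orP; auto.
Qed.

Lemma bmf_bool (b : T -> bool) : measurable_fun setT b -> bmf (fun w => ind R (b w)).
Proof.
move=> mb; rewrite /ind; split; last by exists 1 => w; case: (b w); rewrite ?lexx ?ler01.
rewrite (_ : (fun w => _) = fun w => if b w then 1 else 0 :> R).
  exact: measurable_fun_ifT.
by apply/funext => w; case: (b w).
Qed.

Lemma bmf_sum (I : Type) (s : seq I) (Q : pred I) (F : I -> T -> R) :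
  (forall i, Q i -> bmf (F i)) -> bmf (fun w => \sum_(i <- s | Q i) F i w).
Proof.
move=> bF; elim: s => [|i s ih].
  by under eq_fun do rewrite big_nil; exact: bmf_cst.
have [Qi|Qi] := boolP (Q i).
  under eq_fun do rewrite big_cons Qi; apply: bmfD => //; exact: bF.
by under eq_fun do rewrite big_cons (negbTE Qi).
Qed.

Lemma bmf_bigmax (I : Type) (s : seq I) (Q : pred I) (F : I -> T -> R) :
  (forall i, Q i -> bmf (F i)) ->
  bmf (fun w => \big[Num.max/0]_(i <- s | Q i) F i w).
Proof.
move=> bF; elim: s => [|i s ih].
  by under eq_fun do rewrite big_nil; exact: bmf_cst.
have [Qi|Qi] := boolP (Q i).
  under eq_fun do rewrite big_cons Qi; apply: bmf_max => //; exact: bF.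
by under eq_fun do rewrite big_cons (negbTE Qi).
Qed.

Lemma bmf_eq X Y : (forall w, X w = Y w) -> bmf X -> bmf Y.
Proof. by move=> XY; rewrite (_ : X = Y) //; exact/funext. Qed.

End bounded_measurable.

Lemma bmf_comp (R : realType) d (T : measurableType d) d' (T' : measurableType d')
  (X : T' -> R) (f : T -> T') :
  measurable_fun setT f -> bmf X -> bmf (fun w => X (f w)).
Proof.
move=> mf [mX [M XM]]; split; last by exists M.
exact: measurableT_comp.
Qed.

Section expectation.
Context (R : realType) d (T : measurableType d) (P : probability T R).
Implicit Types X Y : T -> R.

(** For [bmf] functions the integral is finite ([ExE]), so [fine] loses nothing. *)
Definition Ex X : R := fine (\int[P]_w (X w)%:E).

Lemma bmf_EFin X : bmf X -> measurable_fun setT (fun w => (X w)%:E).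
Proof. by move=> [mX _]; exact/measurable_EFinP. Qed.

Lemma ExE X : bmf X -> (\int[P]_w (X w)%:E = (Ex X)%:E)%E.
Proof.
move=> bX; have [M XM] := bX.2; rewrite /Ex fineK// ge0_fin_numE; last first.
  by apply: integral_ge0 => w _; rewrite lee_fin bmf_ge0.
apply: (@le_lt_trans _ _ (\int[P]_w (M%:E))%E).
  apply: ge0_le_integral => //.
  - by move=> w _; rewrite lee_fin bmf_ge0.
  - exact: bmf_EFin.
  - by move=> w _; rewrite lee_fin; case/andP: (XM w).
by rewrite integral_cst// [X in (_ * X)%E]probability_setT mule1 ltry.
Qed.

Lemma Ex_ge0 X : bmf X -> 0 <= Ex X.
Proof.
move=> bX; rewrite -lee_fin -ExE//.
by apply: integral_ge0 => w _; rewrite lee_fin bmf_ge0.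
Qed.

Lemma Ex_le X Y : bmf X -> bmf Y -> (forall w, X w <= Y w) -> Ex X <= Ex Y.
Proof.
move=> bX bY XY; rewrite -lee_fin -!ExE//; apply: ge0_le_integral => //.
- by move=> w _; rewrite lee_fin bmf_ge0.
- exact: bmf_EFin.
- exact: bmf_EFin.
- by move=> w _; rewrite lee_fin.
Qed.

Lemma ExD X Y : bmf X -> bmf Y -> Ex (fun w => X w + Y w) = Ex X + Ex Y.
Proof.
move=> bX bY; apply: EFin_inj; rewrite EFinD -!ExE//; last exact: bmfD.
under eq_integral do rewrite EFinD.
rewrite ge0_integralD//; try exact: bmf_EFin;
  by move=> w _; rewrite lee_fin bmf_ge0.
Qed.

Lemma ExZ r X : 0 <= r -> bmf X -> Ex (fun w => r * X w) = r * Ex X.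
Proof.
move=> r0 bX; apply: EFin_inj; rewrite EFinM -!ExE//; last first.
  by apply: bmfM => //; exact: bmf_cst.
under eq_integral do rewrite EFinM.
rewrite ge0_integralZl//; first exact: bmf_EFin.
by move=> w _; rewrite lee_fin bmf_ge0.
Qed.

Lemma Ex_cst r : Ex (fun=> r) = r.
Proof. by rewrite /Ex integral_cst// [X in (_ * X)%E]probability_setT mule1. Qed.

Lemma Ex_sum (I : Type) (s : seq I) (Q : pred I) (F : I -> T -> R) :
  (forall i, Q i -> bmf (F i)) ->
  Ex (fun w => \sum_(i <- s | Q i) F i w) = \sum_(i <- s | Q i) Ex (F i).
Proof.
move=> bF; elim: s => [|i s ih].
  by rewrite big_nil; under eq_fun do rewrite big_nil; exact: Ex_cst.
rewrite big_cons; case: ifPn => Qi.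
  under eq_fun do rewrite big_cons Qi.
  by rewrite ExD ?ih//; [exact: bF|exact: bmf_sum].
by under eq_fun do rewrite big_cons (negbTE Qi).
Qed.

Lemma Ex_bool (b : T -> bool) : measurable_fun setT b ->
  Ex (fun w => ind R (b w)) = fine (P [set w | b w]).
Proof.
move=> mb; rewrite /Ex; congr fine.
have mB : measurable [set w | b w].
  by rewrite -[X in measurable X]setTI; exact: mb.
transitivity (\int[P]_w (\1_[set w | b w] w)%:E)%E.
  apply: eq_integral => w _; rewrite indicE; congr ((nat_of_bool _)%:R)%:E.
  by apply/idP/idP; rewrite inE.
by rewrite integral_indic// setIT.
Qed.

Lemma Ex_eq X Y : (forall w, X w = Y w) -> Ex X = Ex Y.
Proof. by move=> XY; congr Ex; exact/funext. Qed.

End expectation.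

Section measurable_plane.
Context (R : realType).
Notation pt := (R * R)%type.

Lemma measurable_plane_add : measurable_fun [set: pt * pt] (fun z => z.1 + z.2).
Proof.
apply/measurable_fun_pairP; split; apply: measurable_funD;
  by do 2?[apply: measurableT_comp => //].
Qed.

Lemma measurable_plane_opp : measurable_fun [set: pt] (fun z => - z).
Proof.
apply/measurable_fun_pairP; split; apply: measurable_funN => //; exact: measurable_fst || exact: measurable_snd.
Qed.

Lemma measurable_plane_norm : measurable_fun [set: pt] (fun z => `|z|).
Proof.
under eq_fun do rewrite prod_normE.
apply: measurable_maxr; by do 2?[apply: measurableT_comp => //].
Qed.

Context d (T : measurableType d).
Implicit Types f g : T -> pt.

Lemma measurable_ptD f g : measurable_fun setT f -> measurable_fun setT g ->
  measurable_fun setT (fun w => f w + g w).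
Proof.
move=> mf mg.
exact: (measurableT_comp measurable_plane_add (measurable_fun_pair mf mg)).
Qed.

Lemma measurable_ptN f : measurable_fun setT f -> measurable_fun setT (fun w => - f w).
Proof. by move=> mf; exact: (measurableT_comp measurable_plane_opp mf). Qed.

Lemma measurable_ptB f g : measurable_fun setT f -> measurable_fun setT g ->
  measurable_fun setT (fun w => f w - g w).
Proof. by move=> mf mg; apply: measurable_ptD => //; exact: measurable_ptN. Qed.

Lemma measurable_ptnorm f : measurable_fun setT f ->
  measurable_fun setT (fun w => `|f w|).
Proof. by move=> mf; exact: (measurableT_comp measurable_plane_norm mf). Qed.

Lemma measurable_ptsum (s : seq nat) (F : nat -> T -> pt) :
  (forall i, i \in s -> measurable_fun setT (F i)) ->
  measurable_fun setT (fun w => \sum_(i <- s) F i w).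
Proof.
elim: s => [|i s ih] mF; first by under eq_fun do rewrite big_nil; exact: measurable_cst.
under eq_fun do rewrite big_cons; apply: measurable_ptD.
  by apply: mF; rewrite mem_head.
by apply: ih => j js; apply: mF; rewrite in_cons js orbT.
Qed.

Lemma measurable_ptclose f (r : R) : measurable_fun setT f ->
  measurable_fun setT (fun w => `|f w| <= r).
Proof. by move=> mf; apply: measurable_fun_ler => //; exact: measurable_ptnorm. Qed.

Lemma bmf_ptclose f (r : R) : measurable_fun setT f ->
  bmf (fun w => ind R (`|f w| <= r)).
Proof. by move=> mf; apply: bmf_bool; exact: measurable_ptclose. Qed.

End measurable_plane.

Section walk.
Context (R : realType) d (T : measurableType d) (P : probability T R).
Notation pt := (R * R)%type.

(** The law is prescribed for all block sums and not only for single steps: for sampled Brownian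
    motion this is immediate, and convolutions of Gaussian laws never have to be computed. *)
Record gaussian_walk (h : R) (xi : nat -> T -> R * R) : Prop := GaussianWalk {
  gw_meas : forall i, measurable_fun setT (xi i) ;
  gw_indep : indep_seq P xi ;
  gw_gauss : forall j k, (j < k)%N -> forall E, measurable E ->
    P [set w | E (\sum_(j <= i < k) xi i w)] = gauss2 ((k - j)%:R * h) E }.

Variables (h : R) (xi : nat -> T -> R * R).
Hypothesis gw : gaussian_walk h xi.

(** The space [T] carrying only the sigma-algebra of the increments in [I]. Giving a function the
    type [sg I -> U] turns its measurability into adaptedness. *)
Definition sg (I : pred nat) := g_sigma_algebraType (incr_rect xi I).
Definition past k := sg (fun i => i < k)%N.
Definition future k := sg (fun i => k <= i)%N.
Definition wsum j k (w : T) : R * R := \sum_(j <= i < k) xi i w.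

Lemma sg_measurable I : @measurable _ (sg I) `<=` @measurable _ T.
Proof.
apply: smallest_sub; first exact: sigma_algebra_measurable.
exact: (incr_rect_measurable (gw_meas gw)).
Qed.

Lemma sg_sub (I J : pred nat) : (forall i, I i -> J i) ->
  @measurable _ (sg I) `<=` @measurable _ (sg J).
Proof.
move=> IJ; apply: smallest_sub; first exact: sigma_algebra_measurable.
move=> _ [n [A [mA AI An ->]]]; apply: sub_sigma_algebra; exists n, A; split => //.
by move=> i /negP iJ; apply: AI; apply/negP => /IJ.
Qed.

Lemma sg_measurable_fun I d' (U : measurableType d') (X : T -> U) :
  measurable_fun [set: sg I] (X : sg I -> U) -> measurable_fun [set: T] X.
Proof.
by move=> mX _ Y mY; apply: (@sg_measurable I); exact: mX.
Qed.

Lemma sg_measurable_sub (I J : pred nat) d' (U : measurableType d') (X : T -> U) :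
  (forall i, I i -> J i) ->
  measurable_fun [set: sg I] (X : sg I -> U) ->
  measurable_fun [set: sg J] (X : sg J -> U).
Proof. by move=> IJ mX _ Y mY; apply: (sg_sub IJ); exact: mX. Qed.

Lemma sg_id I : measurable_fun [set: T] (id : T -> sg I).
Proof. by move=> _ Y mY; rewrite setTI; exact: (@sg_measurable I). Qed.

Lemma sg_xi (I : pred nat) i : I i -> measurable_fun [set: sg I] (xi i : sg I -> pt).
Proof.
move=> Ii _ Y mY; apply: sub_sigma_algebra.
exists i.+1, (fun j => if j == i then Y else setT); split.
- by move=> j; case: ifP.
- by move=> j; case: ifP => // /eqP -> /negP.
- by move=> j; case: eqP => // ->; rewrite ltnn.
rewrite setTI; apply/seteqP; split => w /=.
- by move=> Yw j /= _; case: eqP => // ->.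
- by move=> /(_ i); rewrite eqxx; apply => /=.
Qed.

Lemma sg_wsum (I : pred nat) j k : (forall i, (j <= i < k)%N -> I i) ->
  measurable_fun [set: sg I] (wsum j k : sg I -> pt).
Proof.
move=> jkI; apply: measurable_ptsum => i; rewrite mem_index_iota => ijk.
by apply: sg_xi; exact: jkI.
Qed.

Lemma wsum_measurable j k : measurable_fun [set: T] (wsum j k).
Proof. exact: (sg_measurable_fun (@sg_wsum xpredT j k (fun _ _ => isT))). Qed.

Lemma wsum_cat j k l w : (j <= k <= l)%N -> wsum j l w = wsum j k w + wsum k l w.
Proof. by move=> /andP[jk kl]; rewrite /wsum -big_cat_nat. Qed.

Lemma sg_bmf (I : pred nat) (X : T -> R) : bmf (X : sg I -> R) -> bmf X.
Proof. by move=> [mX ?]; split => //; exact: sg_measurable_fun mX. Qed.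

Lemma sg_bmf_sub (I J : pred nat) (X : T -> R) : (forall i, I i -> J i) ->
  bmf (X : sg I -> R) -> bmf (X : sg J -> R).
Proof. by move=> IJ [mX ?]; split => //; exact: sg_measurable_sub mX. Qed.

(** The identity map, viewed with values in two sub-sigma-algebras, gives two independent random
    elements; the diagonal integral therefore becomes a double integral. *)
Lemma walk_indep (I J : pred nat) (Phi : sg I * sg J -> \bar R) :
  (forall i, ~~ (I i && J i)) ->
  measurable_fun [set: sg I * sg J] Phi -> (forall z, (0 <= Phi z)%E) ->
  (\int[P]_w Phi (w, w) = \int[P]_u \int[P]_v Phi (u, v))%E.
Proof.
move=> IJ mPhi Phi0.
apply: (@independent_integral _ _ _ _ T (sg I) (sg J) P id id Phi) => //; try exact: sg_id.
move=> A B mA mB; rewrite !preimage_id.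
have mi := gw_meas gw.
apply: (@sigma_indep _ _ _ P (incr_rect xi I) (incr_rect xi J)) => //.
- exact: incr_rect_measurable.
- exact: incr_rect_measurable.
- exact: incr_rect_setI.
- exact: incr_rect_setI.
- exact: incr_rectT.
- exact: incr_rectT.
- by move=> A' B'; exact: (incr_rect_indep (gw_indep gw) IJ).
Qed.

Definition hitp r j (c : R * R) : R := Ex P (fun w => ind R (`|wsum 0 j w - c| <= r)).

Lemma hitp_shift r j k c : (j <= k)%N ->
  Ex P (fun w => ind R (`|wsum j k w - c| <= r)) = hitp r (k - j) c.
Proof.
rewrite leq_eqVlt => /predU1P[->|jk].
  by rewrite subnn; apply: Ex_eq => w; rewrite /wsum !big_geq.
have mb i l : measurable_fun [set: T] (fun w => `|wsum i l w - c| <= r).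
  by apply: measurable_ptclose; apply: measurable_ptB => //; exact: wsum_measurable.
have mE : measurable [set z : pt | `|z - c| <= r].
  rewrite -[X in measurable X]setTI.
  by apply: (measurable_ptclose (f := fun z : pt => z - c)) => //; apply: measurable_ptB => //.
rewrite /hitp !Ex_bool //.
have k0 : (0 < k - j)%N by rewrite subn_gt0.
by rewrite (gw_gauss gw jk mE) (gw_gauss gw k0 mE) subn0.
Qed.

Lemma bmf_hitp r j d' (U : measurableType d') (f : U -> pt) :
  measurable_fun setT f -> bmf (fun u => hitp r j (f u)).
Proof.
move=> mf.
have bI (u : U) : bmf (fun w => ind R (`|wsum 0 j w - f u| <= r)).
  by apply: bmf_ptclose; apply: measurable_ptB => //; exact: wsum_measurable.
split; last first.
  exists 1 => u; rewrite /hitp Ex_ge0//= -[leRHS](Ex_cst P 1); apply: Ex_le => //.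
    exact: bmf_cst.
  by move=> w; rewrite /ind; case: (_ <= r).
pose phi (z : U * T) := (ind R (`|wsum 0 j z.2 - f z.1| <= r))%:E.
have mphi : measurable_fun [set: U * T] phi.
  apply/measurable_EFinP; apply: (bmf_ptclose _ _).1; apply: measurable_ptB.
    by apply: measurableT_comp => //; exact: wsum_measurable.
  exact: measurableT_comp.
have := @measurable_fun_fubini_tonelli_F _ _ _ _ _ P _ mphi.
rewrite /fubini_F/= => mF; apply/measurable_EFinP.
rewrite (_ : _ \o _ = (fun x => \int[P]_y (ind R (`|wsum 0 j y - f x| <= r))%:E)%E).
  by apply: mF => z; rewrite lee_fin /ind.
by apply/funext => u; rewrite /= ExE.
Qed.

(** The Markov property at time [k], integrated against a weight [H] of the past. The displacement
    [V] may itself depend on the first [k] steps, which later allows the path to be moved to a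
    prescribed point. *)
Lemma markov_hit r k l (H : T -> R) (V : T -> pt) y : (k <= l)%N ->
  bmf (H : past k -> R) -> measurable_fun [set: past k] (V : past k -> pt) ->
  Ex P (fun w => H w * ind R (`|V w + wsum 0 l w - y| <= r)) =
  Ex P (fun w => H w * hitp r (l - k) (y - (V w + wsum 0 k w))).
Proof.
move=> kl bH mV.
have mS : measurable_fun [set: past k] (wsum 0 k : past k -> pt).
  by apply: sg_wsum => i /andP[].
have mD : measurable_fun [set: future k] (wsum k l : future k -> pt).
  by apply: sg_wsum => i /andP[].
pose Phi (z : past k * future k) : \bar R :=
  (H z.1 * ind R (`|wsum k l z.2 - (y - (V z.1 + wsum 0 k z.1))| <= r))%:E.
have mPhi : measurable_fun [set: past k * future k] Phi.
  apply/measurable_EFinP; apply: measurable_funM.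
    by apply: measurableT_comp => //; exact: bmf_meas bH.
  apply: (bmf_ptclose _ _).1; apply: measurable_ptB; first exact: measurableT_comp.
  apply: measurable_ptB => //; apply: measurable_ptD; exact: measurableT_comp.
have Phi0 z : (0 <= Phi z)%E.
  by rewrite lee_fin mulr_ge0//; exact: bmf_ge0 bH.
have bI (c : pt) : bmf (fun w => ind R (`|wsum k l w - c| <= r)).
  by apply: bmf_ptclose; apply: measurable_ptB => //; exact: wsum_measurable.
rewrite /Ex; congr fine.
transitivity (\int[P]_w Phi (w, w))%E.
  apply: eq_integral => w _; rewrite /Phi/=; congr (_ * ind R (`|_| <= r))%:E.
  rewrite (@wsum_cat 0 k l)// opprB addrA [RHS]addrA; congr (_ - y).
  by rewrite [RHS]addrC.
rewrite (@walk_indep (fun i => i < k)%N (fun i => k <= i)%N Phi)//; last first.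
  by move=> i; case: ltnP.
apply: eq_integral => u _; rewrite /Phi/=.
under eq_integral do rewrite EFinM.
rewrite ge0_integralZl//; first by rewrite ExE// -EFinM hitp_shift.
- exact: bmf_EFin.
- by move=> w _; rewrite lee_fin /ind.
- by rewrite lee_fin; exact: bmf_ge0 bH.
Qed.

End walk.

(** * The logarithmic kernel *)

Section harmonic.
Context {R : realType}.
Implicit Types x y : R.

Lemma le_lnD x y : 0 < x -> 0 < y -> x <= y -> ln x <= ln y.
Proof. by move=> x0 y0 xy; rewrite ler_ln ?posrE. Qed.

Lemma ln_lower x : 0 < x -> 1 - x^-1 <= ln x.
Proof.
move=> x0; rewrite -[in leRHS](invrK x) lnV ?posrE ?invr_gt0//.
rewrite lerNr opprB; have := @le_ln1Dx R (x^-1 - 1).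
by rewrite (addrC 1) subrK; apply; rewrite ltrBrDr addNr invr_gt0.
Qed.

Lemma ln_upper x : 0 < x -> ln x <= x - 1.
Proof.
move=> x0; have := @le_ln1Dx R (x - 1); rewrite (addrC 1) subrK; apply.
by rewrite ltrBrDr addNr.
Qed.

Lemma harmonic_ge a b : (0 < a)%N -> (a <= b)%N ->
  ln (b%:R / a%:R) <= \sum_(a <= j < b) (j%:R)^-1 :> R.
Proof.
move=> a0; elim: b => [|b ih]; first by rewrite leqn0 => /eqP a0'; rewrite a0' in a0.
rewrite leq_eqVlt => /predU1P[<-|]; first by rewrite big_geq// divff ?ln1// pnatr_eq0 -lt0n.
rewrite ltnS => ab; rewrite big_nat_recr//=.
have a0' : 0 < a%:R :> R by rewrite ltr0n.
have b0 : 0 < b%:R :> R by rewrite ltr0n (leq_trans a0).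
have b1 : 0 < b.+1%:R :> R by rewrite ltr0n.
rewrite (_ : b.+1%:R / a%:R = (b%:R / a%:R) * (b.+1%:R / b%:R)); last first.
  by field; rewrite !gt_eqF.
rewrite lnM ?posrE ?divr_gt0//; apply: lerD; first exact: ih.
apply: le_trans (ln_upper _) _; first exact: divr_gt0.
by rewrite -addn1 natrD mulrDl divff ?gt_eqF// mul1r addrC addrA addNr add0r.
Qed.

Lemma harmonic_le a b : (0 < a)%N -> (a <= b)%N ->
  \sum_(a <= j < b) (j%:R)^-1 <= (a%:R)^-1 + ln (b%:R / a%:R) :> R.
Proof.
move=> a0 ab.
have a0' : 0 < a%:R :> R by rewrite ltr0n.
suff H c : (a <= c)%N -> \sum_(a <= j < c.+1) (j%:R)^-1 <= (a%:R)^-1 + ln (c%:R / a%:R) :> R.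
  move: ab; rewrite leq_eqVlt => /predU1P[<-|].
    by rewrite big_geq// divff ?gt_eqF// ln1 addr0 invr_ge0 ltW.
  case: b => // c; rewrite ltnS => ac; apply: le_trans (H _ ac) _.
  rewrite lerD2l le_lnD// ?divr_gt0// ?ltr0n ?(leq_trans a0)//.
  by rewrite ler_pM2r ?invr_gt0// ler_nat.
elim: c => [|c ih]; first by rewrite leqn0 => /eqP a0''; rewrite a0'' in a0.
rewrite leq_eqVlt => /predU1P[<-|].
  by rewrite big_nat1 divff ?gt_eqF// ln1 addr0.
rewrite ltnS => ac; rewrite big_nat_recr/=; last exact: leqW.
have c0 : 0 < c%:R :> R by rewrite ltr0n (leq_trans a0).
have c1 : 0 < c.+1%:R :> R by rewrite ltr0n.
rewrite (_ : c.+1%:R / a%:R = (c%:R / a%:R) * (c.+1%:R / c%:R)); last first.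
  by field; rewrite !gt_eqF.
rewrite lnM ?posrE ?divr_gt0// addrA; apply: lerD; first exact: ih.
apply: le_trans (ln_lower _); last exact: divr_gt0.
rewrite invf_div -[X in X - _](@divff _ c.+1%:R) ?gt_eqF// -mulrBl.
by rewrite -{2}addn1 natrD (addrC c%:R) addrK mul1r.
Qed.

End harmonic.

Section log_kernel.
Context {R : realType}.
Implicit Types (D r x y : R).

(* Logarithmic kernel at scale D, truncated below at r. *)
Definition Lam D r x : R := 1 + ln (Num.max 1 (D / Num.max x r)).

Lemma Lam_ge1 D r x : 1 <= Lam D r x.
Proof. by rewrite /Lam lerDl ln_ge0// le_max lexx. Qed.

Lemma Lam_ge0 D r x : 0 <= Lam D r x.
Proof. exact: le_trans ler01 (Lam_ge1 _ _ _). Qed.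

Lemma Lam_ge_ln D r x : 0 < D -> 0 < r -> 1 + ln (D / Num.max x r) <= Lam D r x.
Proof.
move=> D0 r0; rewrite /Lam lerD2l le_lnD//.
- by rewrite divr_gt0// lt_max r0 orbT.
- by rewrite lt_max ltr01.
- by rewrite le_max lexx orbT.
Qed.

(** Changing the ratio of scale to distance by a factor [K] adds [ln K]; since [Lam >= 1], this is
    at most a factor [1 + ln K]. *)
Lemma Lam_scale D r K x D' r' y : 0 < D -> 0 < r -> 0 < D' -> 0 < r' -> 1 <= K ->
  D * Num.max y r' <= K * D' * Num.max x r ->
  Lam D r x <= (1 + ln K) * Lam D' r' y.
Proof.
move=> D0 r0 D'0 r'0 K1 H.
have K0 : 0 < K by exact: lt_le_trans K1.
have mx : 0 < Num.max x r by rewrite lt_max r0 orbT.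
have my : 0 < Num.max y r' by rewrite lt_max r'0 orbT.
have lK := ln_ge0 K1.
have L1 := Lam_ge1 D' r' y.
suff: Lam D r x <= ln K + Lam D' r' y.
  by move=> h; apply: le_trans h _; rewrite mulrDl mul1r addrC lerD2l ler_peMr.
rewrite /Lam addrCA lerD2l -lnM ?posrE//; last by rewrite lt_max ltr01.
apply: le_lnD; [by rewrite lt_max ltr01|by rewrite mulr_gt0// lt_max ltr01|].
rewrite ge_max; apply/andP; split.
  by rewrite -[leLHS]mulr1 ler_pM// le_max lexx.
rewrite -[leRHS]mulr1; apply: (@le_trans _ _ (K * (D' / Num.max y r'))); last first.
  by rewrite mulr1 ler_pM2l// le_max lexx orbT.
by rewrite mulrA ler_pdivrMr// mulrAC ler_pdivlMr.
Qed.

Lemma Lam_anti D r x y : 0 < D -> 0 < r -> x <= y -> Lam D r y <= Lam D r x.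
Proof.
move=> D0 r0 xy; have := @Lam_scale D r 1 y D r x D0 r0 D0 r0 (lexx _).
rewrite ln1 addr0 !mul1r; apply; rewrite ler_pM2l//.
by rewrite ge_max !le_max xy lexx orbT.
Qed.

(* Used with q j the probability that the walk is within r, at step j, of a
   point at distance x. *)
Lemma green_upper (C0 CT : R) : 1 <= C0 -> 1 <= CT -> exists2 C, 0 < C &
  forall (D r h x : R) (q : nat -> R) J, 0 < D -> 0 < r -> 0 < h -> h <= r ^+ 2 ->
    (forall j, q j <= C0 * r ^+ 2 / (Num.max x r) ^+ 2) ->
    (forall j, (0 < j)%N -> q j <= r ^+ 2 / (j%:R * h)) ->
    J%:R * h <= CT * D ^+ 2 ->
    \sum_(0 <= j < J) h * q j <= C * r ^+ 2 * Lam D r x.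
Proof.
move=> C01 CT1; exists (2 * C0 + 3 + ln CT).
  have := ln_ge0 CT1; lra.
move=> D r h x q J D0 r0 h0 hr q1 q2 JT.
set m := Num.max x r.
have m0 : 0 < m by rewrite lt_max r0 orbT.
have rm : r <= m by rewrite le_max lexx orbT.
have m20 : 0 < m ^+ 2 by rewrite exprn_gt0.
have hm : h <= m ^+ 2 by apply: le_trans hr _; rewrite ler_sqr ?nnegrE// ltW.
(* Cut at the time of order [m ^+ 2] that the walk needs to cover the distance [m]. The earlier
   terms add up to at most [2 * C0 * r ^+ 2]; the later ones are [r ^+ 2 / j], a harmonic sum from
   [m ^+ 2] to [CT * D ^+ 2] in time. *)
pose a := (Num.trunc (m ^+ 2 / h)).+1.
have ta : a.-1%:R <= m ^+ 2 / h < a%:R.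
  by apply: truncn_itv; rewrite divr_ge0 ?ltW.
have ah1 : m ^+ 2 < a%:R * h by case/andP: ta => _; rewrite ltr_pdivrMr.
have ah2 : a%:R * h <= 2 * m ^+ 2.
  case/andP: ta; rewrite ler_pdivlMr//= => + _ => tle.
  by rewrite /a -addn1 natrD mulrDl mul1r; lra.
have L1 := Lam_ge1 D r x.
have lT := ln_ge0 CT1.
have small n : (n <= a)%N -> \sum_(0 <= j < n) h * q j <= 2 * C0 * r ^+ 2.
  move=> na; apply: (@le_trans _ _ (\sum_(0 <= j < n) h * (C0 * r ^+ 2 / m ^+ 2))).
    by apply: ler_sum => j _; rewrite ler_pM2l.
  rewrite sumr_const_nat subn0 -[leLHS]mulr_natl.
  apply: (@le_trans _ _ (a%:R * h * (C0 * r ^+ 2 / m ^+ 2))).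
    rewrite -[leRHS]mulrA ler_wpM2r ?ler_nat// mulr_ge0 ?ltW//.
    by rewrite divr_gt0// mulr_gt0 ?exprn_gt0//; lra.
  rewrite (_ : 2 * C0 * r ^+ 2 = 2 * m ^+ 2 * (C0 * r ^+ 2 / m ^+ 2)); last first.
    by field; rewrite gt_eqF.
  by rewrite ler_wpM2r// divr_ge0 ?mulr_ge0 ?sqr_ge0//; lra.
have r20 : 0 < r ^+ 2 by rewrite exprn_gt0.
have fin u : u <= 2 * C0 * r ^+ 2 + r ^+ 2 * ((3 + ln CT) * Lam D r x) ->
    u <= (2 * C0 + 3 + ln CT) * r ^+ 2 * Lam D r x.
  move=> /le_trans; apply.
  have : 0 <= C0 * r ^+ 2 * (Lam D r x - 1).
    by rewrite !mulr_ge0 ?subr_ge0//; lra.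
  lra.
apply: fin.
have pos : 0 <= r ^+ 2 * ((3 + ln CT) * Lam D r x).
  by rewrite !mulr_ge0//; lra.
have [Ja|aJ] := leqP J a.
  by apply: le_trans (small _ Ja) _; lra.
rewrite (big_cat_nat _ (n := a)) ?(ltnW aJ)//=.
apply: lerD; first exact: small.
apply: (@le_trans _ _ (\sum_(a <= j < J) r ^+ 2 * (j%:R)^-1)).
  rewrite big_seq [leRHS]big_seq; apply: ler_sum => j.
  rewrite mem_index_iota => /andP[aj _].
  have j0 : (0 < j)%N by exact: leq_trans aj.
  apply: (@le_trans _ _ (h * (r ^+ 2 / (j%:R * h)))).
    by rewrite ler_pM2l// q2.
  rewrite le_eqVlt; apply/orP; left; apply/eqP; field.
  by rewrite !gt_eqF// ltr0n.
rewrite -mulr_sumr ler_pM2l//.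
apply: le_trans (harmonic_le _ (ltnW aJ)) _ => //.
have a1 : (a%:R)^-1 <= 1 :> R by rewrite invf_le1 ?ltr0n// ler1n.
have : ln (J%:R / a%:R) <= ln CT + 2 * (Lam D r x - 1).
  apply: (@le_trans _ _ (ln (CT * (D / m) ^+ 2))).
    apply: le_lnD.
    - by rewrite divr_gt0 ?ltr0n// (leq_trans _ aJ).
    - by rewrite mulr_gt0 ?exprn_gt0 ?divr_gt0//; lra.
    rewrite ler_pdivrMr ?ltr0n// -(ler_pM2r h0); apply: le_trans JT _.
    rewrite expr_div_n (_ : CT * _ * _ * h = CT * D ^+ 2 * (a%:R * h / m ^+ 2)); last first.
      by field; rewrite gt_eqF.
    rewrite ler_peMr//; first by rewrite mulr_ge0 ?sqr_ge0//; lra.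
    by rewrite ler_pdivlMr// mul1r ltW.
  rewrite lnM ?posrE ?exprn_gt0 ?divr_gt0//; last lra.
  rewrite lerD2l lnXn ?divr_gt0// -[leLHS]mulr_natl ler_pM2l//.
  by have := @Lam_ge_ln D r x D0 r0; rewrite -/m; lra.
have : 0 <= ln CT * (Lam D r x - 1) by rewrite mulr_ge0// subr_ge0.
by move=> ? ?; lra.
Qed.

Lemma green_lower (c : R) : 0 < c ->
  forall (D r h x : R) (q : nat -> R) J, 0 < D -> 0 < r -> 0 < h -> h <= r ^+ 2 ->
    r <= 2 * D -> x <= 2 * D ->
    (forall j, 0 <= q j) ->
    (forall j, (Num.max x r) ^+ 2 <= j%:R * h -> c * r ^+ 2 / (j%:R * h) <= q j) ->
    64 * D ^+ 2 <= J%:R * h ->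
    c * r ^+ 2 * Lam D r x <= \sum_(0 <= j < J) h * q j.
Proof.
move=> c0 D r h x q J D0 r0 h0 hr rD xD q0 q1 JT.
set m := Num.max x r.
have m0 : 0 < m by rewrite lt_max r0 orbT.
have mD : m <= 2 * D by rewrite ge_max xD rD.
have rm : r <= m by rewrite le_max lexx orbT.
have m20 : 0 < m ^+ 2 by rewrite exprn_gt0.
have hm : h <= m ^+ 2 by apply: le_trans hr _; rewrite ler_sqr ?nnegrE// ltW.
have mD2 : m ^+ 2 <= 4 * D ^+ 2.
  rewrite (_ : 4 * D ^+ 2 = (2 * D) ^+ 2); last by ring.
  by rewrite ler_sqr// nnegrE; lra.
pose a := (Num.trunc (m ^+ 2 / h)).+1.
have ta : a.-1%:R <= m ^+ 2 / h < a%:R.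
  by apply: truncn_itv; rewrite divr_ge0 ?ltW.
have ah1 : m ^+ 2 < a%:R * h by case/andP: ta => _; rewrite ltr_pdivrMr.
have ah2 : a%:R * h <= 2 * m ^+ 2.
  case/andP: ta; rewrite ler_pdivlMr//= => + _ => tle.
  by rewrite /a -addn1 natrD mulrDl mul1r; lra.
have D20 : 0 < D ^+ 2 by rewrite exprn_gt0.
have aJ : (a <= J)%N.
  by rewrite -(ler_nat R) -(ler_pM2r h0); lra.
rewrite (big_cat_nat _ (n := a))//=.
apply: (@le_trans _ _ (0 + \sum_(a <= j < J) c * r ^+ 2 * (j%:R)^-1)).
  rewrite add0r -mulr_sumr ler_pM2l ?mulr_gt0 ?exprn_gt0//.
  apply: le_trans (harmonic_ge _ aJ) => //.
  (* The quotient of the horizon 64 D^2 and the cut, at most 2 m^2. As m <= 2 D it is at least 8,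
     which leaves room for the summand 1 of [Lam]. *)
  apply: (@le_trans _ _ (ln (32 * (D / m) ^+ 2))); last first.
    apply: le_lnD.
    - by rewrite mulr_gt0 ?exprn_gt0 ?divr_gt0//; lra.
    - by rewrite divr_gt0 ?ltr0n// (leq_trans _ aJ).
    rewrite ler_pdivlMr ?ltr0n// -(ler_pM2r h0); apply: le_trans JT.
    rewrite expr_div_n (_ : 32 * _ * _ * h = 32 * D ^+ 2 * (a%:R * h / m ^+ 2)); last first.
      by field; rewrite gt_eqF.
    rewrite (_ : 64 * D ^+ 2 = 32 * D ^+ 2 * 2); last by ring.
    by rewrite ler_pM2l ?mulr_gt0// ler_pdivrMr.
  have l4 : 1 <= ln 4 :> R.
    have : 1 - (2:R)^-1 <= ln 2 by apply: ln_lower.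
    rewrite (_ : 4 = 2 * 2 :> R); last by ring.
    by rewrite lnM ?posrE// => ?; lra.
  have Dm0 : 0 < D / m by rewrite divr_gt0.
  rewrite /Lam -/m.
  have [Dm|Dm] := leP 1 (D / m).
    have := ln_ge0 Dm.
    have -> : ln (32 * (D / m) ^+ 2) = ln 32 + 2 * ln (D / m).
      by rewrite lnM ?posrE ?exprn_gt0// lnXn// mulr_natl.
    have : ln 4 <= ln 32 :> R by apply: le_lnD; rewrite ?ltr0n// ler_nat.
    lra.
  rewrite ln1 addr0; apply: le_trans l4 _; apply: le_lnD => //.
    by rewrite mulr_gt0 ?exprn_gt0.
  rewrite expr_div_n -[leLHS]mulr1; apply: (@le_trans _ _ (32 * (1 / 4))); first lra.
  by rewrite ler_pM2l// ler_pdivlMr// ; lra.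
apply: lerD; first by apply: sumr_ge0 => j _; rewrite mulr_ge0// ltW.
rewrite big_seq [leRHS]big_seq; apply: ler_sum => j.
rewrite mem_index_iota => /andP[aj _].
have j0 : (0 < j)%N by exact: leq_trans aj.
apply: (@le_trans _ _ (h * (c * r ^+ 2 / (j%:R * h)))).
  rewrite le_eqVlt; apply/orP; left; apply/eqP; field.
  by rewrite !gt_eqF// ltr0n.
rewrite ler_pM2l//; apply: q1; apply/ltW; apply: lt_le_trans ah1 _.
by rewrite ler_pM2r// ler_nat.
Qed.

End log_kernel.

(** * Gaussian probabilities of squares *)

Section gaussian_square.
Context {R : realType}.
Notation pt := (R * R)%type.
Local Notation leb := (@lebesgue_measure R).

(** The norm on [R * R] is the max norm, so its balls are products of intervals and their Gaussian
    mass factorises. *)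
Lemma square_prod (c : pt) (r : R) :
  [set z : pt | `|z - c| <= r] =
  `[c.1 - r, c.1 + r]%classic `*` `[c.2 - r, c.2 + r]%classic.
Proof.
apply/seteqP; split => z /=; rewrite !in_itv/= prod_normE/= ge_max !ler_distl.
  by move=> /andP[].
by move=> [-> ->].
Qed.

Definition citv (a r : R) : set R := `[a - r, a + r]%classic.

Lemma measurable_citv a r : measurable (citv a r).
Proof. exact: measurable_itv. Qed.
Hint Resolve measurable_citv : core.

Lemma measurable_square (c : pt) (r : R) : measurable [set z : pt | `|z - c| <= r].
Proof. by rewrite square_prod; by apply: measurableX; exact: measurable_itv. Qed.

Lemma leb_itv_center (a r : R) : 0 < r ->
  leb (citv a r) = (2 * r)%:E.
Proof.
move=> r0; rewrite /citv lebesgue_measure_itv/= lte_fin ifT; last lra.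
by rewrite -EFinD; congr EFin; ring.
Qed.

Lemma normal_prob_le (s a r M : R) : 0 < r ->
  (forall x, a - r <= x <= a + r -> normal_pdf 0 s x <= M) ->
  (normal_prob 0 s (citv a r) <= (2 * r * M)%:E)%E.
Proof.
move=> r0 H; rewrite /normal_prob.
apply: (@le_trans _ _ (\int[leb]_(x in citv a r) M%:E)%E).
  apply: ge0_le_integral => //.
  - exact: measurable_itv.
  - by move=> x _; rewrite lee_fin normal_pdf_ge0.
  - by apply/measurable_EFinP; apply: measurable_funTS; exact: measurable_normal_pdf.
rewrite integral_cst; last exact: measurable_itv.
  by rewrite [X in (_ * X)%E](leb_itv_center a r0) -EFinM mulrC.
Qed.

Lemma normal_prob_ge (s a r M : R) : 0 < r -> 0 <= M ->
  (forall x, a - r <= x <= a + r -> M <= normal_pdf 0 s x) ->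
  ((2 * r * M)%:E <= normal_prob 0 s (citv a r))%E.
Proof.
move=> r0 M0 H; rewrite /normal_prob.
apply: (@le_trans _ _ (\int[leb]_(x in citv a r) M%:E)%E).
  rewrite integral_cst; last exact: measurable_itv.
  by rewrite [X in (_ * X)%E](leb_itv_center a r0) -EFinM mulrC.
apply: ge0_le_integral => //.
- exact: measurable_itv.
- by apply/measurable_EFinP; apply: measurable_funTS; exact: measurable_normal_pdf.
Qed.

(* Maximal value of the planar Gaussian density of variance v. *)
Definition peak2 (v : R) : R := (2 * pi * v)^-1.

Lemma peak2_ge0 v : 0 < v -> 0 <= peak2 v.
Proof. by move=> v0; rewrite invr_ge0 !mulr_ge0// ?pi_ge0// ltW. Qed.

Lemma peak2_le v : 0 < v -> peak2 v <= (4 * v)^-1.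
Proof.
move=> v0; rewrite lef_pV2 ?posrE; [|by rewrite mulr_gt0// mulr_gt0// pi_gt0|by rewrite mulr_gt0].
by rewrite ler_pM2r//; have := pi_ge2 R; lra.
Qed.

Lemma peak2_ge v : 0 < v -> (8 * v)^-1 <= peak2 v.
Proof.
move=> v0; rewrite lef_pV2 ?posrE; [|by rewrite mulr_gt0|by rewrite mulr_gt0// mulr_gt0// pi_gt0].
by rewrite ler_pM2r//; have := pihalf_lt2 R; lra.
Qed.

Lemma normal_pdfEv (v x : R) : 0 < v ->
  normal_pdf 0 (Num.sqrt v) x = normal_peak (Num.sqrt v) * expR (- (x ^+ 2 / (2 * v))).
Proof.
move=> v0; rewrite /normal_pdf gt_eqF ?sqrtr_gt0// /normal_fun subr0.
by rewrite sqr_sqrtr ?ltW// -mulr_natl mulNr.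
Qed.

Lemma normal_peak_sq v : 0 < v -> normal_peak (Num.sqrt v) ^+ 2 = peak2 v.
Proof.
move=> v0; rewrite /normal_peak /peak2 exprVn sqr_sqrtr; last first.
  by rewrite mulrn_wge0// mulr_ge0 ?sqr_ge0 ?pi_ge0.
by rewrite sqr_sqrtr ?ltW// -mulr_natl; congr (_^-1); ring.
Qed.

Lemma gauss2_square (v : R) (c : pt) (r : R) :
  gauss2 v [set z | `|z - c| <= r] =
  (normal_prob 0 (Num.sqrt v) (citv c.1 r) *
   normal_prob 0 (Num.sqrt v) (citv c.2 r))%E.
Proof. by rewrite square_prod /gauss2 product_measure1E//; exact: measurable_itv. Qed.

(** Here [m] is a lower bound for the distance of the interval from the origin; the alternative
    [m = 0] covers the bound by the peak alone. *)
Lemma normal_prob_square_le (v a r m : R) : 0 < v -> 0 < r -> 0 <= m -> m + r <= `|a| \/ m = 0 ->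
  (normal_prob 0 (Num.sqrt v) (citv a r) <=
   (2 * r * (normal_peak (Num.sqrt v) * expR (- (m ^+ 2 / (2 * v)))))%:E)%E.
Proof.
move=> v0 r0 m0 H; apply: normal_prob_le => // x /andP[x1 x2].
rewrite normal_pdfEv// ler_wpM2l ?normal_peak_ge0// ler_expR lerN2.
rewrite ler_pM2r ?invr_gt0 ?mulr_gt0//; case: H => [H|->]; last by rewrite expr0n/= sqr_ge0.
rewrite -[leRHS]real_normK ?num_real// ler_sqr ?nnegrE//.
by move: H; case: (ger0P a); case: (ger0P x); lra.
Qed.

Lemma gauss2_square_le (v : R) (c : pt) (r m : R) : 0 < v -> 0 < r -> 0 <= m ->
  m + r <= `|c| \/ m = 0 ->
  fine (gauss2 v [set z | `|z - c| <= r]) <=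
  (2 * r) ^+ 2 * peak2 v * expR (- (m ^+ 2 / (2 * v))).
Proof.
move=> v0 r0 m0 H; rewrite gauss2_square.
(* The max norm is attained by one coordinate, which supplies the whole exponential factor; the
   other coordinate is bounded by its peak. *)
have [k [l [k0 [l0 [H1 H2 kl]]]]] : exists k l : R, [/\ 0 <= k, 0 <= l &
    [/\ k + r <= `|c.1| \/ k = 0, l + r <= `|c.2| \/ l = 0 & k ^+ 2 + l ^+ 2 = m ^+ 2]].
  case: H => [|->]; last by exists 0, 0; split => //; split; [right|right|rewrite expr0n addr0].
  rewrite prod_normE le_max => /orP[h|h].
    by exists m, 0; split => //; split; [left|right|rewrite expr0n addr0].
  by exists 0, m; split => //; split; [right|left|rewrite expr0n add0r].
have N1 := normal_prob_square_le v0 r0 k0 H1.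
have N2 := normal_prob_square_le v0 r0 l0 H2.
rewrite -lee_fin fineK; last by rewrite fin_numM// fin_num_measure//; exact: measurable_citv.
apply: le_trans (lee_pmul _ _ N1 N2) _ => //.
rewrite -EFinM lee_fin -kl -normal_peak_sq// (mulrDl (k ^+ 2)) opprD expRD.
by rewrite le_eqVlt; apply/orP; left; apply/eqP; ring.
Qed.

Lemma gauss2_square_ge (v : R) (c : pt) (r : R) : 0 < v -> 0 < r ->
  (2 * r) ^+ 2 * peak2 v * expR (- (((`|c.1| + r) ^+ 2 + (`|c.2| + r) ^+ 2) / (2 * v))) <=
  fine (gauss2 v [set z | `|z - c| <= r]).
Proof.
move=> v0 r0; rewrite gauss2_square.
have H (a : R) : ((2 * r * (normal_peak (Num.sqrt v) *
    expR (- ((`|a| + r) ^+ 2 / (2 * v)))))%:E <=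
    normal_prob 0 (Num.sqrt v) (citv a r))%E.
  apply: normal_prob_ge => //; first by rewrite mulr_ge0 ?normal_peak_ge0 ?expR_ge0.
  move=> x /andP[x1 x2].
  rewrite normal_pdfEv// ler_wpM2l ?normal_peak_ge0// ler_expR lerN2.
  rewrite ler_pM2r ?invr_gt0 ?mulr_gt0//.
  rewrite -[leLHS]real_normK ?num_real// ler_sqr ?nnegrE ?addr_ge0// ?(ltW r0)//.
  by case: (ger0P a); case: (ger0P x); lra.
rewrite -lee_fin fineK; last by rewrite fin_numM// fin_num_measure//; exact: measurable_citv.
apply: le_trans (lee_pmul _ _ (H c.1) (H c.2));
  rewrite ?lee_fin ?mulr_ge0 ?normal_peak_ge0 ?expR_ge0 ?(ltW r0)//.
rewrite -normal_peak_sq// [(_ + _) / _]mulrDl opprD expRD.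
by rewrite le_eqVlt; apply/orP; left; apply/eqP; ring.
Qed.

Lemma expRN_le (x : R) : 0 < x -> expR (- x) <= x^-1.
Proof.
move=> x0; rewrite expRN lef_pV2 ?posrE ?expR_gt0//.
by apply: le_trans (expR_ge1Dx x); rewrite lerDr.
Qed.

End gaussian_square.

Section hitp_bounds.
Context {R : realType} {d} {T : measurableType d} {P : probability T R}.
Context {h : R} {xi : nat -> T -> R * R}.
Hypothesis (h0 : 0 < h) (gw : gaussian_walk P h xi).
Notation pt := (R * R)%type.

Lemma hitpE r j c : (0 < j)%N ->
  hitp P xi r j c = fine (gauss2 (j%:R * h) [set z | `|z - c| <= r]).
Proof.
move=> j0; rewrite /hitp Ex_bool; last first.
  by apply: measurable_ptclose; apply: measurable_ptB => //; exact: wsum_measurable gw _ _.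
by rewrite (gw_gauss gw j0 (measurable_square c r)) subn0.
Qed.

Lemma hitp_bmf r j c : bmf (fun w => ind R (`|wsum xi 0 j w - c| <= r)).
Proof.
by apply: bmf_ptclose; apply: measurable_ptB => //; exact: wsum_measurable gw _ _.
Qed.

Lemma hitp_ge0 r j c : 0 <= hitp P xi r j c.
Proof. by apply: Ex_ge0; exact: hitp_bmf. Qed.

Lemma hitp_le1 r j c : hitp P xi r j c <= 1.
Proof.
rewrite -[leRHS](Ex_cst P 1); apply: Ex_le; first exact: hitp_bmf.
  exact: bmf_cst.
by move=> w; rewrite /ind; case: (_ <= r).
Qed.

Lemma hitp_le_far r j c m : (0 < j)%N -> 0 < r -> 0 <= m ->
  m + r <= `|c| \/ m = 0 ->
  hitp P xi r j c <= (2 * r) ^+ 2 * peak2 (j%:R * h) * expR (- (m ^+ 2 / (2 * (j%:R * h)))).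
Proof.
move=> j0 r0 m0 H; rewrite hitpE//; apply: gauss2_square_le => //.
by rewrite mulr_gt0// ltr0n.
Qed.

Lemma hitp_le_peak r j c : (0 < j)%N -> 0 < r ->
  hitp P xi r j c <= (2 * r) ^+ 2 * peak2 (j%:R * h).
Proof.
move=> j0 r0; apply: le_trans (@hitp_le_far r j c 0 j0 r0 _ _) _ => //; first by right.
by rewrite expr0n/= mul0r oppr0 expR0 mulr1.
Qed.

Lemma hitp_le r j c : (0 < j)%N -> 0 < r -> hitp P xi r j c <= r ^+ 2 / (j%:R * h).
Proof.
move=> j0 r0; apply: le_trans (hitp_le_peak _ _ _) _ => //.
have v0 : 0 < j%:R * h by rewrite mulr_gt0// ltr0n.
apply: (@le_trans _ _ ((2 * r) ^+ 2 * (4 * (j%:R * h))^-1)).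
  by rewrite ler_wpM2l ?sqr_ge0 ?peak2_le.
by rewrite le_eqVlt; apply/orP; left; apply/eqP; field; rewrite !gt_eqF// ltr0n.
Qed.

(** Uniform in [j]: for [|c| >= 2 r] the inequality exp(-x) <= 1/x cancels the variance in the peak,
    and for smaller [|c|] the bound by 1 suffices. *)
Lemma hitp_le_dist (r : R) j (c : pt) : 0 < r -> hitp P xi r j c <= 16 * r ^+ 2 / (Num.max `|c| r) ^+ 2.
Proof.
move=> r0; set m := Num.max _ _.
have m0 : 0 < m by rewrite lt_max r0 orbT.
have r20 : 0 < r ^+ 2 by rewrite exprn_gt0.
have m20 : 0 < m ^+ 2 by rewrite exprn_gt0.
have [c2|c2] := ltP `|c| (2 * r).
  apply: le_trans (hitp_le1 _ _ _) _; rewrite ler_pdivlMr// mul1r.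
  have mr : m <= 2 * r by rewrite ge_max (ltW c2)/=; lra.
  have : m ^+ 2 <= (2 * r) ^+ 2 by rewrite ler_sqr ?nnegrE ?(ltW m0)//; lra.
  lra.
have mE : m = `|c| by apply/max_idPl; lra.
have [->|j0] := posnP j.
  have -> : hitp P xi r 0 c = 0.
    rewrite -(Ex_cst P 0); apply: Ex_eq => w; rewrite /wsum big_geq// sub0r normrN /ind.
    by rewrite lt_geF//; lra.
  by rewrite divr_ge0 ?sqr_ge0// mulr_ge0// ltW.
have v0 : 0 < j%:R * h by rewrite mulr_gt0// ltr0n.
have k0 : 0 <= m / 2 by rewrite divr_ge0// ltW.
have kc : m / 2 + r <= `|c| \/ m / 2 = 0 by left; rewrite -mE; lra.
apply: le_trans (@hitp_le_far r j c _ j0 r0 k0 kc) _.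
apply: (@le_trans _ _ ((2 * r) ^+ 2 * (4 * (j%:R * h))^-1 * ((m / 2) ^+ 2 / (2 * (j%:R * h)))^-1)).
  apply: ler_pM; rewrite ?expR_ge0//.
  - by rewrite mulr_ge0 ?peak2_ge0// sqr_ge0.
  - by rewrite ler_wpM2l ?sqr_ge0 ?peak2_le.
  - by apply: expRN_le; rewrite divr_gt0 ?exprn_gt0 ?(mulr_gt0 _ v0)// divr_gt0.
have -> : (2 * r) ^+ 2 / (4 * (j%:R * h)) / ((m / 2) ^+ 2 / (2 * (j%:R * h))) = 8 * r ^+ 2 / m ^+ 2.
  by field; rewrite !gt_eqF// ltr0n.
by rewrite ler_pM2r ?invr_gt0//; lra.
Qed.

Lemma hitp_ge r j c : (0 < j)%N -> 0 < r ->
  (2 * r) ^+ 2 * peak2 (j%:R * h) *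
    expR (- (((`|c.1| + r) ^+ 2 + (`|c.2| + r) ^+ 2) / (2 * (j%:R * h)))) <=
  hitp P xi r j c.
Proof.
by move=> j0 r0; rewrite hitpE//; apply: gauss2_square_ge => //; rewrite mulr_gt0// ltr0n.
Qed.

(** From time m^2 on the exponent is at least -4: each coordinate adds at most (2 m)^2 to a
    numerator that is divided by at least 2 m^2. *)
Lemma hitp_ge_near (r : R) j (c : pt) : 0 < r -> (Num.max `|c| r) ^+ 2 <= j%:R * h ->
  expR (- 4) / 2 * r ^+ 2 / (j%:R * h) <= hitp P xi r j c.
Proof.
move=> r0; set m := Num.max _ _ => mj.
have m0 : 0 < m by rewrite lt_max r0 orbT.
have m20 : 0 < m ^+ 2 by rewrite exprn_gt0.
have v0 : 0 < j%:R * h by exact: lt_le_trans mj.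
have j0 : (0 < j)%N by move: v0; rewrite pmulr_lgt0// ltr0n.
apply: le_trans (hitp_ge _ _ _) => //.
have -> : expR (- 4) / 2 * r ^+ 2 / (j%:R * h) = (2 * r) ^+ 2 * (8 * (j%:R * h))^-1 * expR (- 4).
  by field; rewrite !gt_eqF// ltr0n.
apply: ler_pM; rewrite ?expR_ge0//.
- by rewrite mulr_ge0 ?sqr_ge0// invr_ge0; lra.
- by rewrite ler_wpM2l ?sqr_ge0 ?peak2_ge.
rewrite ler_expR lerN2 ler_pdivrMr ?(mulr_gt0 _ v0)//.
have a1 : `|c.1| <= m by rewrite /m prod_normE !le_max lexx.
have a2 : `|c.2| <= m by rewrite /m prod_normE !le_max lexx orbT.
have rm : r <= m by rewrite le_max lexx orbT.
have : (`|c.1| + r) ^+ 2 <= (2 * m) ^+ 2.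
  by rewrite ler_sqr ?nnegrE ?addr_ge0 ?mulr_ge0// ?(ltW r0) ?(ltW m0)//; lra.
have : (`|c.2| + r) ^+ 2 <= (2 * m) ^+ 2.
  by rewrite ler_sqr ?nnegrE ?addr_ge0 ?mulr_ge0// ?(ltW r0) ?(ltW m0)//; lra.
lra.
Qed.

End hitp_bounds.

(** [C] is chosen before the space, the mesh and the walk: this is the uniformity that survives the
    limit of fine grids. *)
Lemma hit_green_upper (R : realType) (CT : R) : 1 <= CT -> exists2 C : R, 0 < C &
  forall d (T : measurableType d) (P : probability T R) h xi,
  0 < h -> gaussian_walk P h xi -> forall D r c J, 0 < D -> 0 < r -> h <= r ^+ 2 ->
  J%:R * h <= CT * D ^+ 2 ->
  \sum_(0 <= j < J) h * hitp P xi r j c <= C * r ^+ 2 * Lam D r `|c|.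
Proof.
move=> CT1; have [C C0 HC] := @green_upper R 16 CT ltac:(lra) CT1.
exists C => // d T P h xi h0 gw D r c J D0 r0 hr JT; apply: HC => //.
- by move=> j; exact: (hitp_le_dist h0 gw).
- by move=> j j0; exact: (hitp_le h0 gw).
Qed.

Lemma hit_green_lower (R : realType) d (T : measurableType d) (P : probability T R) h xi :
  0 < h -> gaussian_walk P h xi -> forall (D r : R) c J, 0 < D -> 0 < r -> h <= r ^+ 2 ->
  r <= 2 * D -> `|c| <= 2 * D -> 64 * D ^+ 2 <= J%:R * h ->
  expR (- 4) / 2 * r ^+ 2 * Lam D r `|c| <= \sum_(0 <= j < J) h * hitp P xi r j c.
Proof.
move=> h0 gw D r c J D0 r0 hr rD cD JT.
have e0 : 0 < expR (- 4) / 2 :> R by rewrite divr_gt0// expR_gt0.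
apply: (green_lower e0) => //.
- by move=> j; exact: (hitp_ge0 gw).
- by move=> j; exact: (hitp_ge_near h0 gw).
Qed.

(** * Doob's inequality and occupation times *)

Section doob.
Context (R : realType) d (T : measurableType d) (P : probability T R).

Fixpoint runmax (N : nat -> T -> R) n (w : T) : R :=
  if n is n'.+1 then Num.max (runmax N n' w) (N n' w) else 0.

Lemma runmax_ge0 N n w : 0 <= runmax N n w.
Proof. by elim: n => [|n ih] //=; rewrite le_max ih. Qed.

Lemma runmax_ge N n i w : (i < n)%N -> N i w <= runmax N n w.
Proof.
elim: n => // n ih; rewrite ltnS leq_eqVlt => /predU1P[->|/ih H] /=.
  by rewrite le_max lexx orbT.
by rewrite le_max H.
Qed.

Lemma runmax_bmf d' (U : measurableType d') (f : U -> T) N n :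
  (forall i, (i < n)%N -> bmf (fun u => N i (f u))) -> bmf (fun u => runmax N n (f u)).
Proof.
elim: n => [|n ih] bN /=; first exact: bmf_cst.
by apply: bmf_max; [apply: ih => i im; apply: bN; exact: leqW|exact: bN].
Qed.

(** Abel summation. With S the running maximum, S_{i+1}^2 - S_i^2 <= 2 (S_{i+1} - S_i) S_{i+1}, and
    the increment vanishes unless S_{i+1} = N_i. *)
Lemma runmax_sq_le N n w : (forall i, (i < n)%N -> 0 <= N i w) ->
  runmax N n w ^+ 2 <=
  \sum_(i < n) 2 * ((runmax N i.+1 w - runmax N i w) * N i w).
Proof.
elim: n => [|n ih] N0; first by rewrite big_ord0 expr0n.
rewrite big_ord_recr/=; have := ih (fun i im => N0 i (leqW im)).
set S := runmax N n w; have S0 : 0 <= S by exact: runmax_ge0.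
have := N0 n (ltnSn n); set x := N n w => x0.
set s := \sum_(_ < _) _; move=> Ss.
have [xS|Sx] := leP x S; first by rewrite subrr mul0r mulr0 addr0.
have : 0 <= (x - S) ^+ 2 by exact: sqr_ge0.
nra.
Qed.

(* Doob's L2 inequality without conditional expectations: it is enough that
   N i is dominated by Z after integration against the increments of the
   running maximum. *)
Lemma doob_L2 (N : nat -> T -> R) (Z H : T -> R) n :
  bmf Z -> bmf H -> (forall i, (i < n)%N -> bmf (N i)) ->
  (forall i, (i < n)%N ->
    Ex P (fun w => H w * (runmax N i.+1 w - runmax N i w) * N i w) <=
    Ex P (fun w => H w * (runmax N i.+1 w - runmax N i w) * Z w)) ->
  Ex P (fun w => H w * runmax N n w ^+ 2) <= 4 * Ex P (fun w => H w * Z w ^+ 2).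
Proof.
move=> bZ bH bN HN.
have bS i : (i <= n)%N -> bmf (runmax N i).
  by move=> im; apply: (@runmax_bmf _ _ id) => j ji; apply: bN; exact: leq_trans im.
have bD i : (i < n)%N -> bmf (fun w => runmax N i.+1 w - runmax N i w).
  move=> im; split; first by apply: measurable_funB; apply: bmf_meas; apply: bS => //; exact: ltnW.
  have [M HM] := (bS _ im).2; exists M => w; rewrite subr_ge0 le_max lexx/=.
  by rewrite lerBlDr (le_trans (proj2 (andP (HM w))))// lerDl runmax_ge0.
have bSn := bS n (leqnn n).
set X := Ex P _; set Y := Ex P (fun w => H w * Z w ^+ 2).
(* Then 2 S Z <= S^2 / 2 + 2 Z^2 gives X <= X / 2 + 2 Y. Subtracting X / 2 is legitimate since [X]
   is a real number, and yields the constant 4. *)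
suff : X <= 2 * Ex P (fun w => H w * (runmax N n w * Z w)).
  move=> XY; have : 2 * Ex P (fun w => H w * (runmax N n w * Z w)) <= 2^-1 * X + 2 * Y.
    rewrite -!ExZ//; try by do !apply: bmfM => //; apply: bmfX.
    rewrite -ExD; try by apply: bmfM; [exact: bmf_cst|apply: bmfM => //; exact: bmfX].
    apply: Ex_le.
    - by apply: bmfM; [exact: bmf_cst|apply: bmfM => //; exact: bmfM].
    - by apply: bmfD; apply: bmfM; try exact: bmf_cst; apply: bmfM => //; exact: bmfX.
    move=> w; have := bmf_ge0 w bH; set a := H w; set s := runmax N n w; set z := Z w => a0.
    have : 0 <= a * (s - 2 * z) ^+ 2 by rewrite mulr_ge0// sqr_ge0.
    nra.
  lra.
apply: (@le_trans _ _ (\sum_(i < n) 2 * Ex P (fun w => H w * (runmax N i.+1 w - runmax N i w) * N i w))).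
  have -> : \sum_(i < n) 2 * Ex P (fun w => H w * (runmax N i.+1 w - runmax N i w) * N i w) =
     Ex P (fun w => \sum_(i < n) 2 * (H w * (runmax N i.+1 w - runmax N i w) * N i w)).
    rewrite Ex_sum//; last first.
      by move=> i _; apply: bmfM; [exact: bmf_cst|apply: bmfM; [apply: bmfM => //; exact: bD|exact: bN]].
    apply: eq_bigr => i _; rewrite ExZ//.
    by apply: bmfM; [apply: bmfM => //; exact: bD|exact: bN].
  apply: Ex_le.
  - by apply: bmfM => //; exact: bmfX.
  - apply: bmf_sum => i _; apply: bmfM; first exact: bmf_cst.
    by apply: bmfM; [apply: bmfM => //; exact: bD|exact: bN].
  move=> w; have := runmax_sq_le (fun i im => bmf_ge0 w (bN i im)).
  move=> /(ler_wpM2l (bmf_ge0 w bH)) /le_trans; apply.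
  rewrite mulr_sumr le_eqVlt; apply/orP; left; apply/eqP; apply: eq_bigr => i _.
  ring.
apply: (@le_trans _ _ (\sum_(i < n) 2 * Ex P (fun w => H w * (runmax N i.+1 w - runmax N i w) * Z w))).
  by apply: ler_sum => i _; rewrite ler_pM2l// HN.
rewrite -mulr_sumr ler_pM2l//.
rewrite -Ex_sum; last by move=> i _; apply: bmfM => //; apply: bmfM => //; exact: bD.
rewrite le_eqVlt; apply/orP; left; apply/eqP; apply: Ex_eq => w.
rewrite -mulr_suml -mulr_sumr -mulrA; congr (_ * (_ * _)).
elim: (n) => [|m ih]; first by rewrite big_ord0.
by rewrite big_ord_recr ih/=; ring.
Qed.

End doob.

Lemma sum_shift0 (R : realType) (F : nat -> R) k k1 :
  \sum_(k <= l < k1) F (l - k)%N = \sum_(0 <= i < k1 - k) F i.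
Proof.
rewrite -[in LHS](add0n k) big_addn add0n.
by apply: eq_bigr => i _; rewrite addnK.
Qed.

Section occupation.
Context {R : realType} {d} {T : measurableType d} {P : probability T R}.
Context {h : R} {xi : nat -> T -> R * R}.
Hypothesis (h0 : 0 < h) (gw : gaussian_walk P h xi).
Notation pt := (R * R)%type.

(** The cut-off [2 * D] is the range in which [hit_green_lower] bounds the occupation time over a
    horizon 64 D^2 from below. *)
Definition Lker (D r : R) (x : pt) : R := ind R (`|x| <= 2 * D) * Lam D r `|x|.

Lemma Lker_ge0 D r x : 0 <= Lker D r x.
Proof. by rewrite mulr_ge0 ?Lam_ge0// /ind. Qed.

Lemma bmf_Lam (D r : R) d' (U : measurableType d') (f : U -> pt) : 0 < D -> 0 < r ->
  measurable_fun setT f -> bmf (fun u => Lam D r `|f u|).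
Proof.
move=> D0 r0 mf; split; last first.
  exists (Lam D r 0) => u; rewrite Lam_ge0/=; exact: Lam_anti.
have -> : (fun u => Lam D r `|f u|) = (fun u => (1 + ln (Num.max 1 (D * ((Num.max `|f u| r)^-1))))) by [].
apply: measurable_funD => //.
suff m1 : measurable_fun setT (fun u => Num.max 1 (D * (Num.max `|f u| r)^-1)).
  exact: (measurableT_comp (@measurable_ln R) m1).
apply: measurable_maxr => //; apply: measurable_funM => //.
have -> : (fun u => (Num.max `|f u| r)^-1) = (fun u => expR (- ln (Num.max `|f u| r))).
  by apply/funext => u; rewrite expRN lnK// posrE lt_max r0 orbT.
suff m2 : measurable_fun setT (fun u => - ln (Num.max `|f u| r)).
  exact: (measurableT_comp (@measurable_expR R) m2).
apply: measurable_funN.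
have m3 : measurable_fun setT (fun u => Num.max `|f u| r).
  by apply: measurable_maxr => //; exact: measurable_ptnorm.
exact: (measurableT_comp (@measurable_ln R) m3).
Qed.

Lemma bmf_Lker D r d' (U : measurableType d') (f : U -> pt) : 0 < D -> 0 < r ->
  measurable_fun setT f -> bmf (fun u => Lker D r (f u)).
Proof. by move=> D0 r0 mf; apply: bmfM; [exact: bmf_ptclose|exact: bmf_Lam]. Qed.

Variables (k0 : nat) (V : T -> pt).
Hypothesis mV : measurable_fun [set: past xi k0] (V : past xi k0 -> pt).

(** The displacement [V] is any function of the first [k0] steps. It is constant for the first time
    interval and moves the path to a given point at the start of the second one. *)
Definition shifted k w : pt := V w + wsum xi 0 k w.

Definition occ (r : R) k1 (y : pt) (w : T) : R :=
  h / r ^+ 2 * \sum_(k0 <= k < k1) ind R (`|shifted k w - y| <= r).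

Lemma past_shifted k l : (k0 <= k)%N -> (k <= l)%N ->
  measurable_fun [set: past xi l] (shifted k : past xi l -> pt).
Proof.
move=> k0k kl; apply: measurable_ptD.
  apply: (sg_measurable_sub _ mV) => i ik0.
  by rewrite (leq_trans ik0)// (leq_trans k0k).
by apply: sg_wsum => i /andP[_ ik]; exact: leq_trans kl.
Qed.

Lemma shifted_measurable k : (k0 <= k)%N -> measurable_fun setT (shifted k).
Proof. by move=> k0k; exact: (sg_measurable_fun gw (past_shifted k0k (leqnn k))). Qed.

Lemma bmf_visit k r y : (k0 <= k)%N -> bmf (fun w => ind R (`|shifted k w - y| <= r)).
Proof. by move=> k0k; apply: bmf_ptclose; apply: measurable_ptB => //; exact: shifted_measurable. Qed.

Lemma bmf_occ r k1 y : bmf (occ r k1 y).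
Proof.
apply: bmfM; first by apply: bmf_cst; rewrite divr_ge0 ?sqr_ge0// ltW.
under eq_fun do rewrite big_seq.
by apply: bmf_sum => k; rewrite mem_index_iota => /andP[k0k _]; exact: bmf_visit.
Qed.

Lemma markov_visit r k l (H : T -> R) y : (k0 <= k)%N -> (k <= l)%N ->
  bmf (H : past xi k -> R) ->
  Ex P (fun w => H w * ind R (`|shifted l w - y| <= r)) =
  Ex P (fun w => H w * hitp P xi r (l - k) (y - shifted k w)).
Proof.
move=> k0k kl bH; apply: (markov_hit gw) => //.
by apply: (sg_measurable_sub _ mV) => i ik0; rewrite (leq_trans ik0).
Qed.

Lemma bmf_hitp_shifted r j k y : (k0 <= k)%N ->
  bmf (fun w => hitp P xi r j (y - shifted k w)).
Proof.
by move=> k0k; apply: (bmf_hitp gw); apply: measurable_ptB => //; exact: shifted_measurable.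
Qed.

(** Visits before [k] are dropped; those after it are counted by the Markov property and the lower
    Green bound. As [G] is any weight of the past of [k], the kernel at time [k] is dominated by the
    conditional expectation of the final occupation time, which is what Doob's inequality asks
    for. *)
Lemma occ_lower (D r : R) k k1 (G : T -> R) y : 0 < D -> 0 < r -> h <= r ^+ 2 -> r <= 2 * D ->
  (k0 <= k)%N -> (k <= k1)%N -> 64 * D ^+ 2 <= (k1 - k)%:R * h ->
  bmf (G : past xi k -> R) ->
  expR (- 4) / 2 * Ex P (fun w => G w * Lker D r (shifted k w - y)) <=
  Ex P (fun w => G w * occ r k1 y w).
Proof.
move=> D0 r0 hr rD k0k kk1 kD bG.
have bG' := sg_bmf gw bG.
have c0 : 0 <= expR (- 4) / 2 :> R by rewrite divr_ge0// expR_ge0.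
have r20 : 0 < r ^+ 2 by rewrite exprn_gt0.
have bL : bmf (fun w => Lker D r (shifted k w - y)).
  by apply: bmf_Lker => //; apply: measurable_ptB => //; exact: shifted_measurable.
apply: (@le_trans _ _ (Ex P (fun w => \sum_(k <= l < k1) (h / r ^+ 2 * (G w * ind R (`|shifted l w - y| <= r)))))); last first.
  apply: Ex_le.
  - under eq_fun do rewrite big_seq.
    apply: bmf_sum => l; rewrite mem_index_iota => /andP[kl _]; apply: bmfM.
      by apply: bmf_cst; rewrite divr_ge0// ltW.
    by apply: bmfM => //; apply: bmf_visit; exact: leq_trans kl.
  - by apply: bmfM => //; exact: bmf_occ.
  move=> w; rewrite -mulr_sumr -mulr_sumr /occ [leRHS]mulrCA.
  rewrite ler_wpM2l ?divr_ge0 ?(ltW h0) ?(ltW r20)// ler_wpM2l ?(bmf_ge0 w bG')//.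
  rewrite [leRHS](big_cat_nat _ (n := k))//= lerDr; apply: sumr_ge0 => i _.
  by rewrite /ind.
under [in leRHS]eq_fun do rewrite big_seq.
rewrite Ex_sum; last first.
  move=> l; rewrite mem_index_iota => /andP[kl _]; apply: bmfM.
    by apply: bmf_cst; rewrite divr_ge0// ltW.
  by apply: bmfM => //; apply: bmf_visit; exact: leq_trans kl.
rewrite (eq_bigr (fun l => Ex P (fun w => h / r ^+ 2 * (G w * hitp P xi r (l - k) (y - shifted k w))))); last first.
  move=> l; rewrite mem_index_iota => /andP[kl _].
  rewrite !ExZ ?divr_ge0 ?(ltW h0) ?(ltW r20)//.
  - by rewrite (markov_visit _ _ k0k kl).
  - by apply: bmfM => //; exact: bmf_hitp_shifted.
  - by apply: bmfM => //; apply: bmf_visit; exact: leq_trans kl.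
rewrite -big_seq -Ex_sum; last first.
  move=> l _; apply: bmfM; first by apply: bmf_cst; rewrite divr_ge0// ltW.
  by apply: bmfM => //; exact: bmf_hitp_shifted.
rewrite -ExZ//; last exact: bmfM.
apply: Ex_le.
- by apply: bmfM; [exact: bmf_cst|exact: bmfM].
- apply: bmf_sum => l _; apply: bmfM; first by apply: bmf_cst; rewrite divr_ge0// ltW.
  by apply: bmfM => //; exact: bmf_hitp_shifted.
move=> w; rewrite mulrCA -mulr_sumr -mulr_sumr [leRHS]mulrCA ler_wpM2l ?(bmf_ge0 w bG')//.
rewrite [leRHS]mulrAC ler_pdivlMr// [leRHS]mulr_sumr.
rewrite (sum_shift0 (fun i => h * hitp P xi r i (y - shifted k w))).
rewrite /Lker /ind; have [xD|_] := boolP (`|shifted k w - y| <= 2 * D); last first.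
  rewrite /= mul0r mulr0 mul0r; apply: sumr_ge0 => j _; rewrite mulr_ge0 ?(ltW h0)//.
  exact: (hitp_ge0 gw).
rewrite mul1r mulrAC distrC; apply: (hit_green_lower h0 gw) => //.
by rewrite distrC.
Qed.

Lemma bmf_lin (J : finType) (m : J -> R) (F : J -> T -> R) :
  (forall j, 0 <= m j) -> (forall j, bmf (F j)) -> bmf (fun w => \sum_j m j * F j w).
Proof. by move=> m0 bF; apply: bmf_sum => j _; apply: bmfM => //; exact: bmf_cst. Qed.

Lemma occ_lower_sum (J : finType) (m : J -> R) (y : J -> pt) (D r : R) k k1 (G : T -> R) :
  (forall j, 0 <= m j) -> 0 < D -> 0 < r -> h <= r ^+ 2 -> r <= 2 * D ->
  (k0 <= k)%N -> (k <= k1)%N -> 64 * D ^+ 2 <= (k1 - k)%:R * h ->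
  bmf (G : past xi k -> R) ->
  expR (- 4) / 2 * Ex P (fun w => G w * \sum_j m j * Lker D r (shifted k w - y j)) <=
  Ex P (fun w => G w * \sum_j m j * occ r k1 (y j) w).
Proof.
move=> m0 D0 r0 hr rD k0k kk1 kD bG.
have bG' := sg_bmf gw bG.
have bL j : bmf (fun w => Lker D r (shifted k w - y j)).
  by apply: bmf_Lker => //; apply: measurable_ptB => //; exact: shifted_measurable.
have bO j := bmf_occ r k1 (y j).
have E (F : J -> T -> R) : (forall j, bmf (F j)) ->
    Ex P (fun w => G w * \sum_j m j * F j w) = \sum_j m j * Ex P (fun w => G w * F j w).
  move=> bF; under eq_fun do rewrite mulr_sumr.
  rewrite Ex_sum; last by move=> j _; do 2!apply: bmfM => //; exact: bmf_cst.
  apply: eq_bigr => j _; under eq_fun do rewrite mulrCA.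
  by rewrite ExZ//; exact: bmfM.
rewrite (E _ bL) (E _ bO) mulr_sumr; apply: ler_sum => j _.
by rewrite mulrCA ler_wpM2l// occ_lower.
Qed.

(** The event that a given term is the largest belongs to the past, so the weight [G] can be
    restricted to it; domination of each term thus passes to the maximum. *)
Lemma max_domination (I : finType) (l : seq I) (F : I -> T -> R) (Z : T -> R) k (c : R) :
  bmf Z -> (forall s, bmf (F s : past xi k -> R)) ->
  (forall s G, bmf (G : past xi k -> R) ->
    Ex P (fun w => G w * F s w) <= Ex P (fun w => G w * Z w)) ->
  forall G, bmf (G : past xi k -> R) ->
    Ex P (fun w => G w * \big[Num.max/0]_(s <- l) F s w) <= Ex P (fun w => G w * Z w).
Proof.
move=> bZ bF FZ; elim: l => [|s l ih] G bG.
  under eq_fun do rewrite big_nil mulr0.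
  rewrite Ex_cst; apply: Ex_ge0; apply: bmfM => //; exact: (sg_bmf gw bG).
have bM : bmf ((fun w => \big[Num.max/0]_(s <- l) F s w) : past xi k -> R).
  by apply: bmf_bigmax => i _; exact: bF.
pose b w := \big[Num.max/0]_(s <- l) F s w <= F s w.
have mb : measurable_fun [set: past xi k] (b : past xi k -> bool).
  by apply: measurable_fun_ler; [exact: bmf_meas bM|exact: bmf_meas (bF s)].
have b1 : bmf ((fun w => G w * ind R (b w)) : past xi k -> R).
  by apply: bmfM => //; exact: bmf_bool.
have b2 : bmf ((fun w => G w * ind R (~~ b w)) : past xi k -> R).
  by apply: bmfM => //; apply: bmf_bool; exact: measurable_neg.
have := lerD (FZ s _ b1) (ih _ b2).
have b1' := sg_bmf gw b1; have b2' := sg_bmf gw b2.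
have bF' := sg_bmf gw (bF s); have bM' := sg_bmf gw bM.
rewrite -!ExD; try by apply: bmfM.
under eq_fun => w.
  rewrite (_ : _ + _ = G w * \big[Num.max/0]_(i <- s :: l) F i w); last first.
    rewrite big_cons -mulrA -(mulrA _ _ (\big[_/_]_(_ <- _) _)) -mulrDr; congr (_ * _).
    rewrite /b /ind; case: leP => H; rewrite /= ?mul1r ?mul0r ?addr0 ?add0r.
      by [].
    by [].
  over.
rewrite (_ : (fun w => _ + _) = (fun w => G w * Z w)); last first.
  apply/funext => w; rewrite -mulrA -(mulrA _ _ (Z w)) -mulrDr; congr (_ * _).
  by rewrite /ind; case: (b w); rewrite /= ?mul1r ?mul0r ?addr0 ?add0r.
by [].
Qed.

(** A whole family of measures is treated at once. With two passages, [s] runs over the times of the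
    second block and [m s] is the given measure weighted by the kernel seen from the second path at
    that time. *)
Lemma maximal_ineq (I J : finType) (m : I -> J -> R) (y : J -> pt) (D r : R) n k1 (H : T -> R) :
  (forall s j, 0 <= m s j) -> 0 < D -> 0 < r -> h <= r ^+ 2 -> r <= 2 * D ->
  (k0 + n <= k1)%N -> 64 * D ^+ 2 <= (k1 - (k0 + n))%:R * h ->
  bmf (H : past xi k0 -> R) ->
  Ex P (fun w => H w * runmax (fun i w => \big[Num.max/0]_s
      \sum_j m s j * Lker D r (shifted (k0 + i) w - y j)) n w ^+ 2) <=
  4 * (expR (- 4) / 2) ^- 2 *
  Ex P (fun w => H w * (\big[Num.max/0]_s \sum_j m s j * occ r k1 (y j) w) ^+ 2).
Proof.
move=> m0 D0 r0 hr rD kk1 kD bH.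
set N := fun (i : nat) (w : T) => _.
set c0 := expR (- 4) / 2.
have c0_gt0 : 0 < c0 by rewrite divr_gt0// expR_gt0.
pose Y w := \big[Num.max/0]_s \sum_j m s j * occ r k1 (y j) w.
have bH' := sg_bmf gw bH.
have bY : bmf Y by apply: bmf_bigmax => s _; apply: bmf_lin => // j; exact: bmf_occ.
pose Z w := c0^-1 * Y w.
have bZ : bmf Z by apply: bmfM => //; apply: bmf_cst; rewrite invr_ge0 ltW.
have bF k l s : (k0 <= k)%N -> (k <= l)%N ->
    bmf ((fun w => \sum_j m s j * Lker D r (shifted k w - y j)) : past xi l -> R).
  move=> k0k kl; apply: bmf_sum => j _; apply: bmfM; first exact: bmf_cst.
  by apply: bmf_Lker => //; apply: measurable_ptB => //; exact: past_shifted.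
have bN i l : (k0 + i <= l)%N -> bmf (N i : past xi l -> R).
  by move=> il; apply: bmf_bigmax => s _; apply: bF => //; exact: leq_addr.
have -> : 4 * c0 ^- 2 * Ex P (fun w => H w * Y w ^+ 2) = 4 * Ex P (fun w => H w * Z w ^+ 2).
  rewrite -mulrA -ExZ; [|by rewrite invr_ge0 sqr_ge0|by apply: bmfM => //; exact: bmfX].
  congr (_ * _); apply: Ex_eq => w; have -> : Z w ^+ 2 = c0 ^- 2 * Y w ^+ 2 by rewrite /Z exprMn exprVn.
  by rewrite mulrCA.
apply: doob_L2 => //.
  by move=> i _; exact: (sg_bmf gw (bN i _ (leqnn _))).
move=> i im; apply: (@max_domination I (index_enum I) _ Z (k0 + i) 0) => //.
- by move=> s; apply: bF => //; exact: leq_addr.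
- move=> s G bG; rewrite -(ler_pM2l c0_gt0).
  apply: (@le_trans _ _ (Ex P (fun w => G w * \sum_j m s j * occ r k1 (y j) w))).
    apply: occ_lower_sum => //; first exact: leq_addr.
      by apply: leq_trans kk1; rewrite leq_add2l ltnW.
    apply: le_trans kD _; rewrite ler_pM2r// ler_nat leq_sub2l// leq_add2l.
    exact: ltnW.
  have bG' := sg_bmf gw bG.
  rewrite -ExZ ?(ltW c0_gt0)//; last exact: bmfM.
  apply: Ex_le.
  - by apply: bmfM => //; apply: bmf_lin => // j; exact: bmf_occ.
  - by apply: bmfM; [apply: bmf_cst; exact: ltW|exact: bmfM].
  move=> w; rewrite /Z mulrCA mulVKf ?gt_eqF// ler_wpM2l ?(bmf_ge0 w bG')//.
  exact: le_bigmax.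
- apply: bmfM; first by apply: sg_bmf_sub bH => j; move/leq_trans; apply; exact: leq_addr.
  have bR n' : (n' <= i.+1)%N -> bmf (runmax N n' : past xi (k0 + i) -> R).
    move=> n'i; apply: (@runmax_bmf _ _ _ _ (past xi (k0 + i)) id) => j jn.
    by apply: bN; rewrite leq_add2l -ltnS (leq_trans jn).
  split; first by apply: measurable_funB; apply: bmf_meas; exact: bR.
  have [M HM] := (bR _ (leqnn _)).2; exists M => w; rewrite subr_ge0 le_max lexx/=.
  by rewrite lerBlDr (le_trans (proj2 (andP (HM w))))// lerDl runmax_ge0.
Qed.

(** Ordered pairs of visits only. The first visit puts the walk within [r] of [y]; the Green bound
    for [y'] from there is the kernel at [y - y'] up to the factor [1 + ln 2]. *)
Lemma occ_pair (C CT D r : R) k1 (H : T -> R) (y y' : pt) : 0 < C ->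
  0 < D -> 0 < r -> h <= r ^+ 2 ->
  (forall c J, J%:R * h <= CT * D ^+ 2 ->
     \sum_(0 <= j < J) h * hitp P xi r j c <= C * r ^+ 2 * Lam D r `|c|) ->
  bmf (H : past xi k0 -> R) -> (k1 - k0)%:R * h <= CT * D ^+ 2 ->
  Ex P (fun w => H w * (h / r ^+ 2 * (h / r ^+ 2 * \sum_(k0 <= k < k1) \sum_(k <= l < k1)
      ind R (`|shifted k w - y| <= r) * ind R (`|shifted l w - y'| <= r)))) <=
  C * (1 + ln 2) * Lam D r `|y - y'| * Ex P (fun w => H w * occ r k1 y w).
Proof.
move=> C0 D0 r0 hr HC bH kT.
have bH' := sg_bmf gw bH.
have r20 : 0 < r ^+ 2 by rewrite exprn_gt0.
have hr0 : 0 <= h / r ^+ 2 by rewrite divr_ge0 ?(ltW h0) ?(ltW r20).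
have l2 : 0 <= ln 2 :> R by rewrite ln_ge0// ler1n.
set L := Lam D r `|y - y'|; have L0 : 0 <= L by exact: Lam_ge0.
have bP k l : (k0 <= k)%N -> (k <= l)%N ->
    bmf (fun w => H w * ind R (`|shifted k w - y| <= r) * ind R (`|shifted l w - y'| <= r)).
  move=> k0k kl; apply: bmfM; last exact: bmf_visit (leq_trans k0k kl).
  by apply: bmfM => //; exact: bmf_visit.
have bS k : (k0 <= k)%N -> bmf (fun w => \sum_(k <= l < k1) H w * ind R (`|shifted k w - y| <= r) * ind R (`|shifted l w - y'| <= r)).
  move=> k0k; under eq_fun do rewrite big_seq.
  by apply: bmf_sum => l; rewrite mem_index_iota => /andP[kl _]; exact: bP.
have -> : Ex P (fun w => H w * (h / r ^+ 2 * (h / r ^+ 2 * \sum_(k0 <= k < k1) \sum_(k <= l < k1)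
      ind R (`|shifted k w - y| <= r) * ind R (`|shifted l w - y'| <= r)))) =
    h / r ^+ 2 * (h / r ^+ 2 * \sum_(k0 <= k < k1) Ex P (fun w => \sum_(k <= l < k1) H w * ind R (`|shifted k w - y| <= r) * ind R (`|shifted l w - y'| <= r))).
  rewrite [in RHS]big_seq -Ex_sum; last first.
    by move=> k; rewrite mem_index_iota => /andP[k0k _]; exact: bS.
  have b0 : bmf (fun w => \sum_(i <- index_iota k0 k1 | i \in index_iota k0 k1)
      \sum_(i <= l < k1) H w * ind R (`|shifted i w - y| <= r) * ind R (`|shifted l w - y'| <= r)).
    by apply: bmf_sum => k; rewrite mem_index_iota => /andP[k0k _]; exact: bS.
  rewrite -!ExZ//; last by apply: bmfM => //; exact: bmf_cst.
  apply: Ex_eq => w; rewrite mulrCA; congr (_ * _); rewrite mulrCA; congr (_ * _).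
  rewrite -big_seq mulr_sumr; apply: eq_bigr => k _.
  by rewrite mulr_sumr; apply: eq_bigr => l _; rewrite mulrA.
rewrite (_ : Ex P (fun w => H w * occ r k1 y w) =
    h / r ^+ 2 * \sum_(k0 <= k < k1) Ex P (fun w => H w * ind R (`|shifted k w - y| <= r))); last first.
  rewrite [in RHS]big_seq -Ex_sum; last first.
    by move=> k; rewrite mem_index_iota => /andP[k0k _]; apply: bmfM => //; exact: bmf_visit.
  rewrite -ExZ//; last first.
    by apply: bmf_sum => k; rewrite mem_index_iota => /andP[k0k _]; apply: bmfM => //; exact: bmf_visit.
  by apply: Ex_eq => w; rewrite /occ -big_seq -mulr_sumr mulrCA.
rewrite [leRHS]mulrCA ler_wpM2l// !mulr_sumr big_seq [leRHS]big_seq; apply: ler_sum => k.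
rewrite mem_index_iota => /andP[k0k kk1].
pose G w := H w * ind R (`|shifted k w - y| <= r).
have bHk : bmf (H : past xi k -> R).
  by apply: sg_bmf_sub bH => i /leq_trans; apply.
have bG : bmf (G : past xi k -> R).
  by apply: bmfM => //; apply: bmf_ptclose; apply: measurable_ptB => //; exact: past_shifted.
have bG' : bmf G := sg_bmf gw bG.
have c1 : 0 <= C * (1 + ln 2) * L * r ^+ 2.
  by rewrite mulr_ge0 ?(ltW r20)// mulr_ge0// mulr_ge0 ?(ltW C0)// addr_ge0.
have -> : Ex P (fun w => \sum_(k <= l < k1) H w * ind R (`|shifted k w - y| <= r) * ind R (`|shifted l w - y'| <= r)) =
    Ex P (fun w => \sum_(0 <= i < k1 - k) G w * hitp P xi r i (y' - shifted k w)).
  transitivity (\sum_(k <= l < k1) Ex P (fun w => G w * hitp P xi r (l - k) (y' - shifted k w))).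
    rewrite [RHS]big_seq; under eq_fun do rewrite big_seq.
    rewrite Ex_sum; last by move=> l; rewrite mem_index_iota => /andP[kl _]; exact: bP.
    apply: eq_bigr => l; rewrite mem_index_iota => /andP[kl _].
    exact: markov_visit.
  rewrite Ex_sum; last by move=> i _; apply: bmfM => //; exact: bmf_hitp_shifted.
  exact: (sum_shift0 (fun i => Ex P (fun w => G w * hitp P xi r i (y' - shifted k w)))).
rewrite mulrAC ler_pdivrMr// -ExZ ?(ltW h0)//; last first.
  by apply: bmf_sum => i _; apply: bmfM => //; exact: bmf_hitp_shifted.
apply: (@le_trans _ _ (Ex P (fun w => C * (1 + ln 2) * L * r ^+ 2 * G w))); last first.
  by rewrite ExZ// [leRHS]mulrAC.
apply: Ex_le.
- apply: bmfM; first by apply: bmf_cst; exact: ltW.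
  by apply: bmf_sum => i _; apply: bmfM => //; exact: bmf_hitp_shifted.
- by apply: bmfM => //; exact: bmf_cst.
move=> w; rewrite -mulr_sumr mulrCA [leRHS]mulrC /G /ind.
have [Wy|_] := boolP (`|shifted k w - y| <= r); last by rewrite mulr0 !mul0r.
rewrite mulr1 ler_wpM2l ?(bmf_ge0 w bH')// mulr_sumr.
apply: le_trans (HC _ _ _) _.
  by apply: le_trans kT; rewrite ler_pM2r// ler_nat leq_sub2l.
rewrite (_ : C * (1 + ln 2) * L * r ^+ 2 = C * r ^+ 2 * ((1 + ln 2) * L)); last by ring.
rewrite ler_pM2l ?mulr_gt0//.
apply: Lam_scale => //; first lra.
rewrite (mulrC 2) -mulrA ler_pM2l//.
have tri : `|y - y'| <= `|y' - shifted k w| + r.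
  rewrite distrC -(subrKA (shifted k w)) (le_trans (ler_normD _ _))// lerD2l//.
have m1 : `|y' - shifted k w| <= Num.max `|y' - shifted k w| r by rewrite le_max lexx.
have m2 : r <= Num.max `|y' - shifted k w| r by rewrite le_max lexx orbT.
by rewrite ge_max; apply/andP; split; lra.
Qed.

Lemma occ_second_moment (C CT D r : R) k1 (H : T -> R) (y y' : pt) : 0 < C ->
  0 < D -> 0 < r -> h <= r ^+ 2 ->
  (forall c J, J%:R * h <= CT * D ^+ 2 ->
     \sum_(0 <= j < J) h * hitp P xi r j c <= C * r ^+ 2 * Lam D r `|c|) ->
  bmf (H : past xi k0 -> R) -> (k1 - k0)%:R * h <= CT * D ^+ 2 ->
  Ex P (fun w => H w * (occ r k1 y w * occ r k1 y' w)) <=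
  C * (1 + ln 2) * Lam D r `|y - y'| *
    (Ex P (fun w => H w * occ r k1 y w) + Ex P (fun w => H w * occ r k1 y' w)).
Proof.
move=> C0 D0 r0 hr HC bH kT.
have bH' := sg_bmf gw bH.
have r20 : 0 < r ^+ 2 by rewrite exprn_gt0.
have hr0 : 0 <= h / r ^+ 2 by rewrite divr_ge0 ?(ltW h0) ?(ltW r20).
have A1 := occ_pair y y' C0 D0 r0 hr HC bH kT.
have A2 := occ_pair y' y C0 D0 r0 hr HC bH kT.
rewrite (distrC y' y) in A2; rewrite mulrDr.
apply: le_trans (lerD A1 A2).
have bX (a b : pt) : bmf (fun w => H w * (h / r ^+ 2 * (h / r ^+ 2 * \sum_(k0 <= k < k1) \sum_(k <= l < k1)
      ind R (`|shifted k w - a| <= r) * ind R (`|shifted l w - b| <= r)))).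
  do 3!(apply: bmfM => //; try exact: bmf_cst).
  under eq_fun do rewrite big_seq.
  apply: bmf_sum => k; rewrite mem_index_iota => /andP[k0k _].
  under eq_fun do rewrite big_seq.
  apply: bmf_sum => l; rewrite mem_index_iota => /andP[kl _].
  by apply: bmfM; apply: bmf_visit => //; exact: leq_trans kl.
rewrite -ExD//; apply: Ex_le.
- by apply: bmfM => //; apply: bmfM; exact: bmf_occ.
- exact: bmfD.
move=> w; rewrite -mulrDr ler_wpM2l ?(bmf_ge0 w bH')// -!mulrDr /occ.
set a := h / r ^+ 2; rewrite mulrACA -mulrA ler_wpM2l// ler_wpM2l//.
pose F k := ind R (`|shifted k w - y| <= r).
pose G k := ind R (`|shifted k w - y'| <= r).
have F0 k : 0 <= F k by rewrite /F /ind.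
have G0 k : 0 <= G k by rewrite /G /ind.
(* The product of the sums splits into the two orders of the visits; the diagonal is counted in
   both, hence an inequality. *)
rewrite -/F -/G; change ((\sum_(k0 <= k < k1) F k) * (\sum_(k0 <= k < k1) G k) <=
  \sum_(k0 <= k < k1) \sum_(k <= l < k1) F k * G l + \sum_(k0 <= k < k1) \sum_(k <= l < k1) G k * F l).
have [k01|k10] := leqP k0 k1; last by rewrite !(big_geq (ltnW k10)) mul0r addr0.
rewrite -(subnKC k01); elim: (k1 - k0)%N => [|n ih].
  by rewrite addn0 !big_geq// mul0r addr0.
have S1 (A : nat -> R) : \sum_(k0 <= k < (k0 + n).+1) A k = \sum_(k0 <= k < k0 + n) A k + A (k0 + n)%N.
  by rewrite big_nat_recr ?leq_addr.
rewrite addnS !S1 !big_nat1.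
have E (A B : nat -> R) : \sum_(k0 <= k < k0 + n) \sum_(k <= l < (k0 + n).+1) A k * B l =
    \sum_(k0 <= k < k0 + n) \sum_(k <= l < k0 + n) A k * B l + (\sum_(k0 <= k < k0 + n) A k) * B (k0 + n)%N.
  rewrite mulr_suml -big_split/= big_seq [RHS]big_seq; apply: eq_bigr => k.
  rewrite mem_index_iota => /andP[_ kn]; rewrite big_nat_recr//=; exact: ltnW.
rewrite !E; set f := F (k0 + n)%N; set g := G (k0 + n)%N.
have : 0 <= f * g by rewrite mulr_ge0.
set SF := \sum_(k0 <= k < k0 + n) F k in ih *; set SG := \sum_(k0 <= k < k0 + n) G k in ih *.
move: ih; clear; nra.
Qed.

End occupation.

(** * Two disjoint time intervals *)

Lemma measurable_param_integral d1 d2 (U : measurableType d1) (T : measurableType d2)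
    (R : realType) (m : {sigma_finite_measure set T -> \bar R}) (F : U * T -> \bar R) :
  measurable_fun setT F -> (forall z, 0 <= F z)%E ->
  measurable_fun setT (fun u => \int[m]_z F (u, z))%E.
Proof. by move=> mF F0; exact: measurable_fun_fubini_tonelli_F. Qed.

Section param_expectation.
Context (R : realType) d (T : measurableType d) (P : probability T R).

Lemma bmf_Ex d' (U : measurableType d') (X : U -> T -> R) :
  bmf (fun z : U * T => X z.1 z.2) -> bmf (fun u => Ex P (X u)).
Proof.
move=> [mX [M XM]].
have bX u : bmf (X u).
  split; last by exists M => w; exact: (XM (u, w)).
  exact: (measurableT_comp mX (pair1_measurable u)).
split; last first.
  exists M => u; rewrite Ex_ge0//= -[leRHS](Ex_cst P M); apply: Ex_le => //.
    by apply: bmf_cst; have /andP[] := XM (u, point); exact: le_trans.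
  by move=> w; have /andP[] := XM (u, w).
pose phi (z : U * T) := (X z.1 z.2)%:E.
have mphi : measurable_fun [set: U * T] phi by exact/measurable_EFinP.
have := @measurable_fun_fubini_tonelli_F _ _ _ _ _ P _ mphi.
rewrite /fubini_F/= => mF; apply/measurable_EFinP.
rewrite (_ : _ \o _ = (fun x => \int[P]_y (X x y)%:E)%E).
  by apply: mF => z; rewrite lee_fin; have /andP[] := XM z.
by apply/funext => u; rewrite /= ExE.
Qed.

Lemma bmf_section1 d' (U : measurableType d') (X : U * T -> R) u :
  bmf X -> bmf (fun w => X (u, w)).
Proof.
move=> [mX [M XM]]; split; last by exists M => w.
exact: (measurableT_comp mX (pair1_measurable u)).
Qed.

Lemma bmf_section2 d' (U : measurableType d') (X : U * T -> R) w :
  bmf X -> bmf (fun u => X (u, w)).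
Proof.
move=> [mX [M XM]]; split; last by exists M => u.
exact: (measurableT_comp mX (pair2_measurable w)).
Qed.

Lemma Ex_swap d' (U : measurableType d') (m : {sigma_finite_measure set U -> \bar R})
    (X : U * T -> R) : bmf X ->
  (\int[m]_u (Ex P (fun w => X (u, w)))%:E = \int[P]_w \int[m]_u (X (u, w))%:E)%E.
Proof.
move=> bX.
have mX : measurable_fun [set: U * T] (fun z => (X z)%:E) by exact: bmf_EFin.
have X0 z : (0 <= (X z)%:E)%E by rewrite lee_fin; exact: bmf_ge0 bX.
transitivity (\int[m]_u \int[P]_w (X (u, w))%:E)%E.
  by apply: eq_integral => u _; rewrite ExE//; exact: bmf_section1.
by rewrite -(fubini_tonelli1 _ mX X0) (fubini_tonelli2 _ mX X0).
Qed.

End param_expectation.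

Section plane_measure.
Context {R : realType}.
Notation pt := (R * R)%type.

(* Lebesgue and Gaussian measures on R with its canonical Borel structure
   (the library states them on the convertible type measurableTypeR R). *)
Definition leb1 : set R -> \bar R := @lebesgue_measure R.
HB.instance Definition _ := isMeasure.Build default_measure_display R R leb1
  (measure0 (@lebesgue_measure R)) (measure_ge0 (@lebesgue_measure R))
  (@measure_semi_sigma_additive _ _ _ (@lebesgue_measure R)).

Let leb1_sigma_finite : sigma_finite setT leb1.
Proof. exact: (sigma_finiteT (@lebesgue_measure R)). Qed.
HB.instance Definition _ := Measure_isSigmaFinite.Build _ _ _ leb1 leb1_sigma_finite.

Definition norm1 (s : R) : set R -> \bar R := @normal_prob R 0 s.
HB.instance Definition _ s := isMeasure.Build default_measure_display R R (norm1 s)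
  (measure0 (normal_prob 0 s)) (measure_ge0 (normal_prob 0 s))
  (@measure_semi_sigma_additive _ _ _ (normal_prob 0 s)).

Let norm1T s : norm1 s setT = 1%E.
Proof. exact: (probability_setT (normal_prob 0 s)). Qed.
HB.instance Definition _ s := Measure_isProbability.Build _ _ _ (norm1 s) (norm1T s).

Definition leb2 : set pt -> \bar R := (leb1 \x leb1)%E.
HB.instance Definition _ := isMeasure.Build _ pt R leb2
  (measure0 (leb1 \x leb1)%E) (measure_ge0 (leb1 \x leb1)%E)
  (@measure_semi_sigma_additive _ _ _ (leb1 \x leb1)%E).

Lemma leb2_square (c : pt) (r : R) : 0 < r ->
  leb2 [set z | `|z - c| <= r] = (4 * r ^+ 2)%:E.
Proof.
move=> r0; rewrite square_prod /leb2 product_measure1E; try exact: measurable_itv.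
rewrite [X in (X * _)%E](leb_itv_center c.1 r0) [X in (_ * X)%E](leb_itv_center c.2 r0).
by rewrite -EFinM; congr EFin; ring.
Qed.

Let leb2_sigma_finite : sigma_finite setT leb2.
Proof.
exists (fun n => [set z : pt | `|z - 0| <= n.+1%:R]).
  apply/esym; apply/seteqP; split => // z _; exists (Num.trunc `|z|) => //=.
  by rewrite subr0 ltW// truncnS_gt.
by move=> n; split; [exact: measurable_square|rewrite leb2_square// ltry].
Qed.
HB.instance Definition _ := Measure_isSigmaFinite.Build _ _ _ leb2 leb2_sigma_finite.

Lemma leb2_close (c y : pt) (r : R) : 0 < r ->
  (\int[leb2]_z (ind R (`|z + c - y| <= r))%:E = (4 * r ^+ 2)%:E)%E.
Proof.
move=> r0; have E : [set z : pt | `|z + c - y| <= r] = [set z : pt | `|z - (y - c)| <= r].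
  by apply/seteqP; split => z /=; rewrite opprB addrA.
have mE : measurable [set z : pt | `|z + c - y| <= r] by rewrite E; exact: measurable_square.
transitivity (\int[leb2]_z (\1_[set z : pt | `|z + c - y| <= r] z)%:E)%E.
  apply: eq_integral => z _; rewrite indicE /ind; congr ((nat_of_bool _)%:R)%:E.
  by apply/idP/idP; rewrite inE.
by rewrite integral_indic// setIT E; exact: leb2_square.
Qed.

Import HBNNSimple.

Lemma integral_measure_le d (T : measurableType d) (m1 m2 : {measure set T -> \bar R})
    (f : T -> \bar R) :
  (forall A, measurable A -> (m1 A <= m2 A)%E) -> (forall x, 0 <= f x)%E ->
  (\int[m1]_x f x <= \int[m2]_x f x)%E.
Proof.
move=> m12 f0; rewrite !ge0_integralTE//; apply: ge_ereal_sup => _ [g /= gf <-].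
apply: (@le_trans _ _ (sintegral m2 g)); last by apply: ereal_sup_ubound; exists g.
rewrite !sintegralE; apply: lee_fsum => // x [w _ <-].
by apply: lee_wpmul2l; [rewrite lee_fin|exact: m12].
Qed.

Lemma norm1_le (v : R) (A : set R) : 0 < v -> measurable A ->
  (norm1 (Num.sqrt v) A <= (normal_peak (Num.sqrt v))%:E * leb1 A)%E.
Proof.
move=> v0 mA; rewrite /norm1 /normal_prob.
apply: (@le_trans _ _ (\int[@lebesgue_measure R]_(x in A) (normal_peak (Num.sqrt v))%:E)%E).
  apply: ge0_le_integral => //.
  - by move=> x _; rewrite lee_fin normal_pdf_ge0.
  - by apply/measurable_EFinP; apply: measurable_funTS; exact: measurable_normal_pdf.
  - by move=> x _; rewrite lee_fin normal_pdf_ub// gt_eqF// sqrtr_gt0.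
by rewrite integral_cst.
Qed.

(** Only the maximum of the density is used: each coordinate costs one [normal_peak], and their
    product is [peak2]. *)
Lemma gauss2_integral_le (v : R) (F : pt -> \bar R) : 0 < v ->
  measurable_fun setT F -> (forall z, 0 <= F z)%E ->
  (\int[norm1 (Num.sqrt v) \x norm1 (Num.sqrt v)]_z F z <= (peak2 v)%:E * \int[leb2]_z F z)%E.
Proof.
move=> v0 mF F0; set s := Num.sqrt v; have p0 := normal_peak_ge0 s.
have dom (f : R -> \bar R) : measurable_fun setT f -> (forall x, 0 <= f x)%E ->
    (\int[norm1 s]_x f x <= (normal_peak s)%:E * \int[leb1]_x f x)%E.
  move=> mf f0; rewrite -[normal_peak s]/((NngNum p0)%:num) -ge0_integral_mscale//.
  apply: integral_measure_le => // A mA.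
  by rewrite /mscale/=; exact: norm1_le.
rewrite [X in (_ * X)%E](_ : _ = \int[leb1 \x leb1]_z F z)%E// !fubini_tonelli1//.
have mG : measurable_fun setT (fubini_F leb1 F) by exact: measurable_fun_fubini_tonelli_F.
apply: (@le_trans _ _ (\int[norm1 s]_x ((normal_peak s)%:E * fubini_F leb1 F x))%E).
  apply: ge0_le_integral => //.
  - by move=> x _; exact: integral_ge0.
  - exact: measurable_fun_fubini_tonelli_F.
  - exact: measurable_funeM.
  - move=> x _; apply: dom => //; exact: (measurableT_comp mF (pair1_measurable x)).
have G0 x : (0 <= fubini_F leb1 F x)%E by exact: integral_ge0.
rewrite ge0_integralZl// -normal_peak_sq// expr2 EFinM -muleA.
by apply: lee_wpmul2l; [rewrite lee_fin|exact: dom].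
Qed.

End plane_measure.

Lemma bmf_runmax_param (R : realType) d d' (U : measurableType d) (T : measurableType d')
    (f : U -> T) (N : U -> nat -> T -> R) n :
  (forall i, (i < n)%N -> bmf (fun u => N u i (f u))) -> bmf (fun u => runmax (N u) n (f u)).
Proof.
elim: n => [|n ih] bN /=; first exact: bmf_cst.
by apply: bmf_max; [apply: ih => i im; apply: bN; exact: leqW|exact: bN].
Qed.

Section two_intervals.
Context {R : realType} {d} {T : measurableType d} {P : probability T R}.
Context {h : R} {xi : nat -> T -> R * R}.
Hypothesis (h0 : 0 < h) (gw : gaussian_walk P h xi).
Notation pt := (R * R)%type.

(** Weighted by [Hg], the position at time [b] of a walk that is at [x] at time [c] has density at
    most [psi], uniformly in [x]. The form with test functions applies directly to [meet_max]. *)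
Definition dominated_gap (psi : R) c b (Hg : T -> R) :=
  forall (x : pt) (F : pt -> \bar R), measurable_fun setT F -> (forall z, 0 <= F z)%E ->
  (\int[P]_u ((Hg u)%:E * F (x + wsum xi c b u)%R) <= psi%:E * \int[leb2]_z F z)%E.

Variables (J : finType) (m : J -> R) (y : J -> pt) (x0 : pt) (D r : R) (a n b : nat).
Hypotheses (m0 : forall j, 0 <= m j) (D0 : 0 < D) (r0 : 0 < r) (hr : h <= r ^+ 2) (rD : r <= 2 * D).

(* Two blocks of n steps, after time a for the path w and after time b for the
   path v, which is at z at time b.  The maximum over the second block is the
   inner one, so that Doob's inequality applies to each path in turn. *)
Definition meet_max (w : T) (z : pt) (v : T) : R :=
  runmax (fun i w => \big[Num.max/0]_(l < n) \sum_j
    (m j * Lker D r (z + wsum xi b (b + l) v - y j)) *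
    Lker D r (x0 + wsum xi 0 (a + i) w - y j)) n w ^+ 2.

Lemma bmf_meet_max d' (U : measurableType d') (f : U -> T) (g : U -> pt) (e : U -> T) :
  (forall i, (i < n)%N -> measurable_fun setT (fun u => wsum xi 0 (a + i) (f u))) ->
  measurable_fun setT g ->
  (forall l, measurable_fun setT (fun u => wsum xi b (b + l) (e u))) ->
  bmf (fun u => meet_max (f u) (g u) (e u)).
Proof.
move=> mf mg me; apply: bmfX.
apply: bmf_runmax_param => i im; apply: bmf_bigmax => l _; apply: bmf_sum => j _; apply: bmfM.
  apply: bmfM; first exact: bmf_cst.
  by apply: bmf_Lker => //; apply: measurable_ptB => //; exact: measurable_ptD.
apply: bmf_Lker => //; apply: measurable_ptB => //; apply: measurable_ptD => //.
exact: mf.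
Qed.

Variables (nx : nat) (C CT psi K : R) (Ha Hg : T -> R).
Let c := (a + n)%N.
Hypotheses (cb : (c <= b)%N) (C0 : 0 < C) (psi0 : 0 <= psi) (K0 : 0 <= K).
Hypothesis long : 64 * D ^+ 2 <= nx%:R * h.
Hypothesis short : (n + nx)%:R * h <= CT * D ^+ 2.
Hypothesis HC : forall c J, J%:R * h <= CT * D ^+ 2 ->
     \sum_(0 <= j < J) h * hitp P xi r j c <= C * r ^+ 2 * Lam D r `|c|.
Hypothesis bHa : bmf (Ha : past xi a -> R).
Hypothesis bHg : bmf (Hg : sg xi (fun i => c <= i < b)%N -> R).
Hypothesis gap : dominated_gap psi c b Hg.
Hypothesis base : forall j k, (a <= k < c + nx)%N ->
  Ex P (fun w => Ha w * ind R (`|x0 + wsum xi 0 k w - y j| <= r)) <= K * r ^+ 2.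

Let C1 : R := 4 * (expR (- 4) / 2) ^- 2.
Let C2 : R := C * (1 + ln 2).
Let occ1 j w := occ (h := h) (xi := xi) a (fun=> x0) r (c + nx) (y j) w.
Let Y (z : pt) (v w : T) := \big[Num.max/0]_(l < n) \sum_j
    (m j * Lker D r (z + wsum xi b (b + l) v - y j)) * occ1 j w.
(** With this displacement the shifted walk is at [z] at time [b], so the lemmas on one interval
    apply to the second path. *)
Let S2 (z : pt) (v : T) := z - wsum xi 0 b v.
Let occ2 j z v := occ (h := h) (xi := xi) b (S2 z) r (b + n + nx) (y j) v.

Let bHa' : bmf Ha := sg_bmf gw bHa.
Let bHg' : bmf Hg := sg_bmf gw bHg.
Let C1_ge0 : 0 <= C1.
Proof. by rewrite mulr_ge0// invr_ge0 sqr_ge0. Qed.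
Let C2_ge0 : 0 <= C2.
Proof. by rewrite mulr_ge0 ?(ltW C0)// addr_ge0// ln_ge0// ler1n. Qed.

Let mwsum j k : measurable_fun setT (wsum xi j k).
Proof. exact: (wsum_measurable gw). Qed.

Let bG (I : pred nat) : (forall i, (i < c)%N -> I i) ->
  bmf (fun q : sg xi I * pt => Ex P (fun v => meet_max q.1 q.2 v)).
Proof.
move=> HI; apply: (@bmf_Ex _ _ T P _ (sg xi I * pt)%type (fun q v => meet_max q.1 q.2 v)).
apply: bmf_meet_max.
- move=> i im.
  have m11 : measurable_fun setT (fun u : sg xi I * pt * T => u.1.1) by exact: measurableT_comp.
  have mw : measurable_fun [set: sg xi I] (wsum xi 0 (a + i) : sg xi I -> pt).
    apply: sg_wsum => k /andP[_ ki]; apply: HI; apply: leq_trans ki _.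
    by rewrite leq_add2l ltnW.
  exact: (measurableT_comp mw m11).
- by apply: measurableT_comp => //; exact: measurable_snd.
- by move=> l; apply: measurableT_comp => //.
Qed.

Let bmf_meet_T : bmf (fun q : T * pt => Ex P (meet_max q.1 q.2)).
Proof.
apply: (@bmf_Ex _ _ T P _ (T * pt)%type (fun q v => meet_max q.1 q.2 v)).
apply: bmf_meet_max.
- move=> i im; have m11 : measurable_fun setT (fun u : T * pt * T => u.1.1) by exact: measurableT_comp.
  exact: (measurableT_comp (mwsum 0 (a + i)) m11).
- by apply: measurableT_comp => //; exact: measurable_snd.
- by move=> l; apply: measurableT_comp.
Qed.

Let bmf_meet1 w z : bmf (meet_max w z).
Proof. exact: (@bmf_meet_max _ T (fun=> w) (fun=> z) id). Qed.

(** The steps from [b] on are independent of those before, so the second block may be run along an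
    independent path. *)
Lemma two_interval_split :
  Ex P (fun w => Ha w * Hg w * meet_max w (x0 + wsum xi 0 b w) w) =
  Ex P (fun w => Ha w * Hg w * Ex P (meet_max w (x0 + wsum xi 0 b w))).
Proof.
pose I i := (i < b)%N; pose I' i := (b <= i)%N.
pose Phi (z : sg xi I * sg xi I') : \bar R :=
  (Ha z.1 * Hg z.1 * meet_max z.1 (x0 + wsum xi 0 b z.1) z.2)%:E.
have aI i : (i < a)%N -> I i by move=> /leq_trans; apply; apply: leq_trans cb; exact: leq_addr.
have bHH : bmf ((fun w => Ha w * Hg w) : sg xi I -> R).
  apply: bmfM; first exact: (sg_bmf_sub aI bHa).
  by apply: (sg_bmf_sub _ bHg) => i /andP[].
have bPhi : bmf (fun z : sg xi I * sg xi I' => Ha z.1 * Hg z.1 * meet_max z.1 (x0 + wsum xi 0 b z.1) z.2).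
  apply: bmfM; first exact: (bmf_comp measurable_fst bHH).
  apply: bmf_meet_max.
  - move=> i im; apply: measurableT_comp => //; apply: sg_wsum => k /andP[_ ki].
    by apply: leq_trans ki _; apply: leq_trans cb; rewrite leq_add2l ltnW.
  - apply: measurable_ptD => //; apply: measurableT_comp => //; apply: sg_wsum => k /andP[_ ki] //.
  - by move=> l; apply: measurableT_comp => //; apply: sg_wsum => k /andP[].
rewrite /Ex; congr fine.
transitivity (\int[P]_w Phi (w, w))%E => //.
rewrite (walk_indep gw _ (bmf_EFin bPhi)); last 2 first.
- by move=> i; rewrite /I /I'; case: ltnP.
- by move=> z; rewrite lee_fin; exact: bmf_ge0 bPhi.
apply: eq_integral => u _; rewrite /Phi/=.
have bM : bmf (meet_max u (x0 + wsum xi 0 b u)).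
  by apply: (@bmf_meet_max _ T (fun=> u) (fun=> x0 + wsum xi 0 b u) id).
under eq_integral do rewrite EFinM.
rewrite ge0_integralZl//.
- by rewrite ExE// EFinM.
- exact: bmf_EFin.
- by move=> v _; rewrite lee_fin; exact: bmf_ge0 bM.
- by rewrite lee_fin; apply: (bmf_ge0 u (bmfM bHa' bHg')).
Qed.

(** Given the first [c] steps, the gap hypothesis replaces the law of the position at time [b] by
    [psi] times Lebesgue measure. This decouples the starting point of the second path from the
    first path. *)
Lemma two_interval_gap :
  ((Ex P (fun w => Ha w * Hg w * meet_max w (x0 + wsum xi 0 b w) w))%:E <=
   psi%:E * \int[P]_w ((Ha w)%:E * \int[leb2]_z (Ex P (meet_max w z))%:E))%E.
Proof.
rewrite two_interval_split.
pose I i := (i < c)%N; pose I' i := (c <= i < b)%N.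
pose G (q : sg xi I * pt) := Ex P (fun v => meet_max q.1 q.2 v).
have bG' : bmf G by exact: bG.
pose X (z : sg xi I * sg xi I') := Ha z.1 * (Hg z.2 * G (z.1, x0 + wsum xi 0 c z.1 + wsum xi c b z.2)).
have bX : bmf X.
  apply: bmfM.
    apply: (bmf_comp measurable_fst (X := (Ha : sg xi I -> R))).
    by apply: (sg_bmf_sub _ bHa) => i /leq_trans; apply; exact: leq_addr.
  apply: bmfM; first exact: (bmf_comp measurable_snd bHg).
  apply: (bmf_comp _ bG'); apply: measurable_fun_pair => //.
  apply: measurable_ptD; last by apply: measurableT_comp => //; apply: sg_wsum.
  by apply: measurable_ptD => //; apply: measurableT_comp => //; apply: sg_wsum => i /andP[].
rewrite -ExE; last first.
  apply: bmfM; first exact: bmfM.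
  have mm : measurable_fun [set: T] (fun w => (w, x0 + wsum xi 0 b w) : T * pt).
    by apply: measurable_fun_pair => //; apply: measurable_ptD.
  exact: (bmf_comp mm bmf_meet_T).
rewrite (_ : \int[P]_w _ = \int[P]_w (X (w, w))%:E)%E; last first.
  apply: eq_integral => w _; rewrite /X /G/= -mulrA; congr (_ * (_ * Ex P (meet_max w _)))%:E.
  by rewrite (@wsum_cat _ _ _ xi 0 c b w) ?leq0n//= addrA.
rewrite (walk_indep gw _ (bmf_EFin bX)); last 2 first.
- by move=> i; rewrite /I /I' negb_and negb_and -!leqNgt; case: leqP.
- by move=> z; rewrite lee_fin; exact: bmf_ge0 bX.
have E0 u z : (0 <= (Ex P (meet_max u z))%:E)%E by rewrite lee_fin; exact: Ex_ge0.
have mEz u : measurable_fun setT (fun z => (Ex P (meet_max u z))%:E).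
  by apply: bmf_EFin; exact: (bmf_section1 u bmf_meet_T).
have mint : measurable_fun [set: T] (fun w => (Ha w)%:E * \int[leb2]_z (Ex P (meet_max w z))%:E)%E.
  apply: emeasurable_funM; first exact: bmf_EFin.
  apply: (measurable_param_integral _ (F := fun q : T * pt => (Ex P (meet_max q.1 q.2))%:E)) => //.
  exact: bmf_EFin.
have int0 w : (0 <= (Ha w)%:E * \int[leb2]_z (Ex P (meet_max w z))%:E)%E.
  by apply: mule_ge0; [rewrite lee_fin; exact: bmf_ge0 bHa'|exact: integral_ge0].
rewrite -ge0_integralZl//.
apply: ge0_le_integral => //.
- by move=> u _; apply: integral_ge0 => v _; rewrite lee_fin; exact: bmf_ge0 bX.
- apply: (sg_measurable_fun gw (I := I)).
  pose XX (z : sg xi I * T) := X (z.1, z.2 : sg xi I').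
  have bXX : bmf XX.
    have m2 : measurable_fun [set: sg xi I * T] ((fun z => z.2) : sg xi I * T -> sg xi I').
      move=> _ A mA; apply: (@measurable_snd _ _ (sg xi I) T) => //.
      by have := sg_id gw (I := I') measurableT mA; rewrite setTI.
    by apply: (bmf_comp _ bX); exact: measurable_fun_pair.
  have := @measurable_fun_fubini_tonelli_F _ _ _ _ _ P _ (bmf_EFin bXX).
  by apply => z; rewrite lee_fin; exact: bmf_ge0 bXX.
- exact: measurable_funeM.
move=> u _; rewrite muleCA /X /G/=.
under eq_integral do rewrite EFinM.
have bHgG : bmf (fun v => Hg v * Ex P (meet_max u (x0 + wsum xi 0 c u + wsum xi c b v))).
  apply: bmfM => //.
  have mm : measurable_fun [set: T] (fun v => (u, x0 + wsum xi 0 c u + wsum xi c b v) : T * pt).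
    by apply: measurable_fun_pair => //; apply: measurable_ptD.
  exact: (bmf_comp mm bmf_meet_T).
rewrite ge0_integralZl//.
- apply: lee_wpmul2l; first by rewrite lee_fin; exact: bmf_ge0 bHa'.
  by under eq_integral do rewrite EFinM; exact: (gap (x0 + wsum xi 0 c u) (mEz u) (E0 u)).
- exact: bmf_EFin.
- by move=> v _; rewrite lee_fin; exact: bmf_ge0 bHgG.
- by rewrite lee_fin; exact: bmf_ge0 bHa'.
Qed.

(** Doob along the first path, with the second one frozen: the maximum over [l] is a maximum over a
    finite family of measures. *)
Lemma meet_max_path1 (z : pt) (v : T) :
  Ex P (fun w => Ha w * meet_max w z v) <= C1 * Ex P (fun w => Ha w * Y z v w ^+ 2).
Proof.
have mV : measurable_fun [set: past xi a] ((fun=> x0) : past xi a -> pt) by exact: measurable_cst.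
apply: (@maximal_ineq _ _ _ _ _ _ h0 gw a _ mV 'I_n J
  (fun l j => m j * Lker D r (z + wsum xi b (b + l) v - y j)) y D r n (c + nx) Ha) => //.
- by move=> s j; rewrite mulr_ge0// Lker_ge0.
- exact: leq_addr.
- by rewrite addKn.
Qed.

Let mS2 z : measurable_fun [set: past xi b] (S2 z : past xi b -> pt).
Proof. by apply: measurable_ptB => //; apply: sg_wsum => i /andP[]. Qed.

Let shiftedS2 z k v : (b <= k)%N -> shifted (xi := xi) (S2 z) k v = z + wsum xi b k v.
Proof.
move=> bk; rewrite /shifted /S2 (@wsum_cat _ _ _ xi 0 b k v) ?leq0n//.
by rewrite addrA subrK.
Qed.

Let occ1_ge0 j w : 0 <= occ1 j w.
Proof.
rewrite mulr_ge0 ?divr_ge0 ?sqr_ge0 ?(ltW h0)//.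
by apply: sumr_ge0 => k _; rewrite /ind.
Qed.

(** With the first path frozen, the weights [m j * occ1 j w] form a single measure, and Doob is
    applied along the second path with the index set [unit]. *)
Lemma Y_path2 (z : pt) (w : T) :
  Ex P (fun v => Y z v w ^+ 2) <=
  C1 * Ex P (fun v => (\sum_j m j * occ1 j w * occ2 j z v) ^+ 2).
Proof.
have m1 (s : unit) j : 0 <= m j * occ1 j w by rewrite mulr_ge0.
have nb : 64 * D ^+ 2 <= (b + n + nx - (b + n))%:R * h by rewrite addKn.
have b1 : bmf ((fun=> 1) : past xi b -> R) by exact: bmf_cst.
have := @maximal_ineq _ _ _ _ _ _ h0 gw b _ (mS2 z) unit J
  (fun _ j => m j * occ1 j w) y D r n (b + n + nx) (fun=> 1) m1 D0 r0 hr rD (leq_addr _ _) nb b1.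
have big_unit (F : R) : 0 <= F -> \big[Num.max/0]_(s : unit) F = F.
  by move=> F0; rewrite big_const card_unit/=; exact/max_idPl.
have E1 : Ex P (fun v => 1 * (\big[Num.max/0]_(s : unit) \sum_j m j * occ1 j w * occ (h := h) (xi := xi) b (S2 z) r (b + n + nx) (y j) v) ^+ 2)
    = Ex P (fun v => (\sum_j m j * occ1 j w * occ2 j z v) ^+ 2).
  apply: Ex_eq => v; rewrite mul1r big_unit//; apply: sumr_ge0 => j _; apply: mulr_ge0 (m1 tt j) _.
  exact: (bmf_ge0 v (bmf_occ h0 gw (mS2 z) r (b + n + nx) (y j))).
rewrite E1 => /(le_trans _); apply.
have bN i : (i < n)%N -> bmf (fun v => \big[Num.max/0]_(s : unit) \sum_j m j * occ1 j w *
    Lker D r (shifted (xi := xi) (S2 z) (b + i) v - y j)).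
  move=> im; apply: bmf_bigmax => s _; apply: bmf_sum => j _; apply: bmfM; first exact: bmf_cst (m1 tt j).
  apply: bmf_Lker => //; apply: measurable_ptB => //.
  exact: (shifted_measurable gw (mS2 z) (leq_addr _ _)).
apply: Ex_le.
- apply: bmfX; apply: bmf_bigmax => l _; apply: bmf_sum => j _; apply: bmfM => //; last exact: bmf_cst.
  apply: bmfM; first exact: bmf_cst.
  by apply: bmf_Lker => //; apply: measurable_ptB => //; exact: measurable_ptD.
- apply: bmfM; first exact: bmf_cst.
  by apply: bmfX; apply: (@runmax_bmf _ _ _ _ T id).
move=> v; rewrite mul1r ler_sqr ?nnegrE ?runmax_ge0//; last first.
  by apply: bigmax_ge_id.
apply/bigmax_leP; split; first exact: runmax_ge0.
move=> l _; apply: le_trans (runmax_ge _ _ (ltn_ord l)).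
rewrite big_unit; last first.
  apply: sumr_ge0 => j _; apply: mulr_ge0 (m1 tt j) _.
  by rewrite mulr_ge0// ?Lam_ge0// /ind.
by apply: ler_sum => j _; rewrite shiftedS2 ?leq_addr// mulrAC.
Qed.

Let Lam2 j k := Lam D r `|y j - y k|.

Let bocc2 z j : bmf (occ2 j z).
Proof. exact: (bmf_occ h0 gw (mS2 z)). Qed.

Lemma occ2_square (z : pt) (w : T) :
  Ex P (fun v => (\sum_j m j * occ1 j w * occ2 j z v) ^+ 2) <=
  \sum_j \sum_k m j * occ1 j w * (m k * occ1 k w) * (C2 * Lam2 j k) *
     (Ex P (occ2 j z) + Ex P (occ2 k z)).
Proof.
have bb j k : bmf (fun v => m j * occ1 j w * (m k * occ1 k w) * (occ2 j z v * occ2 k z v)).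
  apply: bmfM; last exact: bmfM.
  by apply: bmf_cst; apply: mulr_ge0; apply: mulr_ge0.
rewrite (_ : Ex P _ = \sum_j \sum_k m j * occ1 j w * (m k * occ1 k w) * Ex P (fun v => occ2 j z v * occ2 k z v)); last first.
  transitivity (Ex P (fun v => \sum_j \sum_k m j * occ1 j w * (m k * occ1 k w) * (occ2 j z v * occ2 k z v))).
    apply: Ex_eq => v; rewrite expr2 mulr_suml; apply: eq_bigr => j _.
    by rewrite mulr_sumr; apply: eq_bigr => k _; rewrite mulrACA.
  rewrite Ex_sum; last by move=> j _; apply: bmf_sum.
  apply: eq_bigr => j _; rewrite Ex_sum//; apply: eq_bigr => k _.
  by rewrite ExZ//; [apply: mulr_ge0; apply: mulr_ge0|exact: bmfM].
apply: ler_sum => j _; apply: ler_sum => k _.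
rewrite -(mulrA _ (C2 * _)); apply: ler_wpM2l; first by apply: mulr_ge0; apply: mulr_ge0.
have bone : bmf ((fun=> 1) : past xi b -> R) by exact: bmf_cst.
have sh : (b + n + nx - b)%:R * h <= CT * D ^+ 2 by rewrite -addnA addKn.
have := @occ_second_moment _ _ _ _ _ _ h0 gw b _ (mS2 z) C CT D r (b + n + nx) (fun=> 1) (y j) (y k) C0 D0 r0 hr HC bone sh.
rewrite (_ : Ex P _ = Ex P (fun v => occ2 j z v * occ2 k z v)); last by apply: Ex_eq => v; rewrite mul1r.
rewrite (_ : Ex P (fun v => 1 * _) = Ex P (occ2 j z)); last by apply: Ex_eq => v; rewrite mul1r.
rewrite (_ : Ex P (fun v => 1 * _) = Ex P (occ2 k z)); last by apply: Ex_eq => v; rewrite mul1r.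
by rewrite /C2 /Lam2 -!mulrA.
Qed.

(** Under Lebesgue measure for the starting point every single visit has total mass 4 r^2, whatever
    the path does; it remains to count the steps. *)
Lemma occ2_leb j : (\int[leb2]_z (Ex P (occ2 j z))%:E <= (4 * CT * D ^+ 2)%:E)%E.
Proof.
have bz k : bmf (fun q : pt * T => ind R (`|q.1 + wsum xi b k q.2 - y j| <= r)).
  apply: bmf_ptclose; apply: measurable_ptB => //; apply: measurable_ptD => //.
  exact: (measurableT_comp (mwsum b k) measurable_snd).
have hr0 : 0 <= h / r ^+ 2 by rewrite divr_ge0 ?sqr_ge0 ?(ltW h0).
rewrite (_ : \int[leb2]_z _ = \int[leb2]_z ((h / r ^+ 2)%:E *
   \sum_(b <= k < b + n + nx) (Ex P (fun v => ind R (`|z + wsum xi b k v - y j| <= r)))%:E))%E; last first.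
  apply: eq_integral => z _; rewrite sumEFin -EFinM; congr EFin.
  rewrite -Ex_sum; last by move=> k _; exact: (bmf_section1 z (bz k)).
  rewrite -ExZ//; last by apply: bmf_sum => k _; exact: (bmf_section1 z (bz k)).
  apply: Ex_eq => v; rewrite /occ2 /occ; congr (_ * _).
  rewrite big_seq [RHS]big_seq; apply: eq_bigr => k; rewrite mem_index_iota => /andP[bk _].
  by rewrite shiftedS2.
have bEz k : bmf (fun z : pt => Ex P (fun v => ind R (`|z + wsum xi b k v - y j| <= r))).
  apply: (@bmf_Ex _ _ T P _ pt (fun z v => ind R (`|z + wsum xi b k v - y j| <= r))); exact: bz.
have E0 k z : (0 <= (Ex P (fun v => ind R (`|z + wsum xi b k v - y j| <= r)))%:E)%E.
  by rewrite lee_fin; apply: Ex_ge0; exact: (bmf_section1 z (bz k)).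
rewrite ge0_integralZl//; last 2 first.
- by apply: emeasurable_sum => k; exact: bmf_EFin.
- by move=> z _; apply: sume_ge0 => k _.
rewrite ge0_integral_sum//; last by move=> k; exact: bmf_EFin.
rewrite (eq_bigr (fun=> (4 * r ^+ 2)%:E)); last first.
  move=> k _; rewrite (Ex_swap P leb2 (bz k))/=.
  under eq_integral do rewrite leb2_close//.
  by rewrite integral_cst// [X in (_ * X)%E]probability_setT mule1.
rewrite sumEFin -EFinM lee_fin sumr_const_nat -[_ *+ _]mulr_natl -addnA addKn.
rewrite (_ : h / r ^+ 2 * _ = 4 * ((n + nx)%:R * h)); last by field; rewrite gt_eqF.
by rewrite -mulrA ler_pM2l.
Qed.

Let bmf_Y : bmf (fun q : T * pt * T => Y q.1.2 q.2 q.1.1).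
Proof.
apply: bmf_bigmax => l _; apply: bmf_sum => j _; apply: bmfM.
  apply: bmfM; first exact: bmf_cst.
  apply: bmf_Lker => //; apply: measurable_ptB => //; apply: measurable_ptD.
    by apply: measurableT_comp => //; exact: measurable_snd.
  exact: (measurableT_comp (mwsum b (b + l)) measurable_snd).
have mV : measurable_fun [set: past xi a] ((fun=> x0) : past xi a -> pt) by exact: measurable_cst.
have m11 : measurable_fun setT (fun u : T * pt * T => u.1.1) by exact: measurableT_comp.
exact: (bmf_comp m11 (bmf_occ h0 gw mV r (c + nx) (y j))).
Qed.

Let sumQ := \sum_j \sum_k m j * m k * Lam2 j k ^+ 2.

Let C3 : R := C1 * (C2 * (8 * CT * D ^+ 2)).

Lemma int_Y_le (w : T) :
  (\int[leb2]_z (Ex P (fun v => Y z v w ^+ 2))%:E <=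
   (C3 * \sum_j \sum_k m j * m k * Lam2 j k * (occ1 j w * occ1 k w))%:E)%E.
Proof.
pose coef j k := C1 * (m j * occ1 j w * (m k * occ1 k w) * (C2 * Lam2 j k)).
have coef0 j k : 0 <= coef j k.
  by apply: mulr_ge0 => //; apply: mulr_ge0; apply: mulr_ge0 => //; try exact: mulr_ge0; exact: Lam_ge0.
have bE2 j : bmf (fun z : pt => Ex P (occ2 j z)).
  apply: (@bmf_Ex _ _ T P _ pt (fun z v => occ2 j z v)); apply: bmfM; first by apply: bmf_cst; rewrite divr_ge0 ?sqr_ge0 ?(ltW h0).
  apply: bmf_sum => k _; apply: bmf_ptclose; apply: measurable_ptB => //; apply: measurable_ptD.
    by apply: measurable_ptB => //; exact: (measurableT_comp (mwsum 0 b) measurable_snd).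
  exact: (measurableT_comp (mwsum 0 k) measurable_snd).
have E20 j z : 0 <= Ex P (occ2 j z) by exact: Ex_ge0.
apply: (@le_trans _ _ (\int[leb2]_z (\sum_j \sum_k (coef j k)%:E * ((Ex P (occ2 j z))%:E + (Ex P (occ2 k z))%:E)))%E).
  apply: ge0_le_integral => //.
  - by move=> z _; rewrite lee_fin; apply: Ex_ge0; apply: bmfX; exact: (bmf_section1 (w, z) bmf_Y).
  - have bY2 : bmf (fun q : pt * T => Y q.1 q.2 w).
      have mm : measurable_fun setT (fun q : pt * T => ((w, q.1), q.2) : T * pt * T).
        by apply: measurable_fun_pair => //; apply: measurable_fun_pair => //.
      exact: (bmf_comp mm bmf_Y).
    apply: bmf_EFin; apply: (@bmf_Ex _ _ T P _ pt (fun z v => Y z v w ^+ 2)).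
    exact: bmfX.
  - apply: emeasurable_sum => j; apply: emeasurable_sum => k.
    by apply: measurable_funeM; apply: emeasurable_funD; exact: bmf_EFin.
  move=> z _; under eq_bigr do under eq_bigr do rewrite -EFinD -EFinM.
  under eq_bigr do rewrite sumEFin; rewrite sumEFin lee_fin.
  apply: le_trans (Y_path2 z w) _; apply: le_trans (ler_wpM2l C1_ge0 (occ2_square z w)) _.
  rewrite mulr_sumr; apply: ler_sum => j _; rewrite mulr_sumr; apply: ler_sum => k _.
  by rewrite /coef !mulrA.
have mE2 j : measurable_fun setT (fun z : pt => (Ex P (occ2 j z))%:E) by exact: bmf_EFin.
have mt j k : measurable_fun setT (fun z : pt => (coef j k)%:E * ((Ex P (occ2 j z))%:E + (Ex P (occ2 k z))%:E))%E.
  by apply: measurable_funeM; exact: emeasurable_funD.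
have t0 j k z : (0 <= (coef j k)%:E * ((Ex P (occ2 j z))%:E + (Ex P (occ2 k z))%:E))%E.
  by rewrite -EFinD -EFinM lee_fin mulr_ge0// addr_ge0.
rewrite ge0_integral_sum//; last 2 first.
- by move=> j; exact: emeasurable_sum.
- by move=> j z _; exact: sume_ge0.
rewrite mulr_sumr -sumEFin; apply: lee_sum => j _.
rewrite ge0_integral_sum// mulr_sumr -sumEFin; apply: lee_sum => k _.
rewrite ge0_integralZl; [|by []|exact: emeasurable_funD| |by rewrite lee_fin]; last first.
  by move=> z _; rewrite -EFinD lee_fin addr_ge0.
rewrite ge0_integralD//; try by move=> z _; rewrite lee_fin.
apply: (@le_trans _ _ ((coef j k)%:E * ((4 * CT * D ^+ 2)%:E + (4 * CT * D ^+ 2)%:E))%E).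
  by apply: lee_wpmul2l; [rewrite lee_fin|apply: leeD; exact: occ2_leb].
rewrite -EFinD -EFinM lee_fin /coef /C3 le_eqVlt; apply/orP; left; apply/eqP.
ring.
Qed.

Lemma occ1_mean j : Ex P (fun w => Ha w * occ1 j w) <= K * (CT * D ^+ 2).
Proof.
have mV : measurable_fun [set: past xi a] ((fun=> x0) : past xi a -> pt) by exact: measurable_cst.
have bv k : bmf (fun w => ind R (`|x0 + wsum xi 0 k w - y j| <= r)).
  by apply: bmf_ptclose; apply: measurable_ptB => //; exact: measurable_ptD.
have hr0 : 0 <= h / r ^+ 2 by rewrite divr_ge0 ?sqr_ge0 ?(ltW h0).
rewrite (_ : Ex P _ = h / r ^+ 2 * \sum_(a <= k < c + nx) Ex P (fun w => Ha w * ind R (`|x0 + wsum xi 0 k w - y j| <= r))); last first.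
  rewrite -Ex_sum; last by move=> k _; exact: bmfM.
  rewrite -ExZ//; last by apply: bmf_sum => k _; exact: bmfM.
  by apply: Ex_eq => w; rewrite /occ1 /occ -mulr_sumr mulrCA.
apply: (@le_trans _ _ (h / r ^+ 2 * \sum_(a <= k < c + nx) K * r ^+ 2)).
  rewrite ler_wpM2l// big_seq [leRHS]big_seq; apply: ler_sum => k.
  by rewrite mem_index_iota; exact: base.
rewrite sumr_const_nat -[_ *+ _]mulr_natl /c -addnA addKn.
rewrite (_ : h / r ^+ 2 * _ = K * ((n + nx)%:R * h)); last by field; rewrite gt_eqF.
by rewrite ler_wpM2l.
Qed.

(** Each of the two second moments of occupation times contributes one factor [Lam], one for each
    passage: this is the origin of the squared logarithm. *)
Lemma two_interval_meet :
  Ex P (fun w => Ha w * Hg w * meet_max w (x0 + wsum xi 0 b w) w) <=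
  psi * (C1 * (C3 * (C2 * (2 * (K * (CT * D ^+ 2)))))) * sumQ.
Proof.
have mV : measurable_fun [set: past xi a] ((fun=> x0) : past xi a -> pt) by exact: measurable_cst.
have bo j : bmf (occ1 j) by exact: (bmf_occ h0 gw mV).
have CT0 : 0 <= CT.
  have : 0 <= CT * D ^+ 2 by apply: le_trans short; rewrite mulr_ge0// ltW.
  by rewrite pmulr_lge0// exprn_gt0.
have C30 : 0 <= C3 by apply: mulr_ge0 => //; apply: mulr_ge0 => //; apply: mulr_ge0 (sqr_ge0 _); exact: mulr_ge0.
rewrite -lee_fin; apply: le_trans two_interval_gap _.
rewrite -mulrA EFinM; apply: lee_wpmul2l; first by rewrite lee_fin.
pose X (q : pt * T) := Ha q.2 * Ex P (meet_max q.2 q.1).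
have bX : bmf X.
  apply: bmfM; first exact: (bmf_comp measurable_snd bHa').
  have mm : measurable_fun setT (fun q : pt * T => (q.2, q.1)) by exact: measurable_fun_pair.
  exact: (bmf_comp mm bmf_meet_T).
pose X2 (q : pt * T) := Ha q.2 * Ex P (fun v => Y q.1 v q.2 ^+ 2).
have bEY : bmf (fun q : T * pt => Ex P (fun v => Y q.2 v q.1 ^+ 2)).
  by apply: (@bmf_Ex _ _ T P _ (T * pt)%type (fun q v => Y q.2 v q.1 ^+ 2)); exact: bmfX bmf_Y.
have bX2 : bmf X2.
  apply: bmfM; first exact: (bmf_comp measurable_snd bHa').
  have mm : measurable_fun setT (fun q : pt * T => (q.2, q.1)) by exact: measurable_fun_pair.
  exact: (bmf_comp mm bEY).
have scale (F : T -> pt -> R) w : (forall z, 0 <= F w z) -> measurable_fun setT (fun z => (F w z)%:E) ->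
    ((Ha w)%:E * \int[leb2]_z (F w z)%:E = \int[leb2]_z (Ha w * F w z)%:E)%E.
  move=> F0 mF; rewrite -ge0_integralZl//; last by rewrite lee_fin; exact: bmf_ge0 bHa'.
  by move=> z _; rewrite lee_fin.
rewrite (_ : \int[P]_w _ = \int[P]_w \int[leb2]_z (X (z, w))%:E)%E; last first.
  apply: eq_integral => w _; rewrite (scale (fun w z => Ex P (meet_max w z)))//.
    by move=> z; exact: Ex_ge0.
  by apply: bmf_EFin; exact: (bmf_section1 w bmf_meet_T).
(* The order of integration is changed so that the first Doob inequality is used for fixed [z] and
   [v], and the second one for fixed [z] and [w]. *)
rewrite -(Ex_swap P leb2 bX).
have fub (V : T -> T -> R) : bmf (fun q : T * T => V q.1 q.2) ->
    Ex P (fun w => Ex P (V w)) = Ex P (fun v => Ex P (V ^~ v)).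
  move=> bV; apply: EFin_inj; rewrite -!ExE; last 2 first.
  - apply: (@bmf_Ex _ _ T P _ T (fun v w => V w v)).
    have mm : measurable_fun setT (fun q : T * T => (q.2, q.1)) by exact: measurable_fun_pair.
    exact: (bmf_comp mm bV).
  - exact: (@bmf_Ex _ _ T P _ T).
  rewrite (Ex_swap P P bV); apply: eq_integral => v _.
  by rewrite ExE//; exact: (bmf_section2 v bV).
apply: (@le_trans _ _ (\int[leb2]_z (C1%:E * (Ex P (fun w => X2 (z, w)))%:E))%E).
  apply: ge0_le_integral => //.
  - by move=> z _; rewrite lee_fin; apply: Ex_ge0; exact: (bmf_section1 z bX).
  - by apply: bmf_EFin; apply: (@bmf_Ex _ _ T P _ pt (fun z w => X (z, w))).
  - apply: measurable_funeM; apply: bmf_EFin; exact: (@bmf_Ex _ _ T P _ pt (fun z w => X2 (z, w))).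
  move=> z _; rewrite -EFinM lee_fin.
  have bM3 : bmf (fun q : T * T => Ha q.1 * meet_max q.1 z q.2).
    apply: bmfM; first exact: (bmf_comp measurable_fst bHa').
    apply: bmf_meet_max => //.
    - by move=> i im; exact: (measurableT_comp (mwsum 0 (a + i)) measurable_fst).
    - by move=> l; exact: (measurableT_comp (mwsum b (b + l)) measurable_snd).
  have bY3 : bmf (fun q : T * T => Ha q.1 * Y z q.2 q.1 ^+ 2).
    apply: bmfM; first exact: (bmf_comp measurable_fst bHa').
    have mm : measurable_fun setT (fun q : T * T => ((q.1, z), q.2) : T * pt * T).
      by apply: measurable_fun_pair => //; apply: measurable_fun_pair => //.
    exact: (bmfX 2 (bmf_comp mm bmf_Y)).
  rewrite (_ : Ex P _ = Ex P (fun w => Ex P (fun v => Ha w * meet_max w z v))); last first.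
    by apply: Ex_eq => w; rewrite /X/= ExZ// (bmf_ge0 w bHa').
  rewrite (_ : Ex P (fun w => X2 (z, w)) = Ex P (fun w => Ex P (fun v => Ha w * Y z v w ^+ 2))); last first.
    apply: Ex_eq => w; rewrite /X2/= ExZ// ?(bmf_ge0 w bHa')//.
    by apply: bmfX; exact: (bmf_section1 (w, z) bmf_Y).
  rewrite (fub (fun w v => Ha w * meet_max w z v) bM3) (fub (fun w v => Ha w * Y z v w ^+ 2) bY3).
  rewrite -ExZ//; last first.
    apply: (@bmf_Ex _ _ T P _ T (fun v w => Ha w * Y z v w ^+ 2)).
    have mm : measurable_fun setT (fun q : T * T => (q.2, q.1)) by exact: measurable_fun_pair.
    exact: (bmf_comp mm bY3).
  have sw (V : T -> T -> R) : bmf (fun q : T * T => V q.1 q.2) -> bmf (fun v => Ex P (V ^~ v)).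
    move=> bV; apply: (@bmf_Ex _ _ T P _ T (fun v w => V w v)).
    have mm : measurable_fun setT (fun q : T * T => (q.2, q.1)) by exact: measurable_fun_pair.
    exact: (bmf_comp mm bV).
  apply: Ex_le.
  - exact: (sw (fun w v => Ha w * meet_max w z v) bM3).
  - by apply: bmfM; [exact: bmf_cst|exact: (sw (fun w v => Ha w * Y z v w ^+ 2) bY3)].
  by move=> v; exact: meet_max_path1.
have E2 z : 0 <= Ex P (fun w => X2 (z, w)) by apply: Ex_ge0; exact: (bmf_section1 z bX2).
rewrite ge0_integralZl//; last 2 first.
- by apply: bmf_EFin; exact: (@bmf_Ex _ _ T P _ pt (fun z w => X2 (z, w))).
- by move=> z _; rewrite lee_fin.
rewrite -(mulrA C1) (EFinM C1); apply: lee_wpmul2l; first by rewrite lee_fin.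
rewrite (Ex_swap P leb2 bX2)/=.
pose S w := \sum_j \sum_k m j * m k * Lam2 j k * (occ1 j w * occ1 k w).
have bjk j k : bmf (fun w => m j * m k * Lam2 j k * (occ1 j w * occ1 k w)).
  by apply: bmfM; [apply: bmf_cst; rewrite !mulr_ge0 ?Lam_ge0|exact: bmfM].
have bS : bmf S by apply: bmf_sum => j _; exact: bmf_sum.
apply: (@le_trans _ _ (\int[P]_w (C3 * (Ha w * S w))%:E)%E).
  apply: ge0_le_integral => //.
  - by move=> w _; apply: integral_ge0 => z _; rewrite lee_fin; exact: (bmf_ge0 (z, w) bX2).
  - have mm : measurable_fun setT (fun q : T * pt => (q.2, q.1)) by exact: measurable_fun_pair.
    have := @measurable_param_integral _ _ _ _ _ leb2 _ (bmf_EFin (bmf_comp mm bX2)).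
    by apply => q; rewrite lee_fin; exact: bmf_ge0 bX2.
  - by apply: bmf_EFin; apply: bmfM; [exact: bmf_cst|exact: bmfM].
  move=> w _; rewrite -(scale (fun w z => Ex P (fun v => Y z v w ^+ 2)))//; last 2 first.
  - by move=> z; apply: Ex_ge0; apply: bmfX; exact: (bmf_section1 (w, z) bmf_Y).
  - by apply: bmf_EFin; exact: (bmf_section1 w bEY).
  rewrite mulrCA EFinM; apply: lee_wpmul2l; first by rewrite lee_fin; exact: bmf_ge0 bHa'.
  exact: int_Y_le.
rewrite ExE; last by apply: bmfM; [exact: bmf_cst|exact: bmfM].
rewrite lee_fin ExZ//; last exact: bmfM.
rewrite -mulrA ler_wpM2l//.
rewrite (_ : Ex P _ = \sum_j \sum_k m j * m k * Lam2 j k * Ex P (fun w => Ha w * (occ1 j w * occ1 k w))); last first.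
  transitivity (Ex P (fun w => \sum_j \sum_k m j * m k * Lam2 j k * (Ha w * (occ1 j w * occ1 k w)))).
    apply: Ex_eq => w; rewrite mulr_sumr; apply: eq_bigr => j _.
    by rewrite mulr_sumr; apply: eq_bigr => k _; rewrite mulrCA.
  have b3 j k : bmf (fun w => m j * m k * Lam2 j k * (Ha w * (occ1 j w * occ1 k w))).
    apply: bmfM; first by apply: bmf_cst; rewrite !mulr_ge0 ?Lam_ge0.
    by apply: bmfM => //; exact: bmfM.
  rewrite Ex_sum; last by move=> j _; exact: bmf_sum.
  apply: eq_bigr => j _; rewrite Ex_sum//; apply: eq_bigr => k _; rewrite ExZ//.
    by rewrite !mulr_ge0 ?Lam_ge0.
  by apply: bmfM => //; exact: bmfM.
rewrite mulr_sumr; apply: ler_sum => j _; rewrite mulr_sumr; apply: ler_sum => k _.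
have sh : (c + nx - a)%:R * h <= CT * D ^+ 2 by rewrite /c -addnA addKn.
have := @occ_second_moment _ _ _ _ _ _ h0 gw a _ mV C CT D r (c + nx) Ha (y j) (y k) C0 D0 r0 hr HC bHa sh.
move=> /(ler_wpM2l (_ : 0 <= m j * m k * Lam2 j k)) H.
apply: le_trans (H _) _; first by rewrite !mulr_ge0 ?Lam_ge0.
have L0 : 0 <= Lam2 j k by exact: Lam_ge0.
apply: (@le_trans _ _ (m j * m k * Lam2 j k * (C2 * Lam2 j k * (K * (CT * D ^+ 2) + K * (CT * D ^+ 2))))).
  apply: ler_wpM2l; first by rewrite !mulr_ge0.
  apply: ler_wpM2l; first exact: mulr_ge0.
  by apply: lerD; exact: occ1_mean.
by rewrite le_eqVlt; apply/orP; left; apply/eqP; ring.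
Qed.

End two_intervals.

(** * Escape over long time intervals *)

Section translation.
Context {R : realType}.
Notation pt := (R * R)%type.

Lemma integral_leb1_translation (a : R) (f : R -> \bar R) :
  measurable_fun setT f -> (forall x, 0 <= f x)%E ->
  (\int[leb1]_x f (x + a)%R = \int[leb1]_x f x)%E.
Proof.
move=> mf f0; symmetry.
have mt : measurable_fun [set: measurableTypeR R] ((fun x => x + a) : measurableTypeR R -> measurableTypeR R).
  exact: (@measurable_funD _ _ R setT id (cst a) (@measurable_id _ _ _) (measurable_cst _)).
pose t : {mfun measurableTypeR R >-> measurableTypeR R} :=
  HB.pack (fun x : measurableTypeR R => x + a : measurableTypeR R) (isMeasurableFun.Build _ _ _ _ _ mt).
have E (A : set (measurableTypeR R)) : measurable A ->
    @lebesgue_measure R A = pushforward (@lebesgue_measure R) t A.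
  apply: lebesgue_measure_unique => _ [[l u]] _ <-.
  rewrite [RHS](_ : _ = @lebesgue_measure R `]l - a, u - a]%classic); last first.
    congr lebesgue_measure; apply/seteqP; split => x /=; rewrite !in_itv/= ltrBlDr lerBrDr//.
  rewrite !lebesgue_measure_itv/= !lte_fin ltrD2r -!EFinD.
  by case: ifP => // _; congr EFin; ring.
have mt' : measurable_fun [set: R] (fun x : R => x + a) by exact: measurable_funD.
pose t' : {mfun R >-> R} := HB.pack (fun x : R => x + a) (isMeasurableFun.Build _ _ _ _ _ mt').
transitivity (\int[pushforward leb1 t']_x f x)%E; last by rewrite ge0_integral_pushforward.
by apply: eq_measure_integral => A mA _; exact: E.
Qed.

Lemma integral_leb2_translation (x : pt) (F : pt -> \bar R) :
  measurable_fun setT F -> (forall z, 0 <= F z)%E ->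
  (\int[leb2]_z F (x + z)%R = \int[leb2]_z F z)%E.
Proof.
move=> mF F0.
have mT : measurable_fun [set: pt] (fun z : pt => x + z) by exact: measurable_ptD.
have mFx : measurable_fun [set: pt] (fun z : pt => F (x + z)) by exact: measurableT_comp mF mT.
transitivity (\int[leb1 \x leb1]_z F (x + z)%R)%E => //.
rewrite fubini_tonelli1//.
transitivity (\int[leb1 \x leb1]_z F z)%E => //.
rewrite (fubini_tonelli1 _ mF F0).
rewrite -[RHS](integral_leb1_translation x.1); last 2 first.
- exact: measurable_fun_fubini_tonelli_F.
- by move=> u; exact: integral_ge0.
apply: eq_integral => u _; rewrite /fubini_F.
have mFu : measurable_fun setT (fun v => F (u + x.1, v)).
  exact: (measurableT_comp mF (pair1_measurable (u + x.1))).
rewrite -[RHS](integral_leb1_translation x.2 mFu)//.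
by apply: eq_integral => v _; rewrite (addrC u) (addrC v); case: (x).
Qed.

End translation.

Section windows.
Context {R : realType} {d} {T : measurableType d} {P : probability T R}.
Context {h : R} {xi : nat -> T -> R * R}.
Hypothesis (h0 : 0 < h) (gw : gaussian_walk P h xi).
Notation pt := (R * R)%type.

Lemma wsum_integral (c b : nat) (F : pt -> \bar R) : (c < b)%N ->
  measurable_fun setT F -> (forall z, 0 <= F z)%E ->
  (\int[P]_u F (wsum xi c b u) =
   \int[norm1 (Num.sqrt ((b - c)%:R * h)%R) \x norm1 (Num.sqrt ((b - c)%:R * h)%R)]_z F z)%E.
Proof.
move=> cb mF F0.
pose W : {mfun T >-> pt} := HB.pack (wsum xi c b)
  (isMeasurableFun.Build _ _ _ _ _ (wsum_measurable gw c b)).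
rewrite -(ge0_integral_distribution (P := P) W mF)//.
apply: eq_measure_integral => A mA _; apply/esym; apply: product_measure_unique => // X Y mX mY.
etransitivity; first exact: (gw_gauss gw cb (measurableX mX mY)).
by rewrite /gauss2 product_measure1E.
Qed.

Lemma wsum_density (c b : nat) (x : pt) (F : pt -> \bar R) : (c < b)%N ->
  measurable_fun setT F -> (forall z, 0 <= F z)%E ->
  (\int[P]_u F (x + wsum xi c b u)%R <= (peak2 ((b - c)%:R * h))%:E * \int[leb2]_z F z)%E.
Proof.
move=> cb mF F0; have mT : measurable_fun [set: pt] (fun z : pt => x + z) by exact: measurable_ptD.
rewrite (wsum_integral (F := fun z => F (x + z)) cb)//; last exact: measurableT_comp mF mT.
rewrite -(integral_leb2_translation x mF F0); apply: gauss2_integral_le => //.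
  by rewrite mulr_gt0// ltr0n subn_gt0.
exact: measurableT_comp mF mT.
Qed.

(** The gap is cut at [e]: the steps before [e] carry the weight, and the independent increment
    after [e] supplies the bounded density. *)
Lemma dominated_gap_split c e b (Hg Hg' : T -> R) : (c <= e < b)%N ->
  bmf Hg -> bmf (Hg' : sg xi (fun i => c <= i < e)%N -> R) -> (forall w, Hg w <= Hg' w) ->
  dominated_gap (P := P) (xi := xi) (peak2 ((b - e)%:R * h) * Ex P Hg') c b Hg.
Proof.
move=> /andP[ce eb] bHg bHg' HH x F mF F0.
pose I i := (c <= i < e)%N; pose I' i := (e <= i)%N.
have mT : measurable_fun [set: pt] (fun z : pt => x + z) by exact: measurable_ptD.
have mW : measurable_fun setT (fun u => F (x + wsum xi c b u)).
  by apply: (measurableT_comp mF); apply: measurable_ptD => //; exact: (wsum_measurable gw).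
have bHg'' : bmf Hg' := sg_bmf gw bHg'.
pose Phi (z : sg xi I * sg xi I') := ((Hg' z.1)%:E * F (x + wsum xi c e z.1 + wsum xi e b z.2)%R)%E.
have Phi0 z : (0 <= Phi z)%E by apply: mule_ge0 => //; rewrite lee_fin; exact: bmf_ge0 bHg'.
apply: (@le_trans _ _ (\int[P]_w Phi (w, w))%E).
  apply: ge0_le_integral => //.
  - by move=> w _; apply: mule_ge0 => //; rewrite lee_fin; exact: bmf_ge0 bHg.
  - by apply: emeasurable_funM => //; exact: bmf_EFin.
  - apply: emeasurable_funM; first exact: bmf_EFin.
    apply: (measurableT_comp mF); apply: measurable_ptD; last exact: (wsum_measurable gw).
    by apply: measurable_ptD => //; exact: (wsum_measurable gw).
  - move=> w _; rewrite /Phi/= -addrA -(@wsum_cat _ _ _ xi c e b w) ?ce ?(ltnW eb)//.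
    by apply: lee_wpmul2r => //; rewrite lee_fin.
rewrite (walk_indep gw)//; last 2 first.
- by move=> i; rewrite /I /I'; case: (leqP e i); rewrite ?andbF.
- apply: emeasurable_funM; first exact: (bmf_EFin (bmf_comp measurable_fst bHg')).
  apply: (measurableT_comp mF); apply: measurable_ptD.
    by apply: measurable_ptD => //; apply: measurableT_comp => //; exact: sg_wsum.
  by apply: measurableT_comp => //; apply: sg_wsum => i /andP[].
apply: (@le_trans _ _ (\int[P]_u ((Hg' u)%:E * ((peak2 ((b - e)%:R * h))%:E * \int[leb2]_z F z)))%E).
  apply: ge0_le_integral => //.
  - by move=> u _; apply: integral_ge0.
  - apply: (sg_measurable_fun gw (I := I)).
    have m2 : measurable_fun [set: sg xi I * T] ((fun z => z.2) : sg xi I * T -> sg xi I').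
      move=> _ A mA; apply: (@measurable_snd _ _ (sg xi I) T) => //.
      by have := sg_id gw (I := I') measurableT mA; rewrite setTI.
    have mm : measurable_fun [set: sg xi I * T] (fun z : sg xi I * T => Phi (z.1, z.2)).
      apply: emeasurable_funM; first exact: (bmf_EFin (bmf_comp measurable_fst bHg')).
      apply: (measurableT_comp mF); apply: measurable_ptD.
        apply: measurable_ptD => //; apply: (measurableT_comp _ measurable_fst).
        exact: sg_wsum.
      exact: (measurableT_comp (wsum_measurable gw e b) (@measurable_snd _ _ (sg xi I) T)).
    have := @measurable_fun_fubini_tonelli_F _ _ _ _ _ P _ mm; apply => z; exact: Phi0.
  - by apply: emeasurable_funM => //; exact: bmf_EFin.
  move=> u _; rewrite /Phi/= ge0_integralZl//.
  - by apply: lee_wpmul2l; [rewrite lee_fin (bmf_ge0 _ bHg'')|exact: wsum_density].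
  - apply: (measurableT_comp mF); apply: measurable_ptD => //.
    exact: (wsum_measurable gw).
  - by rewrite lee_fin (bmf_ge0 _ bHg'').
have p0 : 0 <= peak2 ((b - e)%:R * h) by apply: peak2_ge0; rewrite mulr_gt0// ltr0n subn_gt0.
rewrite ge0_integralZr//.
- by rewrite ExE// EFinM muleCA muleA.
- exact: bmf_EFin.
- by move=> w _; rewrite lee_fin (bmf_ge0 _ bHg'').
- by apply: mule_ge0; [rewrite lee_fin|exact: integral_ge0].
Qed.

Variable L : nat.
Hypothesis Lh : 72 <= L%:R * h.

(* The walk moves by at most 6 over each of n windows of L steps.  A path that
   stays within distance 3 of the origin satisfies this, and each window costs
   a factor 1/2. *)
Definition win c n (w : T) : R := \prod_(i < n) ind R (`|wsum xi (c + i * L) (c + i.+1 * L) w| <= 6).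

Lemma winS c n w : win c n.+1 w = win c n w * ind R (`|wsum xi (c + n * L) (c + n.+1 * L) w| <= 6).
Proof. by rewrite /win big_ord_recr. Qed.

Lemma win_le1 c n w : 0 <= win c n w <= 1.
Proof.
elim: n => [|n /andP[i0 i1]]; first by rewrite /win big_ord0 ler01 lexx.
by rewrite winS /ind; case: (_ <= 6); rewrite ?mulr1 ?mulr0 ?i0 ?i1 ?lexx ?ler01.
Qed.

Lemma win_le c n k w : win c (n + k) w <= win c n w.
Proof.
elim: k => [|k ih]; first by rewrite addn0.
apply: le_trans ih; rewrite addnS winS ler_piMr//; first by case/andP: (win_le1 c (n + k) w).
by rewrite /ind; case: (_ <= 6).
Qed.

Lemma bmf_win c n (I : pred nat) : (forall i, (c <= i < c + n * L)%N -> I i) ->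
  bmf (win c n : sg xi I -> R).
Proof.
elim: n => [|n ih] HI.
  rewrite (_ : win c 0 = fun=> 1); first exact: bmf_cst.
  by apply/funext => w; rewrite /win big_ord0.
rewrite (_ : win c n.+1 = fun w => win c n w * ind R (`|wsum xi (c + n * L) (c + n.+1 * L) w| <= 6)); last first.
  by apply/funext => w; exact: winS.
apply: bmfM.
  apply: ih => i /andP[ci ic]; apply: HI; rewrite ci/= (leq_trans ic)// leq_add2l.
  by rewrite leq_mul2r leqnSn orbT.
apply: bmf_ptclose; apply: sg_wsum => i /andP[ci ic]; apply: HI; rewrite ic andbT.
by apply: leq_trans ci; exact: leq_addr.
Qed.

(** Origin of 72: by [hitp_le] an increment of variance at least 72 has norm at most 6 with
    probability at most 36/72. The windows are independent of one another and of the past. *)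
Lemma Ex_win (H : T -> R) c n : bmf (H : past xi c -> R) ->
  Ex P (fun w => H w * win c n w) <= 2 ^- n * Ex P H.
Proof.
move=> bH; elim: n => [|n ih].
  by rewrite expr0 invr1 mul1r le_eqVlt (_ : Ex P _ = Ex P H) ?eqxx//; apply: Ex_eq => w; rewrite /win big_ord0 mulr1.
have L0 : (0 < L)%N by rewrite lt0n; apply/eqP => E; move: Lh; rewrite E mul0r; lra.
set k := (c + n * L)%N; have kl : (k <= c + n.+1 * L)%N by rewrite leq_add2l leq_mul2r leqnSn orbT.
have bHW : bmf ((fun w => H w * win c n w) : past xi k -> R).
  apply: bmfM; first by apply: (sg_bmf_sub _ bH) => i /leq_trans; apply; exact: leq_addr.
  by apply: bmf_win => i /andP[].
(* Displacing by minus the position at time [k] turns the walk at the end of the window into the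
   increment over the window. *)
have mV : measurable_fun [set: past xi k] ((fun w => - wsum xi 0 k w) : past xi k -> pt).
  by apply: measurable_ptN; apply: sg_wsum => i /andP[].
have := @markov_hit _ _ _ _ _ _ gw 6 _ _ _ _ 0 kl bHW mV.
rewrite (_ : Ex P _ = Ex P (fun w => H w * win c n.+1 w)); last first.
  apply: Ex_eq => w; rewrite winS mulrA subr0 (@wsum_cat _ _ _ xi 0 k (c + n.+1 * L) w) ?leq0n//.
  by rewrite addKr.
move=> ->; apply: (@le_trans _ _ (Ex P (fun w => 2^-1 * (H w * win c n w)))).
  apply: Ex_le.
  - apply: bmfM; first exact: (sg_bmf gw bHW).
    apply: (bmf_hitp gw); apply: measurable_ptB => //; apply: measurable_ptD; last exact: (wsum_measurable gw).
    by apply: measurable_ptN; exact: (wsum_measurable gw).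
  - by apply: bmfM; [exact: bmf_cst|exact: (sg_bmf gw bHW)].
  move=> w; rewrite mulrC; apply: ler_wpM2r; first exact: (bmf_ge0 w (sg_bmf gw bHW)).
  have kk : (c + n.+1 * L - k)%N = L by rewrite /k mulSn (addnC L) addnA addKn.
  rewrite kk; apply: le_trans (hitp_le h0 gw _ L0 _) _ => //.
  by rewrite ler_pdivrMr; move: (Lh); lra.
rewrite ExZ//; last exact: (sg_bmf gw bHW).
by rewrite exprS invfM -mulrA ler_wpM2l// .
Qed.

(** For [n > 0] one window is not charged in [win], so its [L] steps can bound the density of the
    position. For [n = 0] the distance 1/2 of [y] from the starting point takes over: 16 r^2 /
    (1/2)^2 is the constant 64. *)
Lemma window_base (x0 y : pt) (r : R) n k : 0 < r -> 1 / 2 <= `|y - x0| -> (n * L <= k)%N ->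
  Ex P (fun w => win 0 n w * ind R (`|x0 + wsum xi 0 k w - y| <= r)) <= 64 * 2 ^- n * r ^+ 2.
Proof.
move=> r0 xy nk.
have mc l : measurable_fun [set: past xi l] ((fun=> x0) : past xi l -> pt) by exact: measurable_cst.
have r20 : 0 < r ^+ 2 by exact: exprn_gt0.
case: n nk => [|n] nk.
  have bH : bmf ((fun=> 1) : past xi 0 -> R) by exact: bmf_cst.
  have := @markov_hit _ _ _ _ _ _ gw r _ _ _ _ y (leq0n k) bH (mc 0%N).
  rewrite (_ : Ex P _ = Ex P (fun w => win 0 0 w * ind R (`|x0 + wsum xi 0 k w - y| <= r))); last first.
    by apply: Ex_eq => w; rewrite /win big_ord0.
  move=> ->; rewrite (_ : Ex P _ = Ex P (fun=> hitp P xi r k (y - x0))); last first.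
    by apply: Ex_eq => w; rewrite mul1r subn0 /wsum big_geq// addr0.
  rewrite Ex_cst; apply: le_trans (hitp_le_dist h0 gw _ _ r0) _.
  have M0 : 1 / 2 <= Num.max `|y - x0| r by rewrite le_max xy.
  have M2 : 1 / 4 <= Num.max `|y - x0| r ^+ 2 by nra.
  rewrite ler_pdivrMr; last by apply: lt_le_trans M2; lra.
  by rewrite expr0 invr1; nra.
have bH : bmf (win 0 n : past xi (n * L) -> R) by apply: bmf_win => i /andP[].
have nk' : (n * L <= k)%N by apply: leq_trans nk; rewrite leq_mul2r leqnSn orbT.
have L0 : (0 < L)%N by rewrite lt0n; apply/eqP => E; move: Lh; rewrite E mul0r; lra.
apply: (@le_trans _ _ (Ex P (fun w => win 0 n w * ind R (`|x0 + wsum xi 0 k w - y| <= r)))).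
  have bI : bmf (fun w => ind R (`|x0 + wsum xi 0 k w - y| <= r)).
    by apply: bmf_ptclose; apply: measurable_ptB => //; apply: measurable_ptD => //; exact: (wsum_measurable gw).
  apply: Ex_le.
  - by apply: bmfM => //; apply: (sg_bmf gw (I := xpredT)); exact: bmf_win.
  - by apply: bmfM => //; exact: (sg_bmf gw bH).
  move=> w; apply: ler_wpM2r; first exact: bmf_ge0 bI.
  by rewrite -addn1; exact: win_le.
rewrite (@markov_hit _ _ _ _ _ _ gw r _ _ _ _ y nk' bH (mc _)).
apply: (@le_trans _ _ (Ex P (fun w => r ^+ 2 / 72 * win 0 n w))).
  apply: Ex_le.
  - apply: bmfM; first exact: (sg_bmf gw bH).
    by apply: (bmf_hitp gw); apply: measurable_ptB => //; apply: measurable_ptD => //; exact: (wsum_measurable gw).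
  - by apply: bmfM; [apply: bmf_cst; rewrite divr_ge0// ltW|exact: (sg_bmf gw bH)].
  move=> w; rewrite mulrC; apply: ler_wpM2r; first exact: (bmf_ge0 w (sg_bmf gw bH)).
  have Lk : (L <= k - n * L)%N by rewrite leq_subRL// addnC -mulSn.
  have k0 : (0 < k - n * L)%N by exact: leq_trans Lk.
  apply: le_trans (hitp_le h0 gw _ k0 r0) _; rewrite ler_wpM2l ?(ltW r20)//.
  rewrite lef_pV2 ?posrE ?mulr_gt0 ?ltr0n//.
  by apply: le_trans Lh _; rewrite ler_pM2r// ler_nat.
rewrite ExZ; [|by rewrite divr_ge0// ltW|exact: (sg_bmf gw bH)].
have b1 : bmf ((fun=> 1) : past xi 0 -> R) by exact: bmf_cst.
have := Ex_win n b1; rewrite Ex_cst mulr1 (_ : Ex P _ = Ex P (win 0 n)); last first.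
  by apply: Ex_eq => w; rewrite mul1r.
move=> HW; apply: le_trans (ler_wpM2l _ HW) _; first by rewrite divr_ge0// ltW.
rewrite (exprS _ n) invfM; have : 0 <= 2 ^- n :> R by rewrite invr_ge0 exprn_ge0.
by nra.
Qed.

(* The density of the increment over a gap is only charged on the last window,
   the earlier full windows contribute the geometric factor. *)
Lemma window_gap_short c b : (c < b)%N ->
  dominated_gap (P := P) (xi := xi) (peak2 ((b - c)%:R * h)) c b (fun=> 1).
Proof.
move=> cb; have b1 : bmf ((fun=> 1) : sg xi (fun i => c <= i < c)%N -> R) by exact: bmf_cst.
have := @dominated_gap_split c c b (fun=> 1) (fun=> 1) _ (bmf_cst _ ler01) b1.
by rewrite Ex_cst mulr1 leqnn cb; apply.
Qed.

Lemma window_gap c b n : (c + n.+1 * L <= b)%N ->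
  dominated_gap (P := P) (xi := xi) (2 ^- n / 288) c b (win c n.+1).
Proof.
move=> cb; pose e := (c + n * L)%N.
have L0 : (0 < L)%N by rewrite lt0n; apply/eqP => E; move: Lh; rewrite E mul0r; lra.
have eb : (e + L <= b)%N by rewrite /e -addnA -(addnC L) -mulSn.
have bw : bmf (win c n : sg xi (fun i => c <= i < e)%N -> R) by apply: bmf_win.
have bw1 : bmf (win c n.+1) by apply: (sg_bmf gw (I := xpredT)); exact: bmf_win.
have ceb : (c <= e < b)%N by rewrite leq_addr/=; apply: leq_trans eb; rewrite -addn1 leq_add2l.
have := dominated_gap_split ceb bw1 bw; move=> /(_ _) H.
move=> x F mF F0; apply: le_trans (H _ x F mF F0) _; first by move=> w; rewrite -addn1; exact: win_le.
apply: lee_wpmul2r; first exact: integral_ge0.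
rewrite lee_fin mulrC; have Lb : L%:R * h <= (b - e)%:R * h.
  by rewrite ler_pM2r// ler_nat leq_subRL ?(leq_trans _ eb) ?leq_addr.
have b1 : bmf ((fun=> 1) : past xi c -> R) by exact: bmf_cst.
have := Ex_win n b1; rewrite Ex_cst mulr1 (_ : Ex P _ = Ex P (win c n)); last first.
  by apply: Ex_eq => w; rewrite mul1r.
move=> HW; apply: ler_pM => //; first by apply: Ex_ge0; exact: (sg_bmf gw bw).
  by apply: peak2_ge0; apply: lt_le_trans Lb; apply: lt_le_trans Lh.
(* At least one window of variance 72 remains after [e], and 288 = 4 * 72. *)
apply: le_trans (peak2_le _) _; first by apply: lt_le_trans Lb; apply: lt_le_trans Lh.
have X : 288 <= 4 * ((b - e)%:R * h) by rewrite (_ : 288 = 4 * 72 :> R) ?ler_pM2l ?(le_trans Lh)//; ring.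
have p288 : 0 < 288 :> R := ltr0n R 288.
by rewrite lef_pV2 ?posrE ?p288 ?(lt_le_trans p288 X) ?X.
Qed.

End windows.

(** * Double points of continuous paths *)

Section plane_topology.
Context {R : realType}.
Notation pt := (R * R)%type.

Lemma enorm_ge0 (x : pt) : 0 <= enorm x.
Proof. exact: sqrtr_ge0. Qed.

Lemma enorm_sqr (x : pt) : enorm x ^+ 2 = x.1 ^+ 2 + x.2 ^+ 2.
Proof. by rewrite sqr_sqrtr// addr_ge0 ?sqr_ge0. Qed.

Lemma fst_le_norm (x : pt) : `|x.1| <= `|x|.
Proof. by rewrite prod_normE le_max lexx. Qed.

Lemma snd_le_norm (x : pt) : `|x.2| <= `|x|.
Proof. by rewrite prod_normE le_max lexx orbT. Qed.

Lemma norm_le_enorm (x : pt) : `|x| <= enorm x.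
Proof.
have H (a b : R) : `|a| <= Num.sqrt (a ^+ 2 + b ^+ 2).
  by rewrite -sqrtr_sqr ler_sqrt ?addr_ge0 ?sqr_ge0// lerDl sqr_ge0.
by rewrite prod_normE ge_max H/= /enorm addrC H.
Qed.

Lemma enorm_le_norm (x : pt) : enorm x <= 2 * `|x|.
Proof.
have n0 : 0 <= 2 * `|x| by rewrite mulr_ge0.
rewrite -(ger0_norm n0) -sqrtr_sqr ler_sqrt ?sqr_ge0//.
have H (a : R) : `|a| <= `|x| -> a ^+ 2 <= `|x| ^+ 2.
  by move=> ax; rewrite -(real_normK (num_real a)) ler_sqr ?nnegrE.
have := H _ (fst_le_norm x); have := H _ (snd_le_norm x).
have := sqr_ge0 `|x|; rewrite exprMn; lra.
Qed.

Lemma enorm_lip (x y : pt) : enorm x <= enorm y + 2 * `|x - y|.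
Proof.
have n0 : 0 <= enorm y + 2 * `|x - y| by rewrite addr_ge0 ?enorm_ge0// mulr_ge0.
rewrite -(ger0_norm n0) -sqrtr_sqr ler_sqrt ?sqr_ge0//.
have d0 := normr_ge0 (x - y); have e0 := enorm_ge0 y; have es := enorm_sqr y.
have H (a b : R) : `|a - b| <= `|x - y| -> `|b| <= enorm y ->
    a ^+ 2 <= b ^+ 2 + 2 * enorm y * `|x - y| + `|x - y| ^+ 2.
  move=> h1 h2; have -> : a = b + (a - b) by rewrite addrC subrK.
  have : b * (a - b) <= enorm y * `|x - y|.
    by apply: le_trans (ler_norm _) _; rewrite normrM ler_pM.
  have : (a - b) ^+ 2 <= `|x - y| ^+ 2.
    by rewrite -(real_normK (num_real (a - b))) ler_sqr ?nnegrE.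
  rewrite sqrrD mulr2n; lra.
have := H _ _ (fst_le_norm (x - y)) (le_trans (fst_le_norm y) (norm_le_enorm y)).
have := H _ _ (snd_le_norm (x - y)) (le_trans (snd_le_norm y) (norm_le_enorm y)).
move=> h1 h2; nra.
Qed.

Lemma dist_lt (a b e : R) : `|a - b| < e -> b - e < a < b + e.
Proof. by rewrite ltr_distl. Qed.

Lemma ray_continuousP (beta : R -> pt) : {within `[0, +oo[, continuous beta} ->
  forall t e, 0 <= t -> 0 < e -> exists2 eta, 0 < eta &
    forall u, 0 <= u -> `|u - t| < eta -> `|beta u - beta t| < e.
Proof.
move=> /subspace_continuousP cb t e t0 e0.
have /cb : `[0, +oo[%classic t by rewrite /= in_itv/= t0.
move=> /cvgrPdist_lt/(_ _ e0); rewrite /within/= => /nbhs_ballP[eta /= eta0 H].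
exists eta => // u u0 ut; rewrite distrC; apply: H => /=; last by rewrite in_itv/= u0.
by rewrite /ball/= distrC.
Qed.

Lemma measurable_open_plane (O : set pt) : open O -> measurable O.
Proof.
move=> oO.
pose Q (p q r : rat) : set pt := [set z | `|z - (ratr p, ratr q)| <= ratr r].
pose F (p q r : rat) := if `[< Q p q r `<=` O >] then Q p q r else set0.
rewrite (_ : O = \bigcup_p \bigcup_q \bigcup_r F p q r).
  apply: bigcupT_measurable_rat => p; apply: bigcupT_measurable_rat => q.
  apply: bigcupT_measurable_rat => r; rewrite /F; case: ifP => // _; exact: measurable_square.
apply/seteqP; split => [z Oz|z [p _ [q _ [r _]]]]; last first.
  by rewrite /F; case: asboolP => // + Qz; apply.
have : nbhs z O by exact: open_nbhs_nbhs.
move=> /nbhs_ballP[e /= e0 He].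
have [r]: exists q : rat, ratr q \in `]e / 4, e / 2[ by apply: rat_in_itvoo; lra.
have [p]: exists q : rat, ratr q \in `]z.1 - e / 4, z.1 + e / 4[ by apply: rat_in_itvoo; lra.
have [q]: exists q : rat, ratr q \in `]z.2 - e / 4, z.2 + e / 4[ by apply: rat_in_itvoo; lra.
rewrite !in_itv/= => /andP[q1 q2] /andP[p1 p2] /andP[r1 r2].
have zpq : `|z - (ratr p, ratr q)| <= e / 4.
  by rewrite prod_normE/= ge_max !ler_norml; apply/andP; split; lra.
exists p => //; exists q => //; exists r => //; rewrite /F.
case: asboolP => [_|[]]; first by apply: le_trans zpq _; lra.
move=> x; rewrite /Q/= => xpq; apply: He; rewrite -ball_normE /ball_/=.
rewrite -(subrK (ratr p, ratr q) z) -addrA; apply: le_lt_trans (ler_normD _ _) _.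
rewrite (distrC _ x); move: zpq xpq => /= H1 H2.
by apply: le_lt_trans (lerD H1 H2) _; lra.
Qed.

Lemma measurable_closed_plane (C : set pt) : closed C -> measurable C.
Proof. by move=> cC; rewrite -(setCK C); apply: measurableC; apply: measurable_open_plane; exact: closed_openC. Qed.

Lemma measurable_near (C : set pt) (e : R) : measurable [set z | exists2 y, C y & `|z - y| < e].
Proof.
apply: measurable_open_plane.
rewrite (_ : mkset _ = \bigcup_(y in C) [set z | `|z - y| < e]); last first.
  by apply/seteqP; split => z [y Cy H]; exists y.
apply: bigcup_open => y _.
rewrite (_ : mkset _ = ball y e); first exact: ball_open.
by apply/seteqP; split => z /=; rewrite -ball_normE /ball_/= distrC.
Qed.

Lemma measurable_enorm_le rho : measurable [set x : pt | enorm x <= rho].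
Proof.
have mf : measurable_fun [set: pt] (fun x : pt => x.1 ^+ 2 + x.2 ^+ 2).
  by apply: measurable_funD; apply: measurable_funX.
have me : measurable_fun [set: pt] (fun x : pt => enorm x).
  exact: (measurableT_comp (continuous_measurable_fun (@sqrt_continuous R)) mf).
rewrite (_ : mkset _ = [set: pt] `&` (fun x => enorm x) @^-1` `]-oo, rho]%classic).
  exact: me.
by apply/seteqP; split => x /=; rewrite in_itv/=; [|case].
Qed.

End plane_topology.

Section double_point_paths.
Context {R : realType}.
Notation pt := (R * R)%type.

(** A closed version of a separated double point: weak inequalities, a finite horizon [N], and
    confinement to the disk of radius [rho] in place of the exit time. Such conditions survive
    limits. *)
Definition dblpt (beta : R -> pt) (N rho gap : R) (x : pt) : Prop :=
  exists r s : R, [/\ 0 <= r, s <= N, r + gap <= s, beta r = x /\ beta s = x &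
    forall u, 0 <= u <= s -> enorm (beta u) <= rho].

(** Every condition of [dblpt] holds up to the tolerance [e]. Confinement is asked at some time
    within [e] of each [u], so that information at grid times or rational times suffices. *)
Definition approx_dblpt (beta : R -> pt) (N rho gap : R) (C : set pt) (e : R) (p : R * R) : Prop :=
  [/\ 0 <= p.1 <= N, 0 <= p.2 <= N, p.1 + gap <= p.2 + e,
     `|beta p.1 - beta p.2| <= e /\ (exists2 y, C y & `|beta p.1 - y| <= e) &
     forall u, 0 <= u <= p.2 - e -> exists u', [/\ 0 <= u', `|u - u'| <= e & enorm (beta u') <= rho]].

Variables (beta : R -> pt) (N rho gap : R).
Hypothesis cb : {within `[0, +oo[, continuous beta}.
Hypothesis gap0 : 0 < gap.

Lemma approx_dblptW C e e' p : e <= e' ->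
  approx_dblpt beta N rho gap C e p -> approx_dblpt beta N rho gap C e' p.
Proof.
move=> ee [h1 h2 h3 [h4 [y Cy h5]] h6]; split => //.
- by apply: le_trans h3 _; rewrite lerD2l.
- by split; [exact: le_trans h4 ee|exists y => //; exact: le_trans h5 ee].
- move=> u /andP[u0 us]; have [|u' [k1 k2 k3]] := h6 u.
    by rewrite u0/=; apply: le_trans us _; rewrite lerD2l lerN2.
  by exists u'; split => //; exact: le_trans k2 ee.
Qed.

(** The pairs of times of approximate double points have a cluster point in the compact square
    [0, N]^2 as the tolerance tends to 0; continuity of the path turns it into an exact double
    point. *)
Lemma dblpt_cluster (C : set pt) : closed C ->
  (forall e, 0 < e -> exists p, approx_dblpt beta N rho gap C e p) ->
  exists x, dblpt beta N rho gap x /\ C x.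
Proof.
move=> cC H; have g0 := gap0.
pose Q : set (R * R) := `[0, N]%classic `*` `[0, N]%classic.
have cQ : compact Q by apply: compact_setX; exact: segment_compact.
pose F := filter_from [set e : R | 0 < e] (fun e => [set p | approx_dblpt beta N rho gap C e p]).
have FF : ProperFilter F.
  apply: filter_from_proper; last by move=> e /H[p Hp]; exists p.
  apply: filter_from_filter; first by exists 1 => /=.
  move=> e e' /= e0 e'0; exists (Num.min e e'); first by rewrite /= lt_min e0.
  by move=> p /= Hp; split; apply: approx_dblptW Hp; rewrite ge_min lexx ?orbT.
have FQ : F Q.
  by exists 1 => //= p [/andP[a1 a2] /andP[b1 b2] _ _ _]; split; rewrite /= in_itv/= ?a1 ?b1.
have [[r s] [[/= r0N s0N] cl]] := cQ F FF FQ.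
move: r0N s0N; rewrite !in_itv/= => /andP[r0 rN] /andP[s0 sN].
have near e : 0 < e -> exists p, [/\ approx_dblpt beta N rho gap C e p, `|p.1 - r| < e & `|p.2 - s| < e].
  move=> e0; have Fe : F [set p | approx_dblpt beta N rho gap C e p] by exists e.
  have [p [Hp pb]] := cl _ _ Fe (nbhsx_ballx (r, s) e e0).
  by exists p; split => //; move: pb => -[/=]; rewrite /ball/= distrC // => ? ; rewrite distrC.
have close e : 0 < e -> exists p, [/\ approx_dblpt beta N rho gap C e p, `|p.1 - r| < e, `|p.2 - s| < e,
    `|beta p.1 - beta r| < e & `|beta p.2 - beta s| < e].
  move=> e0; have [a a0 Ha] := ray_continuousP cb r0 e0; have [b b0 Hb] := ray_continuousP cb s0 e0.
  have m0 : 0 < Num.min e (Num.min a b) by rewrite !lt_min e0 a0 b0.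
  have [p [Ap]] := near _ m0; rewrite !lt_min => /and3P[p1 p2 p3] /and3P[q1 q2 q3].
  have [/andP[p10 _] /andP[p20 _] _ _ _] := Ap.
  exists p; split => //; [|exact: Ha|exact: Hb].
  by apply: approx_dblptW Ap; rewrite ge_min lexx.
have rs : r + gap <= s.
  apply/ler_addgt0Pr => e e0; have e3 : 0 < e / 3 by lra.
  have [p [[_ _ h _ _] /dist_lt/andP[h1 _] /dist_lt/andP[_ h2] _ _]] := close _ e3.
  lra.
have brs : beta r = beta s.
  apply/eqP; rewrite -subr_eq0 -normr_le0; apply/ler_addgt0Pr => e e0; have e3 : 0 < e / 3 by lra.
  have [p [[_ _ _ [h _] _] _ _ h1 h2]] := close _ e3; rewrite add0r.
  have -> : beta r - beta s = (beta r - beta p.1) + ((beta p.1 - beta p.2) + (beta p.2 - beta s)).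
    by rewrite !addrA !subrK.
  apply: le_trans (ler_normD _ _) _; rewrite distrC.
  have := ler_normD (beta p.1 - beta p.2) (beta p.2 - beta s); move: h h1 h2.
  set a := `|_|; set b := `|_|; set c := `|_|; set f := `|_|; lra.
exists (beta r); split; last first.
  apply: cC => B /nbhs_ballP[e /= e0 HB]; have e3 : 0 < e / 3 by lra.
  have [p [[_ _ _ [_ [y Cy h]] _] _ _ h1 _]] := close _ e3.
  exists y; split => //; apply: HB; rewrite -ball_normE /ball_/=.
  rewrite -(subrK (beta p.1) (beta r)) -addrA; apply: le_lt_trans (ler_normD _ _) _.
  by move: h h1; rewrite (distrC (beta r)); set a := `|_|; set b := `|_|; lra.
exists r, s; split => // u /andP[u0 us].
apply/ler_addgt0Pr => e e0.
have [eta eta0 Heta] := ray_continuousP cb u0 (ltac:(lra) : 0 < e / 2).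
pose e1 := Num.min (eta / 4) (gap / 4).
have e10 : 0 < e1 by rewrite lt_min !divr_gt0.
have [e1a e1b] : e1 <= eta / 4 /\ e1 <= gap / 4 by split; rewrite ge_min lexx ?orbT.
have [p [[_ _ _ _ h] _ /dist_lt/andP[h2 _] _ _]] := close _ e10.
(* Approximate confinement is known only up to [p.2 - e1], and [p.2] may fall below [s] by [e1];
   hence [u] is moved back by [2 * e1]. *)
pose v := Num.max 0 (u - 2 * e1).
have v0 : 0 <= v by rewrite le_max lexx.
have [v1 v2] : u - 2 * e1 <= v /\ v <= u by split; [rewrite le_max lexx orbT|rewrite ge_max u0/=; lra].
have [|u' [u'0 uu' en]] := h v.
  rewrite v0/= ge_max; apply/andP; split; lra.
apply: le_trans (enorm_lip _ (beta u')) _.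
have : `|beta u' - beta u| < e / 2.
  apply: Heta => //; move: uu'; rewrite ler_distl => /andP[k1 k2].
  by rewrite ltr_distl; apply/andP; split; lra.
by rewrite distrC; move: en; set a := `|_|; lra.
Qed.

(** Double points near [x] are approximate double points for the target reduced to the single point
    [x], so [dblpt_cluster] yields one at [x] itself. *)
Lemma dblpt_closed (A : set pt) : closed A -> closed [set x | dblpt beta N rho gap x /\ A x].
Proof.
move=> cA x clx; have g0 := gap0; suff [y [Dy [Ay]]] : exists y, dblpt beta N rho gap y /\ (A `&` [set x]) y.
  by move=> xy; rewrite -[x]xy.
have cx : closed [set x] by exact/accessible_closed_set1/hausdorff_accessible/norm_hausdorff.
apply: dblpt_cluster; first exact: closedI.
move=> e e0; have [y [[Dy Ay] yx]] := clx _ (nbhsx_ballx x e e0).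
have Ax : A x by apply: cA => B /clx[z [[_ Az] Bz]]; exists z.
move: yx; rewrite -ball_normE/= => yx.
have [r [s [r0 sN rs [br bs] H]]] := Dy.
have [rN s0] : r <= N /\ 0 <= s by split; lra.
exists (r, s); split => /=; rewrite ?r0 ?rN ?s0 ?sN//; first lra.
- by rewrite br bs subrr normr0; split; [exact: ltW|exists x => //; rewrite distrC; exact: ltW].
- move=> u /andP[u0 us]; exists u; split => //; first by rewrite subrr normr0 ltW.
  by apply: H; rewrite u0/=; lra.
Qed.

End double_point_paths.

Section brownian.
Context {R : realType} {d} {T : measurableType d} {P : probability T R}.
Notation pt := (R * R)%type.

Definition bm_step (B : R -> T -> pt) (h : R) (i : nat) (w : T) : pt :=
  B (i.+1%:R * h) w - B (i%:R * h) w.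

Variables (x0 : pt) (B : R -> T -> pt).
Hypothesis bm : planar_brownian_motion P x0 B.

Lemma bm_wsum h j k w : (j <= k)%N -> wsum (bm_step B h) j k w = B (k%:R * h) w - B (j%:R * h) w.
Proof. by move=> jk; rewrite /wsum /bm_step telescope_sumr. Qed.

Lemma bm_wsum0 h k w : x0 + wsum (bm_step B h) 0 k w = B (k%:R * h) w.
Proof. by rewrite bm_wsum// mul0r (bm_start bm) addrC subrK. Qed.

Lemma bm_walk h : 0 < h -> gaussian_walk P h (bm_step B h).
Proof.
move=> h0; have hk (k : nat) : 0 <= k%:R * h by rewrite mulr_ge0// ltW.
split.
- by move=> i; apply: measurable_ptB; exact: (bm_measurable bm (hk _)).
- move=> n A mA; apply: (bm_independent bm n (t := fun i => i%:R * h)) => //.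
  by move=> i; rewrite ler_pM2r// ler_nat.
- move=> j k jk E mE.
  rewrite (_ : [set w | _] = [set w | E (B (k%:R * h) w - B (j%:R * h) w)]).
    have jkh : j%:R * h < k%:R * h by rewrite ltr_pM2r// ltr_nat.
    have -> : (k - j)%:R * h = k%:R * h - j%:R * h by rewrite (natrB _ (ltnW jk)) mulrBl.
    exact: (bm_gaussian bm (hk j) jkh mE).
  by apply/seteqP; split => w /=; rewrite -[\sum_(_ <= i < _) _]/(wsum _ _ _ _) bm_wsum// ltnW.
Qed.

Let cB w : {within `[0, +oo[, continuous (B ^~ w)}.
Proof. exact: (bm_continuous bm). Qed.

(** The uncountable quantifiers become countable: for every tolerance there is a pair of rational
    times forming an approximate double point. That this suffices is [dblpt_cluster]. *)
Lemma measurable_dblpt (N : nat) (rho gap : R) (C : set pt) : 0 < gap -> closed C ->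
  measurable [set w | exists x, dblpt (B ^~ w) N%:R rho gap x /\ C x].
Proof.
move=> gap0 cC.
pose e m : R := m.+1%:R^-1.
have e0 m : 0 < e m by rewrite invr_gt0 ltr0n.
pose G m (r s : R) := [set w | [/\ `|B r w - B s w| <= e m, exists2 y, C y & `|B r w - y| < e m &
   forall u : rat, 0 <= (ratr u : R) <= s - e m -> enorm (B (ratr u) w) <= rho]].
have mG m r s : 0 <= r -> 0 <= s -> measurable (G m r s).
  move=> r0 s0.
  rewrite (_ : G m r s = (B r \- B s) @^-1` [set z | `|z - 0| <= e m] `&` (B r @^-1` [set z | exists2 y, C y & `|z - y| < e m] `&`
    \bigcap_(u in [set: rat]) [set w | 0 <= (ratr u : R) <= s - e m -> enorm (B (ratr u) w) <= rho])); last first.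
    apply/seteqP; split => w /=.
      by move=> [h1 h2 h3]; rewrite subr0; split => //; split => // u _; exact: h3.
    by rewrite subr0 => -[h1 [h2 h3]]; split => // u; exact: h3.
  have mB t : 0 <= t -> measurable_fun setT (B t) by move=> t0; exact: (bm_measurable bm t0).
  apply: measurableI.
    rewrite -[X in measurable X]setTI; apply: (measurable_ptB (mB _ r0) (mB _ s0)) => //.
    exact: measurable_square.
  apply: measurableI.
    by rewrite -[X in measurable X]setTI; apply: mB => //; exact: measurable_near.
  rewrite -[X in measurable X]setCK; apply: measurableC; rewrite setC_bigcap.
  apply: bigcupT_measurable_rat => u.
  have [u0|nu] := pselect (0 <= (ratr u : R) <= s - e m); last first.
    by rewrite (_ : ~` _ = set0)//; apply/seteqP; split => w //=; apply.
  apply: measurableC; rewrite (_ : mkset _ = setT `&` B (ratr u) @^-1` [set x | enorm x <= rho]).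
    by apply: mB => //; [case/andP: u0|exact: measurable_enorm_le].
  by rewrite setTI; apply/seteqP; split => w //=; apply.
pose F m (q q' : rat) := if `[< [/\ 0 <= (ratr q : R) <= N%:R, 0 <= (ratr q' : R) <= N%:R & ratr q + gap <= ratr q' + e m] >]
  then G m (ratr q) (ratr q') else set0.
rewrite (_ : mkset _ = \bigcap_m \bigcup_q \bigcup_q' F m q q').
  apply: bigcap_measurable => // m _; apply: bigcupT_measurable_rat => q; apply: bigcupT_measurable_rat => q'.
  rewrite /F; case: asboolP => // -[/andP[? _] /andP[? _] _]; exact: mG.
apply/seteqP; split => w /=.
  move=> [x [[r [s [r0 sN rs [br bs] H]]] Cx]] m _.
  have em2 : 0 < e m / 2 by rewrite divr_gt0.
  have [rN s0] : r < N%:R /\ 0 < s by split; lra.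
  have [a a0 Ha] := ray_continuousP (@cB w) r0 em2.
  have [b b0 Hb] := ray_continuousP (@cB w) (ltW s0) em2.
  pose eta := Num.min (e m / 2) (Num.min a b).
  have eta0 : 0 < eta by rewrite !lt_min em2 a0 b0.
  have [et1 et2 et3] : [/\ eta <= e m / 2, eta <= a & eta <= b].
    by split; rewrite !ge_min lexx ?orbT.
  (* The rational times are taken to the right of [r] and to the left of [s]: both stay in [0, N],
     and confinement up to [s] covers all times needed. *)
  have [q] : exists q : rat, ratr q \in `]r, Num.min (r + eta) N%:R[.
    by apply: rat_in_itvoo; rewrite lt_min ltrDl eta0.
  have [q'] : exists q' : rat, ratr q' \in `]Num.max 0 (s - eta), s[.
    by apply: rat_in_itvoo; rewrite gt_max s0/=; lra.
  rewrite !in_itv/= gt_max lt_min => /andP[/andP[k1 k2] k3] /andP[l1 /andP[l2 l3]].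
  have q0 : 0 <= (ratr q : R) by apply: le_trans r0 (ltW l1).
  have h1 : `|B (ratr q) w - B r w| < e m / 2.
    by apply: Ha => //; rewrite ger0_norm ?subr_ge0 ?(ltW l1)//; lra.
  have h2 : `|B (ratr q') w - B s w| < e m / 2.
    by apply: Hb; [exact: ltW|rewrite ltr0_norm ?subr_lt0//; lra].
  exists q => //; exists q' => //; rewrite /F; case: asboolP => [_|[]]; last first.
    split; [by rewrite q0 ltW|by rewrite (ltW k1)/=; lra|lra].
  split.
  - rewrite -(subrK (B r w) (B (ratr q) w)) -addrA; apply: le_trans (ler_normD _ _) _.
    rewrite br -bs (distrC _ (B (ratr q') w)); move: h1 h2; rewrite br -bs.
    by set a' := `|_|; set b' := `|_|; lra.
  - by exists x => //; rewrite -br; lra.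
  - by move=> u /andP[u0 us]; apply: H; rewrite u0/=; move: (e0 m); lra.
move=> H; apply: (dblpt_cluster (@cB w) gap0 cC) => ep ep0.
pose m := Num.trunc ep^-1.
have em : e m <= ep.
  rewrite /e -[leRHS]invrK lef_pV2 ?posrE ?invr_gt0 ?ltr0n// ltW// truncnS_gt//.
have [q _ [q' _]] := H m I.
rewrite /F; case: asboolP => // -[Q1 Q2 Q3] [g1 [y Cy g2] g3].
exists (ratr q, ratr q'); apply: (approx_dblptW em); split => //=.
  by split => //; exists y => //; exact: ltW.
move=> u /andP[u0 us].
have [->|un0] := eqVneq u 0.
  exists 0; rewrite subrr normr0 (ltW (e0 m)); split => //.
  by have := g3 0; rewrite rmorph0; apply; rewrite lexx/=; exact: le_trans us.
have u0' : 0 < u by rewrite lt_neqAle eq_sym un0.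
have [p] : exists p : rat, ratr p \in `]Num.max 0 (u - e m), u[.
  by apply: rat_in_itvoo; rewrite gt_max u0'/=; move: (e0 m); lra.
rewrite in_itv/= gt_max => /andP[/andP[p1 p2] p3].
exists (ratr p); split; first exact: ltW.
  by rewrite ger0_norm; lra.
by apply: g3; rewrite (ltW p1)/=; lra.
Qed.

End brownian.

(** * Measurable selection from a random compact set *)

Section selection.
Context {R : realType} {d} {T : measurableType d}.
Notation pt := (R * R)%type.

(** By compactness the minimum is attained, so it is at most [t] exactly when [K w] meets the closed
    set of the points of [C] with [f x <= t]; such hitting events are measurable by hypothesis. *)
Lemma min_coord_measurable (K : T -> set pt) (f : pt -> R) :
  continuous f -> (forall w, compact (K w)) ->
  (forall C, closed C -> measurable [set w | exists x, K w x /\ C x]) ->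
  forall C, closed C -> measurable_fun setT (fun w => inf (f @` (K w `&` C))) /\
   forall w x, K w x -> C x -> inf (f @` (K w `&` C)) <= f x /\
     exists y, [/\ K w y, C y & f y = inf (f @` (K w `&` C))].
Proof.
move=> cf cK mK C cC.
have cKC w : compact (K w `&` C) by apply: compact_closedI.
have attained w x : K w x -> C x -> inf (f @` (K w `&` C)) <= f x /\
     exists y, [/\ K w y, C y & f y = inf (f @` (K w `&` C))].
  move=> Kx Cx.
  have KC0 : (K w `&` C) !=set0 by exists x.
  have [y /set_mem[Ky Cy] Hy] := compact_EVT_min KC0 (cKC w) (continuous_subspaceT cf).
  have E : inf (f @` (K w `&` C)) = f y.
    apply/eqP; rewrite eq_le; apply/andP; split.
      apply: ge_inf; last by exists y.
      by exists (f y) => _ [z Kz <-]; apply: Hy; exact/mem_set.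
    apply: lb_le_inf; first by exists (f y), y.
    by move=> _ [z Kz <-]; apply: Hy; exact/mem_set.
  by rewrite E; split; [apply: Hy; exact/mem_set|exists y].
split => // mT; apply: (measurability _ (RGenOInfty.measurableE R)) => // _ [_ [t ->] <-].
rewrite setTI -[X in measurable X]setCK; apply: measurableC.
have cCt : closed (C `&` [set x | f x <= t]).
  apply: closedI => //; apply: (@closed_comp _ _ f [set x | x <= t]); last exact: closed_le.
  by move=> x _; exact: cf.
(* The second set accounts for the value 0 that [inf] takes on the empty set. *)
rewrite (_ : ~` _ = [set w | exists x, K w x /\ (C `&` [set x | f x <= t]) x] `|`
   (~` [set w | exists x, K w x /\ C x] `&` [set w | 0 <= t])).
  apply: measurableU; first exact: mK.
  apply: measurableI; first by apply: measurableC; exact: mK.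
  by case: (0 <= t); rewrite ?set_true ?set_false.
apply/seteqP; split => w /=; rewrite in_itv/= andbT.
  move=> /negP; rewrite -leNgt => it.
  have [[x [Kx Cx]]|nK] := pselect (exists x, K w x /\ C x).
    by left; have [_ [y [Ky Cy yE]]] := attained _ _ Kx Cx; exists y; do !split => //; rewrite /= yE.
  right; split => //; move: it; rewrite (_ : _ `&` _ = set0) ?image_set0 ?inf0//.
  by apply/seteqP; split => x // [Kx Cx]; apply: nK; exists x.
move=> [[x [Kx [Cx xt]]]|[nK t0]]; apply/negP; rewrite -leNgt.
  by have [+ _] := attained _ _ Kx Cx; move/le_trans; apply.
rewrite (_ : _ `&` _ = set0) ?image_set0 ?inf0//.
by apply/seteqP; split => x // [Kx Cx]; apply: nK; exists x.
Qed.

(* X w is the lexicographically smallest point of K w. *)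
Lemma measurable_selection (K : T -> set pt) : (forall w, compact (K w)) ->
  (forall C, closed C -> measurable [set w | exists x, K w x /\ C x]) ->
  exists2 X : T -> pt, measurable_fun setT X & forall w, K w !=set0 -> K w (X w).
Proof.
move=> cK mK.
have c1 : continuous (fst : pt -> R) by move=> x; exact: cvg_fst.
have c2 : continuous (snd : pt -> R) by move=> x; exact: cvg_snd.
have H1 := min_coord_measurable c1 cK mK.
pose m1 C w := inf (fst @` (K w `&` C)).
pose K' w := K w `&` [set x | x.1 = m1 setT w].
have [mm1 att1] := H1 _ closedT.
have K'0 w : K w !=set0 -> K' w !=set0.
  by move=> [x Kx]; have [_ [y [Ky _ yE]]] := att1 _ _ Kx I; exists y.
have cl1 a : closed [set x : pt | x.1 = a].
  rewrite (_ : mkset _ = fst @^-1` [set a])//; apply: closed_comp => [x _|]; first exact: c1.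
  exact/accessible_closed_set1/hausdorff_accessible/Rhausdorff.
have cK' w : compact (K' w) by apply: compact_closedI.
(* The minimisers of the first coordinate meet [C] exactly when [K w] meets [C] and the minimum over
   [K w] and [C] together equals the minimum over [K w]. *)
have mK' C : closed C -> measurable [set w | exists x, K' w x /\ C x].
  move=> cC; have [mC attC] := H1 _ cC.
  rewrite (_ : mkset _ = [set w | exists x, K w x /\ C x] `&` [set w | m1 C w = m1 setT w]).
    apply: measurableI; first exact: mK.
    have := measurable_funB mC mm1; move=> /(_ measurableT [set 0] (measurable_set1 _)).
    rewrite setTI (_ : _ @^-1` _ = [set w | m1 C w = m1 setT w])//; apply/seteqP; split => w /=.
      by move/eqP; rewrite subr_eq0 => /eqP.
    by move/eqP; rewrite -subr_eq0 => /eqP.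
  apply/seteqP; split => w /=.
    move=> [x [[Kx x1] Cx]]; split; first by exists x.
    have [le1 [y [Ky Cy yE]]] := attC _ _ Kx Cx; have [le2 _] := att1 _ _ Ky I.
    apply/eqP; rewrite eq_le; apply/andP; split; first by rewrite -x1.
    by move: le2; rewrite yE.
  move=> [[x [Kx Cx]] E]; have [_ [y [Ky Cy yE]]] := attC _ _ Kx Cx.
  by exists y; split => //; split => //=; rewrite yE -E.
have [mm2 att2] := min_coord_measurable c2 cK' mK' closedT.
exists (fun w => (m1 setT w, inf (snd @` (K' w `&` setT)))); first exact: measurable_fun_pair.
move=> w /K'0[x K'x]; have [_ [y [[Ky y1] _ yE]]] := att2 _ _ K'x I.
by rewrite -y1 -yE -surjective_pairing.
Qed.

End selection.

(** * Second moment of the number of near double points *)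

Lemma le_absorb (R : realType) (A B E C V D : R) :
  A + (B + E) <= C + V + D -> V <= E -> A + B <= C + D.
Proof. by move=> *; lra. Qed.

Section chains.
Context {R : realType} {d} {T : measurableType d} {P : probability T R}.
Context {h : R} {xi : nat -> T -> R * R}.
Hypothesis (h0 : 0 < h) (gw : gaussian_walk P h xi).
Notation pt := (R * R)%type.

Variables (x0 : pt) (r : R) (J : nat).
Hypotheses (r0 : 0 < r) (hr : h <= r ^+ 2) (Jh : J%:R * h <= 2).

Definition vis k (y : pt) (w : T) : R := ind R (`|x0 + wsum xi 0 k w - y| <= r).

Lemma vis_past k l y : (k <= l)%N -> bmf (vis k y : past xi l -> R).
Proof.
move=> kl; apply: bmf_ptclose; apply: measurable_ptB => //; apply: measurable_ptD => //.
by apply: sg_wsum => i /andP[_ ik]; exact: leq_trans ik kl.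
Qed.

Lemma bmf_vis k y : bmf (vis k y).
Proof. exact: (sg_bmf gw (vis_past y (leqnn k))). Qed.

Lemma vis_ge0 k y w : 0 <= vis k y w.
Proof. by rewrite /vis /ind. Qed.

Lemma markov_vis k l (H : T -> R) y : (k <= l)%N -> bmf (H : past xi k -> R) ->
  Ex P (fun w => H w * vis l y w) =
  Ex P (fun w => H w * hitp P xi r (l - k) (y - (x0 + wsum xi 0 k w))).
Proof.
move=> kl bH; have mc : measurable_fun [set: past xi k] ((fun=> x0) : past xi k -> pt) by exact: measurable_cst.
exact: (@markov_hit _ _ _ _ _ _ gw r k l H (fun=> x0) y kl bH mc).
Qed.

Lemma bmf_hitp_walk j k y : bmf (fun w => hitp P xi r j (y - (x0 + wsum xi 0 k w))).
Proof.
by apply: (bmf_hitp gw); apply: measurable_ptB => //; apply: measurable_ptD => //; exact: (wsum_measurable gw).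
Qed.

(** Price [U] of passing from [z] at time [k] to [z'] at any later time [l] allowed by [c], whatever
    the past. Moments of several visits are obtained by multiplying such prices. *)
Definition step_bound (c : nat -> nat -> bool) (z z' : pt) (U : R) :=
  forall k (H : T -> R), (k < J)%N -> bmf (H : past xi k -> R) ->
  \sum_(l < J) h * (ind R (c k l) * Ex P (fun w => H w * vis k z w * vis l z' w)) <=
  U * Ex P (fun w => H w * vis k z w).

Variables (C : R).
Hypothesis C0 : 0 < C.
Hypothesis HC : forall c n, n%:R * h <= 2 * 1 ^+ 2 ->
     \sum_(0 <= j < n) h * hitp P xi r j c <= C * r ^+ 2 * Lam 1 r `|c|.

Let C' := C * (1 + ln 2).

Lemma step_any z z' : step_bound leq z z' (C' * r ^+ 2 * Lam 1 r `|z - z'|).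
Proof.
move=> k H kJ bH.
have bHv : bmf ((fun w => H w * vis k z w) : past xi k -> R) by apply: bmfM => //; exact: vis_past.
have bHv' := sg_bmf gw bHv.
have bt j : bmf (fun w => h * hitp P xi r j (z' - (x0 + wsum xi 0 k w))).
  by apply: bmfM; [apply: bmf_cst; exact: ltW|exact: bmf_hitp_walk].
apply: (@le_trans _ _ (\sum_(k <= l < J) h * Ex P (fun w => H w * vis k z w * vis l z' w))).
  rewrite -(big_mkord xpredT (fun l => h * (ind R (k <= l)%N * Ex P (fun w => H w * vis k z w * vis l z' w)))).
  rewrite (big_cat_nat (n := k))//=; last exact: ltnW.
  rewrite [X in X + _]big_nat_cond big1 ?add0r; last first.
    by move=> i /andP[/andP[_ ik] _]; rewrite leqNgt ik /ind mul0r mulr0.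
  rewrite big_nat_cond [leRHS]big_nat_cond; apply: ler_sum => l /andP[/andP[kl _] _].
  by rewrite kl /ind mul1r.
rewrite (_ : \sum_(k <= l < J) _ = Ex P (fun w => H w * vis k z w *
    \sum_(0 <= j < J - k) h * hitp P xi r j (z' - (x0 + wsum xi 0 k w)))); last first.
  transitivity (Ex P (fun w => \sum_(0 <= j < J - k) H w * vis k z w * (h * hitp P xi r j (z' - (x0 + wsum xi 0 k w))))).
    rewrite Ex_sum; last by move=> j _; apply: bmfM.
    rewrite -(sum_shift0 (fun j => Ex P (fun w => H w * vis k z w * (h * hitp P xi r j (z' - (x0 + wsum xi 0 k w)))))).
    rewrite big_nat_cond [RHS]big_nat_cond; apply: eq_bigr => l /andP[/andP[kl _] _].
    rewrite (markov_vis _ kl bHv) -ExZ ?(ltW h0)//; first by apply: Ex_eq => w; rewrite mulrCA.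
    by apply: bmfM => //; exact: bmf_hitp_walk.
  by apply: Ex_eq => w; rewrite mulr_sumr.
have U0 : 0 <= C' * r ^+ 2 * Lam 1 r `|z - z'|.
  rewrite mulr_ge0 ?Lam_ge0// mulr_ge0 ?sqr_ge0// mulr_ge0 ?(ltW C0)//.
  by rewrite addr_ge0// ln_ge0// ler1n.
rewrite -ExZ//; apply: Ex_le.
- by apply: bmfM => //; apply: bmf_sum.
- by apply: bmfM => //; exact: bmf_cst.
move=> w; have [kz|kz] := boolP (`|x0 + wsum xi 0 k w - z| <= r); last first.
  by rewrite /vis (negbTE kz) /ind mulr0 mul0r mulr0.
rewrite mulrC; apply: ler_wpM2r; first exact: (bmf_ge0 w bHv').
apply: le_trans (HC _ _) _.
  by rewrite expr1n mulr1; apply: le_trans Jh; rewrite ler_pM2r// ler_nat leq_subr.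
rewrite (_ : C' * r ^+ 2 * _ = C * r ^+ 2 * ((1 + ln 2) * Lam 1 r `|z - z'|)); last by rewrite /C'; ring.
rewrite ler_pM2l ?mulr_gt0 ?exprn_gt0//.
apply: Lam_scale => //; first by rewrite ler1n.
rewrite mul1r mulr1 ge_max; apply/andP; split; last first.
  by apply: (@le_trans _ _ (2 * r)); [move: (r0); lra|rewrite ler_pM2l// le_max lexx orbT].
set S := x0 + _ in kz *.
have -> : z - z' = - ((S - z) + (z' - S)) by rewrite (addrC (S - z)) addrA subrK opprB.
rewrite normrN; apply: le_trans (ler_normD _ _) _.
have : `|z' - S| <= Num.max `|z' - S| r by rewrite le_max lexx.
have : r <= Num.max `|z' - S| r by rewrite le_max lexx orbT.
by move: kz; set a := `|_|; set b := `|_|; set m := Num.max _ _; lra.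
Qed.

(** After [g] steps the peak bound r^2 / (j h) is used irrespective of the distance: the price is
    the logarithm of [J / g] and not a kernel. *)
Lemma step_gap g z z' : (0 < g)%N -> (g <= J)%N ->
  step_bound (fun k l => k + g <= l)%N z z' (r ^+ 2 * (1 + ln (J%:R / g%:R))).
Proof.
move=> g0 gJ k H kJ bH.
have bHv : bmf ((fun w => H w * vis k z w) : past xi k -> R) by apply: bmfM => //; exact: vis_past.
have bHv' := sg_bmf gw bHv; have E0 := Ex_ge0 P bHv'.
have r20 : 0 < r ^+ 2 by exact: exprn_gt0.
have term l : (k + g <= l)%N -> h * Ex P (fun w => H w * vis k z w * vis l z' w) <=
    r ^+ 2 * Ex P (fun w => H w * vis k z w) * ((l - k)%:R)^-1.
  move=> kgl; have kl : (k <= l)%N by apply: leq_trans kgl; exact: leq_addr.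
  have lk0 : (0 < l - k)%N by rewrite subn_gt0; apply: leq_trans kgl; rewrite -addn1 leq_add2l.
  have lkR : 0 < (l - k)%:R :> R by rewrite ltr0n.
  rewrite (markov_vis _ kl bHv).
  apply: (@le_trans _ _ (h * (r ^+ 2 / ((l - k)%:R * h) * Ex P (fun w => H w * vis k z w)))).
    rewrite ler_pM2l// -ExZ//; last by rewrite divr_ge0 ?(ltW r20)// mulr_ge0 ?ltW.
    apply: Ex_le; [by apply: bmfM => //; exact: bmf_hitp_walk|by apply: bmfM => //; apply: bmf_cst; rewrite divr_ge0 ?(ltW r20)// mulr_ge0 ?ltW|].
    move=> w; rewrite mulrC; apply: ler_wpM2r; first exact: (bmf_ge0 w bHv').
    exact: hitp_le.
  by rewrite le_eqVlt; apply/orP; left; apply/eqP; field; rewrite !gt_eqF.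
apply: (@le_trans _ _ (\sum_(g <= j < J) r ^+ 2 * Ex P (fun w => H w * vis k z w) * (j%:R)^-1)); last first.
  rewrite -mulr_sumr (mulrAC (r ^+ 2)) -mulrA [leLHS]mulrC -mulrA mulrA (mulrC _ (r ^+ 2)).
  rewrite -[leRHS]mulrA ler_pM2l// ler_wpM2r//.
  apply: le_trans (harmonic_le g0 gJ) _; rewrite lerD2r invf_le1 ?ltr0n//.
  by rewrite ler1n.
rewrite -(big_mkord xpredT (fun l => h * (ind R (k + g <= l)%N * Ex P (fun w => H w * vis k z w * vis l z' w)))).
have [kgJ|Jkg] := leqP (k + g) J; last first.
  rewrite big_nat_cond big1 ?sumr_ge0//.
    by move=> j _; rewrite mulr_ge0// mulr_ge0// ltW.
  by move=> l /andP[/andP[_ lJ] _]; rewrite leqNgt (ltn_trans lJ Jkg)/= /ind mul0r mulr0.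
rewrite (big_cat_nat (n := (k + g)%N))//= [X in X + _]big_nat_cond big1 ?add0r; last first.
  by move=> l /andP[/andP[_ lk] _]; rewrite leqNgt lk /ind mul0r mulr0.
apply: (@le_trans _ _ (\sum_(k + g <= l < J) r ^+ 2 * Ex P (fun w => H w * vis k z w) * ((l - k)%:R)^-1)).
  rewrite big_nat_cond [leRHS]big_nat_cond; apply: ler_sum => l /andP[/andP[kl _] _].
  by rewrite kl /ind mul1r; exact: term.
rewrite -{1}(addnC g) big_addn.
under eq_bigr do rewrite addnK.
rewrite [leRHS](big_cat_nat (n := (J - k)%N))//=; last first.
- exact: leq_subr.
- by rewrite leq_subRL ?(ltnW kJ).
by rewrite lerDl sumr_ge0// => j _; rewrite mulr_ge0// mulr_ge0// ltW.
Qed.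

Definition S4 (F : nat -> nat -> nat -> nat -> R) : R :=
  \sum_(a < J) \sum_(b < J) \sum_(c < J) \sum_(e < J) F a b c e.

Lemma S4_swap12 F : S4 F = S4 (fun a b c e => F b a c e).
Proof. exact: exchange_big. Qed.

Lemma S4_swap23 F : S4 F = S4 (fun a b c e => F a c b e).
Proof. by apply: eq_bigr => a _; exact: exchange_big. Qed.

Lemma S4_swap34 F : S4 F = S4 (fun a b c e => F a b e c).
Proof. by do 2!apply: eq_bigr => ? _; exact: exchange_big. Qed.

Lemma S4D F G : S4 (fun a b c e => F a b c e + G a b c e) = S4 F + S4 G.
Proof.
rewrite /S4 -big_split; apply: eq_bigr => a _; rewrite -big_split; apply: eq_bigr => b _.
by rewrite -big_split; apply: eq_bigr => c _; rewrite -big_split.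
Qed.

Lemma S4_le F G : (forall a b c e, F a b c e <= G a b c e) -> S4 F <= S4 G.
Proof. by move=> FG; do 4!apply: ler_sum => ? _. Qed.

Definition vis4 z1 z2 z3 z4 k1 k2 k3 k4 : R :=
  Ex P (fun w => 1 * vis k1 z1 w * vis k2 z2 w * vis k3 z3 w * vis k4 z4 w).

Lemma indM (a b : bool) : ind R (a && b) = ind R a * ind R b.
Proof. by rewrite /ind; case: a; rewrite ?mul1r ?mul0r. Qed.

(** The times are summed out from the last to the first. The first visit is not summed as a Green
    function: since [t0 <= k1], each [k1] contributes at most [r ^+ 2 / t0]. *)
Lemma chain4 t0 (c1 c2 c3 : nat -> nat -> bool) z1 z2 z3 z4 U1 U2 U3 : (0 < t0)%N ->
  (forall k l, c1 k l -> (k <= l)%N) -> (forall k l, c2 k l -> (k <= l)%N) ->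
  0 <= U1 -> 0 <= U2 -> 0 <= U3 ->
  step_bound c1 z1 z2 U1 -> step_bound c2 z2 z3 U2 -> step_bound c3 z3 z4 U3 ->
  h ^+ 4 * S4 (fun k1 k2 k3 k4 => ind R [&& t0 <= k1, c1 k1 k2, c2 k2 k3 & c3 k3 k4]%N *
     vis4 z1 z2 z3 z4 k1 k2 k3 k4) <= U3 * U2 * U1 * (r ^+ 2 * (J%:R / t0%:R)).
Proof.
move=> t00 c1le c2le U10 U20 U30 H1 H2 H3.
have i0 (b : bool) : 0 <= ind R b by [].
pose A3 k1 k2 k3 := Ex P (fun w => 1 * vis k1 z1 w * vis k2 z2 w * vis k3 z3 w).
pose A2 k1 k2 := Ex P (fun w => 1 * vis k1 z1 w * vis k2 z2 w).
pose A1 k1 := Ex P (fun w => 1 * vis k1 z1 w).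
have bone k : bmf ((fun=> 1) : past xi k -> R) by exact: bmf_cst.
have st3 (k1 k2 k3 : 'I_J) : ind R (c1 k1 k2 && c2 k2 k3) * \sum_(k4 < J) h * (ind R (c3 k3 k4) * vis4 z1 z2 z3 z4 k1 k2 k3 k4) <=
    ind R (c1 k1 k2 && c2 k2 k3) * (U3 * A3 k1 k2 k3).
  have [/andP[k12 k23]|_] := boolP (_ && _); last by rewrite /ind !mul0r.
  rewrite ler_wpM2l//; apply: (H3 k3 (fun w => 1 * vis k1 z1 w * vis k2 z2 w)) => //.
  by apply: bmfM; [apply: bmfM => //|]; apply: vis_past; [apply: leq_trans (c1le _ _ k12) _|]; exact: c2le.
have st2 (k1 k2 : 'I_J) : ind R (c1 k1 k2) * \sum_(k3 < J) h * (ind R (c2 k2 k3) * A3 k1 k2 k3) <=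
    ind R (c1 k1 k2) * (U2 * A2 k1 k2).
  have [k12|_] := boolP (c1 _ _); last by rewrite /ind !mul0r.
  rewrite ler_wpM2l//; apply: (H2 k2 (fun w => 1 * vis k1 z1 w)) => //.
  by apply: bmfM => //; apply: vis_past; exact: c1le.
have st1 (k1 : 'I_J) : \sum_(k2 < J) h * (ind R (c1 k1 k2) * A2 k1 k2) <= U1 * A1 k1 by exact: H1.
have st0 (k1 : 'I_J) : ind R (t0 <= k1)%N * (h * A1 k1) <= r ^+ 2 / t0%:R.
  have r20 : 0 < r ^+ 2 by exact: exprn_gt0.
  have [tk|_] := leqP t0 k1; last by rewrite /ind mul0r divr_ge0// ltW.
  rewrite /ind mul1r /A1 (markov_vis _ (leq0n k1) (bone 0%N)).
  rewrite (_ : Ex P _ = Ex P (fun=> hitp P xi r k1 (z1 - x0))); last first.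
    by apply: Ex_eq => w; rewrite mul1r subn0 /wsum big_geq// addr0.
  have k10 : (0 < k1)%N by exact: leq_trans tk.
  have k1R : 0 < k1%:R :> R by rewrite ltr0n.
  rewrite Ex_cst; apply: le_trans (ler_wpM2l (ltW h0) (hitp_le h0 gw _ k10 r0)) _.
  rewrite (_ : h * _ = r ^+ 2 / k1%:R); last by field; rewrite !gt_eqF.
  by rewrite ler_pM2l// lef_pV2 ?posrE ?ltr0n// ler_nat.
rewrite [leLHS](_ : _ = \sum_(k1 < J) ind R (t0 <= k1)%N * (h * \sum_(k2 < J) h * \sum_(k3 < J) h *
   (ind R (c1 k1 k2 && c2 k2 k3) * \sum_(k4 < J) h * (ind R (c3 k3 k4) * vis4 z1 z2 z3 z4 k1 k2 k3 k4)))); last first.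
  rewrite /S4 mulr_sumr; apply: eq_bigr => k1 _; rewrite !mulr_sumr; apply: eq_bigr => k2 _.
  rewrite !mulr_sumr; apply: eq_bigr => k3 _; rewrite !mulr_sumr; apply: eq_bigr => k4 _.
  by rewrite !indM; ring.
apply: (@le_trans _ _ (\sum_(k1 < J) U3 * U2 * U1 * (r ^+ 2 / t0%:R))); last first.
  by rewrite sumr_const card_ord -[_ *+ _]mulr_natr le_eqVlt; apply/orP; left; apply/eqP; ring.
apply: ler_sum => k1 _.
apply: (@le_trans _ _ (ind R (t0 <= k1)%N * (h * (U3 * (U2 * (U1 * A1 k1)))))); last first.
  have := ler_wpM2l (mulr_ge0 (mulr_ge0 U30 U20) U10) (st0 k1).
  by apply: le_trans; rewrite le_eqVlt; apply/orP; left; apply/eqP; ring.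
rewrite ler_wpM2l// ler_pM2l//.
apply: (@le_trans _ _ (U3 * (U2 * \sum_(k2 < J) h * (ind R (c1 k1 k2) * A2 k1 k2)))); last first.
  by do 2!rewrite ler_wpM2l//.
rewrite !mulr_sumr; apply: ler_sum => k2 _.
apply: (@le_trans _ _ (U3 * (h * (ind R (c1 k1 k2) * \sum_(k3 < J) h * (ind R (c2 k2 k3) * A3 k1 k2 k3))))); last first.
  rewrite ler_wpM2l// [leRHS]mulrCA ler_pM2l//; apply: le_trans (st2 k1 k2) _.
  by rewrite mulrCA.
rewrite mulrCA ler_pM2l// mulrCA mulr_sumr mulr_sumr; apply: ler_sum => k3 _.
have := st3 k1 k2 k3; rewrite indM => /(ler_wpM2l (ltW h0)) H.
apply: le_trans H _.
by rewrite le_eqVlt; apply/orP; left; apply/eqP; ring.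
Qed.

(** The max-norm square of radius 2 has Euclidean radius below 29/10 ([dblpt_escape]). The margin up
    to 3 keeps the limiting path strictly before its exit time. *)
Definition alive (n : nat) (w : T) : R := \prod_(k < n.+1) ind R (`|x0 + wsum xi 0 k w| <= 2).

Lemma alive_past n : bmf (alive n : past xi n -> R).
Proof.
have bl k : (k <= n)%N -> bmf ((fun w => ind R (`|x0 + wsum xi 0 k w| <= 2)) : past xi n -> R).
  move=> kn; apply: bmf_ptclose; apply: measurable_ptD => //.
  by apply: sg_wsum => i /andP[_ ik]; exact: leq_trans ik kn.
suff H m : (m <= n.+1)%N -> bmf ((fun w => \prod_(k < m) ind R (`|x0 + wsum xi 0 k w| <= 2)) : past xi n -> R) by exact: H.
elim: m => [|m ih] mn.
  by apply: (@bmf_eq R _ (past xi n) (fun=> 1)); [move=> w; rewrite big_ord0|exact: bmf_cst].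
apply: (@bmf_eq R _ (past xi n) (fun w => \prod_(k < m) ind R (`|x0 + wsum xi 0 k w| <= 2) * ind R (`|x0 + wsum xi 0 m w| <= 2))).
  by move=> w; rewrite big_ord_recr.
by apply: bmfM; [apply: ih; exact: ltnW|exact: bl].
Qed.

Lemma bmf_alive n : bmf (alive n).
Proof. exact: (sg_bmf gw (alive_past n)). Qed.

Lemma aliveS n w : alive n.+1 w = alive n w * ind R (`|x0 + wsum xi 0 n.+1 w| <= 2).
Proof. by rewrite /alive big_ord_recr. Qed.

Lemma alive01 n w : alive n w = 0 \/ alive n w = 1.
Proof.
rewrite /alive; elim: n.+1 => [|m ih]; first by right; rewrite big_ord0.
by rewrite big_ord_recr/= /ind; case: ih => ->; rewrite ?mul0r ?mul1r; [left|case: (_ <= 2); [right|left]].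
Qed.

Lemma alive_le1 n w : alive n w <= 1.
Proof. by case: (alive01 n w) => ->. Qed.

Lemma alive_all n w : alive n w != 0 -> forall k, (k <= n)%N -> `|x0 + wsum xi 0 k w| <= 2.
Proof.
elim: n => [|n ih].
  rewrite /alive big_ord1/= => H k; rewrite leqn0 => /eqP ->.
  by apply: contraR H => /negbTE ->.
rewrite aliveS mulf_eq0 negb_or => /andP[/ih{}ih H] k; rewrite leq_eqVlt => /predU1P[->|/ih//].
by apply: contraR H => /negbTE ->.
Qed.

(** A discretised double time integral. The bound [t0] stays away from time 0, where the walk has no
    density; [t1] and [t2] keep the times in the range where killing is a minor loss. *)
Definition visits t0 t1 g t2 (y : pt) (w : T) : R := h ^+ 2 * \sum_(i < J) \sum_(j < J)
   ind R [&& t0 <= i <= t1, i + g <= j & j <= i + t2]%N * (vis i y w * vis j y w * alive j w).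

Lemma bmf_visits t0 t1 g t2 y : bmf (visits t0 t1 g t2 y).
Proof.
apply: bmfM; first by apply: bmf_cst; rewrite exprn_ge0// ltW.
apply: bmf_sum => i _; apply: bmf_sum => j _; apply: bmfM; first exact: bmf_cst.
by apply: bmfM; [apply: bmfM; exact: bmf_vis|exact: bmf_alive].
Qed.

Lemma S4_Ex (c : nat -> nat -> nat -> nat -> bool) (F : nat -> nat -> nat -> nat -> T -> R) :
  (forall i j k l, bmf (F i j k l)) ->
  Ex P (fun w => S4 (fun i j k l => ind R (c i j k l) * F i j k l w)) =
  S4 (fun i j k l => ind R (c i j k l) * Ex P (F i j k l)).
Proof.
move=> bF; have b4 i j k l : bmf (fun w => ind R (c i j k l) * F i j k l w).
  by apply: bmfM => //; exact: bmf_cst.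
have b3 i j k : bmf (fun w => \sum_(l < J) ind R (c i j k l) * F i j k l w) by exact: bmf_sum.
have b2 i j : bmf (fun w => \sum_(k < J) \sum_(l < J) ind R (c i j k l) * F i j k l w) by exact: bmf_sum.
have b1 i : bmf (fun w => \sum_(j < J) \sum_(k < J) \sum_(l < J) ind R (c i j k l) * F i j k l w) by exact: bmf_sum.
rewrite Ex_sum//; apply: eq_bigr => i _; rewrite Ex_sum//; apply: eq_bigr => j _.
rewrite Ex_sum//; apply: eq_bigr => k _; rewrite Ex_sum//; apply: eq_bigr => l _.
by rewrite ExZ.
Qed.

Lemma ind_or (a b : bool) : ind R (a || b) <= ind R a + ind R b.
Proof. by case: a; case: b; rewrite /ind/= ?addr0 ?add0r// lerDl. Qed.

Definition Ustep (y y' : pt) : R := C' * r ^+ 2 * Lam 1 r `|y - y'|.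
Definition Vstep g' : R := r ^+ 2 * (1 + ln (J%:R / g'%:R)).

(* The four interleavings of a pair of times (i, j) with a pair (i', j') when i
   comes first; the last index of each alternative is the position of a gap. *)
Lemma pair_cover (t0 g g' i j i' j' : nat) : (t0 <= i)%N -> (i + g <= j)%N -> (i' + g <= j')%N ->
  (2 * g' <= g)%N -> (i <= i')%N ->
  [|| [&& t0 <= i, i + g' <= j, j <= i' & i' + g' <= j'],
      [&& t0 <= i, i + g' <= i', i' <= j & j <= j'],
      [&& t0 <= i, i <= i', i' + g' <= j & j <= j'] |
      [&& t0 <= i, i <= i', i' + g' <= j' & j' <= j]]%N.
Proof. by move=> *; lia. Qed.

(** Why [g'] is half of [g]: when [i'] falls between [i] and [j], it cuts an interval of length at
    least [g], and one of the two pieces is at least [g']. Disjoint pairs keep both gaps, giving V U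
    V; every other interleaving keeps at least one, giving U U V. *)
Lemma visits_half t0 g g' y y' : (0 < t0)%N -> (0 < g')%N -> (g' <= J)%N -> (2 * g' <= g)%N ->
  h ^+ 4 * S4 (fun i j i' j' => ind R [&& t0 <= i, i + g <= j, i' + g <= j' & i <= i']%N *
     vis4 y y y' y' i j i' j') <= (Vstep g' * Ustep y y' * Vstep g' + 3 * (Ustep y y' * Ustep y y' * Vstep g')) * (r ^+ 2 * (J%:R / t0%:R)).
Proof.
move=> t00 g0 gJ gg; set U := Ustep _ _; set V := Vstep _.
have JgR : 0 <= ln (J%:R / g'%:R) :> R.
  by rewrite ln_ge0// ler_pdivlMr ?ltr0n// mul1r ler_nat.
have C'0 : 0 <= C' by rewrite mulr_ge0 ?(ltW C0)// addr_ge0// ln_ge0// ler1n.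
have V0 : 0 <= V by rewrite mulr_ge0 ?sqr_ge0// addr_ge0.
have U0 : 0 <= U by rewrite mulr_ge0 ?Lam_ge0// mulr_ge0 ?sqr_ge0.
have v40 z1 z2 z3 z4 a b c e : 0 <= vis4 z1 z2 z3 z4 a b c e.
  apply: Ex_ge0; do 4!(apply: bmfM; last exact: bmf_vis); exact: bmf_cst.
have sgap z z' : step_bound (fun k l => k + g' <= l)%N z z' V by exact: step_gap.
have sany : step_bound leq y y' U by exact: step_any.
have sany' : step_bound leq y' y U by rewrite /U /Ustep distrC; exact: step_any.
have ge k l : (k + g' <= l -> k <= l)%N by apply: leq_trans; exact: leq_addr.
have cA := chain4 t00 ge (fun k l (H : (k <= l)%N) => H) V0 U0 V0 (sgap y y) sany (sgap y' y').
have cB1 := chain4 t00 ge (fun k l (H : (k <= l)%N) => H) V0 U0 U0 (sgap y y') sany' sany.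
have cB2 := chain4 t00 (fun k l (H : (k <= l)%N) => H) ge U0 V0 U0 sany (sgap y' y) sany.
have cC := chain4 t00 (fun k l (H : (k <= l)%N) => H) ge U0 V0 U0 sany (sgap y' y') sany'.
set X := r ^+ 2 * _ in cA cB1 cB2 cC *.
rewrite (_ : (V * U * V + 3 * (U * U * V)) * X = V * U * V * X + (U * U * V * X + (U * V * U * X + U * V * U * X))); last by ring.
apply: le_trans (lerD cA (lerD cB1 (lerD cB2 cC))).
rewrite -!mulrDr ler_wpM2l ?exprn_ge0 ?(ltW h0)//.
(* The chains enumerate times in increasing order; the swaps bring all four sums back to the order
   i, j, i', j' so that they can be compared termwise. *)
rewrite [X in _ <= _ + (X + _)]S4_swap23 [X in _ <= _ + (_ + (X + _))]S4_swap23.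
rewrite [X in _ <= _ + (_ + (_ + X))](S4_swap34 _) [X in _ <= _ + (_ + (_ + X))](S4_swap23 _).
rewrite -!S4D; apply: S4_le => i j i' j'.
have [/and4P[c1 c2 c3 c4]|_] := boolP [&& _, _, _ & _]; last first.
  by rewrite {1}/ind mul0r !addr_ge0// mulr_ge0.
rewrite (_ : vis4 y y' y y' i i' j j' = vis4 y y y' y' i j i' j'); last by apply: Ex_eq => w; ring.
rewrite (_ : vis4 y y' y' y i i' j' j = vis4 y y y' y' i j i' j'); last by apply: Ex_eq => w; ring.
rewrite -!mulrDl ler_wpM2r// {1}/ind; have := pair_cover c1 c2 c3 gg c4.
move=> H; rewrite -[leLHS]/(ind R true) -H; apply: le_trans (ind_or _ _) _; rewrite lerD2l.
by apply: le_trans (ind_or _ _) _; rewrite lerD2l; exact: ind_or.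
Qed.

Lemma visits_second_moment t0 t1 g t2 g' y y' : (0 < t0)%N -> (0 < g')%N -> (g' <= J)%N -> (2 * g' <= g)%N ->
  Ex P (fun w => visits t0 t1 g t2 y w * visits t0 t1 g t2 y' w) <=
  2 * ((Vstep g' * Ustep y y' * Vstep g' + 3 * (Ustep y y' * Ustep y y' * Vstep g')) * (r ^+ 2 * (J%:R / t0%:R))).
Proof.
move=> t00 g0 gJ gg; set U := Ustep _ _; set V := Vstep _.
pose F i j k l w := 1 * vis i y w * vis j y w * vis k y' w * vis l y' w.
have bF i j k l : bmf (F i j k l).
  by do 4!(apply: bmfM; last exact: bmf_vis); exact: bmf_cst.
pose c i j i' j' := [&& t0 <= i, i + g <= j, t0 <= i' & i' + g <= j']%N.
have hp : 0 <= h ^+ 4 by rewrite exprn_ge0// ltW.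
have bS : bmf (fun w => S4 (fun i j k l => ind R (c i j k l) * F i j k l w)).
  by do 4!(apply: bmf_sum => ? _); apply: bmfM => //; exact: bmf_cst.
apply: (@le_trans _ _ (Ex P (fun w => h ^+ 4 * S4 (fun i j k l => ind R (c i j k l) * F i j k l w)))).
  apply: Ex_le.
  - by apply: bmfM; exact: bmf_visits.
  - by apply: bmfM => //; exact: bmf_cst.
  move=> w; rewrite /visits mulrACA -exprD ler_wpM2l//.
  rewrite mulr_suml; apply: ler_sum => i _; rewrite mulr_suml; apply: ler_sum => j _.
  rewrite mulr_sumr; apply: ler_sum => k _; rewrite mulr_sumr; apply: ler_sum => l _.
  rewrite mulrACA -indM.
  have vv : vis i y w * vis j y w * alive j w * (vis k y' w * vis l y' w * alive l w) <= F i j k l w.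
    rewrite mulrACA /F mul1r -(mulrA (vis i y w * _)) ler_piMr//.
      by rewrite !mulr_ge0// vis_ge0.
    have a0 n : 0 <= alive n w by case: (alive01 n w) => ->.
    by rewrite mulr_ile1 ?alive_le1.
  have [|_] := boolP (_ && _); last by rewrite /ind mul0r mulr_ge0//; exact: bmf_ge0 (bF _ _ _ _).
  move=> /andP[/and3P[/andP[k1 _] k2 _] /and3P[/andP[k3 _] k4 _]].
  by rewrite /c k1 k2 k3 k4 /ind !mul1r.
rewrite ExZ// S4_Ex// mulr_natl mulr2n.
have H1 := @visits_half t0 g g' y y' t00 g0 gJ gg.
have H2 := @visits_half t0 g g' y' y t00 g0 gJ gg.
rewrite (_ : Ustep y' y = U) in H2; last by rewrite /U /Ustep distrC.
apply: le_trans (lerD H1 H2); rewrite -mulrDr ler_wpM2l//.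
rewrite [X in _ <= _ + X]S4_swap23 [X in _ <= _ + X]S4_swap12 [X in _ <= _ + X]S4_swap34 [X in _ <= _ + X]S4_swap23.
rewrite -S4D; apply: S4_le => i j i' j'.
rewrite (_ : vis4 y' y' y y i' j' i j = vis4 y y y' y' i j i' j'); last by apply: Ex_eq => w; ring.
rewrite -mulrDl; apply: ler_wpM2r; first exact: Ex_ge0.
have [/and4P[k1 k2 k3 k4]|_] := boolP (c i j i' j'); last by rewrite {1}/ind addr_ge0.
rewrite k1 k2 k3 k4/=; case: (leqP i i') => ii; rewrite /ind/= ?lerDl//.
by rewrite (ltnW ii) lerDr.
Qed.

(* First exit decomposition: a path leaving the square of radius 2 has to come
   back from its first exit point to be counted at time l. *)
Lemma kill_bound a l (G : T -> R) y M : (a <= l)%N -> 0 <= M -> bmf (G : past xi a -> R) ->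
  (forall j z, (j <= l - a)%N -> 2 < `|z| -> hitp P xi r j (y - z) <= M) ->
  Ex P (fun w => G w * alive a w * vis l y w) <=
  Ex P (fun w => G w * alive l w * vis l y w) + M * Ex P (fun w => G w * alive a w).
Proof.
move=> al M0 bG HM.
have bGk k : (a <= k)%N -> bmf (G : past xi k -> R).
  by move=> ak; apply: (sg_bmf_sub _ bG) => i /leq_trans; apply.
have bG' := sg_bmf gw bG.
have bGa n : bmf (fun w => G w * alive n w) by apply: bmfM => //; exact: bmf_alive.
(* The visits lost by killing during [m] steps are at most [M] times the mass killed during these
   steps; the induction adds one step at a time. *)
suff H m : (a + m <= l)%N -> Ex P (fun w => G w * alive a w * vis l y w) + M * Ex P (fun w => G w * alive (a + m) w) <=
    Ex P (fun w => G w * alive (a + m) w * vis l y w) + M * Ex P (fun w => G w * alive a w).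
  have := H (l - a)%N; rewrite subnKC// => /(_ (leqnn _)); apply: le_trans.
  by rewrite lerDl mulr_ge0// Ex_ge0.
elim: m => [|m ih] aml; first by rewrite addn0.
have aml' : (a + m <= l)%N by apply: leq_trans aml; rewrite leq_add2l.
have {}ih := ih aml'; rewrite addnS in aml *.
set k := (a + m)%N in aml ih *.
have ak : (a <= k.+1)%N by rewrite /k ltnW// ltnS leq_addr.
pose E w := G w * alive k w * ind R (2 < `|x0 + wsum xi 0 k.+1 w|).
have mS : measurable_fun [set: past xi k.+1] ((fun w => x0 + wsum xi 0 k.+1 w) : past xi k.+1 -> pt).
  by apply: measurable_ptD => //; apply: sg_wsum => i /andP[].
have bE : bmf (E : past xi k.+1 -> R).
  apply: bmfM.
    apply: bmfM; first exact: bGk.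
    by apply: (sg_bmf_sub _ (alive_past k)) => i ik; exact: leqW.
  apply: bmf_bool; apply: measurable_fun_ltr => //; exact: measurable_ptnorm.
have bE' := sg_bmf gw bE.
have split w : G w * alive k w = G w * alive k.+1 w + E w.
  rewrite aliveS /E -!mulrA -mulrDr -mulrDr; congr (_ * _).
  by rewrite /ind; case: leP => _; rewrite ?addr0 ?add0r mulr1.
have Q1 : Ex P (fun w => G w * alive k w) = Ex P (fun w => G w * alive k.+1 w) + Ex P E.
  by rewrite -ExD//; apply: Ex_eq => w; rewrite split.
have Q2 : Ex P (fun w => G w * alive k w * vis l y w) = Ex P (fun w => G w * alive k.+1 w * vis l y w) + Ex P (fun w => E w * vis l y w).
  rewrite -ExD//; [by apply: Ex_eq => w; rewrite split mulrDl|by apply: bmfM => //; exact: bmf_vis|by apply: bmfM => //; exact: bmf_vis].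
have Q3 : Ex P (fun w => E w * vis l y w) <= M * Ex P E.
  rewrite (markov_vis _ aml bE) -ExZ//; apply: Ex_le.
  - by apply: bmfM => //; exact: bmf_hitp_walk.
  - by apply: bmfM => //; exact: bmf_cst.
  move=> w; have [kz|kz] := boolP (2 < `|x0 + wsum xi 0 k.+1 w|); last first.
    by rewrite /E (negbTE kz) /ind mulr0 mul0r mulr0.
  rewrite mulrC; apply: ler_wpM2r; first exact: bmf_ge0 bE'.
  by apply: HM => //; rewrite leq_sub2l.
by move: ih; rewrite Q1 Q2 mulrDr => /le_absorb; apply.
Qed.

End chains.

(** * First moment of the number of near double points *)

Section first_moment.
Context {R : realType}.
Notation pt := (R * R)%type.

(** 1 + x <= exp x applied to b/tau - b/t. Returning from afar is therefore most likely at the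
    largest time allowed, and escape bounds hold uniformly in the return time. *)
Lemma heat_kernel_mono (b t tau : R) : 0 < tau -> tau <= t -> t <= b ->
  tau^-1 * expR (- (b / tau)) <= t^-1 * expR (- (b / t)).
Proof.
move=> tau0 tt tb; have t0 : 0 < t by exact: lt_le_trans tt.
have H : t / tau <= expR (b / tau - b / t).
  apply: le_trans (expR_ge1Dx _).
  have -> : 1 + (b / tau - b / t) = t / tau + (b - t) * (t - tau) / (tau * t) by field; rewrite !gt_eqF.
  rewrite lerDl; apply: divr_ge0; first by apply: mulr_ge0; rewrite subr_ge0.
  by rewrite mulr_ge0// ltW.
rewrite [leLHS](_ : _ = t^-1 * ((t / tau) * expR (- (b / tau)))); last by field; rewrite !gt_eqF.
rewrite ler_pM2l ?invr_gt0//; apply: le_trans (ler_wpM2r (expR_ge0 _) H) _.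
by rewrite -expRD addrAC subrr add0r.
Qed.

Lemma peak2_gt0 (v : R) : 0 < v -> 0 < peak2 v.
Proof. by move=> v0; rewrite invr_gt0 !mulr_gt0// pi_gt0. Qed.

Lemma peak2E (v : R) : 0 < v -> peak2 v = (2 * pi)^-1 * v^-1.
Proof. by move=> v0; rewrite /peak2 invfM. Qed.

Context {d} {T : measurableType d} {P : probability T R}.
Context {h : R} {xi : nat -> T -> R * R}.
Hypothesis (h0 : 0 < h) (gw : gaussian_walk P h xi).
Variables (x0 : pt) (r : R) (n : nat).
Hypotheses (r0 : 0 < r) (hn : h = (64 * n%:R)^-1) (n0 : (0 < n)%N) (r50 : r <= 1 / 50).
Hypothesis x0E : x0 = (1, 0).

Local Notation vis := (vis (xi := xi) x0 r).
Local Notation alive := (alive (xi := xi) x0).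
Local Notation vs J := (visits (h := h) (xi := xi) x0 r J).

(** A point outside the square of radius 2 is at distance more than 5/3 from [y]; [J h <= m^2 / 2]
    is the range of monotonicity of the heat kernel. *)
Lemma hitp_escape (y z : pt) (J j : nat) (m : R) : `|y| <= 1 / 3 -> 2 < `|z| -> (j <= J)%N -> 0 < m ->
  m + r <= 5 / 3 -> J%:R * h <= m ^+ 2 / 2 ->
  hitp P xi r j (y - z) <= (2 * r) ^+ 2 * peak2 (J%:R * h) * expR (- (m ^+ 2 / (2 * (J%:R * h)))).
Proof.
move=> y3 z2 jJ m0 mr Jm.
have yz : 5 / 3 < `|y - z|.
  have : `|z| <= `|y| + `|y - z| by rewrite -{1}(subKr y z); exact: ler_normB.
  by move: y3 z2; set a := `|_|; set b := `|_|; set c := `|_|; lra.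
case: j jJ => [|j] jJ.
  rewrite /hitp (_ : Ex P _ = Ex P (fun=> 0)); last first.
    apply: Ex_eq => w; rewrite /wsum big_geq// sub0r normrN /ind leNgt.
    by rewrite (lt_trans _ yz)//; move: (r50); lra.
  rewrite Ex_cst; apply: mulr_ge0 (expR_ge0 _); apply: mulr_ge0 (sqr_ge0 _) _.
  by rewrite invr_ge0 !mulr_ge0 ?pi_ge0// ltW.
have J0 : (0 < J)%N by exact: leq_trans jJ.
have t0 : 0 < j.+1%:R * h by rewrite mulr_gt0// ltr0n.
have tJ : 0 < J%:R * h by rewrite mulr_gt0// ltr0n.
apply: le_trans (hitp_le_far h0 gw (m := m) _ _ _ _) _ => //; first exact: ltW.
  by left; apply: le_trans mr (ltW yz).
have e2 t : m ^+ 2 / (2 * t) = m ^+ 2 / 2 / t by rewrite invfM mulrA.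
rewrite !peak2E// !e2; set K := (2 * r) ^+ 2; set q := (2 * pi)^-1.
have E a b : K * (q * a) * b = K * q * (a * b) by ring.
have Kq : 0 < K * q by apply: mulr_gt0; [apply: exprn_gt0; exact: mulr_gt0|rewrite invr_gt0 mulr_gt0// pi_gt0].
rewrite !E ler_pM2l//; apply: heat_kernel_mono => //.
by rewrite ler_pM2r// ler_nat.
Qed.

Lemma expRN_le_inv1D (x : R) : 0 <= x -> expR (- x) <= (1 + x)^-1.
Proof.
move=> x0'; rewrite expRN lef_pV2 ?posrE ?expR_gt0//; last lra.
exact: expR_ge1Dx.
Qed.

Lemma expRN_ge (x : R) : 1 - x <= expR (- x).
Proof. exact: expR_ge1Dx. Qed.

Lemma return_net (y : pt) (j : nat) : `|y| <= 1 / 3 -> 16 * r ^+ 2 <= j%:R * h -> j%:R * h <= 1 -> (0 < j)%N ->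
  exists2 M, 0 <= M & (forall i z, (i <= j)%N -> 2 < `|z| -> hitp P xi r i (y - z) <= M) /\
   (forall c : pt, `|c| <= r -> r ^+ 2 / (8 * (j%:R * h)) + M <= hitp P xi r j c).
Proof.
move=> y3 rj j1 j0; set t := j%:R * h.
have t0 : 0 < t by rewrite mulr_gt0// ltr0n.
pose A := (2 * r) ^+ 2 * peak2 t; have A0 : 0 < A.
  by apply: mulr_gt0; [apply: exprn_gt0; exact: mulr_gt0|exact: peak2_gt0].
exists (A / 2); first by rewrite divr_ge0// ltW.
split => [i z ij z2|c cr].
  apply: le_trans (hitp_escape y3 z2 ij (m := 3 / 2) _ _ _) _ => //; [move: (r50); lra|move: j1; lra|].
  rewrite -/t -/A ler_pM2l//; apply: le_trans (expRN_le_inv1D _) _.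
    by apply: divr_ge0; [exact: sqr_ge0|rewrite mulr_ge0// ltW].
  have c1 : 1 <= (3 / 2) ^+ 2 / (2 * t).
    by rewrite ler_pdivlMr; [move: j1; rewrite -/t; lra|exact: mulr_gt0].
  by move: c1; set X := _ / _ => c1; rewrite lef_pV2 ?posrE; lra.
apply: le_trans (hitp_ge h0 gw _ _ _) => //; rewrite -/t -/A.
have E : 3 / 4 <= expR (- (((`|c.1| + r) ^+ 2 + (`|c.2| + r) ^+ 2) / (2 * t))).
  apply: le_trans (expRN_ge _).
  have H (a : R) : `|a| <= r -> (`|a| + r) ^+ 2 <= 4 * r ^+ 2.
    move=> ar; rewrite -[4 * _](_ : (2 * r) ^+ 2 = _); last by ring.
    have ar2 : `|a| + r <= 2 * r by lra.
    by rewrite ler_sqr ?nnegrE// ?(mulr_ge0 _ (ltW r0))// addr_ge0// ltW.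
  have := H _ (le_trans (fst_le_norm c) cr); have := H _ (le_trans (snd_le_norm c) cr).
  move=> h1 h2; have : ((`|c.1| + r) ^+ 2 + (`|c.2| + r) ^+ 2) / (2 * t) <= 1 / 4.
    rewrite ler_pdivrMr; last exact: mulr_gt0.
    by move: rj h1 h2; rewrite -/t; set u := _ ^+ 2; set v := (_ + _) ^+ 2; set z := (_ + _) ^+ 2; lra.
  lra.
apply: (@le_trans _ _ (A * (3 / 4))); last by rewrite ler_pM2l.
have := peak2_ge t0; move=> /(ler_wpM2l (sqr_ge0 (2 * r))); rewrite -/A => HA.
have -> : r ^+ 2 / (8 * t) = (2 * r) ^+ 2 * (8 * t)^-1 / 4 by field; rewrite gt_eqF.
lra.
Qed.

(** Before time 1/16 leaving the square is a small loss: the direct way from (1, 0) has exponent at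
    most 49/50 / t, while coming back over a distance 8/5 has exponent 64/50 / t, and exp (- (3/10)
    / t) <= 1/2. The constant exp (-32) comes from t >= 1/32. *)
Lemma first_hit (y : pt) (i : nat) : enorm y <= 1 / 3 -> 1 / 32 <= i%:R * h <= 1 / 16 ->
  expR (- 32) * r ^+ 2 <= Ex P (fun w => alive i w * vis i y w).
Proof.
move=> y3 /andP[i32 i16]; set t := i%:R * h in i32 i16 *.
have t0 : 0 < t by lra.
have i0 : (0 < i)%N by move: t0; rewrite /t pmulr_lgt0// ltr0n.
pose A := (2 * r) ^+ 2 * peak2 t; have A0 : 0 < A.
  by apply: mulr_gt0; [apply: exprn_gt0; exact: mulr_gt0|exact: peak2_gt0].
pose q := expR (- (49 / 50 / t)).
have q0 : 0 < q by exact: expR_gt0.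
have y3' : `|y| <= 1 / 3 by exact: le_trans (norm_le_enorm y) y3.
have b1 : bmf ((fun=> 1) : past xi 0 -> R) by exact: bmf_cst.
have M0 : 0 <= A * (q / 2) by apply: mulr_ge0; [exact: ltW|apply: divr_ge0 => //; exact: ltW].
have HM j z : (j <= i - 0)%N -> 2 < `|z| -> hitp P xi r j (y - z) <= A * (q / 2).
  rewrite subn0 => ji z2; apply: le_trans (hitp_escape y3' z2 ji (m := 8 / 5) _ _ _) _ => //.
  - by move: (r50); lra.
  - by rewrite -/t; lra.
  rewrite -/t -/A ler_pM2l//.
  have -> : - ((8 / 5) ^+ 2 / (2 * t)) = - (49 / 50 / t) + - (3 / 10 / t) by field; rewrite gt_eqF.
  rewrite expRD -/q (ler_pM2l q0); apply: le_trans (expRN_le_inv1D _) _; first by rewrite divr_ge0// ltW.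
  rewrite lef_pV2 ?posrE//; last by rewrite addr_gt0// divr_gt0.
  have : 1 <= 3 / 10 / t by rewrite ler_pdivlMr//; lra.
  lra.
have := kill_bound gw x0 (leq0n i) M0 b1 HM.
have S0 w : alive 0 w = 1.
  rewrite /alive big_ord1 /wsum big_geq// addr0 x0E prod_normE/= normr0 normr1.
  by rewrite (max_idPl ler01) /ind ler1n.
have bA := bmf_alive gw x0 i; have bV := bmf_vis gw x0 r i y.
rewrite (_ : Ex P (fun w => 1 * alive 0 w * vis i y w) = hitp P xi r i (y - x0)); last first.
  by apply: Ex_eq => w; rewrite S0 !mul1r /vis opprB addrA (addrC (wsum _ _ _ _)).
rewrite (_ : Ex P (fun w => 1 * alive 0 w) = 1); last first.
  by rewrite -[RHS](Ex_cst P 1); apply: Ex_eq => w; rewrite S0 mul1r.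
rewrite (_ : Ex P (fun w => 1 * alive i w * vis i y w) = Ex P (fun w => alive i w * vis i y w)); last first.
  by apply: Ex_eq => w; rewrite mul1r.
rewrite mulr1 => K.
have L : A * q <= hitp P xi r i (y - x0).
  apply: le_trans (hitp_ge h0 gw _ _ _) => //; rewrite -/t -/A ler_pM2l// ler_expR lerN2.
  rewrite (_ : 49 / 50 / t = (49 / 25) / (2 * t)); last by field; rewrite gt_eqF.
  rewrite ler_pM2r; last by rewrite invr_gt0 mulr_gt0.
  rewrite x0E/= subr0.
  have e2 := enorm_sqr y; have e0 := enorm_ge0 y.
  have e9 : y.1 ^+ 2 + y.2 ^+ 2 <= 1 / 9.
    by rewrite -e2 (_ : 1 / 9 = (1 / 3) ^+ 2) ?ler_sqr ?nnegrE//; field.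
  have a1 : `|y.1| <= 1 / 3 by exact: le_trans (fst_le_norm y) y3'.
  have a2 : `|y.2| <= 1 / 3 by exact: le_trans (snd_le_norm y) y3'.
  have y1 : - (1 / 3) <= y.1 <= 1 / 3 by rewrite -ler_norml.
  have -> : `|y.1 - 1| = 1 - y.1 by rewrite distrC ger0_norm//; move: y1 => /andP[]; lra.
  have n2 : `|y.2| ^+ 2 = y.2 ^+ 2 by rewrite real_normK ?num_real.
  have rr : r * (1 - y.1) <= 1 / 50 * (4 / 3) by apply: ler_pM; rewrite ?(ltW r0)//; move: y1 => /andP[]; lra.
  have rr2 : r * `|y.2| <= 1 / 50 * (1 / 3) by apply: ler_pM; rewrite ?(ltW r0).
  have r2 : r ^+ 2 <= 1 / 50 * (1 / 50) by rewrite expr2; apply: ler_pM (r50) (r50); exact: ltW.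
  move: y1 => /andP[y1 _]; rewrite !sqrrD n2; nra.
apply: (@le_trans _ _ (A * (q / 2))); last by move: K L; lra.
have HA : r ^+ 2 * 8 <= A.
  have := peak2_ge t0 => /(ler_wpM2l (sqr_ge0 (2 * r))); rewrite -/A; apply: le_trans.
  rewrite (_ : r ^+ 2 * 8 = (2 * r) ^+ 2 * 2); last by ring.
  apply: ler_wpM2l; first exact: sqr_ge0.
  rewrite -[leLHS]invrK lef_pV2 ?posrE ?invr_gt0//; first lra.
  exact: mulr_gt0.
have Hq : expR (- 32) <= q.
  rewrite ler_expR lerN2 ler_pdivrMr//; lra.
rewrite mulrC; apply: (@le_trans _ _ (r ^+ 2 * 8 * (q / 2))); last first.
  by rewrite ler_wpM2r// divr_ge0// ltW.
have r2 : 0 < r ^+ 2 by exact: exprn_gt0.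
rewrite -mulrA ler_pM2l//; lra.
Qed.

(** As [h = 1 / (64 n)], the first visit lies in times [1/32, 1/16] and the second at most 1 later,
    so [68 n] is the last index used. The window has length 1/32 and [return_net] gives r^2 / (8 t):
    hence 1/256. Integrating 1/t from eps^2 to 1 produces the logarithm. *)
Lemma visits_first_moment (y : pt) g (eps : R) : enorm y <= 1 / 3 -> 0 < eps -> eps < 1 / 3 -> r <= eps / 4 ->
  eps ^+ 2 <= g%:R * h <= 2 * eps ^+ 2 ->
  expR (- 32) / 256 * r ^+ 4 * `|ln eps| <= Ex P (vs (68 * n).+1 (2 * n) (4 * n) g (64 * n) y).
Proof.
move=> y3 e0 e3 re /andP[ge1 ge2]; set J := (68 * n).+1.
have r20 : 0 < r ^+ 2 by exact: exprn_gt0.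
have nR : 0 < n%:R :> R by rewrite ltr0n.
have n1 : 1 <= n%:R :> R by rewrite ler1n.
have hk (k : nat) : k%:R * h = k%:R / (64 * n%:R) by rewrite hn.
have y3' : `|y| <= 1 / 3 by exact: le_trans (norm_le_enorm y) y3.
have e20 : 0 < eps ^+ 2 by exact: exprn_gt0.
have r16 : 16 * r ^+ 2 <= eps ^+ 2.
  rewrite (_ : 16 * r ^+ 2 = (4 * r) ^+ 2); last by ring.
  have re4 : 4 * r <= eps by lra.
  by rewrite ler_sqr ?nnegrE// ?(ltW e0)// mulr_ge0// ltW.
have g0 : (0 < g)%N.
  by rewrite lt0n; apply/eqP => g0; move: ge1; rewrite g0 mul0r leNgt e20.
have gn : (g <= 64 * n)%N.
  rewrite -(ler_nat R) -(ler_pM2r h0) (hk (64 * n)%N) natrM divff; last by rewrite gt_eqF// mulr_gt0.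
  by apply: le_trans ge2 _; nra.
have bV i j : bmf (fun w => vis i y w * vis j y w * alive j w).
  by apply: bmfM; [apply: bmfM; exact: (bmf_vis gw)|exact: (bmf_alive gw)].
have term i j : (2 * n <= i <= 4 * n)%N -> (i + g <= j)%N -> (j <= i + 64 * n)%N ->
    expR (- 32) * r ^+ 2 * (r ^+ 2 / (8 * ((j - i)%:R * h))) <= Ex P (fun w => vis i y w * vis j y w * alive j w).
  move=> /andP[i1 i2] ij ji.
  have ij' : (i <= j)%N by apply: leq_trans ij; exact: leq_addr.
  have gji : (g <= j - i)%N by rewrite leq_subRL.
  have ji0 : (0 < j - i)%N by exact: leq_trans gji.
  have t1 : 16 * r ^+ 2 <= (j - i)%:R * h.
    by apply: le_trans r16 _; apply: le_trans ge1 _; rewrite ler_pM2r// ler_nat.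
  have t2 : (j - i)%:R * h <= 1.
    rewrite hk ler_pdivrMr ?mulr_gt0// mul1r -natrM ler_nat leq_subLR//.
  have [M M0 [HM Hc]] := return_net y3' t1 t2 ji0.
  have bG : bmf (vis i y : past xi i -> R) by exact: vis_past.
  have K := kill_bound gw x0 ij' M0 bG HM.
  have bGA : bmf ((fun w => vis i y w * alive i w) : past xi i -> R) by apply: bmfM => //; exact: alive_past.
  have bGA' := sg_bmf gw bGA.
  have F : expR (- 32) * r ^+ 2 <= Ex P (fun w => vis i y w * alive i w).
    rewrite (_ : Ex P _ = Ex P (fun w => alive i w * vis i y w)); last by apply: Ex_eq => w; rewrite mulrC.
    apply: first_hit => //; rewrite hk; apply/andP; split.
      rewrite ler_pdivlMr ?mulr_gt0//; have : (2 * n)%:R <= i%:R :> R by rewrite ler_nat.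
      rewrite natrM; lra.
    rewrite ler_pdivrMr ?mulr_gt0//; have : i%:R <= (4 * n)%:R :> R by rewrite ler_nat.
    rewrite natrM; lra.
  have B : (r ^+ 2 / (8 * ((j - i)%:R * h)) + M) * Ex P (fun w => vis i y w * alive i w) <=
      Ex P (fun w => vis i y w * alive i w * vis j y w).
    rewrite (markov_vis gw _ _ _ ij' bGA) -ExZ//; last first.
      by rewrite addr_ge0// divr_ge0 ?ltW// !mulr_gt0// ltr0n.
    apply: Ex_le.
    - by apply: bmfM => //; apply: bmf_cst; rewrite addr_ge0// divr_ge0 ?ltW// !mulr_gt0// ltr0n.
    - by apply: bmfM => //; exact: (bmf_hitp_walk gw).
    move=> w; have [iz|iz] := boolP (`|x0 + wsum xi 0 i w - y| <= r); last first.
      by rewrite /vis (negbTE iz) /ind !mul0r mulr0.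
    rewrite mulrC; apply: ler_wpM2l; first exact: bmf_ge0 bGA'.
    by apply: Hc; rewrite distrC.
  rewrite (_ : Ex P (fun w => vis i y w * vis j y w * alive j w) = Ex P (fun w => vis i y w * alive j w * vis j y w)); last first.
    by apply: Ex_eq => w; rewrite mulrAC.
  have rt0 : 0 <= r ^+ 2 / (8 * ((j - i)%:R * h)) by rewrite divr_ge0 ?ltW// !mulr_gt0// ltr0n.
  have := ler_wpM2r rt0 F; move: K B; rewrite mulrDl; set X := r ^+ 2 / _.
  set a := Ex _ _; set b := Ex _ _; set e := Ex _ _; rewrite (mulrC X); lra.
rewrite /visits ExZ; last 2 first.
- by rewrite exprn_ge0// ltW.
- apply: bmf_sum => i _; apply: bmf_sum => j _; apply: bmfM; [exact: bmf_cst|exact: bV].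
have bV' i j (b : bool) : bmf (fun w => ind R b * (vis i y w * vis j y w * alive j w)).
  by apply: bmfM; [exact: bmf_cst|exact: bV].
rewrite Ex_sum; last by move=> i _; exact: bmf_sum.
set c := expR (- 32) * r ^+ 2.
have c0 : 0 <= c by rewrite mulr_ge0 ?expR_ge0 ?ltW.
(* With g h <= 2 eps^2 the harmonic sum is at least 2 |ln eps| - ln 2, and ln 2 <= |ln eps|. *)
have lnE : `|ln eps| <= \sum_(g <= m < 64 * n) (m%:R)^-1.
  apply: le_trans (harmonic_ge g0 gn).
  have l2 : ln 2 <= `|ln eps|.
    rewrite ltr0_norm; last by rewrite ln_lt0// e0/=; lra.
    rewrite -lnV ?posrE// le_lnD ?invr_gt0//.
    by rewrite -[2]invrK lef_pV2 ?posrE ?invr_gt0//; lra.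
  have -> : (64 * n)%:R / g%:R = (g%:R * h)^-1 :> R.
    by rewrite hn natrM; field; rewrite !gt_eqF ?ltr0n.
  have gh0 : 0 < g%:R * h by rewrite mulr_gt0// ltr0n.
  apply: (@le_trans _ _ (ln (2 * eps ^+ 2)^-1)); last first.
    have e22 : 0 < 2 * eps ^+ 2 by exact: mulr_gt0.
    by apply: le_lnD; rewrite ?invr_gt0// lef_pV2 ?posrE.
  rewrite lnV ?posrE ?mulr_gt0// lnM ?posrE// lnXn//.
  by move: l2; rewrite ltr0_norm; [rewrite mulr2n; lra|rewrite ln_lt0// e0/=; lra].
have inner (i : 'I_J) : (2 * n <= i <= 4 * n)%N ->
    h * (c * (r ^+ 2 / 8 * `|ln eps|)) <= h ^+ 2 * \sum_(j < J) ind R [&& (2 * n <= i <= 4 * n)%N, (i + g <= j)%N & (j <= i + 64 * n)%N] *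
       Ex P (fun w => vis i y w * vis j y w * alive j w).
  move=> Hi; have /andP[i1 i2] := Hi.
  have inJ : (i + 64 * n <= J)%N by rewrite ltnW// ltnS (leq_trans (leq_add i2 (leqnn _)))// -mulnDl.
  have igJ : (i + g <= J)%N by apply: leq_trans inJ; rewrite leq_add2l.
  rewrite -(big_mkord xpredT (fun j => ind R [&& (2 * n <= i <= 4 * n)%N, (i + g <= j)%N & (j <= i + 64 * n)%N] *
       Ex P (fun w => vis i y w * vis j y w * alive j w))).
  apply: (@le_trans _ _ (h ^+ 2 * \sum_(i + g <= j < i + 64 * n) c * (r ^+ 2 / (8 * ((j - i)%:R * h))))); last first.
    rewrite ler_wpM2l ?exprn_ge0 ?(ltW h0)//.
    rewrite [leRHS](big_cat_nat (leq0n (i + g)) igJ).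
    have gin : (i + g <= i + 64 * n)%N by rewrite leq_add2l.
    rewrite [X in _ <= _ + X](big_cat_nat gin inJ).
    have E0 j : 0 <= ind R [&& (2 * n <= i <= 4 * n)%N, (i + g <= j)%N & (j <= i + 64 * n)%N] *
       Ex P (fun w => vis i y w * vis j y w * alive j w) by rewrite mulr_ge0// Ex_ge0.
    apply: ler_wpDl; first exact: sumr_ge0.
    apply: ler_wpDr; first exact: sumr_ge0.
    rewrite /= big_nat_cond [leRHS]big_nat_cond; apply: ler_sum => j /andP[/andP[j1 j2] _].
    by rewrite Hi j1 (ltnW j2) /ind mul1r; apply: term => //; exact: ltnW.
  rewrite (addnC i) (addnC i) big_addn addnK.
  rewrite [leRHS](_ : _ = h * (c * (r ^+ 2 / 8 * \sum_(g <= m < 64 * n) (m%:R)^-1))); last first.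
    rewrite !mulr_sumr big_nat_cond [RHS]big_nat_cond; apply: eq_bigr => m /andP[/andP[m1 _] _].
    by rewrite addnK; field; rewrite !gt_eqF// ltr0n (leq_trans g0).
  by rewrite ler_pM2l// ler_wpM2l// ler_wpM2l// divr_ge0// ltW.
apply: (@le_trans _ _ (\sum_(2 * n <= i < 4 * n) h * (c * (r ^+ 2 / 8 * `|ln eps|)))).
  rewrite sumr_const_nat -mulnBl -[leRHS]mulr_natl natrM.
  have hn32 : 2%:R * n%:R * h = 1 / 32 by rewrite hn; field; rewrite gt_eqF.
  rewrite mulrA hn32.
  by rewrite /c le_eqVlt; apply/orP; left; apply/eqP; field.
rewrite mulr_sumr.
pose F i := h ^+ 2 * Ex P (fun w => \sum_(j < J) ind R [&& (2 * n <= i <= 4 * n)%N, (i + g <= j)%N & (j <= i + 64 * n)%N] *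
       (vis i y w * vis j y w * alive j w)).
rewrite -[leRHS]/(\sum_(i < J) F i) -(big_mkord xpredT F).
have F0 i : 0 <= F i by rewrite mulr_ge0 ?exprn_ge0 ?(ltW h0)// Ex_ge0//; exact: bmf_sum.
rewrite [leRHS](big_cat_nat (n := (2 * n)%N))//=; last by rewrite leqW// leq_mul2r orbT.
rewrite [X in _ <= _ + X](big_cat_nat (n := (4 * n)%N))//=; last 2 first.
- by rewrite leq_mul2r orbT.
- by rewrite leqW// leq_mul2r orbT.
apply: ler_wpDl; first exact: sumr_ge0.
apply: ler_wpDr; first exact: sumr_ge0.
rewrite big_nat_cond [leRHS]big_nat_cond; apply: ler_sum => i /andP[/andP[i1 i2] _].
have iJ : (i < J)%N by rewrite ltnS (leq_trans (ltnW i2))// leq_mul2r orbT.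
have Hi : (2 * n <= Ordinal iJ <= 4 * n)%N by rewrite /= i1 ltnW.
apply: le_trans (inner (Ordinal iJ) Hi) _; rewrite /F ler_wpM2l ?exprn_ge0 ?(ltW h0)//.
rewrite Ex_sum//; apply: ler_sum => j _; rewrite ExZ//.
Qed.

End first_moment.

Section second_moment_method.
Context {R : realType} {d} {T : measurableType d} {P : probability T R}.

(** Cauchy-Schwarz in linear form: 2 l Z <= 1_{Z > 0} + l^2 Z^2, with the optimal l = A / B. *)
Lemma paley_zygmund (Z : T -> R) (A B : R) : bmf Z -> 0 < A -> 0 < B ->
  A <= Ex P Z -> Ex P (fun w => Z w ^+ 2) <= B ->
  A ^+ 2 <= B * Ex P (fun w => ind R (0 < Z w)).
Proof.
move=> bZ A0 B0 AZ ZB.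
have mb : measurable_fun setT (fun w => 0 < Z w) by apply: measurable_fun_ltr => //; exact: bmf_meas.
have bI : bmf (fun w => ind R (0 < Z w)) by exact: bmf_bool.
pose l := A / B; have l0 : 0 < l by exact: divr_gt0.
have bZ2 : bmf (fun w => l ^+ 2 * Z w ^+ 2).
  by apply: bmfM; [apply: bmf_cst; exact: sqr_ge0|exact: bmfX].
have H : Ex P (fun w => 2 * l * Z w) <= Ex P (fun w => ind R (0 < Z w) + l ^+ 2 * Z w ^+ 2).
  apply: Ex_le; [|exact: bmfD|].
    by apply: bmfM => //; apply: bmf_cst; rewrite mulr_ge0// ltW.
  move=> w; have Z0 := bmf_ge0 w bZ; rewrite /ind; have [Zp|] := ltP 0 (Z w).
    by have := sqr_ge0 (1 - l * Z w); rewrite mulr1n; nra.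
  by rewrite le_eqVlt ltNge Z0 orbF => /eqP ->; rewrite mulr0 expr0n/= mulr0 addr0.
have l20 : 0 <= 2 * l by rewrite mulr_ge0// ltW.
have bX := bmfX 2 bZ.
rewrite (ExZ P l20 bZ) (ExD P bI bZ2) (ExZ P (sqr_ge0 l) bX) in H.
have E : A ^+ 2 / B = 2 * l * A - l ^+ 2 * B by rewrite /l; field; rewrite gt_eqF.
have h1 : 2 * l * A <= 2 * l * Ex P Z by exact: ler_wpM2l.
have h2 : l ^+ 2 * Ex P (fun w => Z w ^+ 2) <= l ^+ 2 * B by apply: ler_wpM2l => //; exact: sqr_ge0.
by rewrite mulrC -ler_pdivrMr// E; lra.
Qed.

Lemma bmf_lin' (J : finType) (m : J -> R) (F : J -> T -> R) :
  (forall j, 0 <= m j) -> (forall j, bmf (F j)) -> bmf (fun w => \sum_j m j * F j w).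
Proof. by move=> m0 bF; apply: bmf_sum => j _; apply: bmfM => //; exact: bmf_cst. Qed.

End second_moment_method.

Lemma ln_eps_ge (R : realType) (eps : R) : 0 < eps -> eps < 1 / 3 ->
  ln 2 <= `|ln eps| /\ 2 / 3 <= `|ln eps|.
Proof.
move=> e0 e3; have -> : `|ln eps| = ln eps^-1.
  by rewrite ltr0_norm ?lnV ?posrE// ln_lt0// e0/=; lra.
have e3' : 3 <= eps^-1 by rewrite -[3]invrK lef_pV2 ?posrE ?invr_gt0//; lra.
split; first by apply: le_lnD; rewrite ?invr_gt0//; lra.
apply: le_trans (ln_lower _); rewrite ?invr_gt0// invrK; lra.
Qed.

(** Where the two gauges come from: E Z is of order r^4 |ln eps|, and the chains give V^2 U + 3 U^2
    V with V of order r^2 |ln eps| and U of order r^2 Lam. Divided by (E Z)^2 this is Lam + Lam^2 /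
    |ln eps|. *)
Lemma visits_energy_bound (R : realType) : exists2 c : R, 0 < c &
  forall d (T : measurableType d) (P : probability T R) (h : R) xi (k : nat) (eps : R),
  let n := (k ^ 2)%N in let r := k%:R^-1 in
  h = (64 * n%:R)^-1 -> gaussian_walk P h xi -> (50 <= k)%N -> 0 < eps -> eps < 1 / 3 -> r <= eps / 4 ->
  exists2 g, eps ^+ 2 <= g%:R * h &
  forall (J : finType) (m : J -> R) (y : J -> R * R),
  (forall j, 0 <= m j) -> \sum_j m j = 1 -> (forall j, enorm (y j) <= 1 / 3) ->
  c <= Ex P (fun w => ind R (0 < \sum_j m j * visits (h := h) (xi := xi) (1, 0) r (68 * n).+1 (2 * n) (4 * n) g (64 * n) (y j) w)) *
    \sum_j \sum_j' m j * m j' * (Lam 1 r `|y j - y j'| + Lam 1 r `|y j - y j'| ^+ 2 / `|ln eps|).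
Proof.
have [C C0 HC] := @hit_green_upper R 2 ltac:(lra).
(* 70 is twice the bound 35 for J / t0; 49 and 21 come from V <= 7 r^2 |ln eps| inserted in V^2 U
   and 3 U^2 V. *)
pose C' := C * (1 + ln 2); pose K := 70 * (49 * C' + 21 * C' ^+ 2).
have C'0 : 0 < C' by rewrite mulr_gt0// ltr_pwDl// ln_ge0// ler1n.
have C'2 : 0 < C' ^+ 2 by rewrite exprn_gt0.
have K0 : 0 < K by rewrite /K; nra.
have [a [a0 aE]] : exists a : R, 0 < a /\ a = expR (- 32) / 256.
  exists (expR (- 32) / 256); split; last exact: erefl.
  by rewrite pmulr_rgt0 ?expR_gt0 ?invr_gt0 ?ltr0n.
exists (a ^+ 2 / K); first by rewrite divr_gt0// exprn_gt0.
move=> d T P h xi k eps n r hn gw k50 e0 e3 re.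
have k0 : (0 < k)%N by exact: leq_trans k50.
have kR : 0 < k%:R :> R by rewrite ltr0n.
have n0 : (0 < n)%N by rewrite expn_gt0 k0.
have nR : 0 < n%:R :> R by rewrite ltr0n.
have r0 : 0 < r by rewrite invr_gt0.
have h0 : 0 < h by rewrite hn invr_gt0 mulr_gt0.
have hr64 : h = r ^+ 2 / 64 by rewrite hn /r natrX; field; rewrite gt_eqF.
have r20 : 0 < r ^+ 2 by rewrite exprn_gt0.
have hr : h <= r ^+ 2 by rewrite hr64; lra.
have r50 : r <= 1 / 50.
  by rewrite /r -[1 / 50]invrK lef_pV2 ?posrE ?invr_gt0// div1r invrK ler_nat.
have e20 : 0 < eps ^+ 2 by rewrite exprn_gt0.
have r16 : 16 * r ^+ 2 <= eps ^+ 2.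
  rewrite (_ : 16 * r ^+ 2 = (4 * r) ^+ 2); last by ring.
  have re4 : 4 * r <= eps by lra.
  by rewrite ler_sqr ?nnegrE// ?(ltW e0)// mulr_ge0// ltW.
pose g := (Num.trunc (eps ^+ 2 / h)).+1.
have eh0 : 0 <= eps ^+ 2 / h by rewrite divr_ge0// ltW.
have ge1 : eps ^+ 2 <= g%:R * h.
  by rewrite -ler_pdivrMr// ltW// truncnS_gt.
have ge2 : g%:R * h <= eps ^+ 2 + h.
  rewrite -ler_pdivlMr// mulrDl divff ?gt_eqF// /g -addn1 natrD lerD2r.
  by rewrite truncn_le.
exists g => // J m y m0 m1 y3.
pose V j := visits (h := h) (xi := xi) (1, 0) r (68 * n).+1 (2 * n) (4 * n) g (64 * n) (y j).
have gbig : 4 <= g%:R :> R.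
  rewrite -(ler_pM2r h0); apply: le_trans ge1; rewrite hr64; lra.
pose g' := (g./2)%N.
have gg : (2 * g' <= g)%N by rewrite /g' mul2n -[leqRHS]odd_double_half leq_addl.
have g'4 : g%:R / 4 <= g'%:R :> R.
  have : g%:R <= 1 + 2 * g'%:R :> R.
    rewrite -natrM -[1 + _](natrD R 1 (2 * g')) ler_nat /g' -{1}(odd_double_half g) -mul2n.
    by rewrite leq_add2r leq_b1.
  by move: gbig; clear; lra.
have g'0 : (0 < g')%N by rewrite -(ltr0n R); clear -g'4 gbig; lra.
pose J' := (68 * n).+1.
have n1 : 1 <= n%:R :> R by rewrite ler1n.
have J'R : J'%:R = 68 * n%:R + 1 :> R by rewrite /J' -addn1 natrD natrM.
have nh : n%:R * h = 1 / 64 by rewrite hn; field; rewrite gt_eqF.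
have Jh : J'%:R * h <= 2 by rewrite J'R mulrDl -mulrA nh mul1r; clear -nh n1 h0; nra.
have g'J : (g' <= J')%N.
  rewrite -(ler_nat R) -(ler_pM2r h0); apply: (@le_trans _ _ (g%:R * h)).
    by rewrite ler_pM2r// ler_nat; apply: leq_trans gg; rewrite leq_pmull.
  by rewrite J'R mulrDl -mulrA nh mul1r; apply: le_trans ge2 _; clear -e0 e3; nra.
have HC1 (c : R * R) i : i%:R * h <= 2 * 1 ^+ 2 ->
    \sum_(0 <= j < i) h * hitp P xi r j c <= C * r ^+ 2 * Lam 1 r `|c|.
  by move=> H; apply: HC.
set l := `|ln eps|; have [l2 l23] := ln_eps_ge e0 e3; rewrite -/l in l2 l23.
have l0 : 0 < l by apply: lt_le_trans l23; rewrite divr_gt0.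
have lnJ : 1 + ln (J'%:R / g'%:R) <= 7 * l.
  have g'R : 0 < g'%:R :> R by rewrite ltr0n.
  have Jg : J'%:R / g'%:R <= 2 * 2 * 2 * (eps^-1 * eps^-1).
    rewrite ler_pdivrMr// -(ler_pM2r h0); apply: le_trans Jh _.
    have : eps ^+ 2 / 4 <= g'%:R * h.
      apply: (@le_trans _ _ (g%:R / 4 * h)); last by rewrite ler_pM2r.
      by move: ge1; clear; lra.
    move=> H; rewrite -(mulrA _ g'%:R h).
    apply: (@le_trans _ _ (2 * 2 * 2 * (eps^-1 * eps^-1) * (eps ^+ 2 / 4))).
      by rewrite le_eqVlt; apply/orP; left; apply/eqP; field; rewrite gt_eqF.
    by apply: ler_wpM2l => //; rewrite !mulr_ge0// invr_ge0 ltW.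
  have J0 : 0 < J'%:R / g'%:R :> R by rewrite divr_gt0// ltr0n.
  have ei : 0 < eps^-1 by rewrite invr_gt0.
  have e8 : 0 < 2 * 2 * 2 * (eps^-1 * eps^-1) by rewrite !mulr_gt0.
  have lE : ln eps^-1 = l by rewrite lnV ?posrE// /l ltr0_norm// ln_lt0// e0/=; clear -e3; lra.
  have E8 : ln (2 * 2 * 2 * (eps^-1 * eps^-1)) = 3 * ln 2 + 2 * l.
    by rewrite !lnM ?posrE ?mulr_gt0// lE; ring.
  have := le_lnD J0 e8 Jg; rewrite E8; set q := ln (_ / _).
  by move: l2 l23; clear; lra.
have mom j j' : Ex P (fun w => V j w * V j' w) <= K * r ^+ 8 * l ^+ 2 *
    (Lam 1 r `|y j - y j'| + Lam 1 r `|y j - y j'| ^+ 2 / l).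
  have t00 : (0 < 2 * n)%N by rewrite muln_gt0.
  apply: le_trans (visits_second_moment h0 gw (1, 0) r0 hr Jh C0 HC1 (4 * n) (64 * n) (y j) (y j') t00 g'0 g'J gg) _.
  rewrite /Ustep /Vstep -/C'; set L := Lam _ _ _.
  have L1 : 1 <= L by exact: Lam_ge1.
  set v := 1 + ln _ in lnJ *.
  have v0 : 0 <= v by rewrite addr_ge0// ln_ge0// ler_pdivlMr ?ltr0n// mul1r ler_nat.
  have Jt : J'%:R / (2 * n)%:R <= 35 :> R.
    rewrite ler_pdivrMr ?ltr0n// J'R natrM; clear -n1; lra.
  have Jt0 : 0 <= J'%:R / (2 * n)%:R :> R by rewrite divr_ge0.
  have vv : v ^+ 2 <= 49 * l ^+ 2.
    rewrite (_ : 49 * l ^+ 2 = (7 * l) ^+ 2); last by ring.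
    by rewrite ler_sqr ?nnegrE// mulr_ge0// ltW.
  rewrite (_ : 2 * _ = 2 * r ^+ 8 * ((v ^+ 2 * C' * L + 3 * C' ^+ 2 * L ^+ 2 * v) * (J'%:R / (2 * n)%:R))); last by ring.
  rewrite (_ : K * r ^+ 8 * l ^+ 2 * (L + L ^+ 2 / l) =
     2 * r ^+ 8 * (((49 * l ^+ 2) * C' + 21 * C' ^+ 2 * l ^+ 2) * (L + L ^+ 2 / l) * 35)); last first.
    by rewrite /K; field; rewrite gt_eqF.
  rewrite ler_pM2l; last by rewrite mulr_gt0// exprn_gt0.
  have L0 : 0 <= L by exact: le_trans L1.
  have C'0' := ltW C'0; have l0' := ltW l0.
  have v2 := sqr_ge0 v; have c2 := sqr_ge0 C'; have L2 := sqr_ge0 L; have ll := sqr_ge0 l.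
  have three0 : 0 <= 3 :> R by []. have n49 : 0 <= 49 :> R by []. have n21 : 0 <= 21 :> R by [].
  apply: ler_pM => //.
    exact: (addr_ge0 (mulr_ge0 (mulr_ge0 v2 C'0') L0) (mulr_ge0 (mulr_ge0 (mulr_ge0 three0 c2) L2) v0)).
  have -> : (49 * l ^+ 2 * C' + 21 * C' ^+ 2 * l ^+ 2) * (L + L ^+ 2 / l) =
     (49 * l ^+ 2 * C' * L + 21 * C' ^+ 2 * L ^+ 2 * l) + (49 * C' * L ^+ 2 * l + 21 * C' ^+ 2 * l ^+ 2 * L).
    by field; rewrite gt_eqF.
  have p1 : 0 <= 49 * C' * L ^+ 2 * l := mulr_ge0 (mulr_ge0 (mulr_ge0 n49 C'0') L2) l0'.
  have p2 : 0 <= 21 * C' ^+ 2 * l ^+ 2 * L := mulr_ge0 (mulr_ge0 (mulr_ge0 n21 c2) ll) L0.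
  apply: (@le_trans _ _ (49 * l ^+ 2 * C' * L + 21 * C' ^+ 2 * L ^+ 2 * l)); last by rewrite lerDl addr_ge0.
  apply: lerD; first by rewrite !ler_wpM2r.
  rewrite (_ : 21 * _ * _ * l = 3 * C' ^+ 2 * L ^+ 2 * (7 * l)); last by ring.
  exact: (ler_wpM2l (mulr_ge0 (mulr_ge0 three0 c2) L2) lnJ).
have bV j : bmf (V j) by exact: (bmf_visits h0 gw).
pose Z w := \sum_j m j * V j w.
rewrite -[X in Ex P X]/(fun w => ind R (0 < Z w)).
have bZ : bmf Z by exact: bmf_lin'.
set Q := \sum_j \sum_j' _.
have Q1 : 1 <= Q.
  have -> : 1 = \sum_j \sum_j' m j * m j' :> R.
    by under eq_bigr do rewrite -mulr_sumr m1 mulr1.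
  apply: ler_sum => j _; apply: ler_sum => j' _; rewrite ler_peMr ?mulr_ge0//.
  have L1 := @Lam_ge1 R 1 r `|y j - y j'|; apply: le_trans L1 _.
  by rewrite lerDl divr_ge0 ?sqr_ge0 ?ltW.
have EZ : a * r ^+ 4 * l <= Ex P Z.
  rewrite /Z Ex_sum; last by move=> j _; apply: bmfM => //; exact: bmf_cst.
  rewrite -[leLHS]mul1r -m1 mulr_suml; apply: ler_sum => j _.
  rewrite ExZ// ler_wpM2l// aE.
  have := @visits_first_moment R d T P h xi h0 gw (1, 0) r n r0 hn n0 r50 erefl (y j) g eps (y3 j) e0 e3 re.
  apply; rewrite ge1/=; apply: le_trans ge2 _; rewrite hr64; lra.
have EZ2 : Ex P (fun w => Z w ^+ 2) <= K * r ^+ 8 * l ^+ 2 * Q.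
  rewrite (_ : Ex P _ = \sum_j \sum_j' m j * m j' * Ex P (fun w => V j w * V j' w)); last first.
    transitivity (Ex P (fun w => \sum_j \sum_j' m j * m j' * (V j w * V j' w))).
      apply: Ex_eq => w; rewrite expr2 /Z mulr_suml; apply: eq_bigr => j _.
      by rewrite mulr_sumr; apply: eq_bigr => j' _; rewrite mulrACA.
    have b2 j j' : bmf (fun w => m j * m j' * (V j w * V j' w)).
      by apply: bmfM; [apply: bmf_cst; exact: mulr_ge0|exact: bmfM].
    rewrite Ex_sum; last by move=> j _; exact: bmf_sum.
    apply: eq_bigr => j _; rewrite Ex_sum//; apply: eq_bigr => j' _.
    by rewrite ExZ ?mulr_ge0//; exact: bmfM.
  rewrite /Q mulr_sumr; apply: ler_sum => j _; rewrite mulr_sumr; apply: ler_sum => j' _.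
  by rewrite mulrCA ler_wpM2l ?mulr_ge0.
have A0 : 0 < a * r ^+ 4 * l := mulr_gt0 (mulr_gt0 a0 (exprn_gt0 4 r0)) l0.
have Q0 : 0 < Q by exact: lt_le_trans Q1.
have B0 : 0 < K * r ^+ 8 * l ^+ 2 * Q.
  exact: (mulr_gt0 (mulr_gt0 (mulr_gt0 K0 (exprn_gt0 8 r0)) (exprn_gt0 2 l0)) Q0).
have := paley_zygmund bZ A0 B0 EZ EZ2; set p := Ex P _ => H.
have rl0 : 0 < K * r ^+ 8 * l ^+ 2 := mulr_gt0 (mulr_gt0 K0 (exprn_gt0 8 r0)) (exprn_gt0 2 l0).
have L : K * r ^+ 8 * l ^+ 2 * (a ^+ 2 / K) = (a * r ^+ 4 * l) ^+ 2 by field; rewrite gt_eqF.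
by rewrite -(ler_pM2l rl0) L; apply: le_trans H _; rewrite -mulrA (mulrC Q).
Qed.

(** * The lower bound *)

Section limits.
Context {R : realType} {d} {T : measurableType d}.

(** Read off from the integral as a supremum over the simple functions below; energies of gauges are
    compared in this form. *)
Lemma ge0_integral_mono (mu : {measure set T -> \bar R}) (f g : T -> \bar R) :
  (forall x, 0 <= f x)%E -> (forall x, f x <= g x)%E ->
  (\int[mu]_x f x <= \int[mu]_x g x)%E.
Proof.
move=> f0 fg; have g0 x : (0 <= g x)%E by exact: le_trans (fg x).
rewrite !ge0_integralTE//; apply: ge_ereal_sup => _ [u uf <-].
by apply: ereal_sup_ubound; exists u => // x; exact: le_trans (uf x) (fg x).
Qed.

(** Fatou's lemma; the rank from which the inequality holds may depend on the path, as it does for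
    the mesh. *)
Lemma Ex_eventually_le (P : probability T R) (F : T -> R) (G : nat -> T -> R) (M : R) :
  bmf F -> (forall n, bmf (G n)) -> (forall n, Ex P (G n) <= M) ->
  (forall w, exists n0, forall n, (n0 <= n)%N -> F w <= G n w) -> Ex P F <= M.
Proof.
move=> bF bG GM FG; rewrite -lee_fin -ExE//.
apply: (@le_trans _ _ (\int[P]_w limn_einf (fun n => (G n w)%:E))%E).
  apply: ge0_integral_mono => w; first by rewrite lee_fin; exact: bmf_ge0 bF.
  rewrite limn_einf_lim; apply: lime_ge; first exact: is_cvg_einfs.
  have [n0 Hn0] := FG w; exists n0 => // n /= n0n.
  by apply: le_ereal_inf_tmp => _ [k /= nk <-]; rewrite lee_fin Hn0// (leq_trans n0n).
apply: le_trans (fatou P measurableT _ _) _.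
- by move=> n; exact: bmf_EFin.
- by move=> n w _; rewrite lee_fin; exact: bmf_ge0 (bG n).
rewrite limn_einf_lim; apply: lime_le; first exact: is_cvg_einfs.
apply: nearW => n; apply: ereal_inf_le; exists (Ex P (G n))%:E; last by rewrite lee_fin.
by exists n => //=; rewrite ExE.
Qed.

End limits.

Section cells.
Context {R : realType}.
Notation pt := (R * R)%type.

(* Cells of mesh 1/k of the square [-1/2, 1/2[^2. *)
Definition initv (k i : nat) (t : R) : bool := i%:R <= (t + 1 / 2) * k%:R < i.+1%:R.
Definition incell k (j : 'I_k * 'I_k) (x : pt) : bool := initv k j.1 x.1 && initv k j.2 x.2.

Lemma initv_ex k t : (0 < k)%N -> `|t| <= 1 / 3 -> exists i : 'I_k, initv k i t.
Proof.
move=> k0; rewrite ler_norml => /andP[t1 t2].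
have kR : 0 < k%:R :> R by rewrite ltr0n.
have u0 : 0 <= (t + 1 / 2) * k%:R by rewrite mulr_ge0 ?ltW//; lra.
have uk : (Num.trunc ((t + 1 / 2) * k%:R) < k)%N by rewrite truncn_lt_nat// gtr_pMl//; lra.
by exists (Ordinal uk); rewrite /initv/= truncn_itv.
Qed.

Lemma incell_ex k (x : pt) : (0 < k)%N -> `|x| <= 1 / 3 -> exists j : 'I_k * 'I_k, incell j x.
Proof.
move=> k0 x3.
have [i Hi] := initv_ex k0 (le_trans (fst_le_norm x) x3).
have [l Hl] := initv_ex k0 (le_trans (snd_le_norm x) x3).
by exists (i, l); rewrite /incell Hi Hl.
Qed.

Lemma initv_uniq k i l t : initv k i t -> initv k l t -> i = l.
Proof. by move=> /truncn_def <- /truncn_def. Qed.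

Lemma incell_uniq k (j j' : 'I_k * 'I_k) (x : pt) : incell j x -> incell j' x -> j = j'.
Proof.
case: j j' => [a b] [a' b'] /andP[/= h1 h2] /andP[/= h3 h4].
by congr pair; apply: val_inj; [exact: initv_uniq h1 h3|exact: initv_uniq h2 h4].
Qed.

Lemma initv_close k i s t : (0 < k)%N -> initv k i s -> initv k i t -> `|s - t| <= k%:R^-1.
Proof.
move=> k0 /andP[h1 h2] /andP[h3 h4]; have kR : 0 < k%:R :> R by rewrite ltr0n.
rewrite -(ler_pM2r kR) mulVf ?gt_eqF// -[X in _ * X](gtr0_norm kR) -normrM mulrBl ler_norml.
by move: h1 h2 h3 h4; rewrite -natr1 !mulrDl => *; apply/andP; split; lra.
Qed.

Lemma incell_close k (j : 'I_k * 'I_k) (x y : pt) : (0 < k)%N -> incell j x -> incell j y -> `|x - y| <= k%:R^-1.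
Proof.
move=> k0 /andP[h1 h2] /andP[h3 h4].
by rewrite prod_normE/= ge_max (initv_close k0 h1 h3) (initv_close k0 h2 h4).
Qed.

Lemma bmf_incell d (T : measurableType d) (X : T -> pt) k (j : 'I_k * 'I_k) :
  measurable_fun setT X -> bmf (fun w => ind R (incell j (X w))).
Proof.
move=> mX.
have H (f : T -> R) i : measurable_fun setT f -> bmf (fun w => ind R (initv k i (f w))).
  move=> mf; have mu : measurable_fun setT (fun w => (f w + 1 / 2) * k%:R).
    by apply: measurable_funM => //; apply: measurable_funD.
  apply: bmf_bool; apply: measurable_and.
    exact: measurable_fun_ler.
  exact: measurable_fun_ltr.
apply: (@bmf_eq _ _ _ (fun w => ind R (initv k j.1 (X w).1) * ind R (initv k j.2 (X w).2))).
  by move=> w; rewrite /incell /ind; case: initv; case: initv; rewrite ?mul1r ?mul0r.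
apply: bmfM; apply: H; exact: measurableT_comp mX.
Qed.

Lemma sum_incell k (x : pt) : (0 < k)%N -> `|x| <= 1 / 3 -> exists2 j : 'I_k * 'I_k, incell j x &
  forall F : 'I_k * 'I_k -> R, \sum_i ind R (incell i x) * F i = F j.
Proof.
move=> k0 x3; have [j Hj] := incell_ex k0 x3; exists j => // F.
rewrite (bigD1 j)//= Hj /ind mul1r big1 ?addr0// => i ij.
have [Hi|_] := boolP (incell i x); last by rewrite mul0r.
by move: ij; rewrite (incell_uniq Hi Hj) eqxx.
Qed.

End cells.

Section gauges.
Context {R : realType}.

Definition rgauge (eps t : R) : R := if eps <= t then `|ln t| else ln t ^+ 2 / `|ln eps|.

Lemma gauge_fE (t : R) : 0 < t -> gauge_f t = `|ln t|%:E.
Proof. by move=> t0; rewrite /gauge_f lne_EFin. Qed.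

Lemma gauge_gE (t : R) : 0 < t -> gauge_g t = (ln t ^+ 2)%:E.
Proof. by move=> t0; rewrite /gauge_g lne_EFin// EFin_expe. Qed.

Lemma gauge_ratio (eps : R) : 0 < eps -> eps < 1 ->
  (gauge_f eps / gauge_g eps = `|ln eps|^-1%:E)%E.
Proof.
move=> e0 e1; rewrite gauge_fE// gauge_gE//.
have l0 : ln eps < 0 by rewrite ln_lt0// e0.
rewrite inver gt_eqF ?exprn_even_gt0//= ?lt_eqF//.
by rewrite -EFinM ltr0_norm//; congr EFin; field; rewrite lt_eqF.
Qed.

Lemma gauge_epsE (eps t : R) : 0 < eps -> eps < 1 -> 0 < t ->
  gauge_eps eps t = (rgauge eps t)%:E.
Proof.
move=> e0 e1 t0; rewrite /gauge_eps /rgauge; case: ifP => _; first exact: gauge_fE.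
by rewrite gauge_ratio// gauge_gE// -EFinM.
Qed.

Lemma gauge_eps0 (eps : R) : 0 < eps -> eps < 1 -> gauge_eps eps 0 = +oo%E.
Proof.
move=> e0 e1; rewrite /gauge_eps leNgt e0/= gauge_ratio// /gauge_g.
have -> : lne (0 : R)%:E = -oo%E by rewrite le0_lneNy.
by rewrite expe2 mulNyNy gt0_mulye// lte_fin invr_gt0 normr_gt0 lt_eqF// ln_lt0// e0.
Qed.

Lemma gauge_eps_ge0 (eps t : R) : (0 <= gauge_eps eps t)%E.
Proof.
rewrite /gauge_eps; case: ifP => _; first exact: abse_ge0.
by rewrite mule_ge0//; [exact: sqre_ge0|rewrite mule_ge0 ?abse_ge0// inve_ge0; exact: sqre_ge0].
Qed.

(** With u = |ln t| and l = |ln eps| the gauge is the larger of u and u^2 / l. Since Lam <= 7 u, the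
    constant is 56 = 7 + 49. The hypothesis t <= 2 x relates Euclidean to max norm. *)
Lemma Lam_le_gauge (eps r t x : R) : 0 < eps -> eps < 1 / 3 -> 0 < r -> 0 < t -> t <= 2 / 3 -> t <= 2 * x ->
  Lam 1 r x + Lam 1 r x ^+ 2 / `|ln eps| <= 56 * rgauge eps t.
Proof.
move=> e0 e3 r0 t0 t3 tx.
have [l2 l23] := ln_eps_ge e0 e3.
set l := `|ln eps| in l2 l23 *; have lE : l = - ln eps by rewrite /l ltr0_norm// ln_lt0// e0/=; lra.
set u := `|ln t|; have uE : u = - ln t by rewrite /u ltr0_norm// ln_lt0// t0/=; lra.
have u3 : 1 / 3 <= u.
  rewrite uE -lnV ?posrE//; apply: le_trans (ln_lower _); rewrite ?invr_gt0// invrK; lra.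
have LamU : Lam 1 r x <= 7 * u.
  rewrite /Lam; have m0 : 0 < Num.max x r by rewrite lt_max r0 orbT.
  have tm : t / 2 <= Num.max x r by rewrite le_max; apply/orP; left; lra.
  have : ln (Num.max 1 (1 / Num.max x r)) <= ln (2 * t^-1).
    apply: le_lnD; rewrite ?mulr_gt0 ?invr_gt0 ?lt_max ?ltr01// ge_max; apply/andP; split.
      by rewrite ler_pdivlMr// mul1r; lra.
    by rewrite div1r -[2]invrK -invfM lef_pV2 ?posrE ?mulr_gt0 ?invr_gt0// mulrC.
  rewrite lnM ?posrE ?invr_gt0// lnV ?posrE// -uE.
  have : ln 2 <= 1 :> R by apply: le_trans (ln_upper _) _ => //; lra.
  by set q := ln (Num.max _ _); set q2 := ln 2; lra.
have L1 := @Lam_ge1 R 1 r x; set L := Lam 1 r x in LamU L1 *.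
have l0 : 0 < l by lra.
have L2 : L ^+ 2 <= 49 * u ^+ 2.
  by rewrite (_ : 49 * u ^+ 2 = (7 * u) ^+ 2); [rewrite ler_sqr ?nnegrE; lra|ring].
have L2l : L ^+ 2 / l <= 49 * (u ^+ 2 / l) by rewrite mulrA ler_pM2r ?invr_gt0.
rewrite /rgauge -/u -/l; have [et|te] := leP eps t.
  have : u ^+ 2 / l <= u.
    rewrite ler_pdivrMr// expr2 ler_wpM2l//; first lra.
    by rewrite uE lE lerN2 le_lnD.
  lra.
have : u <= u ^+ 2 / l.
  rewrite ler_pdivlMr// expr2 ler_wpM2l//; first lra.
  by rewrite uE lE lerN2 le_lnD// ltW.
have -> : ln t ^+ 2 = u ^+ 2 by rewrite uE sqrrN.
lra.
Qed.

End gauges.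

Lemma enorm_triangle (R : realType) (x y : R * R) : enorm (x - y) <= enorm x + enorm y.
Proof.
have ex := enorm_ge0 x; have ey := enorm_ge0 y.
rewrite -ler_sqr ?nnegrE ?enorm_ge0 ?addr_ge0// [leRHS]sqrrD !enorm_sqr/=.
have : - (x.1 * y.1 + x.2 * y.2) <= enorm x * enorm y.
  apply: le_trans (ler_norm _) _; rewrite normrN.
  rewrite -(ger0_norm (mulr_ge0 ex ey)) -ler_sqr ?nnegrE//.
  rewrite !real_normK ?num_real// exprMn !enorm_sqr.
  by have := sqr_ge0 (x.1 * y.2 - x.2 * y.1); nra.
by rewrite -mulr_natl; set q := enorm x * _; nra.
Qed.

Lemma dblpt_escape (R : realType) (x : R * R) : `|x| <= 2 -> enorm x <= 29 / 10.
Proof.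
move=> x2; have n0 : 0 <= 29 / 10 :> R by rewrite divr_ge0.
rewrite -(ger0_norm n0) -sqrtr_sqr ler_sqrt ?sqr_ge0//.
have H (a : R) : `|a| <= `|x| -> a ^+ 2 <= 4.
  move=> ax; rewrite -(real_normK (num_real a)) (_ : 4 = 2 ^+ 2); last by ring.
  by rewrite ler_sqr ?nnegrE// (le_trans ax).
have := H _ (fst_le_norm x); have := H _ (snd_le_norm x); lra.
Qed.

(** Moving two points inside their cells changes [Lam] by a factor at most 1 + ln 3 <= 3, hence its
    square by 9, and 504 = 9 * 56. *)
Lemma cell_approximation (R : realType) (A : set (R * R)) (mu : probability (R * R)%type R) (k : nat) (eps : R) :
  closed A -> A `<=` [set x | enorm x <= 1 / 3] -> mu A = 1%E -> (0 < k)%N -> 0 < eps -> eps < 1 / 3 ->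
  exists m : 'I_k * 'I_k -> R, exists y : 'I_k * 'I_k -> R * R,
  [/\ forall j, 0 <= m j, \sum_j m j = 1, forall j, enorm (y j) <= 1 / 3,
      forall j, m j != 0 -> A (y j) &
      forall M, (energy (gauge_eps eps) mu <= M%:E)%E ->
       \sum_j \sum_j' m j * m j' * (Lam 1 k%:R^-1 `|y j - y j'| + Lam 1 k%:R^-1 `|y j - y j'| ^+ 2 / `|ln eps|) <= 504 * M].
Proof.
move=> cA A3 muA k0 e0 e3.
have mA : measurable A by exact: measurable_closed_plane.
have e1 : eps < 1 by lra.
have mb : measurable_fun [set: R * R] (fun x => `[< A x >]).
  apply: (measurable_fun_bool true); rewrite (_ : _ @^-1` _ = A) ?setTI//.
  by apply/seteqP; split => x /=; [move=> H'; apply/asboolP; exact: H'|move=> Ax; apply/asboolP].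
pose a x := ind R `[< A x >].
have ba : bmf a by exact: bmf_bool.
have Ea : Ex mu a = 1.
  rewrite /a Ex_bool// (_ : [set w | `[< A w >]] = A) ?muA//.
  by apply/seteqP; split => x /asboolP.
have bA3 x : A x -> `|x| <= 1 / 3 by move=> Ax; apply: le_trans (norm_le_enorm x) (A3 _ Ax).
pose m (j : 'I_k * 'I_k) := Ex mu (fun x => a x * ind R (incell j x)).
have bm' (j : 'I_k * 'I_k) : bmf (fun x => a x * ind R (incell j x)).
  by apply: bmfM => //; exact: (bmf_incell j (@measurable_id _ _ _)).
have m0 (j : 'I_k * 'I_k) : 0 <= m j by exact: Ex_ge0.
have cell1 x : a x * \sum_(j : 'I_k * 'I_k) ind R (incell j x) = a x.
  rewrite /a; case: asboolP => [Ax|_]; rewrite /ind/= ?mul0r// mul1r.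
  have [j _ Hj] := sum_incell k0 (bA3 _ Ax).
  transitivity (\sum_(i : 'I_k * 'I_k) ind R (incell i x) * 1); last exact: (Hj (fun=> 1)).
  by apply: eq_bigr => i _; rewrite mulr1.
have m1 : \sum_j m j = 1.
  rewrite -Ex_sum// -[RHS]Ea; apply: Ex_eq => x; rewrite -mulr_sumr; exact: cell1.
(* A cell meeting [A] is represented by one of its points in [A], so that limits stay in [A]; a cell
   missing [A] has mass 0 and receives the dummy point 0. *)
have ypos (j : 'I_k * 'I_k) : exists y, enorm y <= 1 / 3 /\
    ((exists y, A y /\ incell j y) -> A y /\ incell j y).
  have [[y [Ay jy]]|ny] := pselect (exists y, A y /\ incell j y).
    by exists y; split => //; exact: A3.
  by exists 0; split => //; rewrite /enorm/= expr0n/= addr0 sqrtr0 divr_ge0.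
pose y j := projT1 (cid (ypos j)).
have yP j : enorm (y j) <= 1 / 3 /\ ((exists y, A y /\ incell j y) -> A (y j) /\ incell j (y j)).
  exact: (projT2 (cid (ypos j))).
exists m, y; split => // [j|j|M EM].
- by case: (yP j).
- move=> mj0; suff /(yP j).2[] : exists y, A y /\ incell j y by [].
  apply: contrapT => ny; move/eqP: mj0; apply.
  rewrite /m -(Ex_cst mu 0); apply: Ex_eq => x.
  rewrite /a; case: asboolP => [Ax|_]; rewrite /ind ?mul0r//.
  by case: (boolP (incell j x)) => [jx|_]; rewrite ?mulr0//; case: ny; exists x.
pose K (j j' : 'I_k * 'I_k) := Lam 1 k%:R^-1 `|y j - y j'| + Lam 1 k%:R^-1 `|y j - y j'| ^+ 2 / `|ln eps|.
have K0 j j' : 0 <= K j j' by rewrite addr_ge0 ?Lam_ge0// divr_ge0 ?sqr_ge0.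
pose F x x' := a x * (a x' * \sum_j ind R (incell j x) * \sum_j' ind R (incell j' x') * K j j').
have bF2 : bmf (fun z : (R * R) * (R * R) => F z.1 z.2).
  apply: bmfM; first exact: (bmf_comp measurable_fst ba).
  apply: bmfM; first exact: (bmf_comp measurable_snd ba).
  apply: bmf_sum => j _; apply: bmfM; first exact: (bmf_incell j (@measurable_fst _ _ _ _)).
  apply: bmf_sum => j' _; apply: bmfM; first exact: (bmf_incell j' (@measurable_snd _ _ _ _)).
  exact: bmf_cst.
have bF x : bmf (F x) by exact: (bmf_section1 x bF2).
have E : Ex mu (fun x => Ex mu (F x)) = \sum_j \sum_j' m j * m j' * K j j'.
  transitivity (Ex mu (fun x => \sum_j (\sum_j' m j' * K j j') * (a x * ind R (incell j x)))).
    apply: Ex_eq => x.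
    transitivity (Ex mu (fun x' => \sum_j a x * ind R (incell j x) * \sum_j' K j j' * (a x' * ind R (incell j' x')))).
      apply: Ex_eq => x'; rewrite /F mulrA mulr_sumr; apply: eq_bigr => j _.
      rewrite mulr_sumr mulr_sumr mulr_sumr; apply: eq_bigr => j' _; ring.
    have b1 j : bmf (fun x' => \sum_j' K j j' * (a x' * ind R (incell j' x'))).
      by apply: bmf_sum => j' _; apply: bmfM; [exact: bmf_cst|exact: bm'].
    have a0 j : 0 <= a x * ind R (incell j x) by rewrite mulr_ge0.
    rewrite Ex_sum; last by move=> j _; apply: bmfM; [exact: bmf_cst|exact: b1].
    apply: eq_bigr => j _; rewrite ExZ// mulrC; congr (_ * _).
    rewrite Ex_sum; last by move=> j' _; apply: bmfM; [exact: bmf_cst|exact: bm'].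
    by apply: eq_bigr => j' _; rewrite ExZ// mulrC.
  have c0' j : 0 <= \sum_j' m j' * K j j' by apply: sumr_ge0 => j' _; exact: mulr_ge0.
  rewrite Ex_sum; last by move=> j _; apply: bmfM; [exact: bmf_cst|exact: bm'].
  apply: eq_bigr => j _; rewrite ExZ// mulr_suml; apply: eq_bigr => j' _.
  by rewrite -/(m j); ring.
have c504 : 0 < 504 :> R by rewrite ltr0n.
have kR : 0 < k%:R^-1 :> R by rewrite invr_gt0 ltr0n.
have FG x x' : ((504^-1 * F x x')%:E <= gauge_eps eps (enorm (x - x')%R))%E.
  rewrite /F /a; case: asboolP => [Ax|_]; last by rewrite /ind mul0r mulr0; exact: gauge_eps_ge0.
  case: asboolP => [Ax'|_]; last by rewrite /ind mul0r !mulr0; exact: gauge_eps_ge0.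
  rewrite /ind/= !mul1r.
  have [j jx HF] := sum_incell k0 (bA3 _ Ax).
  rewrite (HF (fun j => \sum_j' ind R (incell j' x') * K j j')) => {HF}.
  have [j' jx' HF'] := sum_incell k0 (bA3 _ Ax').
  rewrite (HF' (K j)) => {HF'}.
  have [_ yj] := (yP j).2 (ex_intro _ x (conj Ax jx)).
  have [_ yj'] := (yP j').2 (ex_intro _ x' (conj Ax' jx')).
  have [->|xx] := eqVneq (enorm (x - x')) 0.
    by rewrite gauge_eps0// leey.
  have t0 : 0 < enorm (x - x') by rewrite lt_neqAle eq_sym xx enorm_ge0.
  have t3 : enorm (x - x') <= 2 / 3.
    have := enorm_triangle x x'.
    have := A3 _ Ax; have := A3 _ Ax'; rewrite /=; clear; lra.
  rewrite gauge_epsE// lee_fin ler_pdivrMl//.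
  apply: (@le_trans _ _ (9 * (56 * rgauge eps (enorm (x - x'))))); last by rewrite mulrA -natrM.
  have := @Lam_le_gauge R eps k%:R^-1 (enorm (x - x')) `|x - x'| e0 e3 kR t0 t3 (enorm_le_norm _).
  have LL : Lam 1 k%:R^-1 `|y j - y j'| <= 3 * Lam 1 k%:R^-1 `|x - x'|.
    apply: (@le_trans _ _ ((1 + ln 3) * Lam 1 k%:R^-1 `|x - x'|)); last first.
      rewrite ler_wpM2r ?Lam_ge0//.
      by have := @ln_upper R 3 (ltr0n R 3); clear; lra.
    apply: Lam_scale => //; first by rewrite ler1n.
    rewrite mul1r mulr1 ge_max; apply/andP; split.
      have -> : x - x' = (x - y j) + ((y j - y j') + (y j' - x')) by rewrite !addrA !subrK.
      apply: le_trans (ler_normD _ _) _; apply: le_trans (lerD (lexx _) (ler_normD _ _)) _.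
      have := incell_close k0 jx yj; have := incell_close k0 yj' jx'.
      have : `|y j - y j'| <= Num.max `|y j - y j'| k%:R^-1 by rewrite le_max lexx.
      have : k%:R^-1 <= Num.max `|y j - y j'| k%:R^-1 by rewrite le_max lexx orbT.
      by set u := Num.max _ _; set v := `|y j - _|; set p := `|_|; set q := `|_|; clear; lra.
    apply: (@le_trans _ _ (3 * k%:R^-1)); first by rewrite ler_peMl// ?(ltW kR)// ler1n.
    by rewrite ler_pM2l// le_max lexx orbT.
  set L' := Lam _ _ `|x - x'| in LL *; rewrite /K; set L := Lam _ _ `|_| in LL *.
  have L0 : 0 <= L by exact: Lam_ge0.
  have L'0 : 0 <= L' by exact: Lam_ge0.
  have LL2 : L ^+ 2 / `|ln eps| <= 9 * (L' ^+ 2 / `|ln eps|).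
    rewrite mulrA; apply: ler_wpM2r; first by rewrite invr_ge0.
    by rewrite (_ : 9 * L' ^+ 2 = (3 * L') ^+ 2); [rewrite ler_sqr ?nnegrE// mulr_ge0|ring].
  have : 0 <= L' ^+ 2 / `|ln eps| by rewrite divr_ge0 ?sqr_ge0.
  by set u := L ^+ 2 / _; set v := L' ^+ 2 / _; set q := rgauge _ _; move: LL2; rewrite -/u -/v; lra.
have i504 : 0 <= 504^-1 :> R by rewrite invr_ge0 ltW.
rewrite -E -ler_pdivrMl// -lee_fin; apply: le_trans EM.
have bFF := @bmf_Ex _ _ _ mu _ _ F bF2.
rewrite -ExZ// -ExE; last by apply: bmfM => //; exact: bmf_cst.
apply: ge0_integral_mono => x; first by rewrite lee_fin mulr_ge0// Ex_ge0.
rewrite -ExZ// -ExE; last by apply: bmfM => //; exact: bmf_cst.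
by apply: ge0_integral_mono => x'; [rewrite lee_fin mulr_ge0// (bmf_ge0 x' (bF x))|exact: FG].
Qed.

Lemma horizon_bound (n : nat) : (0 < n)%N -> ((68 * n).+1 <= 2 * (64 * n))%N.
Proof. by lia. Qed.

(** A positive count contains a pair of grid times with all the required properties; between grid
    times, confinement is known at distance at most [h]. *)
Lemma visits_approx_dblpt (R : realType) d (T : measurableType d) (B : R -> T -> R * R) (x0 : R * R) (A : set (R * R))
    (h r eps e : R) J t0 t1 g t2 (y : R * R) (w : T) :
  0 < h -> 0 <= r -> J%:R * h <= 2 -> h <= e -> 2 * r <= e -> eps ^+ 2 <= g%:R * h -> A y ->
  (forall k, x0 + wsum (bm_step B h) 0 k w = B (k%:R * h) w) ->
  0 < visits (h := h) (xi := bm_step B h) x0 r J t0 t1 g t2 y w ->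
  exists p, approx_dblpt (B ^~ w) 2 (29 / 10) (eps ^+ 2) A e p.
Proof.
move=> h0 r0 Jh he re ge Ay BS V0.
have [i [j [ij vis_i vis_j al]]] : exists i j : 'I_J, [/\ (i + g <= j)%N,
    `|x0 + wsum (bm_step B h) 0 i w - y| <= r, `|x0 + wsum (bm_step B h) 0 j w - y| <= r &
    alive (xi := bm_step B h) x0 j w != 0].
  apply: contrapT => nE; move: V0; rewrite /visits big1 ?mulr0 ?ltxx// => i _.
  rewrite big1// => j _; apply/eqP; apply: contrapT => /negP.
  rewrite !mulf_eq0 !negb_or /vis /ind !pnatr_eq0 !eqb0 !negbK => /andP[/and3P[_ ij _] /andP[/andP[vi vj] al]].
  by apply: nE; exists i, j; split.
have hk (k : nat) : 0 <= k%:R * h by rewrite mulr_ge0// ltW.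
have kJ (k : 'I_J) : k%:R * h <= 2 by apply: le_trans Jh; rewrite ler_pM2r// ler_nat ltnW.
exists (i%:R * h, j%:R * h); split => /=.
- by rewrite hk kJ.
- by rewrite hk kJ.
- have : (i + g)%:R * h <= j%:R * h by rewrite ler_pM2r// ler_nat.
  by rewrite natrD mulrDl; move: ge; lra.
- rewrite -!BS; split.
    rewrite -(subrK y (x0 + wsum _ 0 i w)) -addrA; apply: le_trans (ler_normD _ _) _.
    by rewrite (distrC y); move: vis_i vis_j; set u := `|_|; set v := `|_|; lra.
  by exists y => //; apply: le_trans vis_i _; lra.
move=> u /andP[u0 uj]; have uh0 : 0 <= u / h by rewrite divr_ge0// ltW.
exists ((Num.trunc (u / h))%:R * h); split; first exact: hk.
  have := truncn_itv uh0; rewrite ler_pdivlMr// ltr_pdivrMr// -natr1 mulrDl mul1r => /andP[k1 k2].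
  by rewrite ger0_norm; lra.
apply: dblpt_escape; rewrite -BS; apply: (alive_all al).
rewrite -(ler_nat R) -(ler_pM2r h0); apply: le_trans (_ : _ <= u) _.
  by have := truncn_itv uh0; rewrite ler_pdivlMr// => /andP[].
lra.
Qed.

(** The grids are refined along k = k0 + n with [eps] and [mu] fixed; [k0] ensures r <= eps / 4 and
    k >= 50. Since the bound does not depend on n, it passes to the limiting event. *)
Lemma double_point_lower (R : realType) : exists2 c : R, 0 < c &
  forall d (T : measurableType d) (P : probability T R) (B : R -> T -> R * R),
  planar_brownian_motion P (1, 0) B ->
  forall A : set (R * R), closed A -> A `<=` [set x | enorm x <= 1 / 3] ->
  forall (eps : R) (mu : probability (R * R)%type R) (M : R), 0 < eps -> eps < 1 / 3 -> mu A = 1%E ->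
  (energy (gauge_eps eps) mu <= M%:E)%E ->
  c <= fine (P [set w | exists x, dblpt (B ^~ w) 2 (29 / 10) (eps ^+ 2) x /\ A x]) * M.
Proof.
have [c0 c00 Hc0] := visits_energy_bound R.
have c504 : 0 < 504 :> R by rewrite ltr0n.
exists (c0 / 504); first exact: divr_gt0.
move=> d T P B bm A cA A3 eps mu M e0 e3 muA EM.
have e20 : 0 < eps ^+ 2 by rewrite exprn_gt0.
pose H := [set w | exists x, dblpt (B ^~ w) 2 (29 / 10) (eps ^+ 2) x /\ A x].
have mH : measurable H by exact: (measurable_dblpt bm 2 (29 / 10) e20 cA).
pose k0 := (50 + (Num.trunc (4 / eps)).+1)%N.
pose k n := (k0 + n)%N.
have kn50 n : (50 <= k n)%N by rewrite /k /k0 -addnA leq_addr.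
have kn0 n : (0 < k n)%N by exact: leq_trans (kn50 n).
pose r n : R := (k n)%:R^-1; pose N n := (k n ^ 2)%N; pose h n : R := (64 * (N n)%:R)^-1.
have knR n : 0 < (k n)%:R :> R by rewrite ltr0n.
have r0 n : 0 < r n by rewrite invr_gt0.
have re n : r n <= eps / 4.
  rewrite /r -[leRHS]invrK lef_pV2 ?posrE ?invr_gt0 ?divr_gt0// invf_div.
  apply: le_trans (ltW (truncnS_gt (4 / eps))) _; rewrite ler_nat /k /k0.
  by rewrite (addnC 50) -addnA leq_addr.
have h0 n : 0 < h n by rewrite invr_gt0 mulr_gt0// ltr0n expn_gt0 kn0.
have [m [y my]] : exists (m : forall n, 'I_(k n) * 'I_(k n) -> R) (y : forall n, 'I_(k n) * 'I_(k n) -> R * R),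
    forall n, [/\ forall j, 0 <= m n j, \sum_j m n j = 1, forall j, enorm (y n j) <= 1 / 3,
      forall j, m n j != 0 -> A (y n j) &
      \sum_j \sum_j' m n j * m n j' * (Lam 1 (r n) `|y n j - y n j'| + Lam 1 (r n) `|y n j - y n j'| ^+ 2 / `|ln eps|) <= 504 * M].
  have ca n : exists p : ('I_(k n) * 'I_(k n) -> R) * ('I_(k n) * 'I_(k n) -> R * R),
      [/\ forall j, 0 <= p.1 j, \sum_j p.1 j = 1, forall j, enorm (p.2 j) <= 1 / 3,
      forall j, p.1 j != 0 -> A (p.2 j) &
      \sum_j \sum_j' p.1 j * p.1 j' * (Lam 1 (r n) `|p.2 j - p.2 j'| + Lam 1 (r n) `|p.2 j - p.2 j'| ^+ 2 / `|ln eps|) <= 504 * M].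
    have [m [y [h1 h2 h3 h4 h5]]] := cell_approximation cA A3 muA (kn0 n) e0 e3.
    by exists (m, y); split => //; exact: h5.
  exists (fun n => (projT1 (cid (ca n))).1), (fun n => (projT1 (cid (ca n))).2) => n.
  exact: (projT2 (cid (ca n))).
pose V n g j := visits (h := h n) (xi := bm_step B (h n)) (1, 0) (r n) (68 * N n).+1 (2 * N n) (4 * N n) g (64 * N n) (y n j).
have Hn n : exists g : nat, eps ^+ 2 <= g%:R * h n /\
   c0 / 504 <= Ex P (fun w => ind R (0 < \sum_j m n j * V n g j w)) * M.
  have [m0 m1 y3 _ Q] := my n.
  have [g ge Hg] := Hc0 d T P (h n) (bm_step B (h n)) (k n) eps erefl (bm_walk bm (h0 n)) (kn50 n) e0 e3 (re n).
  exists g; split => //; rewrite ler_pdivrMr// -mulrA (mulrC M).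
  apply: le_trans (Hg _ (m n) (y n) m0 m1 y3) _; apply: ler_wpM2l Q.
  apply: Ex_ge0; apply: bmf_bool; apply: measurable_fun_ltr => //; apply: bmf_meas.
  by apply: bmf_lin' => // j; exact: (bmf_visits (h0 n) (bm_walk bm (h0 n))).
pose g n := projT1 (cid (Hn n)).
pose Z n w := \sum_j m n j * V n (g n) j w.
have [gE HZ] : (forall n, eps ^+ 2 <= (g n)%:R * h n) /\
    forall n, c0 / 504 <= Ex P (fun w => ind R (0 < Z n w)) * M.
  by split => n; have := projT2 (cid (Hn n)) => -[].
have mZ n : measurable_fun setT (fun w => 0 < Z n w).
  apply: measurable_fun_ltr => //; apply: bmf_meas; have [m0 _ _ _ _] := my n.
  by apply: bmf_lin' => // j; exact: (bmf_visits (h0 n) (bm_walk bm (h0 n))).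
have bI n : bmf (fun w => ind R (0 < Z n w)) by exact: bmf_bool.
have p01 n : 0 <= Ex P (fun w => ind R (0 < Z n w)) by exact: Ex_ge0.
have M0 : 0 < M.
  rewrite ltNge; apply/negP => M0; have := HZ 0%N; rewrite leNgt => /negP; apply.
  by apply: le_lt_trans (_ : _ <= 0) _; [rewrite mulr_ge0_le0|exact: divr_gt0].
have mHb : measurable_fun setT (fun w => `[< H w >]).
  apply: (measurable_fun_bool true); rewrite (_ : _ @^-1` _ = H) ?setTI//.
  by apply/seteqP; split => x /=; [move=> H'; apply/asboolP; exact: H'|move=> Ax; apply/asboolP].
have comp1 (b : T -> bool) : measurable_fun setT b ->
    Ex P (fun w => ind R (~~ b w)) = 1 - Ex P (fun w => ind R (b w)).
  move=> mb; apply/eqP; rewrite eq_sym subr_eq -ExD; last 2 first.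
  - by apply: bmf_bool; exact: measurable_neg.
  - exact: bmf_bool.
  apply/eqP; rewrite -(Ex_cst P 1); apply: Ex_eq => w.
  by rewrite /ind; case: (b w); rewrite ?add0r ?addr0.
have PH : fine (P H) = Ex P (fun w => ind R `[< H w >]).
  by rewrite Ex_bool//; congr (fine (P _)); apply/seteqP; split => w /asboolP.
have b1 : bmf (fun w => ind R (~~ `[< H w >])) by apply: bmf_bool; exact: measurable_neg.
have b2 n : bmf (fun w => ind R (~~ (0 < Z n w))) by apply: bmf_bool; exact: measurable_neg.
have b3 n : Ex P (fun w => ind R (~~ (0 < Z n w))) <= 1 - c0 / 504 / M.
  by rewrite comp1// lerD2l lerN2 ler_pdivrMr.
(* Fatou is applied to the complements: on a path outside [H] the count vanishes from some n on,
   since positive counts along arbitrarily fine grids would cluster at a double point in [A]. *)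
suff b4 w : exists n0, forall n, (n0 <= n)%N -> ind R (~~ `[< H w >]) <= ind R (~~ (0 < Z n w)).
  by have := Ex_eventually_le b1 b2 b3 b4; rewrite comp1// -PH lerD2l lerN2 ler_pdivrMr.
have [Hw|nHw] := pselect (H w).
  by exists 0%N => n _; rewrite (asboolT Hw) /ind ler0n.
suff [n0 Hn0] : exists n0, forall n, (n0 <= n)%N -> ~ 0 < Z n w.
  by exists n0 => n /Hn0/negP ->; rewrite /ind; case: asboolP.
apply: contrapT => nE; apply: nHw; apply: (dblpt_cluster (bm_continuous bm (w := w)) e20 cA) => e ee0.
have [n [en Zn]] : exists n, (Num.trunc (2 / e) <= n)%N /\ 0 < Z n w.
  apply: contrapT => nn; apply: nE; exists (Num.trunc (2 / e)) => n en Zn.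
  by apply: nn; exists n.
have [m0 m1 y3 mA Q] := my n.
have [j mj Vj] : exists2 j, m n j != 0 & 0 < V n (g n) j w.
  apply: contrapT => nj; move: Zn; rewrite /Z big1 ?ltxx// => j _.
  have [->|mj] := eqVneq (m n j) 0; first by rewrite mul0r.
  have V0 : 0 <= V n (g n) j w by exact: bmf_ge0 (bmf_visits (h0 n) (bm_walk bm (h0 n)) _ _ _ _ _ _ _ _).
  move: V0; rewrite le_eqVlt => /predU1P[<-|Vp]; first by rewrite mulr0.
  by case: nj; exists j.
have re2 : 2 * r n <= e.
  rewrite /r ler_pdivrMr//; rewrite mulrC -ler_pdivrMr//.
  apply: le_trans (ltW (truncnS_gt (2 / e))) _; rewrite ler_nat /k.
  apply: (@leq_trans n.+1) => //.
  by rewrite -add1n leq_add2r.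
have kn1 : 1 <= (k n)%:R :> R by rewrite ler1n.
have NR : (N n)%:R = (k n)%:R ^+ 2 :> R by rewrite /N natrX.
have N1 : 1 <= (N n)%:R :> R by rewrite ler1n expn_gt0 kn0.
apply: (@visits_approx_dblpt R d T B (1, 0) A (h n) (r n) eps e _ _ _ _ _ _ w (h0 n) (ltW (r0 n)) _ _ re2 (gE n) (mA _ mj) _ Vj).
- rewrite /h ler_pdivrMr; last by rewrite mulr_gt0// ltr0n expn_gt0 kn0.
  by rewrite -!natrM ler_nat; apply: horizon_bound; rewrite expn_gt0 kn0.
- apply: le_trans re2; apply: (@le_trans _ _ (r n)); last by rewrite ler_peMl ?(ltW (r0 n))// ler1n.
  rewrite /h /r lef_pV2 ?posrE ?mulr_gt0 ?NR ?exprn_gt0//.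
  by rewrite expr2 mulrA ler_peMl ?(ltW (knR n))// -natrM ler1n muln_gt0 kn0.
- by move=> i; exact: (bm_wsum0 bm).
Qed.

(** * Energy of the law of a selected double point *)

Section cell_points.
Context {R : realType}.
Notation pt := (R * R)%type.

(** The lower left corner of the cell; it need not lie in [A]. In the upper bound the kernels live
    on such deterministic points and only the masses are random. *)
Definition cpt k (j : 'I_k * 'I_k) : pt := (j.1%:R / k%:R - 1 / 2, j.2%:R / k%:R - 1 / 2).

Lemma cpt_close k (j : 'I_k * 'I_k) (x : pt) : (0 < k)%N -> incell j x -> `|x - cpt j| <= k%:R^-1.
Proof.
move=> k0; have kR : 0 < k%:R :> R by rewrite ltr0n.
have H (i : 'I_k) (t : R) : initv k i t -> `|t - (i%:R / k%:R - 1 / 2)| <= k%:R^-1.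
  move=> /andP[h1 h2]; rewrite -(ler_pM2r kR) mulVf ?gt_eqF// -[X in _ * X](gtr0_norm kR) -normrM.
  have -> : (t - (i%:R / k%:R - 1 / 2)) * k%:R = (t + 1 / 2) * k%:R - i%:R by field; rewrite gt_eqF.
  by rewrite ger0_norm ?subr_ge0//; move: h2; rewrite -natr1; lra.
by move=> /andP[/H h1 /H h2]; rewrite prod_normE/= ge_max h1 h2.
Qed.

Lemma cpt_bound k (j : 'I_k * 'I_k) : `|cpt j| <= 1 / 2.
Proof.
have H (i : 'I_k) : `|i%:R / k%:R - 1 / 2| <= 1 / 2 :> R.
  have k0 : 0 < k%:R :> R by rewrite ltr0n (leq_ltn_trans _ (ltn_ord i)).
  have i1 : i%:R / k%:R <= 1 :> R by rewrite ler_pdivrMr// mul1r ler_nat ltnW.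
  have i0 : 0 <= i%:R / k%:R :> R by rewrite divr_ge0// ltW.
  by rewrite ler_norml; apply/andP; split; lra.
by rewrite prod_normE/= ge_max !H.
Qed.

Lemma cpt_diam k (j j' : 'I_k * 'I_k) : `|cpt j - cpt j'| <= 1.
Proof.
apply: le_trans (ler_normB _ _) _; have := cpt_bound j; have := cpt_bound j'.
by set u := `|_|; set v := `|_|; lra.
Qed.

Lemma cpt_far k (j : 'I_k * 'I_k) : 1 / 2 <= `|cpt j - (1, 0)|.
Proof.
apply: le_trans (fst_le_norm _) => /=.
have := le_trans (fst_le_norm (cpt j)) (cpt_bound j); rewrite ler_norml => /andP[_ h].
by rewrite ler0_norm; move: h; rewrite /=; lra.
Qed.

End cell_points.
Arguments cpt R {k} j.

Section self_bounding.
Context {R : realType} {d} {T : measurableType d} {P : probability T R}.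

(* If the potential of the measure m is controlled pathwise and in mean square
   by its energy, Cauchy-Schwarz bounds the energy by the total mass. *)
Lemma self_bounding (J : finType) (q : J -> T -> R) (k : J -> J -> R) (G : nat -> T -> R) (K : R) :
  let m j := Ex P (q j) in let V j := \sum_i m i * k j i in
  0 < K -> (forall j, bmf (q j)) -> (forall i j, 0 <= k i j) -> (forall l, bmf (G l)) ->
  (forall w, exists l0, forall l, (l0 <= l)%N -> \sum_j q j w * V j ^+ 2 <= G l w) ->
  (forall l, Ex P (G l) <= K * \sum_j m j * V j) ->
  \sum_j m j * V j <= K * \sum_j m j.
Proof.
move=> m V K0 bq k0 bG FG GM.
have m0 j : 0 <= m j by exact: Ex_ge0.
have bqV j : bmf (fun w => q j w * V j ^+ 2) by apply: bmfM => //; apply: bmf_cst; exact: sqr_ge0.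
have : \sum_j m j * V j ^+ 2 <= K * \sum_j m j * V j.
  have := @Ex_eventually_le _ _ _ P (fun w => \sum_j q j w * V j ^+ 2) G _ _ bG GM FG.
  rewrite Ex_sum//; move=> /(_ (bmf_sum _ _)) H; apply: le_trans (H _) => //.
  rewrite le_eqVlt; apply/orP; left; apply/eqP; apply: eq_bigr => j _.
  rewrite mulrC -ExZ ?sqr_ge0//; apply: Ex_eq => w; exact: mulrC.
set E := \sum_j m j * V j; set M := \sum_j m j => H.
(* Expanding gives 2 K E <= sum m V^2 + K^2 M <= K E + K^2 M, hence E <= K M. *)
have : \sum_j m j * (V j - K) ^+ 2 >= 0 by apply: sumr_ge0 => j _; rewrite mulr_ge0// sqr_ge0.
rewrite (_ : \sum_j _ = \sum_j m j * V j ^+ 2 - 2 * K * E + K ^+ 2 * M); last first.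
  rewrite /E /M !mulr_sumr -sumrN -!big_split/=; apply: eq_bigr => j _; ring.
move=> H2; have : K * E <= K * (K * M) by move: H H2; set s := \sum_j _; nra.
by rewrite ler_pM2l.
Qed.

End self_bounding.

Section one_path.
Context {R : realType} {d} {T : measurableType d} {P : probability T R}.
Context {h : R} {xi : nat -> T -> R * R}.
Hypothesis (h0 : 0 < h) (gw : gaussian_walk P h xi).
Notation pt := (R * R)%type.
Variables (L : nat) (J : finType) (m : J -> R) (y : J -> pt) (x0 : pt) (r C : R).
Hypotheses (Lh : 72 <= L%:R * h) (hL : L%:R * h <= 72) (m0 : forall j, 0 <= m j).
Hypotheses (r0 : 0 < r) (r2 : r <= 2) (hr : h <= r ^+ 2) (C0 : 0 < C).
Hypothesis far : forall j, 1 / 2 <= `|y j - x0|.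
Hypothesis HC : forall c J, J%:R * h <= 144 * 1 ^+ 2 ->
  \sum_(0 <= j < J) h * hitp P xi r j c <= C * r ^+ 2 * Lam 1 r `|c|.

(** The squared maximum of the potential of [m] over the n-th window; the index set ['I_1] puts it
    in the form of [maximal_ineq]. *)
Definition window_max n (w : T) : R :=
  runmax (fun i w => \big[Num.max/0]_(s < 1)
    \sum_j m j * Lker 1 r (shifted (xi := xi) (fun=> x0) (n * L + i) w - y j)) L w ^+ 2.

Lemma window_maxE n w i : (i < L)%N ->
  (\sum_j m j * Lker 1 r (x0 + wsum xi 0 (n * L + i) w - y j)) ^+ 2 <= window_max n w.
Proof.
move=> iL; rewrite /window_max ler_pXn2r ?nnegrE ?runmax_ge0//; last first.
  by apply: sumr_ge0 => j _; rewrite mulr_ge0 ?Lker_ge0.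
apply: le_trans (runmax_ge _ w iL).
by rewrite big_ord_recl le_max lexx.
Qed.

Lemma bmf_window_max n : bmf (window_max n).
Proof.
apply: bmfX; apply: (@runmax_bmf _ _ _ _ _ id) => i iL.
apply: bmf_bigmax => s _; apply: bmf_lin => // j; apply: bmf_Lker => //.
apply: measurable_ptB => //; apply: (shifted_measurable gw (k0 := 0)) => //.
Qed.

Lemma window_occ n j : Ex P (fun w => win (xi := xi) L 0 n w *
    occ (h := h) (xi := xi) (n * L) (fun=> x0) r (n * L + (L + L)) (y j) w) <= 64 * 144 * 2 ^- n.
Proof.
have bw : bmf (win (xi := xi) L 0 n) by apply: (sg_bmf gw (I := xpredT)); exact: bmf_win.
have bk k : bmf (fun w => ind R (`|shifted (xi := xi) (fun=> x0) k w - y j| <= r)).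
  by apply: (bmf_visit gw (k0 := 0)).
have r20 : 0 < r ^+ 2 by exact: exprn_gt0.
have hr0 : 0 <= h / r ^+ 2 by rewrite divr_ge0 ?ltW.
rewrite (_ : Ex P _ = h / r ^+ 2 * \sum_(n * L <= k < n * L + (L + L))
    Ex P (fun w => win (xi := xi) L 0 n w * ind R (`|x0 + wsum xi 0 k w - y j| <= r))); last first.
  rewrite -Ex_sum; last by move=> k _; apply: bmfM => //; exact: bk.
  rewrite -ExZ//; last by apply: bmf_sum => k _; apply: bmfM => //; exact: bk.
  by apply: Ex_eq => w; rewrite /occ -mulr_sumr mulrCA.
apply: (@le_trans _ _ (h / r ^+ 2 * \sum_(n * L <= k < n * L + (L + L)) 64 * 2 ^- n * r ^+ 2)).
  rewrite ler_wpM2l// big_seq [leRHS]big_seq; apply: ler_sum => k.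
  by rewrite mem_index_iota => /andP[nk _]; exact: (window_base h0 gw Lh).
rewrite sumr_const_nat addKn -[_ *+ _]mulr_natl natrD.
have q0 : 0 <= 2 ^- n :> R by rewrite invr_ge0 exprn_ge0.
rewrite (_ : h / r ^+ 2 * _ = 64 * 2 ^- n * (2 * (L%:R * h))); last by field; rewrite expf_neq0 ?gt_eqF.
rewrite (_ : 64 * 144 * 2 ^- n = 64 * 2 ^- n * (2 * 72)); last by ring.
by rewrite !ler_wpM2l// mulr_ge0.
Qed.

Let C1 : R := 4 * (expR (- 4) / 2) ^- 2.

(** The factor 2^-n is the price of surviving [n] windows and makes the sum over windows converge.
    Occupation is counted over the window and one more, a horizon 144 = 2 * 72. *)
Lemma window_max_mean n :
  Ex P (fun w => win (xi := xi) L 0 n w * window_max n w) <=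
  C1 * (C * (1 + ln 2) * (2 * (64 * 144))) * 2 ^- n * \sum_j \sum_i m j * m i * Lam 1 r `|y j - y i|.
Proof.
have bw : bmf (win (xi := xi) L 0 n : past xi (n * L) -> R) by apply: bmf_win => i /andP[_].
have bw' := sg_bmf gw bw.
have mV : measurable_fun [set: past xi (n * L)] ((fun=> x0) : past xi (n * L) -> pt) by exact: measurable_cst.
have L72 : (n * L + (L + L) - (n * L + L))%:R * h = L%:R * h by rewrite addnA addKn.
have L144 : (n * L + (L + L) - n * L)%:R * h <= 144 * 1 ^+ 2.
  by rewrite addKn natrD expr1n mulrDl; move: (hL); lra.
have long : 64 * 1 ^+ 2 <= (n * L + (L + L) - (n * L + L))%:R * h.
  by rewrite L72 expr1n; move: (Lh); lra.
have le1 : (n * L + L <= n * L + (L + L))%N by rewrite addnA leq_addr.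
have r21 : r <= 2 * 1 by rewrite mulr1.
have := @maximal_ineq _ _ _ _ _ _ h0 gw (n * L) _ mV 'I_1 J (fun _ => m) y 1 r L
  (n * L + (L + L)) _ (fun _ => m0) ltr01 r0 hr r21 le1 long bw.
rewrite -/C1 => /le_trans; apply.
have C10 : 0 <= C1 by rewrite mulr_ge0// invr_ge0 sqr_ge0.
rewrite -!(mulrA C1); apply: ler_wpM2l => //.
have bo j : bmf (occ (h := h) (xi := xi) (n * L) (fun=> x0) r (n * L + (L + L)) (y j)).
  exact: (bmf_occ h0 gw mV).
set o := fun j => occ (h := h) (xi := xi) (n * L) (fun=> x0) r (n * L + (L + L)) (y j).
have bij j i : bmf (fun w => m j * m i * (win (xi := xi) L 0 n w * (o j w * o i w))).
  by apply: bmfM; [apply: bmf_cst; exact: mulr_ge0|apply: bmfM => //; apply: bmfM; exact: bo].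
rewrite (_ : Ex P _ = \sum_j \sum_i m j * m i * Ex P (fun w => win (xi := xi) L 0 n w * (o j w * o i w))); last first.
  transitivity (Ex P (fun w => \sum_j \sum_i m j * m i * (win (xi := xi) L 0 n w * (o j w * o i w)))).
    apply: Ex_eq => w; rewrite big_ord_recl big_ord0 -/(o _) max_l; last first.
      by apply: sumr_ge0 => j _; rewrite mulr_ge0// bmf_ge0.
    rewrite expr2 mulr_suml mulr_sumr; apply: eq_bigr => j _.
    by rewrite mulr_sumr mulr_sumr; apply: eq_bigr => i _; rewrite /o; ring.
  rewrite Ex_sum; last by move=> j _; exact: bmf_sum.
  apply: eq_bigr => j _; rewrite Ex_sum//; apply: eq_bigr => i _; rewrite ExZ ?mulr_ge0//.
  by apply: bmfM => //; apply: bmfM; exact: bo.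
rewrite !mulr_sumr; apply: ler_sum => j _; rewrite !mulr_sumr; apply: ler_sum => i _.
have := @occ_second_moment _ _ _ _ _ _ h0 gw (n * L) _ mV C 144 1 r (n * L + (L + L)) _ (y j) (y i) C0 ltr01 r0 hr HC bw L144.
set p := Ex P _; set Q := Ex P _; set Q' := Ex P _ => pQ.
have := window_occ n j; have := window_occ n i; rewrite -/Q -/Q' => Qi Qj.
have L0 : 0 <= Lam 1 r `|y j - y i| by exact: Lam_ge0.
have C20 : 0 <= C * (1 + ln 2) by rewrite mulr_ge0 ?(ltW C0)// addr_ge0// ln_ge0// ler1n.
apply: (@le_trans _ _ (m j * m i * (C * (1 + ln 2) * Lam 1 r `|y j - y i| * (64 * 144 * 2 ^- n + 64 * 144 * 2 ^- n)))).
  apply: ler_wpM2l; first exact: mulr_ge0.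
  by apply: le_trans pQ _; apply: ler_wpM2l; [exact: mulr_ge0|exact: lerD].
by rewrite le_eqVlt; apply/orP; left; apply/eqP; ring.
Qed.

End one_path.

Section brownian_windows.
Context {R : realType} {d} {T : measurableType d}.
Notation pt := (R * R)%type.
Variable B : R -> T -> pt.

Lemma win_path (h : R) L c n w s : 0 <= h -> (c + n * L)%:R * h <= s ->
  (forall v : R, 0 <= v <= s -> enorm (B v w) <= 3) ->
  win (xi := bm_step B h) L c n w = 1.
Proof.
move=> h0 ns H; rewrite /win big1// => i _; rewrite (bm_wsum B); last first.
  by rewrite leq_add2l leq_mul2r leqnSn orbT.
have Hi k : (k <= n)%N -> `|B ((c + k * L)%:R * h) w| <= 3.
  move=> kn; apply: le_trans (norm_le_enorm _) _; apply: H; rewrite mulr_ge0//=.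
  by apply: le_trans ns; rewrite ler_wpM2r// ler_nat leq_add2l leq_mul2r kn orbT.
rewrite (_ : _ <= 6)//; apply: le_trans (ler_normB _ _) _.
have := Hi i (ltnW (ltn_ord i)); have := Hi i.+1 (ltn_ord i).
by set a := `|_|; set b := `|_|; lra.
Qed.

Lemma mesh_small (e : R) : 0 < e -> exists l0, forall l, (l0 <= l)%N -> 72 / (2 ^ l)%:R <= e.
Proof.
move=> e0; exists (Num.trunc (72 / e)).+1 => l ll.
have l2 : (Num.trunc (72 / e)).+1%:R <= (2 ^ l)%:R :> R.
  by rewrite ler_nat; apply: leq_trans ll (ltnW _); exact: ltn_expl.
have e2 : 0 < (2 ^ l)%:R :> R by rewrite ltr0n expn_gt0.
rewrite ler_pdivrMr// mulrC -ler_pdivrMr//; apply: ltW; apply: lt_le_trans l2; exact: truncnS_gt.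
Qed.

Lemma grid_time (u h : R) : 0 <= u -> 0 < h -> let k := Num.trunc (u / h) in
  k%:R * h <= u /\ u < (k%:R + 1) * h.
Proof.
move=> u0 h0 k; have := truncn_itv (divr_ge0 u0 (ltW h0)).
by rewrite ler_pdivlMr// ltr_pdivrMr// -natr1 => /andP[].
Qed.

End brownian_windows.

Lemma Lam_le_Lker (R : realType) (D r : R) (s y y' : R * R) :
  0 < D -> 0 < r -> `|s - y| <= r -> `|y - y'| <= D -> r <= D ->
  Lam D r `|y - y'| <= 2 * Lker D r (s - y').
Proof.
move=> D0 r0 sy yy rD.
have sy' : `|s - y'| <= `|y - y'| + r.
  have -> : s - y' = (s - y) + (y - y') by rewrite addrA subrK.
  by apply: le_trans (ler_normD _ _) _; rewrite addrC lerD.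
rewrite /Lker (_ : `|s - y'| <= 2 * D) /ind ?mul1r; last first.
  by apply: le_trans sy' _; lra.
apply: (@le_trans _ _ ((1 + ln 2) * Lam D r `|s - y'|)).
  apply: Lam_scale => //; first by rewrite ler1n.
  rewrite (mulrC 2) -mulrA ler_pM2l// ge_max; apply/andP; split.
    apply: le_trans sy' _; rewrite mulr2n mulrDl mul1r lerD// le_max lexx ?orbT//.
  by rewrite mulrDl mul1r; apply: ler_wpDr; rewrite le_max ?lexx ?orbT// (ltW r0) orbT.
apply: ler_wpM2r; first exact: Lam_ge0.
have := @ln_upper R 2 ltac:(lra); lra.
Qed.

(** If [X] is visited at time [u], its squared potential is at most 4 times [window_max] for the
    window containing [u]. The sum over windows is geometric, so [K] does not depend on the horizon
    [N], and [self_bounding] concludes. *)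
Lemma one_point_energy (R : realType) : exists2 K : R, 0 < K &
  forall d (T : measurableType d) (P : probability T R) B, planar_brownian_motion P (1, 0) B ->
  forall (e : T -> bool) (X : T -> R * R) (N k : nat) (r : R),
  measurable_fun setT e -> measurable_fun setT X -> (0 < k)%N -> 2 / k%:R <= r -> r <= 1 ->
  (forall w, e w -> `|X w| <= 1 / 3 /\ exists u : R, [/\ 0 <= u <= N%:R, B u w = X w &
    forall v : R, 0 <= v <= u -> enorm (B v w) <= 3]) ->
  let m j := Ex P (fun w => ind R (e w) * ind R (incell j (X w))) in
  is_true (\sum_(j : 'I_k * 'I_k) m j * (\sum_i m i * Lam 1 r `|cpt R j - cpt R i|) <=
    K * Ex P (fun w => ind R (e w))).
Proof.
have CT1 : 1 <= 144 :> R by rewrite ler1n.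
have [C C0 HC] := hit_green_upper CT1.
pose K1 : R := 4 * (expR (- 4) / 2) ^- 2 * (C * (1 + ln 2) * (2 * (64 * 144))).
have l2 : 0 <= ln 2 :> R by rewrite ln_ge0// ler1n.
have K10 : 0 < K1.
  rewrite /K1; apply: mulr_gt0; first by rewrite mulr_gt0// invr_gt0 exprn_gt0// divr_gt0 ?expR_gt0.
  apply: mulr_gt0; first by apply: mulr_gt0 => //; lra.
  by apply: mulr_gt0 => //; apply: mulr_gt0; rewrite ltr0n.
exists (8 * K1) => [|d T P B bm e X N k r me mX k0 kr r1 He m]; first by rewrite mulr_gt0.
have kR : 0 < k%:R :> R by rewrite ltr0n.
have ik0 : 0 < k%:R^-1 :> R by rewrite invr_gt0.
have r0 : 0 < r by apply: lt_le_trans kr; rewrite divr_gt0.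
have r20 : 0 < r ^+ 2 by exact: exprn_gt0.
have be : bmf (fun w => ind R (e w)) by exact: bmf_bool.
have bq (j : 'I_k * 'I_k) : bmf (fun w => ind R (e w) * ind R (incell j (X w))).
  by apply: bmfM => //; exact: bmf_incell.
have m0 j : 0 <= m j by exact: Ex_ge0.
have [l0 Hl0] := mesh_small r20.
pose L l := (2 ^ (l0 + l))%N; pose hh l : R := 72 / (L l)%:R.
have L0 l : 0 < (L l)%:R :> R by rewrite ltr0n expn_gt0.
have hh0 l : 0 < hh l by rewrite divr_gt0.
have Lh l : (L l)%:R * hh l = 72 by rewrite /hh mulrC divfK// gt_eqF.
have gw l := bm_walk bm (hh0 l).
have y1 (j : 'I_k * 'I_k) : 1 / 2 <= `|cpt R j - (1, 0)| by exact: cpt_far.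
have rr2 : r <= 2 by lra.
have hr l : hh l <= r ^+ 2 by apply: Hl0; exact: leq_addr.
pose WM l := window_max (xi := bm_step B (hh l)) (L l) m (fun j => cpt R j) (1, 0) r.
(* All windows are summed, as the one containing the visit is random. The 4 is the square of the
   factor in [Lam_le_Lker]. *)
pose G l w := \sum_(n < N.+1) 4 * (win (xi := bm_step B (hh l)) (L l) 0 n w * WM l n w).
have bWM l n : bmf (WM l n) by exact: (bmf_window_max (gw l)).
have bw l n : bmf (win (xi := bm_step B (hh l)) (L l) 0 n).
  by apply: (sg_bmf (gw l) (I := xpredT)); exact: bmf_win.
have bwW l n : bmf (fun w => win (xi := bm_step B (hh l)) (L l) 0 n w * WM l n w) by exact: bmfM.
have bG l : bmf (G l) by apply: bmf_sum => n _; apply: bmfM => //; exact: bmf_cst.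
set E := \sum_j _; pose Z := Ex P (fun w => ind R (e w)).
have E0 : 0 <= E.
  by apply: sumr_ge0 => j _; rewrite mulr_ge0// sumr_ge0// => i _; rewrite mulr_ge0 ?Lam_ge0.
have mE : \sum_j m j <= Z.
  rewrite /m -Ex_sum//; apply: Ex_le => //; first exact: bmf_sum.
  move=> w; have [ew|ew] := boolP (e w); last by rewrite big1// => j _; rewrite /ind/= mul0r.
  have [[X3 _]] := (He w ew, tt).
  have [j Hj HS] := sum_incell k0 X3.
  have := HS (fun=> 1) => HS1; rewrite -mulr_sumr (eq_bigr (fun j => ind R (incell j (X w)) * 1)) ?HS1 ?mulr1//.
  by move=> i _; rewrite mulr1.
apply: (@le_trans _ _ (8 * K1 * \sum_j m j)); last by rewrite ler_wpM2l// mulr_ge0// ltW.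
apply: (@self_bounding _ _ _ P _ (fun j w => ind R (e w) * ind R (incell j (X w)))
   (fun j i => Lam 1 r `|cpt R j - cpt R i|) G (8 * K1)) => //.
- by rewrite mulr_gt0.
- by move=> i j; exact: Lam_ge0.
- move=> w; have [ew|ew] := boolP (e w); last first.
    exists 0%N => l _; rewrite big1; first exact: bmf_ge0 (bG l).
    by move=> j _; rewrite /ind/= !mul0r.
  have [X3 [u [/andP[u0 uN] BuX Hu]]] := He w ew.
  have [j jX HS] := sum_incell k0 X3.
  have [eta eta0 Heta] := ray_continuousP (bm_continuous bm (w := w)) u0 ik0.
  have [l1 Hl1] := mesh_small (divr_gt0 eta0 (ltr0n _ 2)).
  exists l1 => l l1l.
  have hle : hh l <= eta / 2 by apply: Hl1; apply: leq_trans l1l _; exact: leq_addl.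
  have [ku uk] := grid_time u0 (hh0 l); have [nu un] := grid_time u0 (ltr0n R 72).
  set kk := Num.trunc (u / hh l) in ku uk; set n := Num.trunc (u / 72) in nu un.
  have nN : (n < N.+1)%N.
    rewrite ltnS -(ler_nat R); apply: le_trans uN; apply: le_trans nu.
    by rewrite ler_peMr// ler1n.
  have nLk : (n * L l <= kk)%N.
    rewrite -ltnS -(ltr_nat R) -(ltr_pM2r (hh0 l)) natrM -mulrA Lh -(natr1 kk).
    exact: le_lt_trans nu uk.
  have kL : (kk - n * L l < L l)%N.
    rewrite ltn_subLR// -(ltr_nat R) -(ltr_pM2r (hh0 l)) natrD natrM mulrDl -mulrA Lh.
    by apply: le_lt_trans ku _; apply: lt_le_trans un _; rewrite mulrDl mul1r.
  have wn : win (xi := bm_step B (hh l)) (L l) 0 n w = 1.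
    by apply: (win_path (s := u)) => //; [exact: ltW|rewrite add0n natrM -mulrA Lh].
  rewrite (eq_bigr (fun i => ind R (incell i (X w)) * (\sum_i' m i' * Lam 1 r `|cpt R i - cpt R i'|) ^+ 2)); last first.
    by move=> i _; rewrite [ind R true]/ind mul1r.
  rewrite HS.
  apply: (@le_trans _ _ (4 * (win (xi := bm_step B (hh l)) (L l) 0 n w * WM l n w))); last first.
    rewrite /G (bigD1 (Ordinal nN))//= lerDl; apply: sumr_ge0 => i _.
    by rewrite mulr_ge0//; exact: bmf_ge0 (bwW l i).
  rewrite wn mul1r.
  have := window_maxE (xi := bm_step B (hh l)) (fun j => cpt R j) (1, 0) r m0 n w kL; rewrite subnKC//.
  rewrite -/(WM l n); set Q := (\sum_j _) ^+ 2 => /(ler_wpM2l (_ : 0 <= 4 :> R)) H.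
  apply: le_trans (H _) => //; rewrite /Q (_ : 4 = 2 ^+ 2); last by ring.
  rewrite -exprMn ler_pXn2r ?nnegrE//; last 2 first.
  - by apply: sumr_ge0 => i _; rewrite mulr_ge0 ?Lam_ge0.
  - by rewrite mulr_ge0// sumr_ge0// => i _; rewrite mulr_ge0 ?Lker_ge0.
  rewrite mulr_sumr; apply: ler_sum => i _; rewrite mulrCA ler_wpM2l//.
  apply: Lam_le_Lker => //; last exact: cpt_diam.
  rewrite (bm_wsum0 bm) -(subrK (X w) (B _ w)) -addrA; apply: le_trans (ler_normD _ _) _.
  apply: le_trans kr; rewrite (_ : 2 / k%:R = k%:R^-1 + k%:R^-1) ?lerD//; last by field; rewrite gt_eqF.
    rewrite -BuX; apply: ltW; apply: Heta; first by rewrite mulr_ge0// ltW.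
    by rewrite ltr_norml; apply/andP; split; move: eta0 hle ku uk; clear; lra.
  exact: cpt_close.
- move=> l; rewrite /G Ex_sum; last by move=> n _; apply: bmfM => //; exact: bmf_cst.
  have E2 : \sum_j \sum_i m j * m i * Lam 1 r `|cpt R j - cpt R i| = E.
    by apply: eq_bigr => j _; rewrite mulr_sumr; apply: eq_bigr => i _; rewrite mulrA.
  apply: (@le_trans _ _ (\sum_(n < N.+1) 4 * (K1 * 2 ^- n * E))).
    apply: ler_sum => n _; rewrite ExZ// ler_wpM2l// -E2.
    apply: (window_max_mean (hh0 l) (gw l)) => //; rewrite ?Lh//.
    by move=> c J Jh; exact: (HC _ _ _ _ _ (hh0 l) (gw l)).
  have -> : \sum_(n < N.+1) 4 * (K1 * 2 ^- n * E) = 4 * K1 * E * \sum_(n < N.+1) 2 ^- n.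
    by rewrite mulr_sumr; apply: eq_bigr => n _; ring.
  have g2 n : \sum_(i < n) 2 ^- i <= 2 - 2 * 2 ^- n :> R.
    elim: n => [|n ih]; first by rewrite big_ord0 expr0 invr1; clear; lra.
    by rewrite big_ord_recr/= exprS invfM; move: ih; set a := \sum_(_ < _) _; set b := 2 ^- n; clear; lra.
  have q0 : 0 <= 2 ^- N.+1 :> R by rewrite invr_ge0 exprn_ge0.
  rewrite (_ : 8 * K1 * E = 4 * K1 * E * 2); last by ring.
  apply: ler_wpM2l; first by apply: mulr_ge0 => //; apply: mulr_ge0 => //; exact: ltW.
  by have := g2 N.+1; move: q0; clear; lra.
Qed.

(** * Two passages: summation over pairs of short intervals *)

Section gap_sums.
Context {R : realType}.
Variable M : nat.
Hypothesis M0 : (0 < M)%N.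

(** [M] consecutive intervals make up one window of 72 time units, so the survival factor is
    geometric in blocks of length [M]. *)
Lemma block_sum n : \sum_(0 <= i < n) 2 ^- (i %/ M) <= 2 * M%:R :> R.
Proof.
have g2 q : \sum_(0 <= i < q * M) 2 ^- (i %/ M) <= (2 - 2 * 2 ^- q) * M%:R :> R.
  elim: q => [|q ih]; first by rewrite mul0n big_geq// expr0 invr1; lra.
  rewrite (@big_cat_nat _ _ _ (q * M))//=; last by rewrite leq_mul2r leqnSn orbT.
  rewrite [X in _ + X](eq_big_nat _ _ (F2 := fun=> 2 ^- q)); last first.
    move=> i /andP[qi iq]; congr (2 ^- _); apply/eqP; rewrite eqn_leq.
    by rewrite leq_divRL// qi andbT -ltnS ltn_divLR.
  rewrite sumr_const_nat mulSn addnK -(mulr_natr _ M) exprS invfM.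
  by move: ih; set a := \sum_(_ <= _ < _) _; set b := 2 ^- q; lra.
have Mn : (n <= n * M)%N by rewrite leq_pmulr.
apply: (@le_trans _ _ (\sum_(0 <= i < n * M) 2 ^- (i %/ M))).
  rewrite (@big_cat_nat _ _ _ n 0 (n * M))//= lerDl; apply: sumr_ge0 => i _.
  by rewrite invr_ge0 exprn_ge0.
apply: le_trans (g2 _) _; rewrite ler_wpM2r//.
have : 0 <= 2 ^- n :> R by rewrite invr_ge0 exprn_ge0.
lra.
Qed.

(* Bound for the density of the position after a gap of g intervals of length
   72 / M, on the event that the path stays bounded. *)
Definition gap_weight g : R :=
  if (g < M)%N then M%:R / 288 * g%:R^-1 else 2 / 288 * 2 ^- (g %/ M).

Lemma gap_weight_ge0 g : 0 <= gap_weight g.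
Proof.
rewrite /gap_weight; case: ifP => _; apply: mulr_ge0 (divr_ge0 (ler0n _ _) (ler0n _ _)) _.
  by rewrite invr_ge0.
by rewrite invr_ge0 exprn_ge0.
Qed.

(** Gaps shorter than a window form a harmonic sum, whose logarithm becomes the factor |ln eps| of
    the energy bound; longer gaps decay geometrically and add only a multiple of [M]. *)
Lemma gap_weight_sum n : \sum_(1 <= g < n) gap_weight g <= M%:R / 288 * (5 + ln M%:R).
Proof.
have MR : 0 < M%:R :> R by rewrite ltr0n.
have M288 : 0 <= M%:R / 288 :> R := divr_ge0 (ler0n _ _) (ler0n _ _).
apply: (@le_trans _ _ (\sum_(1 <= g < n | (g < M)%N) M%:R / 288 * g%:R^-1 +
   \sum_(1 <= g < n) 2 / 288 * 2 ^- (g %/ M))).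
  rewrite [X in _ <= X + _]big_mkcond -big_split/=; apply: ler_sum => g _; rewrite /gap_weight.
  have p0 : 0 <= 2 / 288 * 2 ^- (g %/ M) :> R by apply: mulr_ge0; [exact: (divr_ge0 (ler0n _ _) (ler0n _ _))|rewrite invr_ge0 exprn_ge0].
  by case: ifP => _; rewrite ?add0r// lerDl.
have h1 : \sum_(1 <= g < n | (g < M)%N) M%:R / 288 * g%:R^-1 <= M%:R / 288 * (1 + ln M%:R) :> R.
  apply: (@le_trans _ _ (\sum_(1 <= g < n + M | (g < M)%N) M%:R / 288 * g%:R^-1)).
    have [n0|n0] := leqP n 1.
      by rewrite big_geq//; apply: sumr_ge0 => g _; rewrite mulr_ge0// invr_ge0.
    rewrite (@big_cat_nat _ _ _ n 1 (n + M))//= ?leq_addr// ?(ltnW n0)// lerDl.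
    by apply: sumr_ge0 => g _; rewrite mulr_ge0// invr_ge0.
  have := @big_nat_widen _ _ _ 1 M (n + M) xpredT (fun g => M%:R / 288 * g%:R^-1 : R) (leq_addl _ _) => /= <-.
  rewrite -mulr_sumr; apply: ler_wpM2l => //.
  by have := @harmonic_le R 1 M isT M0; rewrite ?invr1 ?divr1 ?mulr1.
have h2 : \sum_(1 <= g < n) 2 / 288 * 2 ^- (g %/ M) <= M%:R / 288 * 4 :> R.
  rewrite -mulr_sumr.
  have h3 : \sum_(1 <= g < n) 2 ^- (g %/ M) <= 2 * M%:R :> R.
    apply: le_trans (block_sum n); case: (n) => [|n']; first by rewrite !big_geq.
    by rewrite [leRHS]big_ltn// lerDr invr_ge0 exprn_ge0.
  rewrite (_ : _ * 4 = 2 / 288 * (2 * M%:R)); last by field.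
  exact: (ler_wpM2l (divr_ge0 (ler0n _ _) (ler0n _ _)) h3).
by apply: le_trans (lerD h1 h2) _; rewrite -mulrDr ler_wpM2l//; lra.
Qed.

Lemma pair_weight_sum n :
  \sum_(0 <= a < n) \sum_(a.+2 <= b < n) gap_weight (b - a.+1) * 2 ^- (a %/ M) <=
  M%:R / 288 * (5 + ln M%:R) * (2 * M%:R).
Proof.
have MR : 1 <= M%:R :> R by rewrite ler1n.
have W0 : 0 <= M%:R / 288 * (5 + ln M%:R) :> R.
  apply: mulr_ge0 (divr_ge0 (ler0n _ _) (ler0n _ _)) _; exact: (addr_ge0 (ler0n _ _) (ln_ge0 MR)).
apply: (@le_trans _ _ (\sum_(0 <= a < n) M%:R / 288 * (5 + ln M%:R) * 2 ^- (a %/ M))); last first.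
  by rewrite -mulr_sumr; apply: ler_wpM2l => //; exact: block_sum.
apply: ler_sum => a _; rewrite -mulr_suml; apply: ler_wpM2r; first by rewrite invr_ge0 exprn_ge0.
rewrite -add1n big_addn; apply: le_trans (gap_weight_sum (n - a.+1)).
by rewrite le_eqVlt; apply/orP; left; apply/eqP; apply: eq_bigr => g _; rewrite addnK.
Qed.

End gap_sums.

Section two_paths.
Context {R : realType} {d} {T : measurableType d} {P : probability T R}.
Context {h : R} {xi : nat -> T -> R * R}.
Hypothesis (h0 : 0 < h) (gw : gaussian_walk P h xi).
Notation pt := (R * R)%type.
Variables (M n nx : nat) (J : finType) (m : J -> R) (y : J -> pt) (x0 : pt) (D r C CT : R).
Hypotheses (M0 : (0 < M)%N) (n0 : (0 < n)%N) (Lh : (M * n)%:R * h = 72).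
Hypotheses (m0 : forall j, 0 <= m j) (D0 : 0 < D) (r0 : 0 < r) (hr : h <= r ^+ 2) (rD : r <= 2 * D).
Hypotheses (C0 : 0 < C) (far : forall j, 1 / 2 <= `|y j - x0|).
Hypothesis long : 64 * D ^+ 2 <= nx%:R * h.
Hypothesis short : (n + nx)%:R * h <= CT * D ^+ 2.
Hypothesis HC : forall c J, J%:R * h <= CT * D ^+ 2 ->
     \sum_(0 <= j < J) h * hitp P xi r j c <= C * r ^+ 2 * Lam D r `|c|.

(** In a gap shorter than one window only the density of the increment is exploited; a longer gap
    also carries the constraint on its full windows, in parallel with [gap_weight]. *)
Definition gap_window a b : T -> R :=
  if (b - a.+1 < M)%N then fun=> 1 else win (xi := xi) (M * n) (a.+1 * n) ((b - a.+1) %/ M).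

Definition meet_windows a b (w : T) : R :=
  win (xi := xi) (M * n) 0 (a %/ M) w * gap_window a b w *
  meet_max (xi := xi) m y x0 D r (a * n) n (b * n) w (x0 + wsum xi 0 (b * n) w) w.

Let Lh' : 72 <= (M * n)%:R * h.
Proof. by rewrite Lh. Qed.

Lemma gap_window_dominated a b : (a.+1 < b)%N ->
  dominated_gap (P := P) (xi := xi) (gap_weight M (b - a.+1)) (a * n + n) (b * n) (gap_window a b).
Proof.
move=> ab; have e1 : (a * n + n = a.+1 * n)%N by rewrite mulSn addnC.
have ab' : (a.+1 * n < b * n)%N by rewrite ltn_pmul2r.
rewrite e1 /gap_weight /gap_window; case: ltnP => gM.
  move=> x F mF F0; apply: le_trans (window_gap_short h0 gw ab' _ mF F0) _.
  apply: lee_wpmul2r; first exact: integral_ge0.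
  have g0 : 0 < (b - a.+1)%:R :> R by rewrite ltr0n subn_gt0.
  have MR : 0 < M%:R :> R by rewrite ltr0n.
  have nR : 0 < n%:R :> R by rewrite ltr0n.
  rewrite lee_fin -mulnBl natrM; apply: le_trans (peak2_le _) _; first by rewrite !mulr_gt0.
  have hE : h = 72 / (M%:R * n%:R) by rewrite -Lh natrM; field; rewrite !gt_eqF.
  rewrite hE le_eqVlt; apply/orP; left; apply/eqP; field; rewrite !gt_eqF//.
have G0 : (0 < (b - a.+1) %/ M)%N by rewrite divn_gt0.
rewrite -(prednK G0).
have cb : (a.+1 * n + ((b - a.+1) %/ M).-1.+1 * (M * n) <= b * n)%N.
  rewrite (prednK G0) mulnA -mulnDl leq_mul2r; apply/orP; right.
  by rewrite -leq_subRL ?(ltnW ab)// leq_trunc_div.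
rewrite (_ : 2 / 288 * _ = 2 ^- ((b - a.+1) %/ M).-1 / 288); first exact: (window_gap h0 gw Lh').
by rewrite exprS invfM; field; rewrite expf_neq0.
Qed.

Lemma bmf_gap_window a b : (a.+1 < b)%N ->
  bmf (gap_window a b : sg xi (fun i => a * n + n <= i < b * n)%N -> R).
Proof.
move=> ab; rewrite /gap_window; case: ifP => _; first exact: bmf_cst.
apply: bmf_win => i /andP[h1 h2]; rewrite addnC -mulSn h1/=; apply: leq_trans h2 _.
rewrite mulnA -mulnDl leq_mul2r; apply/orP; right.
by rewrite -leq_subRL ?(ltnW ab)// leq_trunc_div.
Qed.

Lemma bmf_meet_windows a b : (a.+1 < b)%N -> bmf (meet_windows a b).
Proof.
move=> ab; apply: bmfM; first apply: bmfM.
- by apply: (sg_bmf gw (I := xpredT)); exact: bmf_win.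
- exact: (sg_bmf gw (bmf_gap_window ab)).
have mw j k : measurable_fun setT (wsum xi j k) by exact: (wsum_measurable gw).
by apply: bmf_meet_max => //; exact: measurable_ptD.
Qed.

Definition meet_const : R :=
  4 * (expR (- 4) / 2) ^- 2 *
  (4 * (expR (- 4) / 2) ^- 2 * (C * (1 + ln 2) * (8 * CT * D ^+ 2)) *
   (C * (1 + ln 2) * (2 * (64 * (CT * D ^+ 2))))).

Lemma meet_windows_mean a b : (a.+1 < b)%N ->
  Ex P (meet_windows a b) <= gap_weight M (b - a.+1) * 2 ^- (a %/ M) * meet_const *
    \sum_j \sum_i m j * m i * Lam D r `|y j - y i| ^+ 2.
Proof.
move=> ab; have cb : (a * n + n <= b * n)%N by rewrite addnC -mulSn leq_mul2r ltnW ?orbT.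
have K0 : 0 <= 64 * 2 ^- (a %/ M) :> R by rewrite mulr_ge0// invr_ge0 exprn_ge0.
have bHa : bmf (win (xi := xi) (M * n) 0 (a %/ M) : past xi (a * n) -> R).
  apply: bmf_win => i /andP[_ ia]; apply: leq_trans ia _; rewrite add0n mulnA leq_mul2r.
  by rewrite leq_trunc_div orbT.
have base j k : (a * n <= k < a * n + n + nx)%N ->
    Ex P (fun w => win (xi := xi) (M * n) 0 (a %/ M) w * ind R (`|x0 + wsum xi 0 k w - y j| <= r)) <=
    64 * 2 ^- (a %/ M) * r ^+ 2.
  move=> /andP[ak _]; apply: (window_base h0 gw Lh') => //.
  by apply: leq_trans ak; rewrite mulnA leq_mul2r leq_trunc_div orbT.
have := two_interval_meet h0 gw m0 D0 r0 hr rD cb C0 (gap_weight_ge0 M _) K0 long short HC bHa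
   (bmf_gap_window ab) (gap_window_dominated ab) base.
move=> H; apply: le_trans H _; rewrite /meet_const.
by rewrite le_eqVlt; apply/orP; left; apply/eqP; set S := \sum_j _; set l2 := ln _; set e4 := expR _; ring.
Qed.

Lemma meet_windows_sum N : 0 <= CT ->
  Ex P (fun w => \sum_(0 <= a < N) \sum_(a.+2 <= b < N) meet_windows a b w) <=
  M%:R / 288 * (5 + ln M%:R) * (2 * M%:R) * meet_const *
    \sum_j \sum_i m j * m i * Lam D r `|y j - y i| ^+ 2.
Proof.
move=> CT0.
have E : (fun w => \sum_(0 <= a < N) \sum_(a.+2 <= b < N) meet_windows a b w) =
   (fun w => \sum_(0 <= a < N) \sum_(a.+2 <= b < N | (a.+1 < b)%N) meet_windows a b w).
  apply/funext => w; apply: eq_bigr => a _; rewrite big_nat_cond [RHS]big_nat_cond.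
  by apply: eq_bigl => b; case: (a.+1 < b)%N; rewrite ?andbF.
rewrite E Ex_sum; last by move=> a _; apply: bmf_sum => b ab; exact: bmf_meet_windows.
set S := \sum_j _.
have S0 : 0 <= S by apply: sumr_ge0 => j _; apply: sumr_ge0 => i _; apply: mulr_ge0 (sqr_ge0 _); exact: mulr_ge0.
have l2 : 0 <= ln 2 :> R by rewrite ln_ge0// ler1n.
have mc0 : 0 <= meet_const.
  rewrite /meet_const; have e0 : 0 <= 4 * (expR (- 4) / 2) ^- 2 :> R by rewrite mulr_ge0// invr_ge0 sqr_ge0.
  have c0 : 0 <= C * (1 + ln 2) by rewrite mulr_ge0 ?(ltW C0)// addr_ge0.
  have d0 : 0 <= CT * D ^+ 2 by rewrite mulr_ge0 ?sqr_ge0.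
  apply: mulr_ge0 => //; apply: mulr_ge0; first apply: mulr_ge0 => //; apply: mulr_ge0 => //.
    by rewrite -mulrA mulr_ge0.
  exact: (mulr_ge0 (ler0n _ _) (mulr_ge0 (ler0n _ _) d0)).
rewrite -(mulrA _ meet_const); apply: (@le_trans _ _ (\sum_(0 <= a < N) \sum_(a.+2 <= b < N)
   gap_weight M (b - a.+1) * 2 ^- (a %/ M) * (meet_const * S))).
  apply: ler_sum => a _; rewrite Ex_sum; last by move=> b; exact: bmf_meet_windows.
  rewrite big_nat_cond [leRHS]big_nat_cond [leRHS](eq_bigl (fun b => (a.+1 < b < N)%N && (a.+1 < b)%N)); last first.
    by move=> b; case: (a.+1 < b)%N; rewrite ?andbF.
  apply: ler_sum => b /andP[_ ab]; rewrite mulrA; exact: meet_windows_mean.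
rewrite [leLHS](_ : _ = (\sum_(0 <= a < N) \sum_(a.+2 <= b < N) gap_weight M (b - a.+1) * 2 ^- (a %/ M)) * (meet_const * S)); last first.
  by rewrite mulr_suml; apply: eq_bigr => a _; rewrite mulr_suml.
apply: ler_wpM2r; first exact: mulr_ge0.
exact: pair_weight_sum.
Qed.

End two_paths.

(** Both passages come within [r] of the same point [y j], so each bounds the kernel at [y j] up to
    a factor 2. The product over two passages gives 4, and its square 16. All window constraints
    hold because the path stays in the disk of radius 3. *)
Lemma meet_windows_ge (R : realType) d (T : measurableType d) (P : probability T R) B
    (M n : nat) (J : finType) (m : J -> R) (y : J -> R * R) (D r h s : R) k1 k2 w (j : J) :
  planar_brownian_motion P (1, 0) B -> (0 < n)%N ->
  (forall i, 0 <= m i) -> 0 < D -> 0 < r -> r <= D -> 0 <= h ->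
  ((k1 %/ n).+1 < k2 %/ n)%N -> k2%:R * h <= s ->
  (forall v : R, 0 <= v <= s -> enorm (B v w) <= 3) ->
  `|B (k1%:R * h) w - y j| <= r -> `|B (k2%:R * h) w - y j| <= r ->
  (forall i, m i = 0 \/ `|y j - y i| <= D) ->
  (\sum_i m i * Lam D r `|y j - y i| ^+ 2) ^+ 2 <=
  16 * meet_windows (xi := bm_step B h) M n m y (1, 0) D r (k1 %/ n) (k2 %/ n) w.
Proof.
move=> bm n0 m0 D0 r0 rD h0 ab ks Hs d1 d2 dm.
set a := (k1 %/ n)%N in ab *; set b := (k2 %/ n)%N in ab *.
have bn : (b * n)%:R * h <= s.
  by apply: le_trans ks; rewrite ler_wpM2r// ler_nat leq_trunc_div.
have an : (a * n)%:R * h <= s.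
  by apply: le_trans bn; rewrite ler_wpM2r// ler_nat leq_mul2r (ltnW (ltnW ab)) orbT.
rewrite /meet_windows (win_path (s := s)) ?mul1r//; last first.
  rewrite add0n; apply: le_trans an; rewrite ler_wpM2r// ler_nat mulnA leq_mul2r.
  by rewrite leq_trunc_div orbT.
have -> : gap_window (xi := bm_step B h) M n a b w = 1.
  rewrite /gap_window; case: ifP => // _; apply: (win_path (s := s)) => //.
  apply: le_trans bn; rewrite ler_wpM2r// ler_nat mulnA -mulnDl leq_mul2r; apply/orP; right.
  by rewrite -leq_subRL ?(ltnW ab)// leq_trunc_div.
rewrite mul1r /meet_max (_ : 16 = 4 ^+ 2); last by ring.
rewrite -exprMn ler_pXn2r ?nnegrE//; last 2 first.
- by apply: sumr_ge0 => i _; rewrite mulr_ge0// sqr_ge0.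
- exact: (mulr_ge0 (ler0n _ _) (runmax_ge0 _ _ _)).
have in1 : (k1 %% n < n)%N by rewrite ltn_mod.
have in2 : (k2 %% n < n)%N by rewrite ltn_mod.
apply: (@le_trans _ _ (4 * \sum_i m i * Lker D r (B (k2%:R * h) w - y i) * Lker D r (B (k1%:R * h) w - y i))).
  rewrite mulr_sumr; apply: ler_sum => i _.
  have [->|di] := dm i; first by rewrite !mul0r mulr0.
  rewrite -(mulrA (m i)) (mulrCA 4); apply: ler_wpM2l => //.
  have e1 := Lam_le_Lker D0 r0 d1 di rD; have e2 := Lam_le_Lker D0 r0 d2 di rD.
  rewrite expr2 (_ : 4 * _ = (2 * Lker D r (B (k2%:R * h) w - y i)) * (2 * Lker D r (B (k1%:R * h) w - y i))); last by ring.
  by apply: ler_pM => //; exact: Lam_ge0.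
rewrite ler_pM2l//; apply: le_trans (runmax_ge _ w in1).
apply: (le_trans _ (le_bigmax _ _ (Ordinal in2))).
rewrite /= -addrA -wsum_cat ?leq0n ?leq_addr// /a /b -!divn_eq !(bm_wsum0 bm).
by [].
Qed.

(** Intervals of length 72 / M <= eps^2 / 4 guarantee a whole interval between two passages
    separated by eps^2. Conversely M eps^2 <= 300 = 12 * 25, so the weighted number of pairs is of
    order eps^-4 |ln eps|. *)
Lemma interval_count (R : realType) (eps : R) : 0 < eps -> eps < 1 / 3 ->
  exists2 M : nat, (0 < M)%N & 72 / M%:R <= eps ^+ 2 / 4 /\
    M%:R / 288 * (5 + ln M%:R) * (2 * M%:R) * eps ^+ 4 <= 25 ^+ 2 * (23 * `|ln eps|).
Proof.
move=> e0 e3; have [_ l23] := ln_eps_ge e0 e3.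
have e20 : 0 < eps ^+ 2 by exact: exprn_gt0.
have e21 : eps ^+ 2 <= 1 by rewrite expr_le1 ?ltW//; lra.
have q0 : 0 <= 288 / eps ^+ 2 := divr_ge0 (ler0n _ _) (ltW e20).
exists (Num.trunc (288 / eps ^+ 2)).+1 => //.
have := truncn_itv q0; set M := (Num.trunc _).+1.
rewrite ler_pdivlMr// ltr_pdivrMr// -/M => /andP[M1 M2].
have {}M1 : M%:R * eps ^+ 2 <= 12 * 25.
  rewrite /M -(natr1 (Num.trunc _)) mulrDl mul1r -[leRHS]natrM.
  by apply: le_trans (lerD M1 e21) _; rewrite natr1 ler_nat.
have M0 : 1 <= M%:R :> R by rewrite ler1n.
have MR : 0 < M%:R :> R by apply: lt_le_trans M0.
split.
  rewrite ler_pdivrMr// mulrAC ler_pdivlMr// mulrC (mulrC (eps ^+ 2)).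
  by apply: le_trans (ltW M2); rewrite -natrM ler_nat.
(* M is at most 2^9 eps^-2, so the left side is at most 14 + 2 |ln eps|, and |ln eps| >= 2/3 turns
   14 into 21 |ln eps|. *)
have lM : 5 + ln M%:R <= 23 * `|ln eps|.
  have lE : ln (eps^-1) = `|ln eps| by rewrite lnV ?posrE// ler0_norm// ln_le0//; lra.
  have -> : M%:R = M%:R * eps ^+ 2 * (eps^-1 ^+ 2) by field; rewrite gt_eqF.
  have h1 : M%:R * eps ^+ 2 * (eps^-1 ^+ 2) <= 2 ^+ 9 * (eps^-1 ^+ 2).
    rewrite ler_wpM2r ?sqr_ge0//; apply: le_trans M1 _.
    by rewrite -natrM -natrX ler_nat.
  have ie : 0 < eps^-1 by rewrite invr_gt0.
  have h2 : ln (M%:R * eps ^+ 2 * (eps^-1 ^+ 2)) <= 9 * ln 2 + 2 * `|ln eps|.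
    apply: le_trans (le_lnD _ _ h1) _; rewrite ?mulr_gt0 ?exprn_gt0//.
    rewrite (lnM (exprn_gt0 9 (ltr0n R 2)) (exprn_gt0 2 ie)) (lnXn 9 (ltr0n R 2)) (lnXn 2 ie) lE.
    by rewrite -(mulr_natl (ln 2)) -(mulr_natl `|ln eps|).
  have l2 := @ln_upper R 2 (ltr0n _ 2).
  by move: h2 l2 l23; lra.
have -> : M%:R / 288 * (5 + ln M%:R) * (2 * M%:R) * eps ^+ 4 =
    (M%:R * eps ^+ 2 / 12) ^+ 2 * (5 + ln M%:R).
  by field.
have l0 : 0 <= ln M%:R :> R by exact: ln_ge0.
apply: ler_pM => //; first exact: sqr_ge0.
  by move: l0; lra.
rewrite ler_pXn2r ?nnegrE ?divr_ge0 ?mulr_ge0 ?(ltW e20) ?(ltW e0)//.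
by rewrite ler_pdivrMr// (mulrC 25).
Qed.

Lemma sum_pairE (V : nmodType) (I J : finType) (G : I * J -> V) :
  \sum_p G p = \sum_i \sum_j G (i, j).
Proof. by rewrite pair_bigA; apply: eq_bigr => -[]. Qed.

Lemma nat_sum_ge (R : realType) (F : nat -> R) a b i : (a <= i < b)%N ->
  (forall j, (a <= j < b)%N -> 0 <= F j) -> F i <= \sum_(a <= j < b) F j.
Proof.
move=> /andP[ai ib] F0; rewrite (@big_cat_nat _ _ _ i)//= ?(ltnW ib)// (big_ltn ib)/=.
have h1 : 0 <= \sum_(a <= j < i) F j.
  rewrite big_nat_cond; apply: sumr_ge0 => j /andP[/andP[aj ji] _]; apply: F0.
  by rewrite aj (ltn_trans ji).
have h2 : 0 <= \sum_(i.+1 <= j < b) F j.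
  rewrite big_nat_cond; apply: sumr_ge0 => j /andP[/andP[ij jb] _]; apply: F0.
  by rewrite jb (leq_trans ai)// ltnW.
by rewrite addrCA lerDl addr_ge0.
Qed.

(** Only points in the same coarse cell of the [n0]-grid interact, at scale D = 2 eps; each coarse
    cell is handled as a measure of its own. The factor D^4 in [meet_const] cancels the eps^-4 from
    the pairs of intervals and |ln eps| remains. *)
Lemma two_point_energy (R : realType) : exists2 K : R, 0 < K &
  forall d (T : measurableType d) (P : probability T R) B, planar_brownian_motion P (1, 0) B ->
  forall (e : T -> bool) (X : T -> R * R) (N k n0 : nat) (r eps : R),
  measurable_fun setT e -> measurable_fun setT X -> (0 < k)%N -> (0 < n0)%N ->
  0 < eps -> eps < 1 / 3 -> 2 / k%:R <= r -> r <= 2 * eps -> n0%:R^-1 + 2 / k%:R <= 2 * eps ->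
  (forall w, e w -> `|X w| <= 1 / 3 /\ dblpt (B ^~ w) N%:R 3 (eps ^+ 2) (X w)) ->
  let m p := Ex P (fun w => ind R (e w) * (ind R (incell p.1 (X w)) * ind R (incell p.2 (X w)))) in
  is_true (\sum_(p : ('I_n0 * 'I_n0) * ('I_k * 'I_k)) m p *
    (\sum_q m q * (ind R (p.1 == q.1) * Lam (2 * eps) r `|cpt R p.2 - cpt R q.2| ^+ 2)) <=
    K * `|ln eps| * Ex P (fun w => ind R (e w))).
Proof.
(* One interval, of length at most eps^2 / 4, followed by 64 D^2 = 256 eps^2 rounded up to whole
   intervals fits into 260 eps^2 = 65 D^2. *)
have CT1 : 1 <= 65 :> R by rewrite ler1n.
have [C C0 HC] := hit_green_upper CT1.
pose K0 := meet_const (2 : R) C 65.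
have l2 : 0 <= ln 2 :> R by rewrite ln_ge0// ler1n.
have K00 : 0 < K0.
  have e0 : 0 < 4 * (expR (- 4) / 2) ^- 2 :> R.
    by rewrite mulr_gt0// invr_gt0 exprn_gt0// divr_gt0 ?expR_gt0.
  have c0 : 0 < C * (1 + ln 2) by apply: mulr_gt0 => //; move: l2; lra.
  have f0 : 0 < 2 ^+ 2 :> R by exact: exprn_gt0.
  apply: mulr_gt0 e0 (mulr_gt0 (mulr_gt0 e0 (mulr_gt0 c0 _)) (mulr_gt0 c0 _)).
    exact: (mulr_gt0 (mulr_gt0 (ltr0n R 8) (ltr0n R 65)) f0).
  exact: (mulr_gt0 (ltr0n R 2) (mulr_gt0 (ltr0n R 64) (mulr_gt0 (ltr0n R 65) f0))).
exists (16 * (25 ^+ 2 * 23 * K0)) => [|d T P B bm e X N k n0 r eps me mX k0 n00 e0 e3 kr re nke He m].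
  exact: (mulr_gt0 (ltr0n R 16) (mulr_gt0 (mulr_gt0 (exprn_gt0 2 (ltr0n R 25)) (ltr0n R 23)) K00)).
have [_ l23] := ln_eps_ge e0 e3.
have ell0 : 0 < `|ln eps| by apply: lt_le_trans l23; rewrite divr_gt0.
have kR : 0 < k%:R :> R by rewrite ltr0n.
have ik0 : 0 < k%:R^-1 :> R by rewrite invr_gt0.
have r0 : 0 < r by apply: lt_le_trans kr; rewrite divr_gt0.
have r20 : 0 < r ^+ 2 by exact: exprn_gt0.
have D0 : 0 < 2 * eps by rewrite mulr_gt0.
have e20 : 0 < eps ^+ 2 by exact: exprn_gt0.
have e40 : 0 < eps ^+ 4 by exact: exprn_gt0.
have [M M0 [hM WM]] := interval_count e0 e3.
have MR : 0 < M%:R :> R by rewrite ltr0n.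
have be : bmf (fun w => ind R (e w)) by exact: bmf_bool.
pose q (p : ('I_n0 * 'I_n0) * ('I_k * 'I_k)) w :=
  ind R (e w) * (ind R (incell p.1 (X w)) * ind R (incell p.2 (X w))).
have bq p : bmf (q p) by apply: bmfM => //; apply: bmfM; exact: bmf_incell.
have m0 p : 0 <= m p by exact: (Ex_ge0 P (bq p)).
have [l0 Hl0] := mesh_small r20.
pose L l := (2 ^ (l0 + l))%N; pose hh l : R := 72 / (M * L l)%:R.
have Ln0 l : (0 < L l)%N by rewrite expn_gt0.
have ML0 l : 0 < (M * L l)%:R :> R by rewrite ltr0n muln_gt0 M0 Ln0.
have hh0 l : 0 < hh l by rewrite divr_gt0.
have Lh l : (M * L l)%:R * hh l = 72 by rewrite /hh mulrC divfK// gt_eqF.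
have hhL l : hh l <= 72 / (L l)%:R.
  rewrite /hh; apply: ler_wpM2l => //.
  by rewrite lef_pV2 ?posrE// ?ltr0n// ler_nat leq_pmull.
have hr l : hh l <= r ^+ 2 by apply: le_trans (hhL l) _; apply: Hl0; exact: leq_addr.
have gw l := bm_walk bm (hh0 l).
have eta_eq l : (L l)%:R * hh l = 72 / M%:R.
  by rewrite -(Lh l) natrM; field; rewrite gt_eqF.
pose V := (Num.trunc (256 * eps ^+ 2 / (72 / M%:R))).+1.
have eta0 : 0 < 72 / M%:R :> R by rewrite divr_gt0.
have Veps : 256 * eps ^+ 2 <= V%:R * (72 / M%:R).
  by rewrite -ler_pdivrMr//; apply: ltW; exact: truncnS_gt.
have Veps2 : V%:R * (72 / M%:R) <= 256 * eps ^+ 2 + 72 / M%:R.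
  rewrite /V -(natr1 (Num.trunc _)) mulrDl mul1r lerD2r -ler_pdivlMr// truncn_le.
  apply: divr_ge0 (ltW eta0); exact: (mulr_ge0 (ler0n R 256) (ltW e20)).
have long l : 64 * (2 * eps) ^+ 2 <= (V * L l)%:R * hh l.
  rewrite natrM -mulrA eta_eq (_ : 64 * _ = 256 * eps ^+ 2)//; ring.
have short l : (L l + V * L l)%:R * hh l <= 65 * (2 * eps) ^+ 2.
  rewrite natrD natrM mulrDl -mulrA eta_eq (_ : 65 * _ = 260 * eps ^+ 2); last by ring.
  by move: Veps2 hM e20; clear; lra.
have r2D : r <= 2 * (2 * eps) by apply: le_trans re _; rewrite ler_peMl ?ler1n// ltW.
have far (j : 'I_k * 'I_k) : 1 / 2 <= `|cpt R j - (1, 0)| by exact: cpt_far.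
pose NN := (N * M).+1.
(* The intervals of the two passages are random, so all pairs with a nonempty gap ([a.+2 <= b]) are
   summed, and all coarse cells. *)
pose G l w := \sum_c 16 * (\sum_(0 <= a < NN) \sum_(a.+2 <= b < NN)
  meet_windows (xi := bm_step B (hh l)) M (L l) (fun j => m (c, j)) (fun j => cpt R j) (1, 0) (2 * eps) r a b w).
have bmw l c a b : (a.+1 < b)%N -> bmf (meet_windows (xi := bm_step B (hh l)) M (L l)
    (fun j => m (c, j)) (fun j => cpt R j) (1, 0) (2 * eps) r a b).
  by move=> ab; apply: (bmf_meet_windows (gw l)).
have bGs l c : bmf (fun w => \sum_(0 <= a < NN) \sum_(a.+2 <= b < NN)
  meet_windows (xi := bm_step B (hh l)) M (L l) (fun j => m (c, j)) (fun j => cpt R j) (1, 0) (2 * eps) r a b w).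
  apply: bmf_sum => a _.
  apply: (@bmf_eq _ _ _ (fun w => \sum_(a.+2 <= b < NN | (a.+1 < b)%N) meet_windows (xi := bm_step B (hh l)) M (L l)
    (fun j => m (c, j)) (fun j => cpt R j) (1, 0) (2 * eps) r a b w)).
    move=> w; rewrite big_nat_cond [RHS]big_nat_cond; apply: eq_bigl => b.
    by case: (a.+1 < b)%N; rewrite ?andbF.
  by apply: bmf_sum => b; exact: bmw.
have bG l : bmf (G l) by apply: bmf_sum => c _; apply: bmfM => //; exact: bmf_cst.
pose kap (p p' : ('I_n0 * 'I_n0) * ('I_k * 'I_k)) : R :=
  ind R (p.1 == p'.1) * Lam (2 * eps) r `|cpt R p.2 - cpt R p'.2| ^+ 2.
have VE c j : \sum_p m p * kap (c, j) p =
    \sum_i m (c, i) * Lam (2 * eps) r `|cpt R j - cpt R i| ^+ 2.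
  rewrite sum_pairE (bigD1 c)//= [X in _ + X]big1.
    by rewrite addr0; apply: eq_bigr => i _; rewrite /kap eqxx /ind mul1r.
  by move=> c' cc; apply: big1 => i _; rewrite /kap/= eq_sym (negbTE cc) /ind mul0r mulr0.
have sumq w F : e w -> exists c j, [/\ incell c (X w), incell j (X w) & \sum_p q p w * F p = F (c, j)].
  move=> ew; have [X3 _] := He w ew.
  have [c Hc Sc] := sum_incell n00 X3; have [j Hj Sj] := sum_incell k0 X3.
  exists c, j; split => //.
  rewrite sum_pairE -(Sc (fun c => F (c, j))).
  apply: eq_bigr => c' _; rewrite -(Sj (fun j => F (c', j))) mulr_sumr; apply: eq_bigr => i _.
  by rewrite /q ew/= [ind R true]/ind mul1r mulrA.
have mE : \sum_p m p <= Ex P (fun w => ind R (e w)).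
  rewrite /m -(Ex_sum P _ (F := q)); last by move=> p _; exact: bq.
  apply: Ex_le => //; first by apply: bmf_sum => p _; exact: bq.
  move=> w; have [ew|ew] := boolP (e w); last by rewrite big1// => j _; rewrite /q (negbTE ew) /ind/= mul0r.
  have [c [j [_ _ H]]] := sumq w (fun=> 1) ew.
  by move: H; under eq_bigr do rewrite mulr1; rewrite /q ew => ->.
apply: (@le_trans _ _ (16 * (25 ^+ 2 * 23 * K0) * `|ln eps| * \sum_p m p)); last first.
  apply: ler_wpM2l => //; apply: mulr_ge0 (ltW ell0).
  apply: mulr_ge0 (ler0n _ _) (mulr_ge0 (mulr_ge0 (exprn_ge0 _ (ler0n _ _)) (ler0n _ _)) (ltW K00)).
apply: (@self_bounding _ _ _ P _ q kap G (16 * (25 ^+ 2 * 23 * K0) * `|ln eps|)) => //.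
- apply: mulr_gt0 ell0.
  exact: (mulr_gt0 (ltr0n R 16) (mulr_gt0 (mulr_gt0 (exprn_gt0 2 (ltr0n R 25)) (ltr0n R 23)) K00)).
- by move=> p p'; apply: mulr_ge0 (sqr_ge0 _); rewrite /ind.
- move=> w; have [ew|ew] := boolP (e w); last first.
    exists 0%N => l _; rewrite big1; first exact: bmf_ge0 (bG l).
    by move=> j _; rewrite /q (negbTE ew) /ind/= !mul0r.
  have [X3 [t1 [t2 [t10 t2N t12 [Bt1 Bt2] Ht]]]] := He w ew.
  have [c [j [Hc Hj ->]]] := sumq w (fun p => (\sum_p' m p' * kap p p') ^+ 2) ew.
  have t20 : 0 <= t2 by apply: le_trans t12; rewrite addr_ge0// ltW.
  have [eta1 eta10 Heta1] := ray_continuousP (bm_continuous bm (w := w)) t10 ik0.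
  have [eta2 eta20 Heta2] := ray_continuousP (bm_continuous bm (w := w)) t20 ik0.
  have [l1 Hl1] := mesh_small (divr_gt0 eta10 (ltr0n _ 2)).
  have [l3 Hl3] := mesh_small (divr_gt0 eta20 (ltr0n _ 2)).
  exists (l1 + l3)%N => l ll.
  have hle1 : hh l <= eta1 / 2.
    apply: le_trans (hhL l) _; apply: Hl1; apply: leq_trans (leq_addl l0 l).
    by apply: leq_trans ll; exact: leq_addr.
  have hle2 : hh l <= eta2 / 2.
    apply: le_trans (hhL l) _; apply: Hl3; apply: leq_trans (leq_addl l0 l).
    by apply: leq_trans ll; exact: leq_addl.
  have [k1t tk1] := grid_time t10 (hh0 l); have [k2t tk2] := grid_time t20 (hh0 l).
  set k1 := Num.trunc (t1 / hh l) in k1t tk1; set k2 := Num.trunc (t2 / hh l) in k2t tk2.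
  (* The separation eps^2 is at least four intervals, and this is inherited by the rounded times; in
     particular their intervals are not adjacent. *)
  have k12 : (k1 + 4 * L l <= k2)%N.
    rewrite -ltnS -(ltr_nat R) -(ltr_pM2r (hh0 l)) natrD natrM mulrDl -mulrA eta_eq -(natr1 k2).
    apply: le_lt_trans tk2; apply: le_trans t12; apply: lerD => //.
    by rewrite mulrC -ler_pdivlMr.
  have ab : ((k1 %/ L l).+1 < k2 %/ L l)%N.
    have := leq_div2r (L l) k12; rewrite addnC divnMDl//.
    by apply: leq_trans; rewrite addSn addSn ltnS ltnS leq_addl.
  have bN : (k2 %/ L l < NN)%N.
    rewrite ltnS -(ler_nat R) natrM -ler_pdivrMr//.
    apply: le_trans t2N; apply: le_trans k2t.
    apply: (@le_trans _ _ ((k2 %/ L l * L l)%:R * hh l)); last first.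
      by rewrite ler_wpM2r ?(ltW (hh0 l))// ler_nat leq_trunc_div.
    rewrite natrM -mulrA eta_eq; apply: ler_wpM2l => //.
    by rewrite ler_peMl ?invr_ge0// ler1n.
  have near k' t : 0 <= t -> B t w = X w -> `|B (k'%:R * hh l) w - B t w| < k%:R^-1 ->
      `|B (k'%:R * hh l) w - cpt R j| <= r.
    move=> tt0 Bt Bk; have -> : B (k'%:R * hh l) w - cpt R j =
       (B (k'%:R * hh l) w - B t w) + (X w - cpt R j) by rewrite Bt addrA subrK.
    apply: le_trans (ler_normD _ _) _; apply: le_trans kr.
    rewrite (_ : 2 / k%:R = k%:R^-1 + k%:R^-1); last by field; rewrite gt_eqF.
    by apply: lerD; [exact: ltW|exact: cpt_close].
  have near1 : `|B (k1%:R * hh l) w - cpt R j| <= r.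
    apply: (near _ t1) => //; apply: Heta1; first by rewrite mulr_ge0// ltW.
    by rewrite ltr_norml; apply/andP; split; move: eta10 hle1 k1t tk1; clear -R; lra.
  have near2 : `|B (k2%:R * hh l) w - cpt R j| <= r.
    apply: (near _ t2) => //; apply: Heta2; first by rewrite mulr_ge0// ltW.
    by rewrite ltr_norml; apply/andP; split; move: eta20 hle2 k2t tk2; clear -R; lra.
  (* A fine cell charged together with the coarse cell [c] contains a value of [X] lying in [c], so
     its corner is within one coarse mesh and two fine ones of the corner for [j]. *)
  have dm i : m (c, i) = 0 \/ `|cpt R j - cpt R i| <= 2 * eps.
    have [[w' /andP[_ /andP[Hc' Hi]]]|nw] := pselect (exists w', e w' && (incell c (X w') && incell i (X w'))).
      right; apply: le_trans nke.
      have -> : cpt R j - cpt R i = (X w - X w') + ((X w' - cpt R i) - (X w - cpt R j)).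
        rewrite opprB -(addrA (X w')) (addrA (X w - X w')) subrK.
        by rewrite addrC -(addrA (- cpt R i)) subrK addrC.
      apply: le_trans (ler_normD _ _) _; apply: lerD; first exact: incell_close Hc Hc'.
      apply: le_trans (ler_normB _ _) _.
      rewrite (_ : 2 / k%:R = k%:R^-1 + k%:R^-1); last by field; rewrite gt_eqF.
      by apply: lerD; exact: cpt_close.
    left; rewrite /m -(Ex_cst P 0); apply: Ex_eq => w'.
    have : ~~ (e w' && (incell c (X w') && incell i (X w'))) by apply/negP => H; apply: nw; exists w'.
    by rewrite /ind/=; case: (e w'); case: (incell c (X w')); case: (incell i (X w')) => //= _; rewrite ?mulr0n ?mul0r ?mulr0 ?mul0r.
  have W0 c' : 0 <= \sum_(0 <= a < NN) \sum_(a.+2 <= b < NN)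
     meet_windows (xi := bm_step B (hh l)) M (L l) (fun j => m (c', j)) (fun j => cpt R j) (1, 0) (2 * eps) r a b w.
    exact: bmf_ge0 w (bGs l c').
  rewrite /G (bigD1 c)//=; apply: ler_wpDr.
    by apply: sumr_ge0 => c' _; exact: mulr_ge0.
  rewrite VE; apply: (@le_trans _ _ (16 * meet_windows (xi := bm_step B (hh l)) M (L l) (fun j => m (c, j))
    (fun j => cpt R j) (1, 0) (2 * eps) r (k1 %/ L l) (k2 %/ L l) w)).
    exact: (@meet_windows_ge _ _ _ P B M (L l) _ (fun j => m (c, j)) (fun j => cpt R j) (2 * eps) r (hh l) t2
      k1 k2 w j bm (Ln0 l) (fun i => m0 (c, i)) D0 r0 re (ltW (hh0 l)) ab k2t Ht near1 near2 dm).
  rewrite ler_pM2l//.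
  have aN : (0 <= k1 %/ L l < NN)%N by rewrite leq0n/=; apply: ltn_trans bN; exact: ltnW.
  pose mw a b := meet_windows (xi := bm_step B (hh l)) M (L l) (fun j => m (c, j))
    (fun j => cpt R j) (1, 0) (2 * eps) r a b w.
  have mw0 a b : (a.+1 < b)%N -> 0 <= mw a b by move=> ab'; exact: bmf_ge0 w (bmw l c _ _ ab').
  apply: (@le_trans _ _ (\sum_((k1 %/ L l).+2 <= b < NN) mw (k1 %/ L l)%N b)).
    apply: (@nat_sum_ge _ (mw (k1 %/ L l)%N)); first by rewrite ab.
    by move=> b /andP[ab' _]; exact: mw0.
  apply: (@nat_sum_ge _ (fun a => \sum_(a.+2 <= b < NN) mw a b)); first exact: aN.
  move=> a _; rewrite big_nat_cond; apply: sumr_ge0 => b /andP[/andP[ab' _] _]; exact: mw0.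
- move=> l; rewrite /G Ex_sum; last by move=> c _; apply: bmfM => //; exact: bmf_cst.
  pose S c := \sum_j \sum_i m (c, j) * m (c, i) * Lam (2 * eps) r `|cpt R j - cpt R i| ^+ 2.
  have S0 c : 0 <= S c.
    by apply: sumr_ge0 => j _; apply: sumr_ge0 => i _; apply: mulr_ge0 (sqr_ge0 _); exact: mulr_ge0.
  have -> : \sum_j m j * (\sum_i m i * kap j i) = \sum_c S c.
    rewrite sum_pairE.
    apply: eq_bigr => c _; apply: eq_bigr => j _; rewrite VE mulr_sumr.
    by apply: eq_bigr => i _; rewrite mulrA.
  rewrite mulr_sumr; apply: ler_sum => c _; rewrite ExZ// -(mulrA 16) -(mulrA 16) ler_pM2l//.
  have := @meet_windows_sum _ _ _ P (hh l) _ (hh0 l) (gw l) M (L l) (V * L l) _ (fun j => m (c, j)) (fun j => cpt R j)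
    (1, 0) (2 * eps) r C 65 M0 (Ln0 l) (Lh l) (fun j => m0 (c, j)) D0 r0 (hr l) r2D C0 far (long l) (short l)
    (fun c J H => HC _ _ _ _ _ (hh0 l) (gw l) _ _ _ _ D0 r0 (hr l) H) NN (le_trans ler01 CT1).
  move=> /le_trans; apply; rewrite -/(S c); apply: ler_wpM2r => //.
  rewrite (_ : meet_const _ _ _ = eps ^+ 4 * K0); last by rewrite /K0 /meet_const; set l2' := ln _; set e4 := expR _; ring.
  rewrite (mulrA _ (eps ^+ 4)); apply: le_trans (ler_wpM2r (ltW K00) WM) _.
  by rewrite (mulrA (25 ^+ 2)) mulrAC.
Qed.

(** * The conditional law of the selected point and its energy *)

Section conditional_law.
Context {R : realType} {d} {T : measurableType d} (P : probability T R).
Notation pt := (R * R)%type.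

Let restrict_zero (D E : set T) (mD : measurable D) (f : T -> \bar R) : measurable E ->
  E `&` D = set0 -> (forall w, ~ E w -> f w = 0%E) -> measurable_fun setT f ->
  (\int[mrestr P mD]_w f w = 0)%E.
Proof.
move=> mE ED f0 mf.
have -> : (\int[mrestr P mD]_w f w = \int[mrestr P mD]_(w in E) f w)%E.
  rewrite [RHS]integral_mkcond; apply: eq_integral => w _; rewrite patchE.
  by case: ifPn => // /negP wE; rewrite f0// => Ew; apply: wE; rewrite inE.
apply: null_set_integral => //; first exact: measurable_funS mf.
by change (P (E `&` D) = 0%E); rewrite ED measure0.
Qed.

Lemma integral_restrict (e : T -> bool) (f : T -> \bar R) (mE : measurable [set w | e w]) :
  (forall w, 0 <= f w)%E -> measurable_fun setT f ->
  (\int[mrestr P mE]_w f w = \int[P]_w ((ind R (e w))%:E * f w))%E.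
Proof.
move=> f0 mf.
have mE' : measurable (~` [set w | e w]) by exact: measurableC.
have me : measurable_fun setT (fun w => (ind R (e w))%:E).
  rewrite (_ : (fun _ => _) = fun w => (\1_[set w | e w] w)%:E); last first.
    apply/funext => w; rewrite indicE; congr ((nat_of_bool _)%:R)%:E.
    by apply/idP/idP; rewrite inE.
  by apply/measurable_EFinP; exact: measurable_indic.
have mef : measurable_fun setT (fun w => (ind R (e w))%:E * f w)%E by exact: emeasurable_funM.
have ef0 w : (0 <= (ind R (e w))%:E * f w)%E by apply: mule_ge0 => //; rewrite lee_fin /ind.
have mnf : measurable_fun setT (fun w => (ind R (~~ e w))%:E * f w)%E.
  apply: emeasurable_funM => //.
  rewrite (_ : (fun _ => _) = fun w => (\1_(~` [set w | e w]) w)%:E); last first.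
    apply/funext => w; rewrite indicE in_setC; congr ((nat_of_bool (~~ _))%:R)%:E.
    by apply/idP/idP; rewrite inE.
  by apply/measurable_EFinP; exact: measurable_indic.
have nf0 w : (0 <= (ind R (~~ e w))%:E * f w)%E by apply: mule_ge0 => //; rewrite lee_fin /ind.
transitivity (\int[mrestr P mE]_w ((ind R (e w))%:E * f w))%E.
  transitivity (\int[mrestr P mE]_w ((ind R (e w))%:E * f w + (ind R (~~ e w))%:E * f w))%E.
    by apply: eq_integral => w _; rewrite /ind; case: (e w); rewrite /= ?mul1e ?mul0e ?adde0 ?add0e.
  rewrite ge0_integralD// [X in (_ + X)%E](restrict_zero (E := ~` [set w | e w])) ?adde0//.
    by rewrite setICl.
  by move=> w /contrapT ew; rewrite /ind ew/= mul0e.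
transitivity (\int[measure_add (mrestr P mE) (mrestr P mE')]_w ((ind R (e w))%:E * f w))%E.
  rewrite ge0_integral_measure_add// [X in (_ + X)%E](restrict_zero (E := [set w | e w])) ?adde0//.
    by rewrite setICr.
  by move=> w /negP ew; rewrite /ind (negbTE ew)/= mul0e.
apply: eq_measure_integral => Y mY _.
change (measure_add (mrestr P mE) (mrestr P mE') Y = P Y).
rewrite measure_addE; change (P (Y `&` [set w | e w]) + P (Y `&` ~` [set w | e w]) = P Y)%E.
rewrite -measureU//.
- by rewrite -setIUr setUv setIT.
- exact: measurableI.
- exact: measurableI.
- by rewrite setIACA setICr setI0.
Qed.

Lemma conditional_law (e : T -> bool) (X : T -> pt) : measurable_fun setT e -> measurable_fun setT X ->
  0 < Ex P (fun w => ind R (e w)) ->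
  exists nu : probability pt R, forall phi : pt -> R, bmf phi ->
    Ex nu phi = (Ex P (fun w => ind R (e w)))^-1 * Ex P (fun w => ind R (e w) * phi (X w)).
Proof.
move=> me mX; set Z := Ex P _ => Z0.
have mE : measurable [set w | e w] by rewrite -[X in measurable X]setTI; exact: me.
have ZE : P [set w | e w] = Z%:E.
  by rewrite /Z Ex_bool// fineK// fin_num_measure.
pose Q := mnormalize (mrestr P mE) P.
pose X' : {mfun T >-> pt} := HB.pack X (isMeasurableFun.Build _ _ _ _ X mX).
have iZ0 : 0 <= Z^-1 by rewrite invr_ge0 ltW.
exists (distribution Q X') => phi bphi.
have bX : bmf (fun w => phi (X w)) by exact: (bmf_comp mX bphi).
have be : bmf (fun w => ind R (e w)) by exact: bmf_bool.
apply: EFin_inj; rewrite -ExE// ge0_integral_distribution//=; last 2 first.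
- exact: bmf_EFin.
- by move=> x; rewrite lee_fin; exact: bmf_ge0 bphi.
have -> : (\int[Q]_w (phi (X w))%:E = \int[mscale (NngNum iZ0) (mrestr P mE)]_w (phi (X w))%:E)%E.
  apply: eq_measure_integral => Y mY _; rewrite /Q/= /mnormalize /mscale/=.
  have rT : mrestr P mE setT = Z%:E by rewrite /mrestr setTI.
  by rewrite rT eqe gt_eqF//= muleC.
rewrite ge0_integral_mscale//; last 2 first.
- exact: bmf_EFin.
- by move=> w _; rewrite lee_fin; exact: bmf_ge0 bX.
rewrite integral_restrict; last 2 first.
- by move=> w; rewrite lee_fin; exact: bmf_ge0 bX.
- exact: bmf_EFin.
rewrite EFinM -ExE//; last exact: bmfM.
Qed.

End conditional_law.

Section double_integrals.
Context {R : realType} {d} {T : measurableType d} (P : probability T R).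

Lemma Ex2_le_sum (J : finType) (q : J -> T -> R) (F : T * T -> R) (k : J -> J -> R) :
  (forall j, bmf (q j)) -> bmf F -> (forall j i, 0 <= k j i) ->
  (forall w v, F (w, v) <= \sum_j \sum_i q j w * q i v * k j i) ->
  Ex P (fun w => Ex P (fun v => F (w, v))) <= \sum_j Ex P (q j) * \sum_i Ex P (q i) * k j i.
Proof.
move=> bq bF k0 HF.
have bG w : bmf (fun v => \sum_j \sum_i q j w * q i v * k j i).
  apply: bmf_sum => j _; apply: bmf_sum => i _; apply: bmfM; last exact: bmf_cst.
  by apply: bmfM => //; apply: bmf_cst; exact: bmf_ge0 (bq j).
have E1 w : Ex P (fun v => \sum_j \sum_i q j w * q i v * k j i) = \sum_j q j w * \sum_i Ex P (q i) * k j i.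
  rewrite Ex_sum; last first.
    move=> j _; apply: bmf_sum => i _; apply: bmfM; last exact: bmf_cst.
    by apply: bmfM => //; apply: bmf_cst; exact: bmf_ge0 (bq j).
  apply: eq_bigr => j _; have qj0 : 0 <= q j w by exact: bmf_ge0 (bq j).
  rewrite Ex_sum; last first.
    move=> i _; apply: bmfM; last exact: bmf_cst.
    by apply: bmfM => //; exact: bmf_cst.
  rewrite mulr_sumr; apply: eq_bigr => i _.
  transitivity (Ex P (fun v => q j w * k j i * q i v)); first by apply: Ex_eq => v; ring.
  by rewrite ExZ ?mulr_ge0//; ring.
have m0 i : 0 <= Ex P (q i) by exact: Ex_ge0.
have bS : bmf (fun w => \sum_j q j w * \sum_i Ex P (q i) * k j i).
  apply: bmf_sum => j _; apply: bmfM => //; apply: bmf_cst; apply: sumr_ge0 => i _.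
  exact: mulr_ge0.
apply: (@le_trans _ _ (Ex P (fun w => \sum_j q j w * \sum_i Ex P (q i) * k j i))).
  apply: Ex_le => //; first by apply: (@bmf_Ex _ _ T P _ T (fun w v => F (w, v))); apply: bmf_eq bF => -[].
  move=> w; rewrite -E1; apply: Ex_le => //; exact: (bmf_section1 w bF).
rewrite Ex_sum; last first.
  move=> j _; apply: bmfM => //; apply: bmf_cst; apply: sumr_ge0 => i _; exact: mulr_ge0.
rewrite le_eqVlt; apply/orP; left; apply/eqP; apply: eq_bigr => j _.
rewrite mulrC -ExZ//; last by apply: sumr_ge0 => i _; exact: mulr_ge0.
by apply: Ex_eq => w; exact: mulrC.
Qed.

(** The gauge, infinite on the diagonal, is bounded by an increasing limit of bounded kernels whose
    truncation shrinks; monotone convergence is applied to these in each variable. *)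
Lemma double_integral_sup (h : T -> T -> \bar R) (F : nat -> T * T -> R) (M : R) :
  (forall x y, 0 <= h x y)%E -> (forall n, bmf (F n)) ->
  (forall n m q, (n <= m)%N -> F n q <= F m q) ->
  (forall x y, h x y <= ereal_sup (range (fun n => (F n (x, y))%:E)))%E ->
  (forall n, Ex P (fun x => Ex P (fun y => F n (x, y))) <= M) ->
  (\int[P]_x \int[P]_y h x y <= M%:E)%E.
Proof.
move=> h0 bF ndF hF FM.
have lim_sup x y : limn (fun n => (F n (x, y))%:E) = ereal_sup (range (fun n => (F n (x, y))%:E)).
  apply/cvg_lim => //; apply: ereal_nondecreasing_cvgn => n m nm; rewrite lee_fin; exact: ndF.
have bFx n x : bmf (fun y => F n (x, y)) by exact: (bmf_section1 x (bF n)).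
have bI n : bmf (fun x => Ex P (fun y => F n (x, y))).
  by apply: (@bmf_Ex _ _ T P _ T (fun x y => F n (x, y))); apply: bmf_eq (bF n) => -[].
have inner x : (\int[P]_y h x y <= limn (fun n => (Ex P (fun y => F n (x, y)))%:E))%E.
  have -> : limn (fun n => (Ex P (fun y => F n (x, y)))%:E) = (\int[P]_y limn (fun n => (F n (x, y))%:E))%E.
    rewrite (_ : (fun n => _) = fun n => (\int[P]_y (F n (x, y))%:E)%E); last first.
      by apply/funext => n; rewrite ExE.
    apply/cvg_lim => //; apply: cvg_monotone_convergence => //.
    - by move=> n; exact: bmf_EFin.
    - by move=> n y _; rewrite lee_fin; exact: bmf_ge0 (bFx n x).
    - by move=> y _ n m nm; rewrite lee_fin; exact: ndF.
  by apply: ge0_integral_mono => // y; rewrite lim_sup.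
apply: (@le_trans _ _ (\int[P]_x limn (fun n => (Ex P (fun y => F n (x, y)))%:E))%E).
  by apply: ge0_integral_mono => // x; exact: integral_ge0.
have ndI x n m : (n <= m)%N -> Ex P (fun y => F n (x, y)) <= Ex P (fun y => F m (x, y)).
  by move=> nm; apply: Ex_le => // y; exact: ndF.
have cI : (\int[P]_x (Ex P (fun y => F n (x, y)))%:E)%E @[n --> \oo] -->
    (\int[P]_x limn (fun n => (Ex P (fun y => F n (x, y)))%:E))%E.
  apply: cvg_monotone_convergence => //.
  - by move=> n; exact: bmf_EFin.
  - by move=> n x _; rewrite lee_fin; exact: Ex_ge0.
  - by move=> x _ n m nm; rewrite lee_fin; exact: ndI.
rewrite -(cvg_lim _ cI)//; apply: lime_le; first by apply/cvg_ex; eexists; exact: cI.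
by apply: nearW => n; rewrite ExE// lee_fin.
Qed.

End double_integrals.

Section kernels.
Context {R : realType}.
Notation pt := (R * R)%type.

(** Distinct indices of equal parity differ by at least 2, so a full cell lies between them. This is
    why a quarter of the cells is kept. *)
Lemma initv_far (n i j : nat) (s t : R) : (0 < n)%N -> odd i = odd j -> i <> j ->
  initv n i s -> initv n j t -> n%:R^-1 <= `|s - t|.
Proof.
move=> n0 oij; wlog ij : i j s t oij / (i < j)%N => [H|_].
  move=> ij si tj; have [l|l|e] := ltngtP i j; first exact: (H i j).
    by rewrite distrC; apply: (H j i) => // e; apply: ij.
  by case: ij.
have {}ij : (i.+2 <= j)%N.
  by rewrite ltn_neqAle ij andbT; apply/eqP => e; move: oij; rewrite -e/=; case: (odd i).
have nR : 0 < n%:R :> R by rewrite ltr0n.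
move=> /andP[_ s2] /andP[t1 _].
rewrite distrC; apply: le_trans (ler_norm _); rewrite -(ler_pM2r nR) mulVf ?gt_eqF//.
have : i.+2%:R <= j%:R :> R by rewrite ler_nat.
rewrite -(natr1 i.+1) => h1.
have -> : (t - s) * n%:R = (t + 1 / 2) * n%:R - (s + 1 / 2) * n%:R by ring.
by move: h1 s2 t1; set a := (s + _) * _; set b := (t + _) * _; lra.
Qed.

Lemma incell_far (n : nat) (c c' : 'I_n * 'I_n) (x y : pt) : (0 < n)%N ->
  (odd c.1, odd c.2) = (odd c'.1, odd c'.2) -> c <> c' -> incell c x -> incell c' y ->
  n%:R^-1 <= `|x - y|.
Proof.
move=> n0 o12; case: (o12) => o1 o2 cc /andP[x1 x2] /andP[y1 y2].
have [e1|/eqP ne1] := eqVneq (c.1 : nat) c'.1.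
  apply: le_trans (snd_le_norm _); apply: initv_far x2 y2 => // e2; apply: cc.
  by case: c c' e1 e2 {o12 o1 o2 x1 y1} => [a b] [a' b'] /= /val_inj -> /val_inj ->.
by apply: le_trans (fst_le_norm _); exact: initv_far x1 y1.
Qed.

Lemma Lam_discrete (D r : R) (k : nat) (x y a b : pt) : 0 < D -> 0 < r -> (0 < k)%N -> 2 / k%:R <= r ->
  `|x - a| <= k%:R^-1 -> `|y - b| <= k%:R^-1 -> Lam D r `|x - y| <= 2 * Lam D r `|a - b|.
Proof.
move=> D0 r0 k0 kr xa yb; have kR : 0 < k%:R :> R by rewrite ltr0n.
have ab : `|a - b| <= `|x - y| + r.
  have -> : a - b = (x - y) + ((y - b) - (x - a)).
    rewrite opprB -(addrA y) (addrA (x - y)) subrK.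
    by rewrite addrC -(addrA (- b)) subrK addrC.
  apply: le_trans (ler_normD _ _) _; rewrite lerD2l; apply: le_trans (ler_normB _ _) _.
  apply: le_trans kr; rewrite (_ : 2 / k%:R = k%:R^-1 + k%:R^-1); last by field; rewrite gt_eqF.
  exact: lerD.
apply: (@le_trans _ _ ((1 + ln 2) * Lam D r `|a - b|)).
  apply: Lam_scale => //; first by rewrite ler1n.
  rewrite (mulrC 2) -mulrA ler_pM2l// ge_max; apply/andP; split.
    by apply: le_trans ab _; rewrite mulr2n mulrDl mul1r lerD// le_max lexx ?orbT.
  by rewrite mulrDl mul1r; apply: ler_wpDr; rewrite le_max ?lexx ?orbT// (ltW r0) orbT.
apply: ler_wpM2r; first exact: Lam_ge0.
have := @ln_upper R 2 ltac:(lra); lra.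
Qed.

(** For t < eps write |ln t| = l + v with l = |ln eps|: then (l + v)^2 / l <= 2 l + 2 v^2 / l. The
    first term is bounded by the one-passage kernel truncated at eps / 2, the second by the squared
    kernel at scale 2 eps. *)
Lemma gauge_le_kernel (eps r u t : R) : 0 < eps -> eps < 1 / 3 -> 0 < r -> r <= u -> u <= t -> t <= 2 * u ->
  t <= 2 / 3 -> rgauge eps t <= 2 * Lam 1 (eps / 2) u +
    ind R (t < eps) * (2 * Lam (2 * eps) r u ^+ 2 / `|ln eps|).
Proof.
move=> e0 e3 r0 ru ut t2u t3.
have u0 : 0 < u by exact: lt_le_trans ru.
have t0 : 0 < t by exact: lt_le_trans ut.
have e20 : 0 < eps / 2 by rewrite divr_gt0.
have tE : `|ln t| = - ln t by rewrite ltr0_norm// ln_lt0// t0/=; lra.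
have [_ l23] := ln_eps_ge e0 e3.
have lE : `|ln eps| = - ln eps by rewrite ltr0_norm// ln_lt0// e0/=; lra.
have l0 : 0 < `|ln eps| by apply: lt_le_trans l23; rewrite divr_gt0.
have L1 := @Lam_ge_ln R 1 (eps / 2) u ltr01 e20.
have Lp : 1 <= Lam 1 (eps / 2) u by exact: Lam_ge1.
have m0 : 0 < Num.max u (eps / 2) by rewrite lt_max u0.
rewrite ln_div ?posrE// ln1 sub0r in L1.
rewrite /rgauge; have [et|te] := leP eps t.
  rewrite /ind mul0r addr0 tE.
  have : ln (Num.max u (eps / 2)) <= ln t.
    by apply: le_lnD => //; rewrite ge_max ut ler_pdivrMr//=; move: et t0; lra.
  by move: L1 Lp; set a := ln (Num.max _ _); lra.
rewrite /ind mul1r.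
have lu : `|ln eps| <= Lam 1 (eps / 2) u.
  have : ln (Num.max u (eps / 2)) <= ln eps.
    by apply: le_lnD => //; rewrite ge_max (le_trans ut (ltW te)) ler_pdivrMr//=; lra.
  by move: L1; rewrite lE; set a := ln (Num.max _ _); lra.
have L2 := @Lam_ge_ln R (2 * eps) r u ltac:(lra) r0.
rewrite (max_l ru) ln_div ?posrE// in L2; last by rewrite mulr_gt0.
have lut : ln u <= ln t by exact: le_lnD.
have l2 : 0 <= ln 2 :> R by rewrite ln_ge0// ler1n.
rewrite lnM ?posrE// in L2.
set v := ln eps - ln t; have v0 : 0 <= v by rewrite subr_ge0; apply: le_lnD => //; exact: ltW.
have vL : v <= Lam (2 * eps) r u by rewrite /v; move: L2 lut l2; lra.
have tv : ln t = - (`|ln eps| + v) by rewrite lE /v; ring.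
apply: (@le_trans _ _ (2 * `|ln eps| + 2 * v ^+ 2 / `|ln eps|)).
  rewrite tv sqrrN ler_pdivrMr// mulrDl divfK ?gt_eqF//.
  have : 0 <= (`|ln eps| - v) ^+ 2 by exact: sqr_ge0.
  by rewrite !expr2; set l := `|ln eps|; lra.
apply: lerD; first by rewrite ler_pM2l.
rewrite ler_pM2r ?invr_gt0// ler_pM2l//.
by rewrite ler_pXn2r ?nnegrE//; exact: Lam_ge0.
Qed.

Lemma ereal_sup_unbounded (a : nat -> R) : (forall A, exists n, A <= a n) ->
  ereal_sup (range (fun n => (a n)%:E)) = +oo%E.
Proof.
move=> H; apply: contrapT => /eqP; rewrite -ltey; set s := ereal_sup _ => sy.
have [n] := H (fine s + 1).
have an : ((a n)%:E <= s)%E by apply: ereal_sup_ubound; exists n.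
have fs : s \is a fin_num by rewrite fin_numE (gt_eqF (lt_le_trans (ltNyr _) an)) lt_eqF.
by move: an; rewrite -{1}(fineK fs) lee_fin; lra.
Qed.

Lemma Lam_r_anti (D r r' x : R) : 0 < D -> 0 < r -> r <= r' -> Lam D r' x <= Lam D r x.
Proof.
move=> D0 r0 rr; rewrite -[leRHS]mul1r -{1}[1](addr0) -ln1.
apply: Lam_scale => //; first exact: lt_le_trans rr.
rewrite mul1r ler_pM2l// ge_max !le_max lexx/= rr orbT//.
Qed.

End kernels.

Lemma sum_incell2 (R : realType) n k (x : R * R) : (0 < n)%N -> (0 < k)%N -> `|x| <= 1 / 3 ->
  exists c j, [/\ incell c x, incell j x & forall F : ('I_n * 'I_n) * ('I_k * 'I_k) -> R,
    \sum_p ind R (incell p.1 x) * ind R (incell p.2 x) * F p = F (c, j)].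
Proof.
move=> n0 k0 x3; have [c Hc Sc] := sum_incell n0 x3; have [j Hj Sj] := sum_incell k0 x3.
exists c, j; split => // F; rewrite sum_pairE -(Sc (fun c => F (c, j))); apply: eq_bigr => c' _.
by rewrite -(Sj (fun j => F (c', j))) mulr_sumr; apply: eq_bigr => i _; rewrite mulrA.
Qed.

(** The measure is the law of the selected point given that it lies in a suitable parity class of
    cells. The two energy bounds are proportional to the probability Z of that event, and
    normalising divides twice by Z, leaving a constant over Z. *)
Lemma double_point_upper (R : realType) : exists2 C : R, 0 < C &
  forall d (T : measurableType d) (P : probability T R) (B : R -> T -> R * R),
  planar_brownian_motion P (1, 0) B ->
  forall A : set (R * R), closed A -> A `<=` [set x | enorm x <= 1 / 3] ->
  forall (eps : R) (N : nat), 0 < eps -> eps < 1 / 3 ->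
  let p := fine (P [set w | exists x, dblpt (B ^~ w) N%:R 3 (eps ^+ 2) x /\ A x]) in 0 < p ->
  exists nu : probability (R * R)%type R, nu A = 1%E /\ (energy (gauge_eps eps) nu <= (C / p)%:E)%E.
Proof.
have [Ka Ka0 HKa] := one_point_energy R; have [Kb Kb0 HKb] := two_point_energy R.
(* The outer 4 is the number of parity classes. Inside, 2 from [gauge_le_kernel] is multiplied by
   the factor 2 of [Lam_discrete], respectively by its square. *)
exists (4 * (4 * Ka + 8 * Kb)) => [|d T P B bm A cA A3 eps N e0 e3 p p0].
  by rewrite mulr_gt0// addr_gt0// mulr_gt0.
have e20 : 0 < eps ^+ 2 by exact: exprn_gt0.
have [_ l23] := ln_eps_ge e0 e3.
have l0 : 0 < `|ln eps| by apply: lt_le_trans l23; rewrite divr_gt0.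
have mA : measurable A by exact: measurable_closed_plane.
have AX x : A x -> `|x| <= 1 / 3 by move=> Ax; apply: le_trans (norm_le_enorm x) (A3 _ Ax).
pose H := [set w | exists x, dblpt (B ^~ w) N%:R 3 (eps ^+ 2) x /\ A x].
have mH : measurable H by exact: (measurable_dblpt bm N 3 e20 cA).
pose K w := [set x | dblpt (B ^~ w) N%:R 3 (eps ^+ 2) x /\ A x].
have cK w : compact (K w).
  have cQ : compact (`[-1 : R, 1] `*` `[-1 : R, 1]) by apply: compact_setX; exact: segment_compact.
  apply: subclosed_compact cQ _; first by apply: dblpt_closed => //; exact: (bm_continuous bm).
  move=> x [_ /AX Ax]; have := le_trans (fst_le_norm x) Ax; have := le_trans (snd_le_norm x) Ax.
  rewrite !ler_norml => /andP[a1 a2] /andP[a3 a4]; clear -a1 a2 a3 a4.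
  split; rewrite /= in_itv/=; apply/andP; split; lra.
have mK C : closed C -> measurable [set w | exists x, K w x /\ C x].
  move=> cC; have := measurable_dblpt bm N 3 e20 (closedI cA cC).
  rewrite (_ : mkset _ = [set w | exists x, K w x /\ C x])//; apply/seteqP.
  by split => w [x]; [move=> [h1 [h2 h3]]|move=> [[h1 h2] h3]]; exists x.
have [X mX KX] := measurable_selection cK mK.
have asb d' (U : measurableType d') (Y : set U) : measurable Y -> measurable_fun setT (fun x => `[< Y x >]).
  move=> mY; apply: (measurable_fun_bool true); rewrite (_ : _ @^-1` _ = Y) ?setTI//.
  by apply/seteqP; split => x /=; [move=> H'; apply/asboolP; exact: H'|move=> Ax; apply/asboolP].
(* Coarse cells of side between eps and 3/2 eps: at least eps so that different cells of one class
   are in the one-passage regime, and small enough to have diameter below 2 eps. *)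
pose n0 := Num.trunc (1 / eps).
have ie0 : 0 <= 1 / eps by rewrite divr_ge0// ltW.
have /andP[n01 n02] := truncn_itv ie0; rewrite -/n0 in n01 n02.
have n0R : 2 < n0%:R :> R.
  have : 3 <= 1 / eps by rewrite ler_pdivlMr//; lra.
  by move: n02; rewrite -natr1; lra.
have n00 : (0 < n0)%N by rewrite -(ltr_nat R); lra.
have n0p : 0 < n0%:R :> R by lra.
have n0e : eps <= n0%:R^-1 by rewrite -[eps]invrK lef_pV2 ?posrE ?invr_gt0// -div1r.
have n0e2 : n0%:R^-1 <= 3 / 2 * eps.
  rewrite -(ler_pM2r n0p) mulVf ?gt_eqF//; move: n02; rewrite ltr_pdivrMr// -natr1 mulrDl mul1r.
  move=> h; have : eps <= 1 / 2 * (eps * n0%:R) by move: n0R e0; clear; nra.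
  by move: h; rewrite (mulrC n0%:R); lra.
pose par (c : 'I_n0 * 'I_n0) := (odd c.1, odd c.2).
pose cls (q : bool * bool) (x : R * R) : R := \sum_(c | par c == q) ind R (incell c x).
have bcls (q : bool * bool) d' (U : measurableType d') (Y : U -> R * R) : measurable_fun setT Y ->
    bmf (fun u => cls q (Y u)).
  by move=> mY; apply: bmf_sum => c _; exact: bmf_incell.
pose s (q : bool * bool) (x : R * R) := `[< A x >] && (0 < cls q x).
have ms q : measurable_fun setT (s q).
  apply: measurable_and; first exact: asb.
  by apply: measurable_fun_ltr => //; apply: bmf_meas; exact: (bcls q _ _ id).
have s_cell q x : s q x -> A x /\ exists2 c, par c = q & incell c x.
  move=> /andP[/asboolP Ax c0]; split => //; apply: contrapT => nE; move: c0.
  rewrite /cls big1 ?ltxx// => c /eqP cq; have [ic|//] := boolP (incell c x).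
  by case: nE; exists c.
pose e0b w := `[< H w >].
pose e (q : bool * bool) w := e0b w && s q (X w).
have me q : measurable_fun setT (e q).
  by apply: measurable_and; [exact: asb|exact: (measurableT_comp (ms q) mX)].
have HX w : e0b w -> K w (X w).
  by move=> /asboolP [x Kx]; apply: KX; exists x.
have e_cover w : e0b w -> exists q, e q w.
  move=> ew; have [_ Ax] := HX w ew; have [c Hc] := incell_ex n00 (AX _ Ax).
  exists (par c); rewrite /e ew /s/=; apply/andP; split; first exact/asboolP.
  rewrite /cls (bigD1 c)//= Hc /ind; apply: ltr_wpDr => //.
  by apply: sumr_ge0 => c' _; rewrite ler0n.
(* Pigeonhole over the four parity classes. *)
have [q Zq] : exists q, p / 4 <= Ex P (fun w => ind R (e q w)).
  apply: contrapT => nE.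
  have lt4 q : Ex P (fun w => ind R (e q w)) < p / 4.
    by rewrite ltNge; apply/negP => H'; apply: nE; exists q.
  have : p <= \sum_q Ex P (fun w => ind R (e q w)).
    rewrite -Ex_sum; last by move=> q _; exact: bmf_bool.
    rewrite (_ : p = Ex P (fun w => ind R (e0b w))); last first.
      rewrite Ex_bool; last exact: asb.
      by congr (fine (P _)); apply/seteqP; split => w /asboolP.
    apply: Ex_le.
    - by apply: bmf_bool; exact: asb.
    - by apply: bmf_sum => q _; exact: bmf_bool.
    move=> w; have [ew|_] := boolP (e0b w); last by apply: sumr_ge0 => q _; rewrite /ind.
    have [q eq] := e_cover w ew; rewrite (bigD1 q)//= eq lerDl.
    by apply: sumr_ge0 => q' _; rewrite /ind.
  apply/negP; rewrite -ltNge (_ : p = \sum_(q : bool * bool) p / 4).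
    have q00 : (0 < #|{: bool * bool}|)%N by rewrite card_prod card_bool.
    by apply: ltr_sum => //; apply/hasP; exists (true, true) => //; rewrite mem_index_enum.
  by rewrite sumr_const card_prod card_bool -mulr_natr; field.
set Z := Ex P _ in Zq.
have Z0 : 0 < Z by apply: lt_le_trans Zq; rewrite divr_gt0.
have [nu nuE] := conditional_law (me q) mX Z0; rewrite -/Z in nuE.
have be : bmf (fun w => ind R (e q w)) by exact: bmf_bool.
exists nu; split.
  have bA : bmf (fun x => ind R `[< A x >]) by apply: bmf_bool; exact: asb.
  have : Ex nu (fun x => ind R `[< A x >]) = 1.
    rewrite nuE// (_ : Ex P _ = Z) ?mulVf ?gt_eqF//.
    apply: Ex_eq => w; rewrite /e /s; case: (e0b w); case: `[< A (X w) >] => //=; rewrite /ind ?mul0r ?mulr1//.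
  rewrite Ex_bool; last exact: asb.
  rewrite (_ : [set w | `[< A w >]] = A); last by apply/seteqP; split => x /asboolP.
  by move=> h; rewrite -(fineK (fin_num_measure nu A mA)) h.
pose k0 := (Num.trunc (4 / eps)).+1.
pose k n := (k0 + n)%N; pose r n : R := 2 / (k n)%:R.
have kn0 n : (0 < k n)%N by [].
have kR n : 0 < (k n)%:R :> R by rewrite ltr0n.
have r0 n : 0 < r n by rewrite divr_gt0.
have re n : r n <= eps / 2.
  have h1 : 4 / eps <= (k n)%:R.
    by apply: (le_trans (ltW (truncnS_gt _))); rewrite ler_nat leq_addr.
  move: h1; rewrite ler_pdivrMr// => h1; rewrite /r ler_pdivrMr// -mulrA mulrCA.
  by move: h1; rewrite (mulrC eps); set a := _ * eps; clear; lra.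
have rnd n m : (n <= m)%N -> r m <= r n.
  by move=> nm; rewrite /r ler_pM2l// lef_pV2 ?posrE// ler_nat leq_add2l.
have D0 : 0 < 2 * eps by rewrite mulr_gt0.
have e20' : 0 < eps / 2 by rewrite divr_gt0.
pose same (z : (R * R) * (R * R)) : R := \sum_(c : 'I_n0 * 'I_n0) ind R (incell c z.1) * ind R (incell c z.2).
(* The last term makes the supremum infinite off the chosen set, so the gauge is dominated at every
   pair of points; under the law of [X] that term vanishes. *)
pose F n (z : (R * R) * (R * R)) : R := 2 * Lam 1 (eps / 2) `|z.1 - z.2| +
  same z * (2 * Lam (2 * eps) (r n) `|z.1 - z.2| ^+ 2 / `|ln eps|) + n%:R * ind R (~~ (s q z.1 && s q z.2)).
have mdiff : measurable_fun setT (fun z : (R * R) * (R * R) => z.1 - z.2) by exact: measurable_ptB.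
have same0 z : 0 <= same z by apply: sumr_ge0 => c _; rewrite mulr_ge0// /ind.
have il0 : 0 <= `|ln eps|^-1 by rewrite invr_ge0.
have L0 n z : 0 <= 2 * Lam (2 * eps) (r n) `|z| ^+ 2 / `|ln eps| :> R.
  by apply: mulr_ge0 => //; apply: mulr_ge0 => //; exact: sqr_ge0.
have bsame : bmf same.
  by apply: bmf_sum => c _; apply: bmfM; exact: bmf_incell.
have bL1 : bmf (fun z : (R * R) * (R * R) => 2 * Lam 1 (eps / 2) `|z.1 - z.2|).
  by apply: bmfM; [exact: bmf_cst|exact: bmf_Lam].
have bL2 n : bmf (fun z : (R * R) * (R * R) => 2 * Lam (2 * eps) (r n) `|z.1 - z.2| ^+ 2 / `|ln eps|).
  apply: bmfM; last exact: bmf_cst.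
  by apply: bmfM; [exact: bmf_cst|apply: bmfX; exact: bmf_Lam].
have bF n : bmf (F n).
  apply: bmfD; first by apply: bmfD => //; exact: bmfM.
  apply: bmfM; first exact: bmf_cst.
  apply: bmf_bool; apply: measurable_neg; apply: measurable_and.
    exact: (measurableT_comp (ms q) measurable_fst).
  exact: (measurableT_comp (ms q) measurable_snd).
have C0 : 0 <= 4 * Ka + 8 * Kb by rewrite addr_ge0// mulr_ge0// ltW.
apply: (@double_integral_sup _ _ _ nu _ F) => //.
- by move=> x y; exact: gauge_eps_ge0.
- move=> n m z nm; apply: lerD.
    rewrite lerD2l; apply: ler_wpM2l => //; rewrite ler_pM2r ?invr_gt0// ler_pM2l//.
    by rewrite ler_pXn2r ?nnegrE ?Lam_ge0//; apply: Lam_r_anti => //; exact: rnd.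
  by apply: ler_wpM2r; [rewrite /ind|rewrite ler_nat].
- have same1 (c : 'I_n0 * 'I_n0) x y : incell c x -> incell c y -> 1 <= same (x, y).
    move=> cx cy; rewrite /same (bigD1 c)//= cx cy /ind mulr1 lerDl.
    by apply: sumr_ge0 => c' _; rewrite mulr_ge0.
  have FL n x y : same (x, y) * (2 * Lam (2 * eps) (r n) `|x - y| ^+ 2 / `|ln eps|) <= F n (x, y).
    rewrite /F/= (addrC (2 * _)) -addrA lerDl; apply: addr_ge0; first by rewrite mulr_ge0 ?Lam_ge0.
    by rewrite mulr_ge0// /ind.
  move=> x y; have [/andP[sx sy]|sxy] := boolP (s q x && s q y); last first.
    rewrite ereal_sup_unbounded ?leey// => a; exists (Num.trunc a).+1.
    apply: le_trans (ltW (truncnS_gt a)) _; rewrite /F/= sxy /ind mulr1 lerDr addr_ge0//.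
      by rewrite mulr_ge0 ?Lam_ge0.
    by rewrite mulr_ge0.
  have [Ax [c cq icx]] := s_cell _ _ sx; have [Ay [c' c'q icy]] := s_cell _ _ sy.
  have [exy|xy] := eqVneq x y.
    (* On the diagonal the truncated kernel is at least ln (2 eps / r), which exceeds any multiple
       of |ln eps| once the fine mesh is small. *)
    rewrite ereal_sup_unbounded ?leey// => a; pose E := expR (`|a| * `|ln eps|).
    have E0 : 0 < E by exact: expR_gt0.
    exists (Num.trunc (E / eps)).+1; set n := (Num.trunc _).+1.
    apply: le_trans (FL n x y); rewrite exy in icx *.
    have h1 : E <= eps * (k n)%:R.
      rewrite mulrC -ler_pdivrMr//; apply: le_trans (ltW (truncnS_gt _)) _.
      by rewrite ler_nat leq_addl.
    rewrite subrr normr0; set Lm := Lam _ _ _.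
    have Lm1 : `|a| * `|ln eps| <= Lm.
      apply: le_trans (Lam_ge_ln _ D0 (r0 n)); rewrite max_r; last exact: ltW.
      rewrite -[leLHS]expRK -/E; apply: ler_wpDl => //; apply: le_lnD => //.
        by rewrite divr_gt0.
      rewrite (_ : 2 * eps / r n = eps * (k n)%:R)//; rewrite /r; field; rewrite gt_eqF//.
    have Lm2 : 1 <= Lm by exact: Lam_ge1.
    apply: (@le_trans _ _ (2 * Lm ^+ 2 / `|ln eps|)); last first.
      rewrite -[leLHS]mul1r; apply: ler_wpM2r; last exact: (same1 c).
      by apply: mulr_ge0 => //; apply: mulr_ge0 => //; exact: sqr_ge0.
    apply: (le_trans (ler_norm a)); rewrite ler_pdivlMr//; apply: (le_trans Lm1).
    by rewrite expr2 mulrA ler_peMl ?(le_trans ler01 Lm2)//; clear -Lm2; lra.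
  have u0 : 0 < `|x - y| by rewrite normr_gt0 subr_eq0.
  have ut := norm_le_enorm (x - y); have tu := enorm_le_norm (x - y).
  have t0 : 0 < enorm (x - y) by exact: lt_le_trans ut.
  have t3 : enorm (x - y) <= 2 / 3.
    apply: le_trans (enorm_triangle _ _) _; apply: le_trans (lerD (A3 _ Ax) (A3 _ Ay)) _; clear; lra.
  have e1 : eps < 1 by apply: lt_trans e3 _; rewrite ltr_pdivrMr// mul1r ltr1n.
  rewrite gauge_epsE//.
  pose n := (Num.trunc (2 / `|x - y|)).+1.
  have rn : r n <= `|x - y|.
    rewrite /r ler_pdivrMr// mulrC -ler_pdivrMr//; apply: le_trans (ltW (truncnS_gt _)) _.
    by rewrite ler_nat leq_addl.
  apply: (@le_trans _ _ (F n (x, y))%:E); last by apply: ereal_sup_ubound; exists n.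
  rewrite lee_fin; apply: le_trans (gauge_le_kernel e0 e3 (r0 n) rn ut tu t3) _.
  rewrite /F/= -addrA lerD2l; apply: ler_wpDr; first by rewrite mulr_ge0 ?/ind.
  apply: ler_wpM2r => //; have [te|_] := ltP (enorm (x - y)) eps; last exact: same0.
  (* Two different cells of the same class are at distance at least 1 / n0 >= eps, so the squared
     kernel is called only inside one cell. *)
  have [cc|cc] := pselect (c = c').
    by rewrite /ind; apply: (same1 c) => //; rewrite cc.
  have := incell_far n00 (etrans cq (esym c'q)) cc icx icy.
  by move=> /(le_trans n0e)/le_trans/(_ ut); rewrite leNgt te.
- move=> n; pose ee (z : T * T) := ind R (e q z.1) * ind R (e q z.2).
  have bee : bmf ee.
    apply: bmfM; first exact: (bmf_comp measurable_fst be).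
    exact: (bmf_comp measurable_snd be).
  have mXX : measurable_fun setT (fun z : T * T => (X z.1, X z.2)).
    by apply: measurable_fun_pair; apply: measurableT_comp.
  pose Phi1 (z : T * T) := ee z * (2 * Lam 1 (eps / 2) `|X z.1 - X z.2|).
  pose Phi2 (z : T * T) := ee z * (same (X z.1, X z.2) *
    (2 * Lam (2 * eps) (r n) `|X z.1 - X z.2| ^+ 2 / `|ln eps|)).
  have bPhi1 : bmf Phi1 by apply: bmfM => //; exact: (bmf_comp mXX bL1).
  have bPhi2 : bmf Phi2.
    by apply: bmfM => //; apply: bmfM; [exact: (bmf_comp mXX bsame)|exact: (bmf_comp mXX (bL2 n))].
  have bEx2 (Phi : T * T -> R) : bmf Phi -> bmf (fun w => Ex P (fun v => Phi (w, v))).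
    move=> bPhi; apply: (@bmf_Ex _ _ T P _ T (fun w v => Phi (w, v))).
    by apply: bmf_eq bPhi => -[].
  have eX w : e q w -> `|X w| <= 1 / 3 /\ dblpt (B ^~ w) N%:R 3 (eps ^+ 2) (X w).
    by move=> /andP[/HX[h1 /AX h2] _].
  have ee0 w v : ~~ (e q w && e q v) -> ee (w, v) = 0.
    by rewrite /ee/=; case: (e q w); case: (e q v) => //= _; rewrite /ind ?mul0r ?mulr0.
  have kr1 : 2 / (k n)%:R <= eps / 2 by exact: re.
  have E1 : Ex P (fun w => Ex P (fun v => Phi1 (w, v))) <= 4 * Ka * Z.
    have He1 w : e q w -> `|X w| <= 1 / 3 /\ exists u : R, [/\ 0 <= u <= N%:R, B u w = X w &
        forall v : R, 0 <= v <= u -> enorm (B v w) <= 3].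
      move=> /eX[h1 [t1 [t2 [t10 t2N t12 [Bt1 _] Ht]]]]; split => //; exists t1; split => //.
        by rewrite t10/=; apply: le_trans t2N; apply: le_trans t12; rewrite lerDl ltW.
      move=> v /andP[v0 vt]; apply: Ht; rewrite v0; apply: le_trans vt _.
      by apply: le_trans t12; rewrite lerDl ltW.
    have e21 : eps / 2 <= 1 by clear -e3; lra.
    have := HKa _ _ _ _ bm (e q) X N (k n) (eps / 2) (me q) mX (kn0 n) kr1 e21 He1.
    cbv zeta; rewrite -/Z => H1; rewrite -mulrA; apply: le_trans (ler_wpM2l (ler0n R 4) H1).
    rewrite mulr_sumr.
    have bq (j : 'I_(k n) * 'I_(k n)) : bmf (fun w => ind R (e q w) * ind R (incell j (X w))).
      by apply: bmfM => //; exact: bmf_incell.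
    have := @Ex2_le_sum _ _ _ P _ (fun j w => ind R (e q w) * ind R (incell j (X w))) Phi1
      (fun j i : 'I_(k n) * 'I_(k n) => 4 * Lam 1 (eps / 2) `|cpt R j - cpt R i|) bq bPhi1 _ _.
    move=> H2; apply: le_trans (H2 _ _) _.
    - by move=> j i; rewrite mulr_ge0 ?Lam_ge0.
    - move=> w v; have [/andP[ew ev]|/ee0 e00] := boolP (e q w && e q v); last first.
        rewrite /Phi1 e00 mul0r; apply: sumr_ge0 => j _; apply: sumr_ge0 => i _.
        by rewrite !mulr_ge0 ?Lam_ge0// /ind.
      have [j Hj Sj] := sum_incell (kn0 n) (eX w ew).1.
      have [i Hi Si] := sum_incell (kn0 n) (eX v ev).1.
      rewrite (eq_bigr (fun j' => ind R (incell j' (X w)) * (4 * Lam 1 (eps / 2) `|cpt R j' - cpt R i|))); last first.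
        move=> j' _; rewrite -(Si (fun i => 4 * Lam 1 (eps / 2) `|cpt R j' - cpt R i|)) mulr_sumr.
        by apply: eq_bigr => i' _; rewrite ew ev [ind R true]/ind !mul1r -mulrA.
      rewrite Sj /Phi1 /ee/= ew ev /ind !mul1r.
      have := Lam_discrete ltr01 e20' (kn0 n) kr1 (cpt_close (kn0 n) Hj) (cpt_close (kn0 n) Hi).
      rewrite (_ : 4 = 2 * 2); last by ring.
      by rewrite -mulrA ler_pM2l.
    rewrite le_eqVlt; apply/orP; left; apply/eqP; apply: eq_bigr => j _.
    by rewrite [RHS]mulrCA; congr (_ * _); rewrite [RHS]mulr_sumr; apply: eq_bigr => i _; rewrite mulrCA.
  have E2 : Ex P (fun w => Ex P (fun v => Phi2 (w, v))) <= 8 * Kb * Z.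
    have re2 : r n <= 2 * eps by apply: le_trans (re n) _; clear -e0; lra.
    have nke : n0%:R^-1 + 2 / (k n)%:R <= 2 * eps.
      by apply: le_trans (lerD n0e2 kr1) _; clear -e0; lra.
    have := HKb _ _ _ _ bm (e q) X N (k n) n0 (r n) eps (me q) mX (kn0 n) n00 e0 e3 (lexx _) re2 nke eX.
    cbv zeta; rewrite -/Z => H1.
    have H1' : 8 / `|ln eps| * (Kb * `|ln eps| * Z) = 8 * Kb * Z by field; rewrite gt_eqF.
    have i80 : 0 <= 8 / `|ln eps| by rewrite mulr_ge0.
    rewrite -H1'; apply: le_trans (ler_wpM2l i80 H1); rewrite mulr_sumr.
    pose q2 (p : ('I_n0 * 'I_n0) * ('I_(k n) * 'I_(k n))) w :=
      ind R (e q w) * (ind R (incell p.1 (X w)) * ind R (incell p.2 (X w))).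
    pose k2 (p p' : ('I_n0 * 'I_n0) * ('I_(k n) * 'I_(k n))) : R :=
      8 / `|ln eps| * (ind R (p.1 == p'.1) * Lam (2 * eps) (r n) `|cpt R p.2 - cpt R p'.2| ^+ 2).
    have bq a : bmf (q2 a) by apply: bmfM => //; apply: bmfM; exact: bmf_incell.
    have k20 a b : 0 <= k2 a b.
      by apply: mulr_ge0 => //; apply: mulr_ge0 (sqr_ge0 _); rewrite /ind.
    have q20 a w : 0 <= q2 a w by exact: bmf_ge0 w (bq a).
    apply: le_trans (@Ex2_le_sum _ _ _ P _ q2 Phi2 k2 bq bPhi2 k20 _) _.
    - move=> w v; have [/andP[ew ev]|/ee0 e00] := boolP (e q w && e q v); last first.
        rewrite /Phi2 e00 mul0r; apply: sumr_ge0 => j _; apply: sumr_ge0 => i _.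
        by apply: mulr_ge0 => //; exact: mulr_ge0.
      have [c [j [Hc Hj Sj]]] := sum_incell2 n00 (kn0 n) (eX w ew).1.
      have [c' [i [Hc' Hi Si]]] := sum_incell2 n00 (kn0 n) (eX v ev).1.
      rewrite (eq_bigr (fun a => ind R (incell a.1 (X w)) * ind R (incell a.2 (X w)) * k2 a (c', i))); last first.
        move=> a _; rewrite -(Si (k2 a)) mulr_sumr; apply: eq_bigr => b _.
        by rewrite /q2 ew ev [ind R true]/ind !mul1r -!mulrA.
      rewrite Sj /Phi2 /ee/= ew ev [ind R true]/ind !mul1r /k2/=.
      have sc : same (X w, X v) <= ind R (c == c').
        have [c1 Hc1 Sc1] := sum_incell n00 (eX w ew).1.
        rewrite /same/= (Sc1 (fun c => ind R (incell c (X v)))) (incell_uniq Hc1 Hc).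
        have [icv|_] := boolP (incell c (X v)); last by rewrite /ind.
        by rewrite (incell_uniq icv Hc') eqxx.
      rewrite [leRHS]mulrCA; apply: ler_pM => //.
      have := Lam_discrete D0 (r0 n) (kn0 n) (lexx _) (cpt_close (kn0 n) Hj) (cpt_close (kn0 n) Hi).
      set a := Lam _ _ _; set b := Lam _ _ _ => ab.
      rewrite [leRHS]mulrAC ler_pM2r ?invr_gt0//.
      have a0 : 0 <= a by exact: Lam_ge0.
      rewrite (_ : 8 * b ^+ 2 = 2 * (2 * b) ^+ 2); last by ring.
      by rewrite ler_pM2l// ler_pXn2r ?nnegrE//; apply: le_trans ab.
    rewrite le_eqVlt; apply/orP; left; apply/eqP; apply: eq_bigr => p1 _.
    by rewrite [RHS]mulrCA; congr (_ * _); rewrite [RHS]mulr_sumr; apply: eq_bigr => p2 _; rewrite mulrCA.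
  pose Psi (z : T * T) := ee z * F n (X z.1, X z.2).
  have bPsi : bmf Psi by apply: bmfM => //; exact: (bmf_comp mXX (bF n)).
  have E3 : Ex P (fun w => Ex P (fun v => Psi (w, v))) <= 4 * Ka * Z + 8 * Kb * Z.
    apply: le_trans (lerD E1 E2); rewrite -ExD; try exact: bEx2.
    apply: Ex_le => [||w]; [exact: bEx2|by apply: bmfD; exact: bEx2|].
    have b1 := bmf_section1 w bPhi1; have b2 := bmf_section1 w bPhi2.
    rewrite -ExD//; apply: Ex_le => [||v]; [exact: (bmf_section1 w bPsi)|exact: bmfD|].
    rewrite /Psi /Phi1 /Phi2 -mulrDr; have [/andP[ew ev]|/ee0 ->] := boolP (e q w && e q v); last by rewrite !mul0r.
    apply: ler_wpM2l; first exact: bmf_ge0 (w, v) bee.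
    rewrite /F/= (_ : s q (X w)); last by case/andP: ew.
    rewrite (_ : s q (X v)); last by case/andP: ev.
    by rewrite /ind/= mulr0 addr0.
  pose phi x := Ex nu (fun y => F n (x, y)).
  have bphi : bmf phi.
    by apply: (@bmf_Ex _ _ _ nu _ _ (fun x y => F n (x, y))); apply: bmf_eq (bF n) => -[].
  rewrite -/phi nuE// (_ : Ex P _ = Z^-1 * Ex P (fun w => Ex P (fun v => Psi (w, v)))); last first.
    rewrite -ExZ ?invr_ge0 ?(ltW Z0)//; last exact: bEx2.
    apply: Ex_eq => w; rewrite /phi nuE; last exact: (bmf_section1 (X w) (bF n)).
    rewrite mulrCA; congr (_ * _); rewrite -ExZ; [|by rewrite /ind|].
      by apply: Ex_eq => v; rewrite /Psi /ee/= mulrA.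
    by apply: bmfM => //; exact: (bmf_comp mX (bmf_section1 (X w) (bF n))).
  have iZ0 : 0 <= Z^-1 by rewrite invr_ge0 ltW.
  apply: le_trans (ler_wpM2l iZ0 (ler_wpM2l iZ0 E3)) _.
  rewrite (_ : Z^-1 * _ = (4 * Ka + 8 * Kb) * Z^-1); last by field; rewrite gt_eqF.
  rewrite (mulrC 4 (_ + _)) -[leRHS]mulrA; apply: ler_wpM2l => //.
  rewrite (_ : 4 / p = (p / 4)^-1); last by rewrite invf_div.
  by rewrite lef_pV2 ?posrE ?divr_gt0.
Qed.

(** * Capacities and hitting probabilities *)

Section exit_times.
Context {R : realType} {T : Type} (B : R -> T -> R * R) (w : T).
Hypothesis cB : {within `[0, +oo[, continuous (B ^~ w)}.

Lemma enorm_path_continuous s : {within `[0, s], continuous (fun u => enorm (B u w))}.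
Proof.
apply/subspace_continuousP => t /=; rewrite in_itv/= => /andP[t0 ts].
apply/cvgrPdist_lt => e e0; have e3 : 0 < e / 3 by rewrite divr_gt0.
have [eta eta0 H] := ray_continuousP cB t0 e3.
rewrite /within/=; apply/nbhs_ballP; exists eta => // u; rewrite /ball/= => ut.
rewrite in_itv/= => /andP[u0 us].
have := H u u0; rewrite distrC => /(_ ut) d.
have h1 := enorm_lip (B t w) (B u w); have h2 := enorm_lip (B u w) (B t w).
rewrite distrC in h1; move: d h1 h2 e0; set a := `|_|; set b := enorm _; set c := enorm _.
move=> h1 h2 h3 h4; change (`|b - c| < e); rewrite ltr_norml; apply/andP; split; lra.
Qed.

(** The exit time is an infimum, so strictness needs a margin: by continuity the path stays off the
    circle for a short time after [s]. *)
Lemma exit_time_gt (s : R) : 0 <= s -> (forall u : R, 0 <= u <= s -> enorm (B u w) < 3) ->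
  (s%:E < exit_time B w)%E.
Proof.
move=> s0 H; have Hs : enorm (B s w) < 3 by apply: H; rewrite s0 lexx.
have e0 : 0 < (3 - enorm (B s w)) / 2 by rewrite divr_gt0// subr_gt0.
have [eta eta0 Heta] := ray_continuousP cB s0 e0.
apply: (@lt_le_trans _ _ (s + eta)%:E); first by rewrite lte_fin ltrDl.
apply: le_ereal_inf_tmp => _ [t /= [t0 Bt] <-]; rewrite lee_fin leNgt; apply/negP => ts.
have [tls|slt] := leP t s; first by have := H t; rewrite t0 tls Bt ltxx => /(_ isT).
have := Heta t t0; rewrite gtr0_norm ?subr_gt0// ltrBlDl => /(_ ts) d.
have := enorm_lip (B t w) (B s w); rewrite Bt; move: d; rewrite ltr_pdivlMr//.
by set a := `|_|; lra.
Qed.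

(** A path starting inside cannot be outside at time [u] without meeting the circle before, by the
    intermediate value theorem. *)
Lemma before_exit (s u : R) : enorm (B 0 w) < 3 -> (s%:E < exit_time B w)%E -> 0 <= u <= s ->
  enorm (B u w) < 3.
Proof.
move=> B0 sE /andP[u0 us]; rewrite ltNge; apply/negP => Bu.
have B3 : Num.min (enorm (B 0 w)) (enorm (B u w)) <= 3 <= Num.max (enorm (B 0 w)) (enorm (B u w)).
  by rewrite ge_min (ltW B0)/= le_max Bu orbT.
have [t] := IVT u0 (enorm_path_continuous (s := u)) B3.
rewrite in_itv/= => /andP[t0 tu] Bt; move: sE; rewrite ltNge => /negP; apply.
apply: (@le_trans _ _ t%:E); last by rewrite lee_fin (le_trans tu).
by apply: ereal_inf_lbound; exists t.
Qed.

End exit_times.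

Section hitting_events.
Context {R : realType} {d} {T : measurableType d} {P : probability T R}.
Variable B : R -> T -> R * R.
Hypothesis bm : planar_brownian_motion P (1, 0) B.
Variable A : set (R * R).
Hypotheses (cA : closed A) (A3 : A `<=` [set x | enorm x <= 1 / 3]).

Definition dblpt_event (N : nat) (rho eps : R) : set T :=
  [set w | exists x, dblpt (B ^~ w) N%:R rho (eps ^+ 2) x /\ A x].

Definition separated_event (eps : R) : set T :=
  [set w | separated_double_points B eps w `&` A !=set0].

Lemma dblpt_event_measurable N rho eps : 0 < eps -> measurable (dblpt_event N rho eps).
Proof. by move=> e0; apply: (measurable_dblpt bm) => //; rewrite exprn_gt0. Qed.

Let cB w : {within `[0, +oo[, continuous (B ^~ w)}.
Proof. exact: (bm_continuous bm). Qed.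

Let start_norm w : enorm (B 0 w) = 1.
Proof. by rewrite (bm_start bm) /enorm/= expr1n expr0n addr0 sqrtr1. Qed.

Lemma dblpt_separated N rho eps : 0 < eps -> rho < 3 ->
  dblpt_event N rho eps `<=` separated_event eps.
Proof.
move=> e0 rho3 w [x [[r [s [r0 sN rs [Br Bs] H]]] Ax]].
have e20 : 0 < eps ^+ 2 by exact: exprn_gt0.
have s0 : 0 <= s by apply: le_trans rs; rewrite addr_ge0// ltW.
exists x; split => //; exists r, s; split => //; last 1 first.
- apply: (exit_time_gt (@cB w) s0) => u us; exact: le_lt_trans (H u us) rho3.
- rewrite lt_neqAle r0 andbT; apply/eqP => r00.
  have := A3 Ax; rewrite /= -Br -r00 start_norm; lra.
by split => //; rewrite ltrDl.
Qed.

(** Before the exit time the norm has a maximum below 3 on the compact interval [0, s], hence at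
    most 3 - 1 / (N + 1) for large [N]. This also gives measurability. *)
Lemma separated_eventE eps : 0 < eps ->
  separated_event eps = \bigcup_N dblpt_event N (3 - N.+1%:R^-1) eps.
Proof.
move=> e0; apply/seteqP; split => w; last first.
  move=> [N _]; apply: dblpt_separated => //.
  by rewrite ltrBlDr ltrDl invr_gt0 ltr0n.
move=> [x [[r [s [r0 [rs1 rs] sE Br Bs]]] Ax]].
have s0 : 0 <= s by apply: le_trans rs; rewrite addr_ge0 ?sqr_ge0// ltW.
have [c] := EVT_max s0 (enorm_path_continuous (@cB w) (s := s)).
rewrite in_itv/= => cs Hc.
have B0 : enorm (B 0 w) < 3 by rewrite start_norm ltr1n.
have c3 := before_exit (@cB w) B0 sE cs.
pose a := 3 - enorm (B c w); have a0 : 0 < a by rewrite subr_gt0.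
pose N := maxn (Num.trunc s).+1 (Num.trunc a^-1).
exists N => //; exists x; split => //; exists r, s; split => //; first exact: ltW.
  by apply: ltW; apply: lt_le_trans (truncnS_gt s) _; rewrite ler_nat leq_maxl.
move=> u us; apply: le_trans (Hc u _) _; first by rewrite in_itv.
rewrite lerBrDl -lerBrDr -/a invf_ple ?posrE ?ltr0n//.
by apply: ltW; apply: lt_le_trans (truncnS_gt _) _; rewrite ler_nat ltnS leq_maxr.
Qed.

Lemma dblpt_event_homo eps N M rho rho' : (N <= M)%N -> rho <= rho' ->
  dblpt_event N rho eps `<=` dblpt_event M rho' eps.
Proof.
move=> NM rr w [x [[r [s [r0 sN rs Brs H]]] Ax]]; exists x; split => //; exists r, s; split => //.
  by apply: le_trans sN _; rewrite ler_nat.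
by move=> u us; exact: le_trans (H u us) rr.
Qed.

Lemma separated_event_measurable eps : 0 < eps -> measurable (separated_event eps).
Proof.
move=> e0; rewrite separated_eventE//; apply: bigcup_measurable => N _.
exact: dblpt_event_measurable.
Qed.

Lemma separated_event_le eps (M : \bar R) : 0 < eps ->
  (forall N, P (dblpt_event N 3 eps) <= M)%E -> (P (separated_event eps) <= M)%E.
Proof.
move=> e0 H; rewrite separated_eventE//.
have mE N : measurable (dblpt_event N (3 - N.+1%:R^-1) eps) by exact: dblpt_event_measurable.
have mU : measurable (\bigcup_N dblpt_event N (3 - N.+1%:R^-1) eps).
  by apply: bigcup_measurable => N _.
have nd : {homo (fun N => dblpt_event N (3 - N.+1%:R^-1) eps) : n m / (n <= m)%N >-> (n <= m)%O}.
  move=> n m nm; apply/subsetPset; apply: dblpt_event_homo => //.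
  by rewrite lerD2l lerN2 lef_pV2 ?posrE ?ltr0n// ler_nat ltnS.
have cv := nondecreasing_cvg_mu (mu := P) mE mU nd.
rewrite -(cvg_lim _ cv)//; apply: lime_le; first by apply/cvg_ex; eexists; exact: cv.
apply: nearW => N /=; apply: le_trans (H N); apply: le_measure; rewrite ?inE//.
  exact: dblpt_event_measurable.
by apply: dblpt_event_homo => //; rewrite lerBlDr lerDl.
Qed.

End hitting_events.

Section capacities.
Context {R : realType}.
Implicit Types (h : R -> \bar R) (A : set (R * R)).
Local Open Scope ereal_scope.

Lemma inve_anti (x y : \bar R) : 0 <= x -> x <= y -> y^-1 <= x^-1.
Proof. by move=> x0 xy; rewrite lee_pV2 ?inE//; exact: le_trans xy. Qed.

Lemma energy_ge0 h (mu : probability (R * R)%type R) : (forall t, 0 <= h t) -> 0 <= energy h mu.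
Proof. by move=> h0; apply: integral_ge0 => x _; apply: integral_ge0 => y _. Qed.

Lemma inf_energy_ge0 h A : (forall t, 0 <= h t) ->
  0 <= ereal_inf [set energy h mu | mu in [set mu : probability (R * R)%type R | mu A = 1]].
Proof. by move=> h0; apply: le_ereal_inf_tmp => _ [mu _ <-]; exact: energy_ge0. Qed.

Lemma capacity_ge0 h A : (forall t, 0 <= h t) -> 0 <= capacity h A.
Proof. by move=> h0; rewrite /capacity inve_ge0; exact: inf_energy_ge0. Qed.

Lemma capacity_le h A (k : R) : (0 < k)%R ->
  (forall mu : probability (R * R)%type R, mu A = 1 -> k^-1%:E <= energy h mu) -> capacity h A <= k%:E.
Proof.
move=> k0 H; have kE : k%:E = (k^-1%:E)^-1 by rewrite inver invr_eq0 gt_eqF// invrK.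
rewrite kE; apply: inve_anti; first by rewrite lee_fin invr_ge0 ltW.
by apply: le_ereal_inf_tmp => _ [mu muA <-]; exact: H.
Qed.

Lemma capacity_ge h A (mu : probability (R * R)%type R) (k : R) : (forall t, 0 <= h t) -> (0 < k)%R ->
  mu A = 1 -> energy h mu <= k^-1%:E -> k%:E <= capacity h A.
Proof.
move=> h0 k0 muA H; have kE : k%:E = (k^-1%:E)^-1 by rewrite inver invr_eq0 gt_eqF// invrK.
rewrite kE; apply: inve_anti; first exact: inf_energy_ge0.
by apply: le_trans H; apply: ereal_inf_lbound; exists mu.
Qed.

Lemma capacity_anti h h' A : (forall t, 0 <= h t) -> (forall t, (0 <= t)%R -> h t <= h' t) ->
  capacity h' A <= capacity h A.
Proof.
move=> h0 hh.
have h'' mu : energy h mu <= energy h' mu.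
  apply: ge0_integral_mono => x; first exact: integral_ge0.
  by apply: ge0_integral_mono => // y; apply: hh; exact: enorm_ge0.
rewrite /capacity; apply: inve_anti; first exact: inf_energy_ge0.
apply: le_ereal_inf_tmp => _ [mu muA <-]; apply: le_trans (h'' mu).
by apply: ereal_inf_lbound; exists mu.
Qed.

(** As [eps] decreases the gauge decreases and the capacity grows; the limit in the two-gauge
    capacity is thereby a supremum. *)
Lemma gauge_eps_homo (e e' t : R) : (0 < e)%R -> (e <= e')%R -> (e' < 1 / 3)%R -> (0 <= t)%R ->
  gauge_eps e t <= gauge_eps e' t.
Proof.
move=> e0 ee e'3; have e'0 : (0 < e')%R by exact: lt_le_trans ee.
have e'1 : (e' < 1)%R by apply: lt_trans e'3 _; rewrite ltr_pdivrMr// mul1r ltr1n.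
have e1 : (e < 1)%R by exact: le_lt_trans e'1.
rewrite le_eqVlt => /predU1P[<-|t0]; first by rewrite !gauge_eps0.
rewrite !gauge_epsE// lee_fin /rgauge.
have lE : (`|ln e| = - ln e)%R by rewrite ltr0_norm// ln_lt0// e0.
have lE' : (`|ln e'| = - ln e')%R by rewrite ltr0_norm// ln_lt0// e'0.
have l'0 : (0 < `|ln e'|)%R by rewrite normr_gt0 lt_eqF// ln_lt0// e'0.
have ll : (`|ln e'| <= `|ln e|)%R by rewrite lE lE' lerN2; exact: le_lnD.
have [te'|te'] := leP e' t.
  by rewrite (le_trans ee te').
have [te|te] := leP e t.
  have ltE : (`|ln t| = - ln t)%R by rewrite ltr0_norm// ln_lt0// t0 (lt_trans te').
  rewrite ler_pdivlMr// -[X in (_ <= X)%R]sqrrN -ltE expr2; apply: ler_wpM2l => //.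
  by rewrite lE' ltE lerN2; apply: le_lnD => //; exact: ltW.
apply: ler_wpM2l; first exact: sqr_ge0.
by rewrite lef_pV2 ?posrE//; exact: lt_le_trans ll.
Qed.

End capacities.

Lemma separated_estimate (R : realType) : exists c C : R, [/\ 0 < c, 0 < C &
  forall (d : measure_display) (Omega : measurableType d) (P : probability Omega R) (B : R -> Omega -> R * R),
  planar_brownian_motion P (1, 0) B -> forall eps : R, 0 < eps < 1 / 3 ->
  capacity_estimate c C (cap_eps eps) (hitting_prob P (separated_double_points B eps))].
Proof.
have [c c0 Hc] := double_point_lower R; have [C C0 HC] := double_point_upper R.
exists c, C; split => // d Omega P B bm eps /andP[e0 e3] A cA A3.
have cap0 : (0 <= cap_eps eps A)%E by apply: capacity_ge0 => t; exact: gauge_eps_ge0.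
change (c%:E * cap_eps eps A <= P (separated_event B A eps) <= C%:E * cap_eps eps A)%E.
have mS : measurable (separated_event B A eps) by exact: (separated_event_measurable bm cA A3).
have mE N rho : measurable (dblpt_event B A N rho eps) by exact: (dblpt_event_measurable bm).
apply/andP; split; last first.
  apply: (separated_event_le bm) => // N; have [p0|p0] := leP (fine (P (dblpt_event B A N 3 eps))) 0.
    rewrite -[leLHS]fineK ?fin_num_measure//; apply: le_trans (_ : _ <= 0%:E)%E _; first by rewrite lee_fin.
    by apply: mule_ge0 => //; rewrite lee_fin ltW.
  have [nu [nuA nuE]] := HC _ _ _ _ bm A cA A3 eps N e0 e3 p0.
  rewrite -(lee_pdivrMl _ _ C0) -[P _]fineK ?fin_num_measure// -EFinM.
  apply: (capacity_ge (mu := nu)) => //; first by move=> t; exact: gauge_eps_ge0.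
    by rewrite mulr_gt0// invr_gt0.
  by rewrite invfM invrK.
apply: (@le_trans _ _ (P (dblpt_event B A 2 (29 / 10) eps))); last first.
  apply: le_measure; rewrite ?inE//.
  by apply: (dblpt_separated bm) => //; rewrite ltr_pdivrMr// -natrM ltr_nat.
set p := fine (P (dblpt_event B A 2 (29 / 10) eps)).
have pE : P (dblpt_event B A 2 (29 / 10) eps) = p%:E by rewrite fineK// fin_num_measure.
have p0 : 0 <= p by rewrite -lee_fin -pE.
have lowM (mu : probability (R * R)%type R) (M : R) : mu A = 1%E -> (energy (gauge_eps eps) mu <= M%:E)%E ->
    c <= p * M by exact: (Hc _ _ _ _ bm A cA A3 eps mu M e0 e3).
rewrite pE -lee_pdivlMl//.
have low (mu : probability (R * R)%type R) q : 0 < q -> p <= q -> mu A = 1%E ->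
    ((c^-1 * q)^-1%:E <= energy (gauge_eps eps) mu)%E.
  move=> q0 pq muA; have : (0 <= energy (gauge_eps eps) mu)%E.
    by apply: energy_ge0 => t; exact: gauge_eps_ge0.
  have := lowM mu _ muA; case: (energy _ mu) => [M| |]; [|by move=> _ _; rewrite leey|by []].
  move=> /(_ _ (lexx _)) h; rewrite lee_fin => M0; rewrite lee_fin invfM invrK ler_pdivrMr//.
  by apply: le_trans h _; rewrite mulrC ler_wpM2l.
(* If [p] vanishes, every admissible measure has infinite energy: the capacity is shown to be below
   each positive [e]. *)
have [p00|pp] := leP p 0; last first.
  rewrite -EFinM; apply: capacity_le; first by rewrite mulr_gt0// invr_gt0.
  by move=> mu; exact: low.
apply/lee_addgt0Pr => e ee; apply: (@le_trans _ _ e%:E); last by rewrite leeDr// mule_ge0// lee_fin ?invr_ge0 ltW.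
apply: capacity_le => // mu muA; have := low mu (c * e); rewrite mulKf ?gt_eqF//.
by apply => //; [exact: mulr_gt0|apply: le_trans p00 _; rewrite mulr_ge0// ltW].
Qed.

(** Both sides increase as [eps] decreases to 0, the probabilities to that of a double point in [A]
    and the capacities to their supremum, so the same constants pass to the limit. *)
Lemma two_gauge_estimate (R : realType) d (Omega : measurableType d) (P : probability Omega R)
    (B : R -> Omega -> R * R) (c C : R) :
  planar_brownian_motion P (1, 0) B -> 0 < c -> 0 < C ->
  (forall eps : R, 0 < eps < 1 / 3 ->
    capacity_estimate c C (cap_eps eps) (hitting_prob P (separated_double_points B eps))) ->
  capacity_estimate c C cap_two_gauge (hitting_prob P (double_points B)).
Proof.
move=> bm c0 C0 H A cA A3.
have lt3 : (BRight (0 : R) < BLeft (1 / 3 : R))%O by rewrite bnd_simp divr_gt0.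
have in3 (e : R) : (e \in Interval (BRight 0) (BLeft (1 / 3))) = (0 < e < 1 / 3) by rewrite in_itv.
pose S := ereal_sup [set cap_eps e A | e in [set` Interval (BRight (0 : R)) (BLeft (1 / 3 : R))]].
have -> : cap_two_gauge A = S.
  apply: cvg_lim; first exact: ereal_hausdorff.
  apply: (@nonincreasing_at_right_cvge R (fun e => cap_eps e A) 0 _ lt3) => e e'.
  rewrite !in3 => /andP[e0 _] /andP[_ e'3] ee; apply: capacity_anti => t; first exact: gauge_eps_ge0.
  exact: gauge_eps_homo.
have capS e : 0 < e < 1 / 3 -> (cap_eps e A <= S)%E.
  by move=> he; apply: ereal_sup_ubound; exists e => //=; rewrite in3.
(* Starting at 1/4 keeps [ep n] below 1/3. *)
pose ep n : R := n.+4%:R^-1.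
have ep0 n : 0 < ep n by rewrite invr_gt0 ltr0n.
have ep3 n : 0 < ep n < 1 / 3.
  by rewrite ep0/= div1r ltf_pV2 ?posrE ?ltr0n// ltr_nat.
pose E := [set w | double_points B w `&` A !=set0].
have EU : E = \bigcup_n separated_event B A (ep n).
  apply/seteqP; split => w.
    move=> [x [[r [s [r0 rs sE Br Bs]]] Ax]]; have rs0 : 0 < s - r by rewrite subr_gt0.
    exists (Num.trunc (s - r)^-1) => //; exists x; split => //; exists r, s; split => //.
    split; first by rewrite ltrDl exprn_gt0.
    rewrite -lerBrDl; apply: (@le_trans _ _ (ep (Num.trunc (s - r)^-1))).
      by rewrite expr2 ger_pMl// invf_le1 ?ltr0n// ler1n.
    rewrite /ep invf_ple ?posrE ?ltr0n//; apply: ltW; apply: lt_trans (truncnS_gt _) _.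
    by rewrite ltr_nat ltnS ltnS ltnW.
  move=> [n _ [x [[r [s [r0 [rs1 rs2] sE Br Bs]]] Ax]]]; exists x; split => //.
  by exists r, s; split => //; exact: lt_le_trans rs2.
have mS n : measurable (separated_event B A (ep n)) by exact: (separated_event_measurable bm cA A3).
have mE : measurable E by rewrite EU; apply: bigcup_measurable.
change (c%:E * S <= P E <= C%:E * S)%E; apply/andP; split.
  rewrite -lee_pdivlMl//; apply: ge_ereal_sup => _ [e /= + <-]; rewrite in3 => he.
  rewrite lee_pdivlMl//; have /andP[h _] := H e he A cA A3; apply: le_trans h _.
  have e0 : 0 < e by case/andP: he.
  have mSe : measurable (separated_event B A e) by exact: (separated_event_measurable bm cA A3).
  apply: (@le_measure _ _ _ P (separated_event B A e) E); rewrite ?inE//.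
  move=> w [x [[r [s [r0 [rs1 rs2] sE Br Bs]]] Ax]]; exists x; split => //.
  by exists r, s; split => //; exact: lt_le_trans rs2.
have nd : {homo (fun n => separated_event B A (ep n)) : n m / (n <= m)%N >-> (n <= m)%O}.
  move=> n m nm; apply/subsetPset => w [x [[r [s [r0 [rs1 rs2] sE Br Bs]]] Ax]]; exists x; split => //.
  exists r, s; split => //; split; first by rewrite ltrDl exprn_gt0.
  apply: le_trans rs2; rewrite lerD2l ler_pXn2r ?nnegrE ?(ltW (ep0 _))//.
  by rewrite lef_pV2 ?posrE ?ltr0n// ler_nat !ltnS.
have mU : measurable (\bigcup_n separated_event B A (ep n)) by rewrite -EU.
have cv := nondecreasing_cvg_mu (mu := P) mS mU nd.
rewrite EU -(cvg_lim _ cv)//; apply: lime_le; first by apply/cvg_ex; eexists; exact: cv.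
apply: nearW => n /=; have /andP[_ h] := H (ep n) (ep3 n) A cA A3; apply: le_trans h _.
by apply: lee_wpmul2l; [rewrite lee_fin ltW|exact: capS].
Qed.

Theorem theorem2p3 (R : realType) :
  (exists c C : R, [/\ 0 < c, 0 < C &
    forall (d : measure_display) (Omega : measurableType d)
           (P : probability Omega R) (B : R -> Omega -> R * R),
    planar_brownian_motion P (1, 0) B ->
      capacity_estimate c C cap_two_gauge (hitting_prob P (double_points B)) /\
      (forall eps : R, 0 < eps < 1 / 3 ->
        capacity_estimate c C (cap_eps eps)
          (hitting_prob P (separated_double_points B eps)))]) /\
  (forall (d : measure_display) (Omega : measurableType d)
          (P : probability Omega R) (B : R -> Omega -> R * R),
    planar_brownian_motion P (1, 0) B ->
    forall c C : R, 0 < c -> 0 < C ->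
      (forall eps : R, 0 < eps < 1 / 3 ->
        capacity_estimate c C (cap_eps eps)
          (hitting_prob P (separated_double_points B eps))) ->
      capacity_estimate c C cap_two_gauge (hitting_prob P (double_points B))).
Proof.
split; last by move=> d Omega P B bm c C c0 C0 H; exact: two_gauge_estimate.
have [c [C [c0 C0 H]]] := separated_estimate R.
exists c, C; split => // d Omega P B bm; split; last exact: H.
by apply: two_gauge_estimate => //; exact: H.
Qed.
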